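(* Consider the setting, standing assumptions and notation of the context: $q\in\mathbb N$ with $2\le q\le m$; the one-dimensional center and stable spaces $\mathcal X^c,\mathcal X^s$; the polynomial nonlinearities $F^{c/s},G^{c/s}$; the geometric rough path cocycle $\mathbf W=(W,\mathbb W)$; the coefficients $\alpha_2,\dots,\alpha_q$; and the function $h^c(\cdot,\mathbf W)$, whose graph is the local center manifold. There exist a truncation radius $R(\mathbf W)\in(0,1]$ that is a tempered from below random variable, a tempered from below random variable $\rho(\mathbf W)\in(0,1]$, and a constant $K\ge 1$ such that the following holds when the truncations $F^{c/s}_R,G^{c/s}_R$ and the bound on the $\alpha_i^{j-1}$ in the context are taken with this $R$. Let $\xi\in\mathcal X^c$ with $\|\xi\|_{\mathcal X}\le\rho(\mathbf W)$. Let $x$ be the solution on $(-\infty,0]$, with $x_0=\xi$, of the truncated center equation $$\mathrm dx_t=(A^cx_t+F^c_R(x,y)[t])\,\mathrm dt+G^c_R(x,y)[t]\,\mathrm d\mathbf W_t$$ along the center manifold. For $j\in\mathbb Z^-$ and $t\in[0,1]$ let $x^{j-1}_t:=x_{j-1+t}$ and $$\phi^{j-1}(x^{j-1}_t):=\sum_{i=2}^q\alpha_i^{j-1}(t)\,(x_t^{j-1})^i .$$ Then $$\big\|h^c(\xi,\mathbf W)-\phi^{-1}(x^{-1}_1)\big\|_{\mathcal X}\le K\|\xi\|_{\mathcal X}^{q+1}.$$ Here $\phi^{-1}$ denotes $\phi^{j-1}$ for $j=0$, evaluated at time $t=1$.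
   Context: **Rough paths.** Fix $\gamma\in(1/3,1/2]$ and $\mathcal V=\mathbb R^d$. A $\gamma$-Hölder rough path is a pair $\mathbf W=(W,\mathbb W)$ with $W$ a $\gamma$-Hölder $\mathcal V$-valued path and $\mathbb W$ a two-parameter $2\gamma$-Hölder $\mathcal V\otimes\mathcal V$-valued map satisfying Chen's relation $\mathbb W_{s,t}-\mathbb W_{s,u}-\mathbb W_{u,t}=W_{s,u}\otimes W_{u,t}$, where $W_{s,t}=W_t-W_s$. It is geometric if it is a limit, in the $\gamma$-Hölder rough path distance, of canonical lifts of smooth paths. The shift is $\Theta_\tau W_t=W_{t+\tau}-W_\tau$, $\Theta_\tau\mathbb W_{s,t}=\mathbb W_{s+\tau,t+\tau}$. We fix a geometric rough path cocycle $\mathbf W$ over a metric dynamical system $(\Omega,\mathcal F,\mathbb P,(\theta_t)_{t\in\mathbb R})$, i.e. $W_{s,s+t}(\omega)=W_t(\theta_s\omega)$ and $\mathbb W_{s,s+t}(\omega)=\mathbb W_{0,t}(\theta_s\omega)$. A positive random variable $\tilde R$ is tempered from above if $\ln^+\tilde R(\theta_t\omega)/|t|\to0$ as $t\to\pm\infty$, and tempered from below if $1/\tilde R$ is tempered from above. $\mathbb Z^-=\{0,-1,-2,\dots\}$. A path $Y$ on $[0,1]$ is controlled by $W$, written $(Y,Y')\in\mathcal D^{2\gamma}_W$, if $Y_t=Y_s+Y_s'W_{s,t}+R^Y_{s,t}$ with $Y,Y'$ $\gamma$-Hölder and $R^Y$ $2\gamma$-Hölder; the norm is $\|Y,Y'\|_{\mathcal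 D^{2\gamma}_W}=\|Y\|_\infty+\|Y'\|_\infty+\|Y'\|_\gamma+\|R^Y\|_{2\gamma}$. Integrals against $\mathbf W$ are controlled rough integrals $\int_s^tY_r\,\mathrm d\mathbf W_r=\lim\sum_{[u,v]}(Y_uW_{u,v}+Y'_u\mathbb W_{u,v})$. **Linear part.** $\mathcal X=\mathcal X^c\oplus\mathcal X^s$ with $\dim\mathcal X^c=\dim\mathcal X^s=1$, with associated projections $P^c,P^s$. $A$ is a linear operator on $\mathcal X$ leaving both subspaces invariant; $A^{c}=A|_{\mathcal X^{c}}$ has its eigenvalue on the imaginary axis and $A^s=A|_{\mathcal X^s}$ has an eigenvalue with negative real part; $S^{c/s}(t)=e^{tA^{c/s}}$. There are $M_c,M_s\ge1$ and $-\beta<0\le\nu<\beta$ with $\|S^c(t)x\|\le M_ce^{\nu t}\|x\|$ for $t\le0$ and $\|S^s(t)x\|\le M_se^{-\beta t}\|x\|$ for $t\ge0$. The norm on $\mathcal X$ is the sum of the norms on $\mathcal X^c$ and $\mathcal X^s$. **Nonlinearities.** Let $m\ge2$. $F^{c/s}:\mathcal X^c\times\mathcal X^s\to\mathcal X^{c/s}$ are $C^m$ and locally Lipschitz with $F^{c/s}(0,0)=\mathrm DF^{c/s}(0,0)=0$. $G^{c/s}:\mathcal X^c\times\mathcal X^s\to\mathcal L(\mathcal V,\mathcal X^{c/s})$ are $C^{m+3}$ and locally Lipschitz with $G^{c/s}(0,0)=\mathrm DG^{c/s}(0,0)=\mathrm D^2G^{c/s}(0,0)=0$. In addition all four are polynomials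 in all variables of degree at most $q$. **Truncation.** Let $\chi$ be a Lipschitz map of $\mathcal D^{2\gamma}_W([0,1];\mathcal X^c)\times\mathcal D^{2\gamma}_W([0,1];\mathcal X^s)$ into itself with $\chi(x,y)=(x,y)$ if the norm of $((x,y),(x',y'))$ is $\le1/2$ and $\chi(x,y)=0$ if it is $\ge1$. For $R>0$ let $\chi_R(x,y)=R\chi((x,y)/R)$, $F_R^{c/s}(x,y)[t]=F^{c/s}(\chi_R(x,y)[t])$, $G_R^{c/s}(x,y)[t]=G^{c/s}(\chi_R(x,y)[t])$. On the time block $[j-1,j]$, $j\in\mathbb Z^-$, paths are reparametrized to $[0,1]$, the driving rough path is $\Theta_{j-1}\mathbf W$ (controlledness is with respect to $\Theta_{j-1}W$), and the truncation radius is $R(\Theta_{j-1}\mathbf W)$. The system is $\mathrm dx=(A^cx+F^c_R(x,y)[t])\mathrm dt+G_R^c(x,y)[t]\mathrm d\mathbf W_t$, $\mathrm dy=(A^sy+F^s_R(x,y)[t])\mathrm dt+G^s_R(x,y)[t]\mathrm d\mathbf W_t$. **The function $h^c$.** Fix $-\beta<\eta<0$. $BC^\eta(\mathcal D^{2\gamma}_W)$ is the space of sequences $\mathbb U=(U^{j-1},(U^{j-1})')_{j\in\mathbb Z^-}$ of controlled rough paths on $[0,1]$ with $U^{j-1}_0=U^{j-2}_1$ and $\sup_{j\in\mathbb Z^-}e^{-\eta(j-1)}\|U^{j-1},(U^{j-1})'\|_{\mathcal D^{2\gamma}_W}<\infty$. For $\xi\in\mathcal X^c$ the discretized Lyapunov–Perron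 map is, with $F_R^{c/s}(U)=F_R^{c/s}(P^cU,P^sU)$ and similarly for $G$, $$\begin{aligned}J(\mathbf W,\mathbb U,\xi)[j-1,t]=\;&S^c(t+j-1)\xi-\sum_{k=j+1}^{0}S^c(t+j-1-k)\Big(\int_0^1S^c(1-r)F^c_R(U^{k-1})[r]\mathrm dr+\int_0^1S^c(1-r)G^c_R(U^{k-1})[r]\mathrm d\Theta_{k-1}\mathbf W_r\Big)\\&-\int_t^1S^c(t-r)F^c_R(U^{j-1})[r]\mathrm dr-\int_t^1S^c(t-r)G^c_R(U^{j-1})[r]\mathrm d\Theta_{j-1}\mathbf W_r\\&+\sum_{k=-\infty}^{j-1}S^s(t+j-1-k)\Big(\int_0^1S^s(1-r)F^s_R(U^{k-1})[r]\mathrm dr+\int_0^1S^s(1-r)G^s_R(U^{k-1})[r]\mathrm d\Theta_{k-1}\mathbf W_r\Big)\\&+\int_0^tS^s(t-r)F^s_R(U^{j-1})[r]\mathrm dr+\int_0^tS^s(t-r)G^s_R(U^{j-1})[r]\mathrm d\Theta_{j-1}\mathbf W_r.\end{aligned}$$ It is a known result (under a suitable gap condition, which is assumed) that $J(\mathbf W,\cdot,\xi)$ has a unique fixed point $\Gamma(\xi,\mathbf W)\in BC^\eta(\mathcal D^{2\gamma}_W)$. Set $h^c(\xi,\mathbf W):=P^s\Gamma(\xi,\mathbf W)[-1,1]$; the local center manifold is $\{\xi+h^c(\xi,\mathbf W):\xi\in B_{\mathcal X^c}(0,\rho(\mathbf W))\}$. The solution $x$ along the center manifold on $(-\infty,0]$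 with $x_0=\xi$ is the one with $x_{j-1+t}=P^c\Gamma(\xi,\mathbf W)[j-1,t]$ and $y_{j-1+t}=P^s\Gamma(\xi,\mathbf W)[j-1,t]$. **The coefficients $\alpha_i$.** Set $\alpha_1\equiv0$. For $i=2,\dots,q$, $\alpha_i$ takes values in $\mathcal L(\mathcal X^c,\mathcal X^s)$ (identified with scalars) and solves $$\mathrm d\alpha_i=[A^{\alpha_i}\alpha_i+f_i]\mathrm dt+g_i\,\mathrm d\mathbf W_t,\qquad A^{\alpha_i}=A^s-iA^c,$$ where, with $\phi(x)=\sum_{i=2}^q\alpha_ix^i$, $f_i$ is the coefficient of $x^i$ in the polynomial $F^s(x,\phi(x))-\sum_{k=2}^qk\alpha_kx^{k-1}F^c(x,\phi(x))$, and $g_i$ is the coefficient of $x^i$ in $G^s(x,\phi(x))-\sum_{k=2}^qk\alpha_kx^{k-1}G^c(x,\phi(x))$ (so $f_i,g_i$ depend only on $\alpha_2,\dots,\alpha_{i-1}$). It is assumed that: $\|e^{A^{\alpha_i}t}x\|\le M_{A^{\alpha_i}}e^{-\delta_it}\|x\|$ for $t\ge0$ with some $\delta_i>0$; these equations admit global solutions, and $\alpha_i$ denotes the stationary solution, i.e. $\varphi_i(t,W,\alpha_i(\mathbf W))=\alpha_i(\Theta_t\mathbf W)$ for the generated random dynamical system $\varphi_i$, so that $\alpha_i(s)=\alpha_i(\Theta_s\mathbf W)=\int_{-\infty}^se^{A^{\alpha_i}(s-r)}f_i(r)\mathrm dr+\int_{-\infty}^se^{A^{\alpha_i}(s-r)}g_i(r)\mathrm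 d\mathbf W_r$ for $s\le0$. For $j\in\mathbb Z^-$, $t\in[0,1]$ put $\alpha_i^{j-1}(t)=\alpha_i(j-1+t)$; it is assumed that $\|\alpha_i^{j-1},(\alpha_i^{j-1})'\|_{\mathcal D^{2\gamma}_W}\le C\,R(\Theta_{j-1}\mathbf W)$ for all $i\in\{2,\dots,q\}$, $j\in\mathbb Z^-$, with a fixed constant $C$.
   Formalization: The rough path norm of W on [0,1] (first-level γ-Hölder plus second-level 2γ-Hölder) is additionally assumed tempered from above, without which a tempered truncation radius giving a unique fixed point Γ need not exist; the Lipschitz constant of χ is common to all noises. *)

(* Defs.v *)
From HB Require Import structures.
From mathcomp Require Import all_boot all_order all_algebra.
From mathcomp Require Import polyXY.
From mathcomp Require Import all_classical all_reals all_analysis.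
From mathcomp.real_closed Require Import complex.

Set Implicit Arguments.
Unset Strict Implicit.
Unset Printing Implicit Defensive.

Import Order.TTheory GRing.Theory Num.Theory.
Import numFieldNormedType.Exports.

Local Open Scope classical_set_scope.
Local Open Scope ring_scope.

(* Iterated directional derivatives give the usual C^n because all domains used
   here are finite-dimensional. *)
Fixpoint Ck (R : realType) (U V : normedModType R) (n : nat) (f : U -> V)
    {struct n} : Prop :=
  match n with
  | 0%N => continuous f
  | n'.+1 => (forall x, differentiable f x) /\
             (forall v, Ck n' (fun x => 'D_v f x))
  end.

Definition incr (R : realType) (V : normedModType R) (f : R -> V) (s t : R) :=
  f t - f s.

Definition sup_norm (R : realType) (V : normedModType R) (a b : R)
    (f : R -> V) : \bar R :=
  ereal_sup [set (`|f t|)%:E | t in [set t : R | a <= t <= b]].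

Definition holder2 (R : realType) (V : normedModType R) (a b al : R)
    (Xi : R -> R -> V) : \bar R :=
  ereal_sup [set (`|Xi st.1 st.2| / (st.2 - st.1) `^ al)%:E
            | st in [set st : R * R | [/\ a <= st.1, st.1 < st.2 & st.2 <= b]]].

Record rough (R : realType) (d : nat) := Rough {
  rp1 : R -> 'rV[R]_d ;
  rp2 : R -> R -> 'M[R]_d }.

(* Both paths are indexed by the whole line, so the Hölder conditions are
   imposed on every compact interval.  The tensor a (x) b is the matrix with
   entries a_i b_j. *)
Record is_rough_path (R : realType) (d : nat) (gamma : R) (X : rough R d) :
    Prop := IsRoughPath {
  rough_holder1 : forall T : R, 0 < T ->
    (holder2 (- T) T gamma (incr (rp1 X)) < +oo)%E ;
  rough_holder2 : forall T : R, 0 < T ->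
    (holder2 (- T) T (2 * gamma) (rp2 X) < +oo)%E ;
  rough_chen : forall s u t : R, s <= u -> u <= t ->
    rp2 X s t - rp2 X s u - rp2 X u t =
    (incr (rp1 X) s u)^T *m incr (rp1 X) u t }.

Definition canonical_lift (R : realType) (d : nat) (w : R -> 'rV[R]_d) :
    rough R d :=
  Rough w (fun s t => \matrix_(i, j)
    \int[lebesgue_measure]_(r in `[s, t])
      (incr w s r 0 i * derive1 (fun u => w u 0 j) r)).

Definition rough_dist (R : realType) (d : nat) (T gamma : R) (X Y : rough R d) :
    \bar R :=
  (holder2 (- T) T gamma (fun s t => (incr (rp1 X) s t - incr (rp1 Y) s t)%R) +
   holder2 (- T) T (2 * gamma) (fun s t => (rp2 X s t - rp2 Y s t)%R))%E.

Definition is_geometric (R : realType) (d : nat) (gamma : R) (X : rough R d) :=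
  forall T : R, 0 < T -> exists w : nat -> R -> 'rV[R]_d,
    (forall n k, Ck k (w n)) /\
    (fun n => rough_dist T gamma (canonical_lift (w n)) X) @ \oo --> 0%E.

Definition shift_rough (R : realType) (d : nat) (tau : R) (X : rough R d) :
    rough R d :=
  Rough (fun t => rp1 X (t + tau) - rp1 X tau)
        (fun s t => rp2 X (s + tau) (t + tau)).

Definition noise_size (R : realType) (d : nat) (gamma : R) (X : rough R d) : R :=
  1 + fine (holder2 0 1 gamma (incr (rp1 X)))
    + fine (holder2 0 1 (2 * gamma) (rp2 X)).

Definition dotrv (R : realType) (d : nat) (x y : 'rV[R]_d) : R :=
  \sum_i x 0 i * y 0 i.

(* A path in R together with its Gubinelli derivative in L(R^d, R). *)
Definition cpath (R : realType) (d : nat) : Type :=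
  ((R -> R) * (R -> 'rV[R]_d))%type.

Definition remainder (R : realType) (d : nat) (w : R -> 'rV[R]_d)
    (Y : cpath R d) (s t : R) : R :=
  Y.1 t - Y.1 s - dotrv (Y.2 s) (incr w s t).

Definition controlled (R : realType) (d : nat) (gamma : R) (w : R -> 'rV[R]_d)
    (Y : cpath R d) : Prop :=
  [/\ (holder2 0 1 gamma (incr Y.1) < +oo)%E,
      (holder2 0 1 gamma (incr Y.2) < +oo)%E &
      (holder2 0 1 (2 * gamma) (remainder w Y) < +oo)%E].

Definition cnorm (R : realType) (d : nat) (gamma : R) (w : R -> 'rV[R]_d)
    (Y : cpath R d) : \bar R :=
  (sup_norm 0 1 Y.1 + sup_norm 0 1 Y.2 + holder2 0 1 gamma (incr Y.2) +
   holder2 0 1 (2 * gamma) (remainder w Y))%E.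

(* A path with values in X = X^c x X^s = R x R: the centre component first, the
   stable one second. *)
Definition cpath2 (R : realType) (d : nat) : Type := (cpath R d * cpath R d)%type.

Definition controlled2 (R : realType) (d : nat) (gamma : R)
    (w : R -> 'rV[R]_d) (U : cpath2 R d) : Prop :=
  controlled gamma w U.1 /\ controlled gamma w U.2.

Definition cnorm2 (R : realType) (d : nat) (gamma : R) (w : R -> 'rV[R]_d)
    (U : cpath2 R d) : \bar R :=
  (cnorm gamma w U.1 + cnorm gamma w U.2)%E.

(* Paths are total functions on R of which only the restriction to [0,1]
   matters. *)
Definition ceq (R : realType) (d : nat) (U V : cpath2 R d) : Prop :=
  forall t : R, 0 <= t <= 1 ->
    [/\ U.1.1 t = V.1.1 t, U.1.2 t = V.1.2 t,
        U.2.1 t = V.2.1 t & U.2.2 t = V.2.2 t].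

(* An integrand: values in L(R^d, R), Gubinelli derivative in
   L(R^d, L(R^d, R)); entry (i, j) of the latter is the derivative of the j-th
   component along the i-th coordinate of the noise. *)
Definition integrand (R : realType) (d : nat) : Type :=
  ((R -> 'rV[R]_d) * (R -> 'M[R]_d))%type.

Definition rough_sum (R : realType) (d : nat) (X : rough R d)
    (Y : integrand R d) (s : R) (p : seq R) : R :=
  \sum_(k < size p)
    let u := nth s (s :: p) k in let v := nth s p k in
    (dotrv (Y.1 u) (incr (rp1 X) u v) +
     \sum_i \sum_j Y.2 u i j * rp2 X u v i j).

Definition is_rough_int (R : realType) (d : nat) (X : rough R d)
    (Y : integrand R d) (s t I : R) : Prop :=
  forall e : R, 0 < e -> exists2 delta : R, 0 < delta &
    forall p : seq R, itv_partition s t p ->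
      (forall k, (k < size p)%N -> nth s p k - nth s (s :: p) k < delta) ->
      `|rough_sum X Y s p - I| < e.

Definition rough_int (R : realType) (d : nat) (X : rough R d)
    (Y : integrand R d) (s t : R) : R :=
  xget 0 [set I | is_rough_int X Y s t I].

Definition drift_conv (R : realType) (a : R) (F : R -> R) (s t u : R) : R :=
  \int[lebesgue_measure]_(r in `[s, t]) (expR (a * (u - r)) * F r).

Definition rough_conv (R : realType) (d : nat) (X : rough R d) (a : R)
    (Y : integrand R d) (s t u : R) : R :=
  rough_int X (fun r => expR (a * (u - r)) *: Y.1 r,
               fun r => expR (a * (u - r)) *: Y.2 r) s t.

Record metric_ds (R : realType) (disp : measure_display)
    (Omega : measurableType disp) (P : probability Omega R)
    (theta : R -> Omega -> Omega) : Prop := MetricDS {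
  mds0 : forall omega, theta 0 omega = omega ;
  mdsD : forall (s t : R) omega, theta (s + t) omega = theta s (theta t omega) ;
  mds_meas : measurable_fun setT
    (fun z : measurableTypeR R * Omega => theta z.1 z.2) ;
  mds_inv : forall (t : R) (A : set Omega), measurable A ->
    P (theta t @^-1` A) = P A }.

Definition tempered_above (R : realType) (Omega : Type)
    (theta : R -> Omega -> Omega) (Z : Omega -> R) : Prop :=
  forall omega,
    (Num.max 0 (ln (Z (theta t omega))) / `|t|) @[t --> +oo] --> (0 : R) /\
    (Num.max 0 (ln (Z (theta t omega))) / `|t|) @[t --> -oo] --> (0 : R).

Definition tempered_below (R : realType) (Omega : Type)
    (theta : R -> Omega -> Omega) (Z : Omega -> R) : Prop :=
  tempered_above theta (fun omega => (Z omega)^-1).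

Record tempered_radius (R : realType) (disp : measure_display)
    (Omega : measurableType disp) (theta : R -> Omega -> Omega)
    (Z : Omega -> R) : Prop := TemperedRadius {
  radius_meas : measurable_fun setT Z ;
  radius_in01 : forall omega, 0 < Z omega <= 1 ;
  radius_tempered : tempered_below theta Z }.

(* coc_tempered: a truncation radius has to be small against the noise on the
   unit blocks, so it can only be tempered from below if that noise is tempered
   from above. *)
Record rough_cocycle (R : realType) (disp : measure_display)
    (Omega : measurableType disp) (theta : R -> Omega -> Omega) (d : nat)
    (gamma : R) (W : Omega -> rough R d) : Prop := RoughCocycle {
  coc_rough : forall omega, is_rough_path gamma (W omega) ;
  coc_geom : forall omega, is_geometric gamma (W omega) ;
  coc_meas1 : forall t i, measurable_fun setT (fun omega => rp1 (W omega) t 0 i) ;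
  coc_meas2 : forall s t i j, s <= t ->
    measurable_fun setT (fun omega => rp2 (W omega) s t i j) ;
  coc_shift1 : forall omega (s t : R),
    incr (rp1 (W omega)) s (s + t) = rp1 (W (theta s omega)) t ;
  coc_shift2 : forall omega (s t : R), 0 <= t ->
    rp2 (W omega) s (s + t) = rp2 (W (theta s omega)) 0 t ;
  coc_tempered : tempered_above theta (fun omega => noise_size gamma (W omega)) }.

(* Both X^c and X^s are identified with R and X with R x R, normed by
   |x| + |y|.  A bivariate polynomial p : {poly {poly R}} has its inner variable
   in X^c and its outer variable in X^s.  The component k of G is the image of
   the k-th basis vector of R^d. *)
Record system (R : realType) (d : nat) := System {
  sAc : R ;
  sAs : R ;
  sFc : {poly {poly R}} ;
  sFs : {poly {poly R}} ;
  sGc : 'I_d -> {poly {poly R}} ;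
  sGs : 'I_d -> {poly {poly R}} }.

Definition ev2 (R : realType) (p : {poly {poly R}}) (z : R * R) : R :=
  p.[z.2, z.1].

Definition evG (R : realType) (d : nat) (G : 'I_d -> {poly {poly R}})
    (z : R * R) : 'rV[R]_d := \row_k ev2 (G k) z.

Definition total_degree_le (R : realType) (q : nat) (p : {poly {poly R}}) :=
  forall i j : nat, p`_j`_i != 0 -> (i + j <= q)%N.

Definition locally_lipschitz (R : realType) (U V : normedModType R)
    (f : U -> V) : Prop :=
  forall z : U, exists2 L : R, 0 <= L &
    \forall u \near z & v \near z, `|f u - f v| <= L * `|u - v|.

Record drift_ok (R : realType) (m q : nat) (p : {poly {poly R}}) : Prop :=
    DriftOk {
  drift_smooth : Ck m (ev2 p) ;
  drift_lip : locally_lipschitz (ev2 p) ;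
  drift_0 : ev2 p 0 = 0 ;
  drift_D0 : forall v, 'D_v (ev2 p) 0 = 0 ;
  drift_deg : total_degree_le q p }.

Record diffusion_ok (R : realType) (d m q : nat)
    (G : 'I_d -> {poly {poly R}}) : Prop := DiffusionOk {
  diff_smooth : Ck (m + 3) (evG G) ;
  diff_lip : locally_lipschitz (evG G) ;
  diff_0 : evG G 0 = 0 ;
  diff_D0 : forall v, 'D_v (evG G) 0 = 0 ;
  diff_DD0 : forall u v, 'D_u ('D_v (evG G)) 0 = 0 ;
  diff_deg : forall k, total_degree_le q (G k) }.

(* Every eigenvalue z of multiplication by a on R, in the complexification,
   satisfies S. *)
Definition spectrum_in (R : realType) (a : R) (S : R[i] -> Prop) : Prop :=
  forall z : R[i],
    eigenvalue ((real_complex R a)%:M : 'M[R[i]]_1) z -> S z.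

Record linear_ok (R : realType) (Ac As Mc Ms nu beta : R) : Prop := LinearOk {
  lin_specc : spectrum_in Ac (fun z => complex.Re z = 0) ;
  lin_specs : spectrum_in As (fun z => complex.Re z < 0) ;
  lin_const : 1 <= Mc /\ 1 <= Ms ;
  lin_rates : [/\ - beta < 0, 0 <= nu & nu < beta] ;
  lin_c : forall t x : R, t <= 0 ->
    `|expR (Ac * t) * x| <= Mc * expR (nu * t) * `|x| ;
  lin_s : forall t x : R, 0 <= t ->
    `|expR (As * t) * x| <= Ms * expR (- beta * t) * `|x| }.

Record is_cutoff (R : realType) (d : nat) (gamma L : R) (w : R -> 'rV[R]_d)
    (chi : cpath2 R d -> cpath2 R d) : Prop := IsCutoff {
  cutoff_into : forall U, controlled2 gamma w U -> controlled2 gamma w (chi U) ;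
  cutoff_lip : forall U V, controlled2 gamma w U -> controlled2 gamma w V ->
    (cnorm2 gamma w (chi U - chi V)%R <= L%:E * cnorm2 gamma w (U - V)%R)%E ;
  cutoff_id : forall U, controlled2 gamma w U ->
    (cnorm2 gamma w U <= (1 / 2)%:E)%E -> ceq (chi U) U ;
  cutoff_0 : forall U, controlled2 gamma w U ->
    (1%:E <= cnorm2 gamma w U)%E -> ceq (chi U) 0 }.

Definition chiR (R : realType) (d : nat) (chi : cpath2 R d -> cpath2 R d)
    (r : R) (U : cpath2 R d) : cpath2 R d := r *: chi (r^-1 *: U).

Definition FR (R : realType) (d : nat) (chi : cpath2 R d -> cpath2 R d)
    (r : R) (p : {poly {poly R}}) (U : cpath2 R d) (t : R) : R :=
  let V := chiR chi r U in ev2 p (V.1.1 t, V.2.1 t).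

(* The Gubinelli derivative of the composition is given by the chain rule. *)
Definition GR (R : realType) (d : nat) (chi : cpath2 R d -> cpath2 R d)
    (r : R) (G : 'I_d -> {poly {poly R}}) (U : cpath2 R d) : integrand R d :=
  let V := chiR chi r U in
  (fun t => evG G (V.1.1 t, V.2.1 t),
   fun t => \matrix_(i, j)
     'D_(V.1.2 t 0 i, V.2.2 t 0 i) (ev2 (G j)) (V.1.1 t, V.2.1 t)).

(* Blocks are numbered by n : nat: block n is [j-1, j] with j = -n. *)
Definition block_start (R : realType) (n : nat) : R := - (n.+1)%:R.

Definition block_noise (R : realType) (d : nat) (X : rough R d) (n : nat) :=
  shift_rough (block_start R n) X.

(* int_s^t e^{a(u-r)} F_R(U)[r] dr + int_s^t e^{a(u-r)} G_R(U)[r] d(noise)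
   on block n, where r is the truncation radius of that block. *)
Definition block_conv (R : realType) (d : nat)
    (chi : (R -> 'rV[R]_d) -> cpath2 R d -> cpath2 R d) (X : rough R d)
    (rad : nat -> R) (a : R) (p : {poly {poly R}})
    (G : 'I_d -> {poly {poly R}}) (n : nat) (U : cpath2 R d) (s t u : R) : R :=
  let c := chi (rp1 (block_noise X n)) in
  drift_conv a (FR c (rad n) p U) s t u +
  rough_conv (block_noise X n) a (GR c (rad n) G U) s t u.

(* With j = -n and k = -l, one has t + j - 1 - k = t - (n+1) + l; the sum over
   k = j+1, ..., 0 is over l < n and the one over k <= j-1 is over l >= n+1.
   The Gubinelli derivative of the image is G_R(U). *)
Definition LPmap (R : realType) (d : nat)
    (chi : (R -> 'rV[R]_d) -> cpath2 R d -> cpath2 R d) (S : system R d)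
    (X : rough R d) (rad : nat -> R) (xi : R) (U : nat -> cpath2 R d)
    (n : nat) : cpath2 R d :=
  let Bc := block_conv chi X rad (sAc S) (sFc S) (sGc S) in
  let Bs := block_conv chi X rad (sAs S) (sFs S) (sGs S) in
  let c := chi (rp1 (block_noise X n)) in
  ((fun t =>
      expR (sAc S * (t + block_start R n)) * xi
      - (\sum_(0 <= l < n)
           expR (sAc S * (t + block_start R n + l%:R)) * Bc l (U l) 0 1 1)
      - Bc n (U n) t 1 t,
    (GR c (rad n) (sGc S) (U n)).1),
   (fun t =>
      limn (fun N => \sum_(n.+1 <= l < N)
        expR (sAs S * (t + block_start R n + l%:R)) * Bs l (U l) 0 1 1)
      + Bs n (U n) 0 t t,
    (GR c (rad n) (sGs S) (U n)).1)).

(* Membership in BC^eta: the weight e^{-eta(j-1)} is e^{eta(n+1)}. *)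
Definition in_BC (R : realType) (d : nat) (gamma eta : R) (X : rough R d)
    (U : nat -> cpath2 R d) : Prop :=
  [/\ forall n, controlled2 gamma (rp1 (block_noise X n)) (U n),
      forall n, (U n).1.1 0 = (U n.+1).1.1 1 /\ (U n).2.1 0 = (U n.+1).2.1 1 &
      (ereal_sup (range (fun n => (expR (- eta * block_start R n))%:E *
         cnorm2 gamma (rp1 (block_noise X n)) (U n))) < +oo)%E].

Definition LP_fixed (R : realType) (d : nat) (gamma eta : R)
    (chi : (R -> 'rV[R]_d) -> cpath2 R d -> cpath2 R d) (S : system R d)
    (X : rough R d) (rad : nat -> R) (xi : R) (U : nat -> cpath2 R d) : Prop :=
  in_BC gamma eta X U /\ forall n, ceq (LPmap chi S X rad xi U n) (U n).

Definition LP_unique_fixed (R : realType) (d : nat) (gamma eta : R)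
    (chi : (R -> 'rV[R]_d) -> cpath2 R d -> cpath2 R d) (S : system R d)
    (X : rough R d) (rad : nat -> R) (xi : R) (U : nat -> cpath2 R d) : Prop :=
  LP_fixed gamma eta chi S X rad xi U /\
  forall V, LP_fixed gamma eta chi S X rad xi V -> forall n, ceq (V n) (U n).

Definition block_radius (R : realType) (Omega : Type)
    (theta : R -> Omega -> Omega) (Rad : Omega -> R) (omega : Omega) (n : nat) :=
  Rad (theta (block_start R n) omega).

(* x_{j-1+t} along the centre manifold, and h^c, read off the fixed point. *)
Definition center_sol (R : realType) (d : nat) (U : nat -> cpath2 R d)
    (n : nat) (t : R) : R := (U n).1.1 t.

Definition hc (R : realType) (d : nat) (U : nat -> cpath2 R d) : R :=
  (U 0%N).2.1 1.

Definition phi_poly (R : realType) (q : nat) (a : nat -> R) : {poly R} :=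
  \sum_(2 <= i < q.+1) a i *: 'X^i.

(* p^s(x, phi(x)) - sum_k k a_k x^{k-1} p^c(x, phi(x)) *)
Definition defect_poly (R : realType) (q : nat) (ps pc : {poly {poly R}})
    (a : nat -> R) : {poly R} :=
  ps.[phi_poly q a] -
  \sum_(2 <= k < q.+1) ((k%:R * a k) *: 'X^(k.-1)) * pc.[phi_poly q a].

Definition f_coef (R : realType) (d q : nat) (S : system R d) (i : nat)
    (a : nat -> R) : R := (defect_poly q (sFs S) (sFc S) a)`_i.

Definition g_coef (R : realType) (d q : nat) (S : system R d) (i : nat)
    (a : nat -> R) : 'rV[R]_d :=
  \row_k (defect_poly q (sGs S k) (sGc S k) a)`_i.

(* Gubinelli derivative of g_i(alpha): the derivative of a |-> g_i(a) applied
   to the Gubinelli derivatives alpha_k' = g_k(alpha). *)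
Definition g_coef' (R : realType) (d q : nat) (S : system R d) (i : nat)
    (a : nat -> R) : 'M[R]_d :=
  \matrix_(l, k) derive1
    (fun h : R => g_coef q S i (fun n => a n + h * g_coef q S n a 0 l) 0 k) 0.

Section AlphaPaths.
Context (R : realType) (d : nat) (Omega : Type) (theta : R -> Omega -> Omega)
  (q : nat) (S : system R d) (alpha : nat -> Omega -> R).

Definition alpha_at (omega : Omega) (r : R) (i : nat) : R :=
  alpha i (theta r omega).

Definition f_path (i : nat) (omega : Omega) (r : R) : R :=
  f_coef q S i (alpha_at omega r).

Definition g_path (i : nat) (omega : Omega) : integrand R d :=
  (fun r => g_coef q S i (alpha_at omega r),
   fun r => g_coef' q S i (alpha_at omega r)).

(* alpha_i as a path started at time tau, with Gubinelli derivative g_i. *)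
Definition alpha_cpath (i : nat) (omega : Omega) (tau : R) : cpath R d :=
  (fun t => alpha_at omega (t + tau) i, fun t => (g_path i omega).1 (t + tau)).

Definition A_alpha (i : nat) : R := sAs S - i%:R * sAc S.

(* The random dynamical system of the i-th equation; f_i and g_i only involve
   alpha_2, ..., alpha_{i-1}. *)
Definition alpha_rds (W : Omega -> rough R d) (i : nat) (t : R) (omega : Omega)
    (x : R) : R :=
  expR (A_alpha i * t) * x
  + drift_conv (A_alpha i) (f_path i omega) 0 t t
  + rough_conv (W omega) (A_alpha i) (g_path i omega) 0 t t.

Definition alpha_cocycle (W : Omega -> rough R d) (i : nat) : Prop :=
  forall omega (t : R), 0 <= t ->
    alpha_rds W i t omega (alpha i omega) = alpha i (theta t omega).

Definition alpha_pullback (W : Omega -> rough R d) (i : nat) : Prop :=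
  forall omega (s : R), s <= 0 -> exists If Ig : R,
    [/\ drift_conv (A_alpha i) (f_path i omega) T s s @[T --> -oo] --> If,
        rough_conv (W omega) (A_alpha i) (g_path i omega) T s s
          @[T --> -oo] --> Ig &
        alpha i (theta s omega) = If + Ig].

Definition phi_block (omega : Omega) (n : nat) (t x : R) : R :=
  \sum_(2 <= i < q.+1) alpha_at omega (t + block_start R n) i * x ^+ i.
End AlphaPaths.

Record alpha_ok (R : realType) (disp : measure_display)
    (Omega : measurableType disp) (theta : R -> Omega -> Omega) (d : nat)
    (gamma : R) (W : Omega -> rough R d) (q : nat) (S : system R d)
    (alpha : nat -> Omega -> R) : Prop := AlphaOk {
  alpha_1 : forall omega, alpha 1%N omega = 0 ;
  alpha_meas : forall i, (2 <= i <= q)%N -> measurable_fun setT (alpha i) ;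
  alpha_decay : forall i, (2 <= i <= q)%N -> exists M delta : R,
    0 < delta /\ forall t x : R, 0 <= t ->
      `|expR (A_alpha S i * t) * x| <= M * expR (- delta * t) * `|x| ;
  alpha_controlled : forall i omega, (2 <= i <= q)%N ->
    controlled gamma (rp1 (W omega)) (alpha_cpath theta q S alpha i omega 0) ;
  alpha_stationary : forall i, (2 <= i <= q)%N ->
    alpha_cocycle theta q S alpha W i ;
  alpha_integral : forall i, (2 <= i <= q)%N ->
    alpha_pullback theta q S alpha W i }.

Definition alpha_bound (R : realType) (Omega : Type)
    (theta : R -> Omega -> Omega) (d : nat) (gamma : R)
    (W : Omega -> rough R d) (q : nat) (S : system R d)
    (alpha : nat -> Omega -> R) (Rad : Omega -> R) (C : R) : Prop :=
  forall omega i n, (2 <= i <= q)%N ->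
    (cnorm gamma (rp1 (block_noise (W omega) n))
       (alpha_cpath theta q S alpha i omega (block_start R n))
     <= (C * block_radius theta Rad omega n)%:E)%E.

(* Main.v *)
Require Import Defs.
From mathcomp Require Import all_boot all_order all_algebra.
From mathcomp Require Import all_classical all_reals all_analysis.
From mathcomp Require Import polyXY measurable_realfun ring lra.
From mathcomp.real_closed Require Import complex.

(* The centre eigenvalue is real and on the imaginary axis, hence zero.  Rough
   integrals come from sewing, where additivity of the integral is obtained by
   taking the limit of the Riemann sums along an ultrafilter on finite sets of
   points.  With R = kappa / (noise size)^p and kappa small, the Lyapunov-Perron
   map is a contraction both for the weight eta and for a slowly growing weight
   e^{h(n+1)}; the fixed point for the latter satisfies |U^n| <= 2 |xi| e^{h(n+1)}.

   Let z = y - sum_i alpha_i x^i.  By the chain rule z solves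
   dz = (A^s z + Q_0) dt + Q_j dW^j, where, because the alpha_i cancel all powers
   of x up to q, every Q is z times a polynomial vanishing at x = z = 0 plus
   x^{q+1} times a polynomial vanishing at alpha = 0.  On the blocks where the
   cutoff is inactive this gives, with r = e^{A^s/4},
   |z^n(1)| <= r^2 |z^{n+1}(1)| + C (2 |xi| e^{h(n+1)})^{q+1}.
   The number N of such blocks satisfies r^{2N} <= C |xi|^{q+1} as soon as
   |xi| <= rho, so iterating over these N blocks bounds z^0(1). *)

Set Implicit Arguments.
Unset Strict Implicit.
Unset Printing Implicit Defensive.

Import Order.TTheory GRing.Theory Num.Theory.
Import numFieldNormedType.Exports.
Local Open Scope classical_set_scope.
Local Open Scope ring_scope.

(** The order of choices shapes the proof. The radius, that is [kappa] and the power [p] of the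
    noise size, is fixed before the constant in the bound on the alpha_i is known; only [rho] and
    [K] may depend on that constant. Polynomial estimates are therefore stated in the form: there is
    a power of the noise size such that for every bound [B] on the paths there is a constant.

    The weight for eta alone would be too weak, since its power q + 1 may outgrow the stable decay.
    The smaller weight satisfies h (q + 1) <= - A^s / 4, and uniqueness in the eta space identifies
    the two fixed points.

    The factor alpha in the term x^(q+1) exists because the nonlinearities have degree at most q.
    The bound of alpha by a multiple of the radius then absorbs the powers of the noise size, which
    makes [K] independent of omega.

    The cancellations are obtained algebraically: x, y and alpha_i are the variables 0, 1 and i of
    one polynomial function, and orders of vanishing are expressed as membership in products of
    ideals generated by variables. *)

Definition hpow (R : realType) (g s t : R) : R := (t - s) `^ g.

Lemma le_cvg_nat (R : realType) (u : nat -> R) (l x : R) :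
  u @ \oo --> l -> (forall n, x <= u n) -> x <= l.
Proof.
move=> ul xu; rewrite -(cvg_lim _ ul) //.
by apply: limr_ge; [exact: cvgP ul|exact: nearW].
Qed.

(** Iterations that improve a constant step by step end with this passage to the limit. *)
Lemma contract_limit (R : realType) (q A c x y : R) : 0 <= q -> q < 1 ->
  (forall n, x <= (A + q ^+ n * c) * y) -> x <= A * y.
Proof.
move=> q0 q1; apply: le_cvg_nat.
have -> : A * y = (A + 0 * c) * y by rewrite mul0r addr0.
apply: cvgM; last exact: cvg_cst.
apply: cvgD; first exact: cvg_cst.
by apply: cvgM; [apply: cvg_expr; rewrite ger0_norm|exact: cvg_cst].
Qed.

(** * The Hölder weight, whose square and cube carry the exponents 2 gamma and 3 gamma *)

Section HolderWeight.
Context (R : realType) (g : R).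
Hypothesis g_range : 1 / 3 < g <= 1 / 2.
Implicit Types s t u : R.
Local Notation h := (hpow g).

Lemma gamma_gt0 : 0 < g.
Proof. by case/andP: g_range; lra. Qed.

Lemma hpow_ge0 s t : 0 <= h s t. Proof. exact: powR_ge0. Qed.

Lemma hpow_refl s : h s s = 0.
Proof. by rewrite /hpow subrr powR0 // gt_eqF // gamma_gt0. Qed.

Lemma hpow_mono s t s' t' : s' <= t' -> s <= s' -> t' <= t -> h s' t' <= h s t.
Proof.
move=> st' ss tt; apply: ge0_ler_powR; rewrite ?nnegrE; try lra.
by move: gamma_gt0; lra.
Qed.

Lemma hpow_le1 s t : 0 <= s -> s <= t -> t <= 1 -> h s t <= 1.
Proof.
move=> s0 st t1; have <- : h 0 1 = 1 by rewrite /hpow subr0 powR1.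
exact: hpow_mono.
Qed.

Lemma hpow2 s t : s <= t -> (t - s) `^ (2 * g) = h s t ^+ 2.
Proof. by move=> st; rewrite mulrC powRrM powR_mulrn // powR_ge0. Qed.

Lemma hpow3 s t : s <= t -> (t - s) `^ (3 * g) = h s t ^+ 3.
Proof. by move=> st; rewrite mulrC powRrM powR_mulrn // powR_ge0. Qed.

Lemma le_hpow2 s t : 0 <= s -> s <= t -> t <= 1 -> t - s <= h s t ^+ 2.
Proof.
case/andP: g_range => g1 g2; move=> s0; rewrite le_eqVlt => /predU1P[<-|st] t1.
  by rewrite hpow_refl subrr expr0n.
rewrite -(hpow2 (ltW st)) -[leLHS]powRr1; last lra.
by apply: ger_powR; [apply/andP; split|]; lra.
Qed.

(** Equals 2^(1 - 3 gamma). Replacing an interval by two of at most half its length multiplies the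
    sum of the cubed weights by at most this factor, which is below 1 because 3 gamma > 1. *)
Definition half_pow : R := 2 * ((1 / 2) `^ g) ^+ 3.

Lemma half_pow_ge0 : 0 <= half_pow.
Proof. by rewrite /half_pow mulr_ge0 // exprn_ge0 // powR_ge0. Qed.

Lemma half_pow_lt1 : half_pow < 1.
Proof.
case/andP: g_range => g1 g2.
rewrite /half_pow -powR_mulrn ?powR_ge0 // -powRrM -mulr_powRB1; [|lra|lra].
have p0 : 0 < g * 3 - 1 by lra.
have := @gt0_ltr_powR R _ p0 (1 / 2) 1.
by rewrite !nnegrE powR1 => /(_ ltac:(lra) ltac:(lra) ltac:(lra)); lra.
Qed.

Lemma hpow_half s t s' t' : s <= t -> s' <= t' -> t' - s' <= (t - s) / 2 ->
  2 * h s' t' ^+ 3 <= half_pow * h s t ^+ 3.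
Proof.
move=> st st' le2; rewrite /half_pow -mulrA ler_pM2l // -exprMn.
rewrite lerXn2r ?nnegrE ?hpow_ge0 ?mulr_ge0 ?powR_ge0 //.
rewrite /hpow -powRM; [|lra|lra].
by apply: ge0_ler_powR; rewrite ?nnegrE; move: gamma_gt0; lra.
Qed.

(** The cubed weight is t - s times the power 3 gamma - 1 > 0 of t - s, so [delta] is e^(1 / (3
    gamma - 1)). *)
Lemma hpow_linear e : 0 < e -> exists2 delta, 0 < delta &
  forall s t, s <= t -> t - s < delta -> h s t ^+ 3 <= e * (t - s).
Proof.
case/andP: g_range => g1 g2 e0; pose p := 3 * g - 1; have p0 : 0 < p by rewrite /p; lra.
exists (e `^ p^-1); first exact: powR_gt0.
move=> s t st lt; rewrite -hpow3 // -mulr_powRB1; [|lra|lra].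
rewrite mulrC ler_wpM2r //; first lra.
rewrite -/p -[leRHS](powRr1 (ltW e0)).
have -> : 1 = p^-1 * p by rewrite mulVf // gt_eqF.
rewrite powRrM; apply: ge0_ler_powR; rewrite ?nnegrE ?powR_ge0 //; lra.
Qed.

End HolderWeight.

Lemma ultra_fmap (T U : Type) (f : T -> U) (F : set_system T) :
  UltraFilter F -> UltraFilter (f @ F).
Proof.
move=> FU; split; first exact: fmap_proper_filter.
move=> G GF sFG; rewrite predeqE => B; split; last exact: sFG.
move=> GB; have [//|nB] := in_ultra_setVsetC (f @^-1` B) FU.
have GnB : G (~` B) by apply: sFG.
by have /filter_ex [? []] : G (B `&` ~` B) by exact: filterI.
Qed.

(** * Sewing *)

Section Sewing.
Context (R : realType) (g : R).
Hypothesis g_range : 1 / 3 < g <= 1 / 2.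
Implicit Types (s t u A c e : R) (p : seq R) (Xi I : R -> R -> R).
Local Notation h := (hpow g).
Local Notation q0 := (half_pow g).

Fixpoint psum Xi s p : R :=
  if p is v :: p' then Xi s v + psum Xi v p' else 0.

Lemma psum_cat Xi s p1 p2 :
  psum Xi s (p1 ++ p2) = psum Xi s p1 + psum Xi (last s p1) p2.
Proof. by elim: p1 s => [|v p IH] s /=; rewrite ?add0r // IH addrA. Qed.

(** The coboundary condition of the sewing lemma with exponent 3 gamma, on the unit block only.
    Vanishing on the diagonal takes care of empty partitions. *)
Definition sewable Xi (A : R) : Prop :=
  (forall s, 0 <= s -> s <= 1 -> Xi s s = 0) /\
  forall s u t, 0 <= s -> s <= u -> u <= t -> t <= 1 ->
    `|Xi s t - Xi s u - Xi u t| <= A * h s t ^+ 3.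

Lemma path_le_last s p : path <=%R s p -> s <= last s p.
Proof.
elim: p s => [|v p IH] s //= /andP[sv /IH]; exact: le_trans.
Qed.

(* Split a partition at the interval containing the midpoint: both remaining
   pieces are at most half as long, so the errors form a geometric series. *)
Lemma psum_maximal Xi A s p : 0 <= A -> sewable Xi A ->
  path <=%R s p -> 0 <= s -> last s p <= 1 ->
  `|psum Xi s p - Xi s (last s p)| <= 2 * A / (1 - q0) * h s (last s p) ^+ 3.
Proof.
move=> A0 [Xi0 dXi]; set C := 2 * A / (1 - q0).
have q1 : q0 < 1 by exact: half_pow_lt1.
have C0 : 0 <= C by rewrite /C divr_ge0 //; lra.
have [n] := ubnP (size p); elim: n p s => // n IH p s.
case: p => [_ _ s0 s1|v0 p0].
  by rewrite /= sub0r Xi0 // oppr0 normr0 mulr_ge0 // exprn_ge0 // hpow_ge0.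
move: (v0 :: p0) (isT : v0 :: p0 != [::]) => p pn0 szp pp s0 l1; set t := last s p; set m := (s + t) / 2.
have st : s <= t by exact: path_le_last.
have hasm : has (fun x => m <= x) p.
  apply/hasP; exists t; last by rewrite /m; lra.
  by rewrite /t; case: {+}p pn0 => //= v ? _; exact: mem_last.
(* [u'] is the first partition point not before the midpoint [m], so its predecessor [u] is not
   after [m] and both outer pieces have at most half the length. *)
have [u' [p1 [p2 [mu nmu pE]]]] : exists u' p1 p2,
    [/\ m <= u', ~~ has (fun x => m <= x) p1 & p = p1 ++ u' :: p2].
  case: (split_find hasm) => u' p1 p2 mu nmu.
  by exists u', p1, p2; split; rewrite // cat_rcons.
have tE : t = last u' p2 by rewrite /t pE last_cat.
move: pp; rewrite pE cat_path /= => /and3P[pp1 uu' pp2].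
set u := last s p1 in uu'.
have su : s <= u by exact: path_le_last.
have u't : u' <= t by rewrite tE; exact: path_le_last.
have um : u <= m.
  rewrite /u; case: (lastP p1) nmu => [_|q x]; first by rewrite /= /m; lra.
  by rewrite has_rcons negb_or last_rcons -ltNge => /andP[/ltW].
have sz : (size p1 < n)%N /\ (size p2 < n)%N.
  move: szp; rewrite pE size_cat /= addnS !ltnS => szp.
  by split; apply: leq_trans szp; rewrite ltnS ?leq_addr ?leq_addl.
have u1 : u <= 1 by move: l1 um u't uu'; rewrite -/t; lra.
have H1 := IH _ _ sz.1 pp1 s0 u1.
have t1 : last u' p2 <= 1 by rewrite -tE.
have H2 := IH _ _ sz.2 pp2 ltac:(lra) t1.
rewrite -/u in H1; rewrite -tE in H2.
have D1 := dXi s u t s0 su ltac:(lra) l1.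
have D2 := dXi u u' t ltac:(lra) uu' u't l1.
have M2 : h u t ^+ 3 <= h s t ^+ 3.
  by rewrite lerXn2r ?nnegrE ?hpow_ge0 //; apply: hpow_mono => //; lra.
have K1 := hpow_half g_range st su ltac:(rewrite /m in um; lra).
have K2 := hpow_half g_range st u't ltac:(rewrite /m in mu; lra).
rewrite psum_cat /= -/u.
have -> : psum Xi s p1 + (Xi u u' + psum Xi u' p2) - Xi s t =
  (psum Xi s p1 - Xi s u) + (psum Xi u' p2 - Xi u' t)
  - (Xi s t - Xi s u - Xi u t) - (Xi u t - Xi u u' - Xi u' t) by ring.
(* [C] solves C = q0 C + 2 A: the two outer pieces together cost q0 C, and the insertion of each of
   the points [u] and [u'] costs A. *)
have E : C * h s t ^+ 3 = C * (q0 * h s t ^+ 3) + 2 * (A * h s t ^+ 3).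
  by rewrite /C; field; lra.
have := ler_wpM2l C0 K1; have := ler_wpM2l C0 K2; have := ler_wpM2l A0 M2.
rewrite E; move: H1 H2 D1 D2.
move: (h s t ^+ 3) (h u t ^+ 3) (h s u ^+ 3) (h u' t ^+ 3) => a b c d.
rewrite !ler_norml => /andP[? ?] /andP[? ?] /andP[? ?] /andP[? ?] ? ? ?.
apply/andP; split; nra.
Qed.

Definition cutpts s t (F : seq R) : seq R :=
  rcons (sort <=%R (undup [seq x <- F | s < x < t])) t.

Lemma cutpts_path s t F : s <= t -> path <=%R s (cutpts s t F).
Proof.
move=> st; rewrite /cutpts rcons_path; set l := sort _ _.
have lP x : x \in l -> s < x < t.
  by rewrite mem_sort mem_undup mem_filter => /andP[].
have sl : sorted <=%R l by exact: sort_le_sorted.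
apply/andP; split.
  rewrite path_min_sorted //; apply/allP => x /lP /andP[/ltW]//.
case: (lastP l) lP => [_|l' x lP] //=; rewrite last_rcons.
by have /andP[_ /ltW] := lP x ltac:(by rewrite mem_rcons mem_head).
Qed.

Lemma last_cutpts s t F : last s (cutpts s t F) = t.
Proof. by rewrite last_rcons. Qed.

Lemma cutpts_split s u t F : s < u -> u < t -> u \in F ->
  cutpts s t F = cutpts s u F ++ cutpts u t F.
Proof.
move=> su ut uF; rewrite /cutpts cat_rcons -rcons_cons -rcons_cat; congr rcons.
apply: (irr_sorted_eq lt_trans ltxx).
- by rewrite sort_lt_sorted undup_uniq.
- rewrite sorted_pairwise; last exact: lt_trans.
  rewrite pairwise_cat /= -!sorted_pairwise; try exact: lt_trans.
  rewrite !sort_lt_sorted !undup_uniq /= andbT.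
  apply/andP; split; last first.
    by apply/allP => x; rewrite mem_sort mem_undup mem_filter => /andP[/andP[]].
  apply/allrelP => x y; rewrite mem_sort mem_undup mem_filter.
  move=> /andP[/andP[_ xu] _]; rewrite inE => /predU1P[->//|].
  rewrite mem_sort mem_undup mem_filter => /andP[/andP[uy _] _].
  exact: lt_trans uy.
- move=> x; rewrite mem_cat inE !mem_sort !mem_undup !mem_filter.
  have [->|xu] := eqVneq x u; first by rewrite su ut uF /= orbT.
  move: xu; rewrite neq_lt => /orP[xu|ux].
    by rewrite xu (lt_trans xu ut) (lt_gtF xu) /= !orbF.
  by rewrite ux (lt_trans su ux) (lt_gtF ux).
Qed.

(* The ultrafilter limit of the Riemann sums over all finite sets of points is
   additive because every point eventually belongs to the set. *)
Lemma sewing_exists Xi A : 0 <= A -> sewable Xi A ->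
  exists I, (forall s u t, 0 <= s -> s <= u -> u <= t -> t <= 1 ->
      I s t = I s u + I u t) /\
    (forall s t, 0 <= s -> s <= t -> t <= 1 ->
      `|I s t - Xi s t| <= 2 * A / (1 - q0) * h s t ^+ 3).
Proof.
move=> A0 sX; set C := 2 * A / (1 - q0).
(* Finite lists are directed by inclusion of their members; [base] is the filter of tails. *)
pose base : set_system (seq R) :=
  [set B | exists F0 : seq R, forall F : seq R, {subset F0 <= F} -> B F].
have baseF : ProperFilter base.
  split; first by move=> [F0 /(_ F0)] /(_ (fun _ => id)).
  split; first by exists [::].
    move=> P Q [F1 H1] [F2 H2]; exists (F1 ++ F2) => F sF; split.
      by apply: H1 => x xF; apply: sF; rewrite mem_cat xF.
    by apply: H2 => x xF; apply: sF; rewrite mem_cat xF orbT.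
  by move=> P Q PQ [F1 H1]; exists F1 => F /H1 /PQ.
have [G [GU baseG]] := ultraFilterLemma baseF.
pose f s t F := psum Xi s (cutpts s t F).
have fb s t F : 0 <= s -> s <= t -> t <= 1 ->
    `|f s t F - Xi s t| <= C * h s t ^+ 3.
  move=> s0 st t1; have := @psum_maximal Xi A s (cutpts s t F) A0 sX.
  by rewrite last_cutpts; apply=> //; exact: cutpts_path.
have fcvg s t : 0 <= s -> s <= t -> t <= 1 ->
    exists l : R, f s t @ G --> l /\ `|l - Xi s t| <= C * h s t ^+ 3.
  move=> s0 st t1; set b := C * h s t ^+ 3.
  have := @segment_compact R (Xi s t - b) (Xi s t + b).
  rewrite compact_ultra => /(_ (f s t @ G) (ultra_fmap _ GU)) [].
    rewrite /fmap /=; apply: filterS filterT => F _ /=.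
    by rewrite in_itv /=; have := fb s t F s0 st t1; rewrite -/b ler_norml => /andP[? ?]; apply/andP; split; lra.
  move=> l [lb ?]; exists l; split => //.
  by move: lb; rewrite /= in_itv /= ler_norml -/b => /andP[? ?]; apply/andP; split; lra.
pose I s t := xget 0 [set l : R | f s t @ G --> l /\
  `|l - Xi s t| <= C * h s t ^+ 3].
have IP s t : 0 <= s -> s <= t -> t <= 1 ->
    f s t @ G --> I s t /\ `|I s t - Xi s t| <= C * h s t ^+ 3.
  by move=> s0 st t1; apply: (xgetPex 0 (fcvg s t s0 st t1)).
exists I; split; last by move=> s t s0 st t1; have [] := IP s t s0 st t1.
move=> s u t s0 su ut t1.
(* Degenerate intervals are treated apart, because [cutpts_split] needs a point strictly inside. *)
have I0 x : 0 <= x -> x <= 1 -> I x x = 0.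
  move=> x0 x1; have [_] := IP x x x0 (lexx x) x1.
  by rewrite sX.1 // subr0 hpow_refl // expr0n mulr0 normr_le0 => /eqP.
have [-> |nsu] := eqVneq s u; first by rewrite I0 ?add0r //; lra.
have [-> |nut] := eqVneq u t; first by rewrite I0 ?addr0 //; lra.
have [h1 _] := IP s t s0 ltac:(lra) t1.
have [h2 _] := IP s u s0 su ltac:(lra).
have [h3 _] := IP u t ltac:(lra) ut t1.
apply: (cvg_unique _ h1) => //=.
have h4 : (fun F => f s u F + f u t F) @ G --> I s u + I u t.
  exact: (@cvgD R _ _ G _ (f s u) (f u t) _ _ h2 h3).
apply: cvg_trans h4; apply: near_eq_cvg.
apply: baseG; exists [:: u] => F uF.
have uF' : u \in F by apply: uF; rewrite mem_head.
rewrite /f (@cutpts_split s u t) ?lt_neqAle ?nsu ?nut // psum_cat.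
by rewrite last_cutpts.
Qed.

Definition additive_on Xi := forall s u t, 0 <= s -> s <= u -> u <= t ->
  t <= 1 -> Xi s t = Xi s u + Xi u t.

(* Halving the interval repeatedly improves any a priori constant [c]. *)
Lemma sewing_bound I Xi A c : 0 <= A -> sewable Xi A -> additive_on I ->
  (forall s t, 0 <= s -> s <= t -> t <= 1 ->
     `|I s t - Xi s t| <= c * h s t ^+ 3) ->
  forall s t, 0 <= s -> s <= t -> t <= 1 ->
    `|I s t - Xi s t| <= A / (1 - q0) * h s t ^+ 3.
Proof.
move=> A0 [X0 dX] Iadd Ic.
have q1 : q0 < 1 by exact: half_pow_lt1.
have q00 : 0 <= q0 by exact: half_pow_ge0.
have B0 : 0 <= A / (1 - q0) by rewrite divr_ge0 //; lra.
pose C n := A / (1 - q0) + q0 ^+ n * `|c|.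
have step n : forall s t, 0 <= s -> s <= t -> t <= 1 ->
    `|I s t - Xi s t| <= C n * h s t ^+ 3.
  elim: n => [|n IH] s t s0 st t1.
    apply: le_trans (Ic s t s0 st t1) _; rewrite ler_wpM2r ?exprn_ge0 ?hpow_ge0 //.
    rewrite /C expr0 mul1r; have := ler_norm c; have := B0; move: (A / _) => B; lra.
  set m := (s + t) / 2.
  have sm : s <= m by rewrite /m; lra.
  have mt : m <= t by rewrite /m; lra.
  have e1 : m - s <= (t - s) / 2 by rewrite /m; lra.
  have e2 : t - m <= (t - s) / 2 by rewrite /m; lra.
  have H1 := IH s m s0 sm ltac:(lra); have H2 := IH m t ltac:(lra) mt t1.
  have D := dX s m t s0 sm mt t1.
  have K1 := hpow_half g_range st sm e1.
  have K2 := hpow_half g_range st mt e2.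
  rewrite (Iadd s m t) //.
  have -> : I s m + I m t - Xi s t = (I s m - Xi s m) + (I m t - Xi m t)
    - (Xi s t - Xi s m - Xi m t) by ring.
  have Cn0 : 0 <= C n by rewrite /C addr_ge0 // mulr_ge0 // exprn_ge0.
  have E : C n.+1 = A + q0 * C n.
    by rewrite /C exprS; field; lra.
  have := ler_wpM2l Cn0 K1; have := ler_wpM2l Cn0 K2.
  rewrite E; move: H1 H2 D; move: (C n) => Cn.
  move: (h s t ^+ 3) (h s m ^+ 3) (h m t ^+ 3) => a b d.
  rewrite !ler_norml => /andP[? ?] /andP[? ?] /andP[? ?] ? ?.
apply/andP; split; nra.
move=> s t s0 st t1.
apply: (@contract_limit R q0 _ `|c| _ (h s t ^+ 3)) => // n.
exact: step.
Qed.

(** For small mesh the error on each interval is at most e/2 times its length, and the lengths add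
    up to at most 1. *)
Lemma psum_mesh I Xi c e : additive_on I ->
  (forall s t, 0 <= s -> s <= t -> t <= 1 ->
     `|I s t - Xi s t| <= c * h s t ^+ 3) -> 0 < e ->
  exists2 delta, 0 < delta & forall s p, path <=%R s p ->
    path (fun u v => v - u < delta) s p -> 0 <= s -> last s p <= 1 ->
    `|psum Xi s p - I s (last s p)| < e.
Proof.
move=> Iadd Ic e0; pose c' := `|c| + 1; have c0 : 0 < c' by rewrite /c' ltr_wpDl.
have [delta d0 dP] := @hpow_linear R g g_range (e / 2 / c') ltac:(by rewrite !divr_gt0).
exists delta => //.
have main s p : path <=%R s p -> path (fun u v => v - u < delta) s p ->
    0 <= s -> last s p <= 1 ->
    `|psum Xi s p - I s (last s p)| <= e / 2 * (last s p - s).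
  elim: p s => [|v p IH] s /=.
    move=> _ _ s0 s1; rewrite subrr mulr0.
    have := Iadd s s s s0 (lexx s) (lexx s) s1 => E.
    have -> : I s s = 0 by lra.
    by rewrite subr0 normr0.
  move=> /andP[sv pv] /andP[dv pd] s0 l1.
  have vl := path_le_last pv.
  have H := IH v pv pd ltac:(lra) l1.
  rewrite (Iadd s v) //.
  have H2 := Ic s v s0 sv ltac:(lra).
  have H3 := dP s v sv dv.
  have H4 : c * h s v ^+ 3 <= e / 2 * (v - s).
    apply: le_trans (_ : c' * h s v ^+ 3 <= _).
      rewrite ler_wpM2r ?exprn_ge0 ?hpow_ge0 //.
      by rewrite /c'; have := ler_norm c; lra.
    apply: le_trans (ler_wpM2l (ltW c0) H3) _.
    by rewrite le_eqVlt; apply/orP; left; apply/eqP; field; lra.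
  move: H H2; rewrite !ler_norml.
  by move: H4; lra.
move=> s p pp pd s0 l1; apply: le_lt_trans (main s p pp pd s0 l1) _.
by have := path_le_last pp; nra.
Qed.

End Sewing.

(** * Controlled paths and rough integrals *)

Section RoughIntegral.
Context (R : realType) (g : R) (d : nat).
Hypothesis g_range : 1 / 3 < g <= 1 / 2.
Implicit Types (s t u a b c N : R) (Y Z : cpath R d) (X : rough R d).
Local Notation h := (hpow g).
Local Notation q0 := (half_pow g).
Local Notation D := (d%:R : R).

(** What the estimates on a unit block need of the noise, in coordinates and with a single constant.
    [N] is at least 1 so that a smaller power of it may be replaced by a larger one; [noise_geom] is
    the pointwise form of geometricity. *)
Record noise_on X N : Prop := NoiseOn {
  noise_ge1 : 1 <= N ;
  noise1 : forall s t i, 0 <= s -> s <= t -> t <= 1 ->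
    `|incr (rp1 X) s t 0 i| <= N * h s t ;
  noise2 : forall s t i j, 0 <= s -> s <= t -> t <= 1 ->
    `|rp2 X s t i j| <= N * h s t ^+ 2 ;
  noise_chen : forall s u t i j, 0 <= s -> s <= u -> u <= t -> t <= 1 ->
    rp2 X s t i j = rp2 X s u i j + rp2 X u t i j +
      incr (rp1 X) s u 0 i * incr (rp1 X) u t 0 j ;
  noise_geom : forall s t i j, 0 <= s -> s <= t -> t <= 1 ->
    rp2 X s t i j + rp2 X s t j i =
      incr (rp1 X) s t 0 i * incr (rp1 X) s t 0 j }.

Lemma incr_add (V : normedModType R) (f : R -> V) s u t :
  incr f s t = incr f s u + incr f u t.
Proof. by rewrite /incr [RHS]addrC addrA subrK. Qed.

Lemma ler_sum_cst (n : nat) (F : 'I_n -> R) c :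
  (forall i, `|F i| <= c) -> `|\sum_i F i| <= n%:R * c.
Proof.
move=> Fc; apply: le_trans (ler_norm_sum _ _ _) _.
apply: le_trans (_ : \sum_(i < n) c <= _); first exact: ler_sum.
by rewrite sumr_const card_ord mulr_natl.
Qed.

Lemma dotrvDl (x y z : 'rV[R]_d) : dotrv (x + y) z = dotrv x z + dotrv y z.
Proof. by rewrite -big_split; apply: eq_bigr => i _; rewrite mxE mulrDl. Qed.

Lemma dotrvDr (x y z : 'rV[R]_d) : dotrv z (x + y) = dotrv z x + dotrv z y.
Proof. by rewrite -big_split; apply: eq_bigr => i _; rewrite mxE mulrDr. Qed.

Lemma dotrvZl c (x z : 'rV[R]_d) : dotrv (c *: x) z = c * dotrv x z.
Proof. by rewrite /dotrv mulr_sumr; apply: eq_bigr => i _; rewrite mxE mulrA. Qed.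

Lemma dotrv0l (z : 'rV[R]_d) : dotrv 0 z = 0.
Proof. by rewrite -(scale0r z) dotrvZl mul0r. Qed.

Lemma dotrv_le (x z : 'rV[R]_d) a b : (forall i, `|x 0 i| <= a) ->
  (forall i, `|z 0 i| <= b) -> `|dotrv x z| <= D * (a * b).
Proof.
by move=> xa zb; apply: ler_sum_cst => i; rewrite normrM ler_pM.
Qed.

Definition mdot (A B : 'M[R]_d) : R := \sum_i \sum_j A i j * B i j.

Lemma mdotDl (A B C : 'M[R]_d) : mdot (A + B) C = mdot A C + mdot B C.
Proof.
rewrite /mdot -big_split; apply: eq_bigr => i _.
by rewrite -big_split; apply: eq_bigr => j _; rewrite !mxE mulrDl.
Qed.

Lemma mdotBl (A B C : 'M[R]_d) : mdot (A - B) C = mdot A C - mdot B C.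
Proof.
rewrite /mdot -sumrB; apply: eq_bigr => i _.
by rewrite -sumrB; apply: eq_bigr => j _; rewrite !mxE mulrBl.
Qed.

Lemma mdotZl c (A C : 'M[R]_d) : mdot (c *: A) C = c * mdot A C.
Proof.
rewrite /mdot mulr_sumr; apply: eq_bigr => i _.
by rewrite mulr_sumr; apply: eq_bigr => j _; rewrite !mxE mulrA.
Qed.

Lemma mdot_le (A B : 'M[R]_d) a b : (forall i j, `|A i j| <= a) ->
  (forall i j, `|B i j| <= b) -> `|mdot A B| <= D * (D * (a * b)).
Proof.
move=> Aa Bb; apply: ler_sum_cst => i; apply: ler_sum_cst => j.
by rewrite normrM ler_pM.
Qed.

(* Same as the controlled-path norm being at most [b], up to a factor 4, but
   stable under limits and free of extended reals. *)
Definition cbound (w : R -> 'rV[R]_d) Y b : Prop :=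
  [/\ forall t, 0 <= t -> t <= 1 -> `|Y.1 t| <= b,
      forall t i, 0 <= t -> t <= 1 -> `|Y.2 t 0 i| <= b,
      forall s t i, 0 <= s -> s <= t -> t <= 1 ->
        `|Y.2 t 0 i - Y.2 s 0 i| <= b * h s t
    & forall s t, 0 <= s -> s <= t -> t <= 1 ->
        `|remainder w Y s t| <= b * h s t ^+ 2].

Definition peq Y Z := forall t, 0 <= t -> t <= 1 -> Y.1 t = Z.1 t /\ Y.2 t = Z.2 t.

Lemma cbound_peq w Y Z b : peq Y Z -> cbound w Y b -> cbound w Z b.
Proof.
move=> YZ [H1 H2 H3 H4]; split.
- by move=> t t0 t1; have [<- _] := YZ t t0 t1; exact: H1.
- by move=> t i t0 t1; have [_ <-] := YZ t t0 t1; exact: H2.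
- move=> s t i s0 st t1; have [_ <-] := YZ t (le_trans s0 st) t1.
  by have [_ <-] := YZ s s0 (le_trans st t1); exact: H3.
- move=> s t s0 st t1; rewrite /remainder.
  have [<- _] := YZ t (le_trans s0 st) t1.
  by have [<- <-] := YZ s s0 (le_trans st t1); exact: H4.
Qed.

Lemma cbound_ge0 w Y b : cbound w Y b -> 0 <= b.
Proof. by case=> /(_ 0 (lexx 0) ler01) H _ _ _; exact: le_trans H. Qed.

Lemma cbound_le w Y b b' : b <= b' -> cbound w Y b -> cbound w Y b'.
Proof.
move=> bb [H1 H2 H3 H4]; split=> *.
- by apply: le_trans (H1 _ _ _) bb.
- by apply: le_trans (H2 _ _ _ _) bb.
- by apply: le_trans (H3 _ _ _ _ _ _) _ => //; rewrite ler_wpM2r // hpow_ge0.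
- apply: le_trans (H4 _ _ _ _ _) _ => //.
  by rewrite ler_wpM2r // exprn_ge0 // hpow_ge0.
Qed.

Lemma remainderD w Y Z s t :
  remainder w (Y + Z) s t = remainder w Y s t + remainder w Z s t.
Proof.
rewrite /remainder -[(Y + Z).1 t]/(Y.1 t + Z.1 t) -[(Y + Z).1 s]/(Y.1 s + Z.1 s).
by rewrite -[(Y + Z).2 s]/(Y.2 s + Z.2 s) dotrvDl; ring.
Qed.

Lemma remainderZ w c Y s t :
  remainder w (c *: Y) s t = c * remainder w Y s t.
Proof.
rewrite /remainder -[(c *: Y).1 t]/(c * Y.1 t) -[(c *: Y).1 s]/(c * Y.1 s).
by rewrite -[(c *: Y).2 s]/(c *: Y.2 s) dotrvZl; ring.
Qed.

Lemma cboundD w Y Z a b : cbound w Y a -> cbound w Z b -> cbound w (Y + Z) (a + b).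
Proof.
move=> [H1 H2 H3 H4] [G1 G2 G3 G4]; split.
- by move=> t t0 t1; apply: le_trans (ler_normD _ _) _; rewrite lerD ?H1 ?G1.
- move=> t i t0 t1; rewrite mxE; apply: le_trans (ler_normD _ _) _.
  by rewrite lerD ?H2 ?G2.
- move=> s t i s0 st t1; rewrite /= !mxE opprD addrACA mulrDl.
  by apply: le_trans (ler_normD _ _) _; rewrite lerD ?H3 ?G3.
- move=> s t s0 st t1; rewrite remainderD mulrDl.
  by apply: le_trans (ler_normD _ _) _; rewrite lerD ?H4 ?G4.
Qed.

Lemma cboundZ w c Y a : cbound w Y a -> cbound w (c *: Y) (`|c| * a).
Proof.
move=> [H1 H2 H3 H4]; split.
- by move=> t t0 t1; rewrite normrM ler_wpM2l ?H1.
- by move=> t i t0 t1; rewrite mxE normrM ler_wpM2l ?H2.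
- by move=> s t i s0 st t1; rewrite /= !mxE -mulrBr normrM -mulrA ler_wpM2l ?H3.
- by move=> s t s0 st t1; rewrite remainderZ normrM -mulrA ler_wpM2l ?H4.
Qed.

Lemma cboundN w Y a : cbound w Y a -> cbound w (- Y) a.
Proof. by rewrite -scaleN1r => /(cboundZ (-1)); rewrite normrN normr1 mul1r. Qed.

Lemma cbound0 w : cbound w 0 0.
Proof.
split; move=> *; rewrite ?mul0r /= ?mxE ?subrr ?normr0 //.
by rewrite /remainder /= dotrv0l !subr0 normr0.
Qed.

Lemma cbound_contract w Y q A c : 0 <= q -> q < 1 ->
  (forall n, cbound w Y (A + q ^+ n * c)) -> cbound w Y A.
Proof.
move=> q0 q1 H; split=> *.
- rewrite -[A]mulr1; apply: (contract_limit q0 q1 (c := c)) => n.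
  by rewrite mulr1; case: (H n) => H1 *; exact: H1.
- rewrite -[A]mulr1; apply: (contract_limit q0 q1 (c := c)) => n.
  by rewrite mulr1; case: (H n) => _ H1 *; exact: H1.
- apply: (contract_limit q0 q1 (c := c)) => n.
  by case: (H n) => _ _ H1 *; exact: H1.
- apply: (contract_limit q0 q1 (c := c)) => n.
  by case: (H n) => _ _ _ H1 *; exact: H1.
Qed.

Definition cmul Y Z : cpath R d :=
  (fun t => Y.1 t * Z.1 t, fun t => Y.1 t *: Z.2 t + Z.1 t *: Y.2 t).

Section Noise.
Context (X : rough R d) (N : R).
Hypothesis HX : noise_on X N.
Local Notation w := (rp1 X).
Local Notation cb := (cbound w).

Definition hconst : R := (D + 1) * N.

Lemma hconst_ge1 : 1 <= hconst.
Proof.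
have N1 := noise_ge1 HX; have D0 : 0 <= D by exact: ler0n.
by rewrite /hconst; nra.
Qed.

(** The increment is the remainder plus the Gubinelli derivative applied to the noise, and h^2 <= h
    on the unit interval. *)
Lemma cbound_holder Y b s t : cb Y b -> 0 <= s -> s <= t -> t <= 1 ->
  `|Y.1 t - Y.1 s| <= hconst * b * h s t.
Proof.
move=> Yb s0 st t1; have b0 := cbound_ge0 Yb; case: Yb => _ H2 _ H4.
have -> : Y.1 t - Y.1 s = remainder w Y s t + dotrv (Y.2 s) (incr w s t).
  by rewrite /remainder; ring.
apply: le_trans (ler_normD _ _) _.
have h0 := hpow_ge0 g s t; have h1 := hpow_le1 g_range s0 st t1.
have N1 := noise_ge1 HX; have D0 : 0 <= D by exact: ler0n.
have e1 := H4 s t s0 st t1.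
have e2 : `|dotrv (Y.2 s) (incr w s t)| <= D * (b * (N * h s t)).
  apply: dotrv_le => i; first by apply: H2 => //; exact: le_trans t1.
  exact: (noise1 HX).
apply: le_trans (lerD e1 e2) _.
rewrite /hconst; set x := h s t in h0 h1 *.
have : b * x ^+ 2 <= N * b * x.
  rewrite expr2 mulrA ler_wpM2r // mulrC ler_wpM2r //; lra.
by nra.
Qed.

Definition mulconst : R := 4 * hconst ^+ 2.

Lemma mulconst_ge1 : 1 <= mulconst.
Proof. by rewrite /mulconst; have := hconst_ge1; nra. Qed.

(** The remainder of the product is Y R^Z + Z R^Y plus the product of the two increments. The
    increments are only gamma-Hölder, each with a factor [hconst], which explains its square in
    [mulconst]. *)
Lemma cbound_mul Y Z a b : cb Y a -> cb Z b -> cb (cmul Y Z) (mulconst * (a * b)).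
Proof.
move=> Ya Zb.
have a0 := cbound_ge0 Ya; have b0 := cbound_ge0 Zb.
have k1 := hconst_ge1; set k := hconst in k1 *.
have ab0 : 0 <= a * b by exact: mulr_ge0.
have Yh := cbound_holder Ya; have Zh := cbound_holder Zb.
case: (Ya) (Zb) => [H1 H2 H3 H4] [G1 G2 G3 G4].
have K2 : 2 + 2 * k <= mulconst by rewrite /mulconst -/k; nra.
have K3 : 2 + k ^+ 2 <= mulconst by rewrite /mulconst -/k; nra.
split.
- move=> t t0 t1; rewrite normrM; apply: le_trans (ler_pM _ _ (H1 t t0 t1) (G1 t t0 t1)) _ => //.
  by rewrite ler_peMl // mulconst_ge1.
- move=> t i t0 t1; rewrite /= !mxE; apply: le_trans (ler_normD _ _) _.
  rewrite !normrM.
  have := ler_pM (normr_ge0 _) (normr_ge0 _) (H1 t t0 t1) (G2 t i t0 t1).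
  have := ler_pM (normr_ge0 _) (normr_ge0 _) (G1 t t0 t1) (H2 t i t0 t1).
  by move: K2; move: mulconst => m K2 e1 e2; nra.
- move=> s t i s0 st t1; rewrite /= !mxE.
  have t0 : 0 <= t by lra. have s1 : s <= 1 by lra.
  have -> : Y.1 t * Z.2 t 0 i + Z.1 t * Y.2 t 0 i -
      (Y.1 s * Z.2 s 0 i + Z.1 s * Y.2 s 0 i) =
    (Y.1 t * (Z.2 t 0 i - Z.2 s 0 i) + Z.1 t * (Y.2 t 0 i - Y.2 s 0 i)) +
    ((Y.1 t - Y.1 s) * Z.2 s 0 i + (Z.1 t - Z.1 s) * Y.2 s 0 i) by ring.
  have e1 := ler_pM (normr_ge0 _) (normr_ge0 _) (H1 t t0 t1) (G3 s t i s0 st t1).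
  have e2 := ler_pM (normr_ge0 _) (normr_ge0 _) (G1 t t0 t1) (H3 s t i s0 st t1).
  have e3 := ler_pM (normr_ge0 _) (normr_ge0 _) (Yh s t s0 st t1) (G2 s i s0 s1).
  have e4 := ler_pM (normr_ge0 _) (normr_ge0 _) (Zh s t s0 st t1) (H2 s i s0 s1).
  rewrite -!normrM -/k in e1 e2 e3 e4.
  apply: le_trans (ler_normD _ _) _.
  apply: le_trans (lerD (ler_normD _ _) (ler_normD _ _)) _.
  apply: le_trans (lerD (lerD e1 e2) (lerD e3 e4)) _.
  have -> : a * (b * h s t) + b * (a * h s t) + (k * a * h s t * b + k * b * h s t * a)
    = (2 + 2 * k) * (a * b) * h s t by ring.
  by rewrite !ler_wpM2r // hpow_ge0.
- move=> s t s0 st t1.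
  have s1 : s <= 1 by lra.
  have -> : remainder w (cmul Y Z) s t = (Y.1 s * remainder w Z s t +
    Z.1 s * remainder w Y s t) + (Y.1 t - Y.1 s) * (Z.1 t - Z.1 s).
    by rewrite /remainder /= dotrvDl !dotrvZl; ring.
  have e1 := ler_pM (normr_ge0 _) (normr_ge0 _) (H1 s s0 s1) (G4 s t s0 st t1).
  have e2 := ler_pM (normr_ge0 _) (normr_ge0 _) (G1 s s0 s1) (H4 s t s0 st t1).
  have e3 := ler_pM (normr_ge0 _) (normr_ge0 _) (Yh s t s0 st t1) (Zh s t s0 st t1).
  rewrite -!normrM -/k in e1 e2 e3.
  apply: le_trans (ler_normD _ _) _.
  apply: le_trans (lerD (ler_normD _ _) (lexx _)) _.
  apply: le_trans (lerD (lerD e1 e2) e3) _.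
  have -> : a * (b * h s t ^+ 2) + b * (a * h s t ^+ 2) + k * a * h s t * (k * b * h s t)
    = (2 + k ^+ 2) * (a * b) * h s t ^+ 2 by ring.
  by rewrite !ler_wpM2r // exprn_ge0 // hpow_ge0.
Qed.

(** Increments of a Lipschitz function count as remainder, since t - s <= h^2 when 2 gamma <= 1. *)
Lemma cbound_smooth (f : R -> R) b : (forall t, 0 <= t -> t <= 1 -> `|f t| <= b) ->
  (forall s t, 0 <= s -> s <= t -> t <= 1 -> `|f t - f s| <= b * (t - s)) ->
  cb (f, fun=> 0) b.
Proof.
move=> fb fl; have b0 : 0 <= b by apply: le_trans (fb 0 _ _).
split=> //=.
- by move=> t i _ _; rewrite mxE normr0.
- by move=> s t i *; rewrite mxE subrr normr0 mulr_ge0 // hpow_ge0.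
- move=> s t s0 st t1; rewrite /remainder /= dotrv0l subr0.
  by apply: le_trans (fl s t s0 st t1) _; rewrite ler_wpM2l // le_hpow2.
Qed.

(** Rows of [Z.2] are indexed by the direction of the noise, so the j-th component of an integrand
    has column j as its Gubinelli derivative. *)
Definition icomp (Z : integrand R d) (j : 'I_d) : cpath R d :=
  (fun t => Z.1 t 0 j, fun t => \row_i Z.2 t i j).

(** The drift is part of the germ, so that one sewing argument controls the Lebesgue and the rough
    integral together. *)
Definition germ (F : R -> R) (Z : integrand R d) s t : R :=
  F s * (t - s) + (dotrv (Z.1 s) (incr w s t) + mdot (Z.2 s) (rp2 X s t)).

Definition holder_path (F : R -> R) b := forall s t, 0 <= s -> s <= t -> t <= 1 ->
  `|F t - F s| <= b * h s t.

Lemma rp2_refl s i j : 0 <= s -> s <= 1 -> rp2 X s s i j = 0.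
Proof.
move=> s0 s1; apply/eqP; rewrite -normr_le0.
have := noise2 HX i j s0 (lexx s) s1.
by rewrite hpow_refl // expr0n mulr0.
Qed.

Definition germconst : R := (1 + D + D * D) * N.

(** Chen's relation turns the coboundary into three products: increment of the drift times length,
    remainder times increment of the noise, and increment of the derivative times second level. Each
    has order 3 gamma. *)
Lemma germ_sewable F (Z : integrand R d) b : holder_path F b -> 0 <= b ->
  (forall j, cb (icomp Z j) b) -> sewable g (germ F Z) (germconst * b).
Proof.
move=> Fb b0 Zb; have N1 := noise_ge1 HX; split.
  move=> s s0 s1; rewrite /germ subrr mulr0 add0r /dotrv /mdot big1 => [|i _].
    rewrite add0r big1 // => i _; rewrite big1 // => j _.
    by rewrite rp2_refl // mulr0.
  by rewrite /incr subrr mxE mulr0.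
move=> s u t s0 su ut t1.
have -> : germ F Z s t - germ F Z s u - germ F Z u t =
  - ((F u - F s) * (t - u)) - (\sum_j remainder w (icomp Z j) s u * incr w u t 0 j)
  - mdot (Z.2 u - Z.2 s) (rp2 X u t).
  rewrite mdotBl /germ (incr_add w s u t) dotrvDr.
  have -> : mdot (Z.2 s) (rp2 X s t) = mdot (Z.2 s) (rp2 X s u) +
     mdot (Z.2 s) (rp2 X u t) +
     \sum_j dotrv (\row_i Z.2 s i j) (incr w s u) * incr w u t 0 j.
    rewrite /mdot /dotrv.
    under [X in _ = _ + X]eq_bigr do rewrite mulr_suml.
    rewrite [X in _ = _ + X]exchange_big /= -!big_split; apply: eq_bigr => i _.
    rewrite -!big_split; apply: eq_bigr => j _ /=.
    by rewrite mxE (noise_chen HX i j s0 su ut t1) !mulrDr mulrA.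
  have -> : \sum_j remainder w (icomp Z j) s u * incr w u t 0 j =
    dotrv (Z.1 u) (incr w u t) - dotrv (Z.1 s) (incr w u t) -
     \sum_j dotrv (\row_i Z.2 s i j) (incr w s u) * incr w u t 0 j.
    rewrite /dotrv -!sumrB; apply: eq_bigr => j _.
    by rewrite /remainder /= !mulrBl.
  ring.
have st : s <= t by lra. have u1 : u <= 1 by lra. have u0 : 0 <= u by lra.
set x := h s t.
have x0 : 0 <= x := hpow_ge0 g s t.
have hsu : h s u <= x by exact: hpow_mono.
have hut : h u t <= x by exact: hpow_mono.
have hsu0 := hpow_ge0 g s u; have hut0 := hpow_ge0 g u t.
have x2 : h u t ^+ 2 <= x ^+ 2 by rewrite lerXn2r ?nnegrE.
have x2' : h s u ^+ 2 <= x ^+ 2 by rewrite lerXn2r ?nnegrE.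
have tu : t - u <= x ^+ 2 by apply: le_trans x2; exact: le_hpow2.
have e1 : `|(F u - F s) * (t - u)| <= b * x ^+ 3.
  rewrite normrM (ger0_norm (_ : 0 <= t - u)); last lra.
  have -> : b * x ^+ 3 = (b * x) * x ^+ 2 by ring.
  apply: ler_pM => //; first lra.
  by apply: le_trans (Fb s u s0 su u1) _; rewrite ler_wpM2l.
have e2 : `|\sum_j remainder w (icomp Z j) s u * incr w u t 0 j| <= D * (b * N * x ^+ 3).
  apply: ler_sum_cst => j; rewrite normrM.
  have -> : b * N * x ^+ 3 = (b * x ^+ 2) * (N * x) by ring.
  case: (Zb j) => _ _ _ /(_ s u s0 su u1) H.
  apply: ler_pM => //; first by apply: le_trans H _; rewrite ler_wpM2l.
  by apply: le_trans (noise1 HX j u0 ut t1) _; rewrite ler_wpM2l //; lra.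
have e3 : `|mdot (Z.2 u - Z.2 s) (rp2 X u t)| <= D * (D * ((b * x) * (N * x ^+ 2))).
  apply: mdot_le => i j.
    rewrite !mxE; case: (Zb j) => _ _ /(_ s u i s0 su u1) + _.
    by rewrite /= !mxE => H; apply: le_trans H _; rewrite ler_wpM2l.
  by apply: le_trans (noise2 HX i j u0 ut t1) _; rewrite ler_wpM2l //; lra.
apply: le_trans (ler_normB _ _) _.
apply: le_trans (lerD (ler_normB _ _) e3) _.
rewrite normrN; apply: le_trans (lerD (lerD e1 e2) (lexx _)) _.
have : b * x ^+ 3 <= N * (b * x ^+ 3) by rewrite ler_peMl // mulr_ge0 // exprn_ge0.
have -> : germconst * b * x ^+ 3 = N * (b * x ^+ 3) + D * (b * N * x ^+ 3) +
  D * (D * (b * x * (N * x ^+ 2))) by rewrite /germconst; ring.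
by rewrite !lerD2r.
Qed.

(** The difference of the two maps is additive and is sewn from the zero germ, for which
    [sewing_bound] gives the constant 0. *)
Lemma sewing_unique I J (Xi : R -> R -> R) c c' : additive_on I -> additive_on J ->
  (forall s t, 0 <= s -> s <= t -> t <= 1 -> `|I s t - Xi s t| <= c * h s t ^+ 3) ->
  (forall s t, 0 <= s -> s <= t -> t <= 1 -> `|J s t - Xi s t| <= c' * h s t ^+ 3) ->
  forall s t, 0 <= s -> s <= t -> t <= 1 -> I s t = J s t.
Proof.
move=> Ia Ja Ic Jc s t s0 st t1.
have S0 : sewable g (fun _ _ : R => 0 : R) 0.
  by split=> // *; rewrite !subr0 normr0 mul0r.
have Da : additive_on (fun s t => I s t - J s t).
  by move=> x y z *; rewrite (Ia x y z) // (Ja x y z) //; ring.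
have := @sewing_bound R g g_range _ _ 0 (c + c') (lexx 0) S0 Da _ s t s0 st t1.
rewrite !mul0r subr0 normr_le0 subr_eq0 => H; apply/eqP/H => x y *.
have -> : I x y - J x y - 0 = (I x y - Xi x y) - (J x y - Xi x y) by ring.
by rewrite mulrDl; apply: le_trans (ler_normB _ _) _; rewrite lerD ?Ic ?Jc.
Qed.

(** Without partitions of arbitrarily small mesh [is_rough_int] would determine no value; this is
    the source of its uniqueness. *)
Lemma fine_partition delta s t : 0 < delta -> s <= t -> exists p,
  [/\ path <%R s p, last s p = t & path (fun u v => v - u < delta) s p].
Proof.
move=> d0 st.
have [n nP] : exists n : nat, t - s < n%:R * (delta / 2).
  have := archi_boundP (_ : 0 <= (t - s) / (delta / 2)).
  rewrite ltr_pdivrMr; last lra.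
  by move=> H; eexists; apply: H; rewrite divr_ge0; lra.
elim: n s st nP => [|n IH] s st; first by rewrite mul0r; lra.
have [->|snt] := eqVneq s t; first by exists [::].
have st' : s < t by rewrite lt_neqAle snt.
have [small _|big] := ltP (t - s) delta.
  by exists [:: t]; split; rewrite //= ?small ?andbT.
rewrite -natr1 mulrDl => nP.
have [|//|p [p1 p2 p3]] := IH (s + delta / 2); [lra|lra|].
exists (s + delta / 2 :: p); split => //=.
  by rewrite p1 andbT; lra.
by rewrite p3 andbT; lra.
Qed.

Lemma rough_sum_psum (Z : integrand R d) s p :
  rough_sum X Z s p = psum (germ (fun=> 0) Z) s p.
Proof.
elim: p s => [|v p IH] s; first by rewrite /rough_sum big_ord0.
rewrite /rough_sum big_ord_recl /= /germ mul0r add0r; congr +%R.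
rewrite -IH; apply: eq_bigr => k _ /=.
by rewrite !add0n !(set_nth_default v s) //= ltnS ltnW.
Qed.

Lemma is_rough_int_psum (Z : integrand R d) s t I :
  is_rough_int X Z s t I <-> forall e, 0 < e -> exists2 delta, 0 < delta &
    forall p, path <%R s p -> last s p = t -> path (fun u v => v - u < delta) s p ->
      `|psum (germ (fun=> 0) Z) s p - I| < e.
Proof.
split=> H e /H [delta d0 dP]; exists delta => // p.
  move=> p1 p2 p3; rewrite -rough_sum_psum; apply: dP.
    by split => //; rewrite p2.
  by move=> k kp; move/(pathP s): p3; apply.
move=> [p1 /eqP p2] p3; rewrite rough_sum_psum; apply: dP => //.
by apply/(pathP s).
Qed.

Lemma is_rough_int_unique (Z : integrand R d) s t I J : s <= t ->
  is_rough_int X Z s t I -> is_rough_int X Z s t J -> I = J.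
Proof.
move=> st /is_rough_int_psum HI /is_rough_int_psum HJ.
apply/eqP; rewrite -subr_eq0 -normr_le0; apply/ler_addgt0Pl => e e0; rewrite addr0.
have [d1 d10 H1] := HI (e / 2) ltac:(lra); have [d2 d20 H2] := HJ (e / 2) ltac:(lra).
have dm : 0 < Num.min d1 d2 by rewrite lt_min d10.
have [p [p1 p2 p3]] := fine_partition dm st.
have q1 : path (fun u v => v - u < d1) s p.
  by apply: sub_path p3 => u v; rewrite lt_min => /andP[].
have q2 : path (fun u v => v - u < d2) s p.
  by apply: sub_path p3 => u v; rewrite lt_min => /andP[].
move: (H1 p p1 p2 q1) (H2 p p1 p2 q2); move: (psum _ _ _) => x.
by rewrite ler_norml !ltr_norml => /andP[? ?] /andP[? ?]; apply/andP; split; lra.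
Qed.

(** Identifies the value picked by [xget] with the sewn additive map: the Riemann sums converge to
    the latter, and their limit is unique. *)
Lemma rough_int_germ (Z : integrand R d) b : (forall j, cb (icomp Z j) b) -> 0 <= b ->
  additive_on (rough_int X Z) /\ exists c, forall s t, 0 <= s -> s <= t -> t <= 1 ->
    `|rough_int X Z s t - germ (fun=> 0) Z s t| <= c * h s t ^+ 3.
Proof.
move=> Zb b0.
have S : sewable g (germ (fun=> 0) Z) (germconst * b).
  apply: germ_sewable => // s t *.
  by rewrite subrr normr0 mulr_ge0 // hpow_ge0.
have A0 : 0 <= germconst * b.
  by rewrite !mulr_ge0 // ?addr_ge0 ?mulr_ge0 // (le_trans ler01) // (noise_ge1 HX).
have [I [Ia Ic]] := sewing_exists g_range A0 S.
have E s t : 0 <= s -> s <= t -> t <= 1 -> rough_int X Z s t = I s t.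
  move=> s0 st t1.
  have H : is_rough_int X Z s t (I s t).
    apply/is_rough_int_psum => e e0.
    have [delta d0 dP] := psum_mesh g_range Ia Ic e0.
    exists delta => // p p1 p2 p3; rewrite -p2; apply: dP => //; last by rewrite p2.
    by apply: sub_path p1 => ? ? /ltW.
  rewrite /rough_int; apply: (is_rough_int_unique st _ H).
  exact: (@xgetPex _ 0 [set K | is_rough_int X Z s t K] (ex_intro _ _ H)).
split.
  move=> s u t s0 su ut t1; rewrite !E ?(Ia s u t) //; lra.
exists (2 * (germconst * b) / (1 - q0)) => s t s0 st t1; rewrite E //.
exact: Ic.
Qed.

End Noise.
End RoughIntegral.

(** * Second-order expansions along the noise and their product rule *)

Section Expansions.
Context (R : realType) (g : R) (d : nat).
Hypothesis g_range : 1 / 3 < g <= 1 / 2.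
Implicit Types (s t u a b c : R) (Y : cpath R d) (Z : integrand R d) (B : R -> R).
Local Notation h := (hpow g).
Local Notation q0 := (half_pow g).
Local Notation D := (d%:R : R).

Lemma holder_within B b s t : holder_path g B b -> 0 <= s -> t <= 1 ->
  {within `[s, t], continuous B}.
Proof.
move=> Bb s0 t1; apply/subspace_continuousP => x; rewrite /= in_itv /= => /andP[sx xt].
apply/cvgrPdist_lt => e e0; rewrite near_withinE.
have gp := gamma_gt0 g_range; set b' := `|b| + 1.
have b0 : 0 < b' by rewrite /b' ltr_wpDl.
have main u v : s <= u -> u <= v -> v <= t -> v - u < (e / b') `^ g^-1 ->
    `|B v - B u| < e.
  move=> su uv vt small.
  apply: le_lt_trans (Bb u v _ _ _) _; [lra|lra|lra|].
  apply: (@le_lt_trans _ _ (b' * h u v)).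
    by rewrite ler_wpM2r ?hpow_ge0 // /b'; have := ler_norm b; lra.
  rewrite mulrC -ltr_pdivlMr //.
  have e0' : 0 <= e / b' by rewrite divr_ge0 //; lra.
  rewrite -[ltRHS](powRr1 e0') -(mulVf (lt0r_neq0 gp)) powRrM /hpow.
  by apply: gt0_ltr_powR; rewrite ?nnegrE ?powR_ge0 //; lra.
near=> y => /=; rewrite in_itv /= => /andP[sy yt].
have dxy : `|x - y| < (e / b') `^ g^-1.
  by near: y; apply: cvgr_dist_lt => //; rewrite powR_gt0 // divr_gt0.
have [xy|yx] := leP x y.
  by rewrite distrC; apply: main => //; move: dxy; rewrite distrC ger0_norm //; lra.
by apply: main => //; [lra|]; move: dxy; rewrite ger0_norm //; lra.
Unshelve. all: by end_near. Qed.

Definition drift B s t : R := \int[lebesgue_measure]_(r in `[s, t]) B r.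

Lemma holder_integrable B b s t : holder_path g B b -> 0 <= s -> t <= 1 ->
  lebesgue_measure.-integrable `[s, t] (EFin \o B).
Proof.
move=> Bb s0 t1; apply: continuous_compact_integrable.
  exact: segment_compact.
exact: holder_within Bb s0 t1.
Qed.

Lemma drift_additive B b : holder_path g B b -> additive_on (drift B).
Proof.
move=> Bb s u t s0 su ut t1; rewrite /drift.
have I := holder_integrable Bb s0 t1.
have := @Rintegral_itvB R B (BLeft s) (BRight t) u I.
rewrite !bnd_simp => /(_ su ut) E.
rewrite -(@Rintegral_itv_obnd_cbnd R u (BRight t)) -?E; first by ring.
by apply: integrableS I => //; apply: subset_itvr; rewrite bnd_simp.
Qed.

(** The integrand differs from its initial value by at most b h, over a length at most h^2. *)
Lemma drift_germ B b s t : holder_path g B b -> 0 <= s -> s <= t -> t <= 1 ->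
  `|drift B s t - B s * (t - s)| <= b * h s t ^+ 3.
Proof.
move=> Bb s0 st t1.
have I := holder_integrable Bb s0 t1.
have Ic (x : R) : lebesgue_measure.-integrable `[s, t] (EFin \o (fun=> x)).
  apply: (@holder_integrable _ 0) => // u v *.
  by rewrite subrr normr0 mul0r.
have C x : \int[lebesgue_measure]_(r in `[s, t]) x = x * (t - s).
  rewrite Rintegral_cst //= lebesgue_measure_itv /= lte_fin.
  case: ltP => [//|ts]; have -> : t = s by lra.
  by rewrite subrr !mulr0.
rewrite /drift -C -RintegralB //.
have IB : lebesgue_measure.-integrable `[s, t] (EFin \o (fun r => B r - B s)).
  apply: (@holder_integrable _ b) => // u v *.
  by rewrite opprB addrA subrK; exact: Bb.
apply: le_trans (le_normr_Rintegral _ IB) _ => //.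
apply: (@le_trans _ _ (\int[lebesgue_measure]_(r in `[s, t]) (b * h s t))).
  apply: le_Rintegral => //.
    exact: (integrable_norm IB).
  move=> r; rewrite /= in_itv /= => /andP[sr rt].
  have b0 : 0 <= b.
    by have := Bb 0 1 (lexx 0) ler01 (lexx 1); rewrite /hpow subr0 powR1 mulr1; apply: le_trans.
  apply: le_trans (Bb s r s0 sr _) _; first lra.
  by rewrite ler_wpM2l // hpow_mono.
have b0 : 0 <= b.
  by have := Bb 0 1 (lexx 0) ler01 (lexx 1); rewrite /hpow subr0 powR1 mulr1; apply: le_trans.
rewrite C exprSr expr2 -mulrA ler_wpM2l // mulrC -expr2 ler_wpM2r ?hpow_ge0 //.
exact: le_hpow2.
Qed.

Definition wintegrand a Z : integrand R d :=
  (fun r => expR (a * r) *: Z.1 r, fun r => expR (a * r) *: Z.2 r).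

(** Bounds the values and the Lipschitz constant of t |-> e^{a (t - t0)} on the unit interval, for
    every t0 in it. *)
Definition expconst a : R := expR `|a| * (1 + `|a|).

Lemma expconst_ge1 a : 1 <= expconst a.
Proof.
rewrite /expconst; have := normr_ge0 a; have := expR_ge1Dx `|a|; nra.
Qed.

Lemma expR_lipschitz (x y : R) : `|expR x - expR y| <= expR (Num.max x y) * `|x - y|.
Proof.
wlog xy : x y / x <= y => [H|].
  case/orP: (le_total x y) => [/H//|/H].
  by rewrite maxC (distrC (expR y)) (distrC y).
rewrite max_r // distrC ger0_norm ?subr_ge0 ?ler_expR // distrC ger0_norm ?subr_ge0 //.
have := expR_ge1Dx (x - y); have := expR_gt0 y => y0.
rewrite expRD expRN => H.
have : expR y * (1 + (x - y)) <= expR x.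
  by rewrite mulrC -ler_pdivlMr.
by lra.
Qed.

Lemma exp_lipschitz a t0 s t : 0 <= t0 <= 1 -> 0 <= s -> s <= t -> t <= 1 ->
  `|expR (a * (t - t0)) - expR (a * (s - t0))| <= expconst a * (t - s).
Proof.
move=> /andP[t00 t01] s0 st t1; apply: le_trans (expR_lipschitz _ _) _.
have -> : a * (t - t0) - a * (s - t0) = a * (t - s) by ring.
rewrite normrM (ger0_norm (_ : 0 <= t - s)); last lra.
rewrite mulrA ler_wpM2r //; first lra.
have bd x : -1 <= x -> x <= 1 -> a * x <= `|a|.
  move=> x1 x2; apply: le_trans (ler_norm _) _; rewrite normrM ler_piMr //.
  by rewrite ler_norml x1.
rewrite /expconst ler_pM ?expR_ge0 ?ler_expR //; last by rewrite ler_wpDl.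
by rewrite ge_max; apply/andP; split; apply: bd; lra.
Qed.

Lemma exp_bound a x : -1 <= x -> x <= 1 -> expR (a * x) <= expconst a.
Proof.
move=> x1 x2; apply: (@le_trans _ _ (expR `|a|)).
  rewrite ler_expR; apply: le_trans (ler_norm _) _; rewrite normrM ler_piMr //.
  by rewrite ler_norml x1.
by rewrite /expconst ler_peMr ?expR_ge0 // lerDl.
Qed.

Section Noise.
Context (X : rough R d) (N : R).
Hypothesis HX : noise_on g X N.
Local Notation w := (rp1 X).
Local Notation cb := (cbound g w).
Local Notation kh := (hconst d N).
Local Notation km := (mulconst d N).
Local Notation kg := (germconst d N).

Lemma N_ge0 : 0 <= N. Proof. by have := noise_ge1 HX; lra. Qed.

Lemma cbound_exp a c t0 : 0 <= t0 <= 1 ->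
  cb (fun t => expR (a * (t - t0)) * c, fun=> 0) (expconst a * `|c|).
Proof.
move=> t01; apply: cbound_smooth => //.
  move=> t tt0 t1; rewrite normrM ler_wpM2r // ger0_norm ?expR_ge0 //.
  by case/andP: t01 => *; apply: exp_bound; lra.
move=> s t s0 st t1; rewrite -mulrBl normrM mulrAC ler_wpM2r //.
exact: exp_lipschitz.
Qed.

Definition near_germ (I : R -> R -> R) B Z := exists c, forall s t,
  0 <= s -> s <= t -> t <= 1 -> `|I s t - germ X B Z s t| <= c * h s t ^+ 3.

Lemma germD B B' Z Z' s t : germ X (fun r => B r + B' r)
   (fun r => Z.1 r + Z'.1 r, fun r => Z.2 r + Z'.2 r) s t =
  germ X B Z s t + germ X B' Z' s t.
Proof.
by rewrite /germ dotrvDl mdotDl /=; ring.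
Qed.

Lemma germZ c B Z s t :
  germ X (fun r => c * B r) (fun r => c *: Z.1 r, fun r => c *: Z.2 r) s t =
  c * germ X B Z s t.
Proof. by rewrite /germ /= dotrvZl mdotZl; ring. Qed.

Lemma near_germZ k I B Z : near_germ I B Z ->
  near_germ (fun s t => k * I s t) (fun r => k * B r)
   (fun r => k *: Z.1 r, fun r => k *: Z.2 r).
Proof.
move=> [c Ic]; exists (`|k| * c) => s t s0 st t1.
by rewrite germZ -mulrBr normrM -mulrA ler_wpM2l ?Ic.
Qed.

Definition intconst : R := kg / (1 - q0).

Lemma intconst_ge0 : 0 <= intconst.
Proof.
have q1 := half_pow_lt1 g_range; have := N_ge0.
rewrite /intconst /germconst => N0; apply: divr_ge0; last lra.
by rewrite mulr_ge0 // !addr_ge0 // mulr_ge0.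
Qed.

(** [near_germ] comes with an unknown constant. [sewing_bound] replaces it by one proportional to
    [b], and the terms of the germ are then estimated one by one. *)
Lemma germ_bound I B Z b : additive_on I -> near_germ I B Z ->
  (forall t, 0 <= t -> t <= 1 -> `|B t| <= b) -> holder_path g B b ->
  (forall j, cb (icomp Z j) b) -> forall s t, 0 <= s -> s <= t -> t <= 1 ->
  `|I s t| <= (kg + intconst) * b /\
  `|I s t - dotrv (Z.1 s) (incr w s t)| <= (kg + intconst) * b * h s t ^+ 2.
Proof.
move=> Ia [c Ic] Bb Bh Zb s t s0 st t1.
have b0 : 0 <= b by apply: le_trans (Bb 0 _ _).
have S := germ_sewable g_range HX Bh b0 Zb.
have kg0 : 0 <= kg * b.
  by rewrite /germconst !mulr_ge0 ?N_ge0 // !addr_ge0 // mulr_ge0.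
have E := sewing_bound g_range kg0 S Ia Ic s0 st t1.
have N1 := noise_ge1 HX; have D0 : 0 <= D := ler0n _ _.
have s1 : s <= 1 by lra.
set x := h s t in E *; have x0 : 0 <= x := hpow_ge0 g s t.
have x1 : x <= 1 := hpow_le1 g_range s0 st t1.
have x32 : x ^+ 3 <= x ^+ 2 by rewrite exprSr ler_piMr // exprn_ge0.
have e0 : t - s <= x ^+ 2 := le_hpow2 g_range s0 st t1.
have e1 : `|B s * (t - s)| <= N * (b * x ^+ 2).
  rewrite normrM (ger0_norm (_ : 0 <= t - s)); last lra.
  rewrite -[leLHS]mul1r ler_pM // ?mulr_ge0 //; first lra.
  by rewrite ler_pM ?Bb //; lra.
have e2 : `|dotrv (Z.1 s) (incr w s t)| <= D * (b * (N * x)).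
  apply: dotrv_le => i; last exact: (noise1 HX).
  by case: (Zb i) => /(_ s s0 s1).
have e3 : `|mdot (Z.2 s) (rp2 X s t)| <= D * (D * (b * (N * x ^+ 2))).
  apply: mdot_le => i j; last exact: (noise2 HX).
  by case: (Zb j) => _ /(_ s i s0 s1); rewrite mxE.
have K := intconst_ge0.
have E' : `|I s t - germ X B Z s t| <= intconst * b * x ^+ 2.
  apply: le_trans E _; have -> : kg * b / (1 - q0) = intconst * b.
    by rewrite /intconst mulrAC.
  by rewrite ler_wpM2l // mulr_ge0.
have R2 : `|I s t - dotrv (Z.1 s) (incr w s t)| <= (kg + intconst) * b * x ^+ 2.
  have -> : I s t - dotrv (Z.1 s) (incr w s t) =
    (I s t - germ X B Z s t) + (B s * (t - s) + mdot (Z.2 s) (rp2 X s t)).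
    by rewrite /germ; ring.
  apply: le_trans (ler_normD _ _) _.
  apply: le_trans (lerD E' (ler_normD _ _)) _.
  apply: le_trans (lerD (lexx _) (lerD e1 e3)) _.
  have : 0 <= D * (b * N * x ^+ 2) by rewrite !mulr_ge0 // ?exprn_ge0 //; lra.
  by rewrite /germconst; lra.
split => //.
have -> : I s t = (I s t - germ X B Z s t) + (B s * (t - s) +
    (dotrv (Z.1 s) (incr w s t) + mdot (Z.2 s) (rp2 X s t))).
  by rewrite /germ; ring.
apply: le_trans (ler_normD _ _) _.
apply: le_trans (lerD E' (ler_normD _ _)) _.
apply: le_trans (lerD (lexx _) (lerD e1 (ler_normD _ _))) _.
apply: le_trans (lerD (lexx _) (lerD (lexx _) (lerD e2 e3))) _.
have x21 : x ^+ 2 <= 1 by rewrite exprn_ile1.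
have f1 : intconst * b * x ^+ 2 <= intconst * b by rewrite ler_piMr // mulr_ge0.
have f2 : N * (b * x ^+ 2) <= N * b.
  by rewrite ler_wpM2l ?N_ge0 // ler_piMr.
have f3 : D * (b * (N * x)) <= D * (b * N).
  by rewrite !ler_wpM2l // ler_piMr // N_ge0.
have f4 : D * (D * (b * (N * x ^+ 2))) <= D * (D * (b * N)).
  by rewrite !ler_wpM2l // ler_piMr // N_ge0.
by rewrite /germconst; lra.
Qed.

(* First-order data [B], [Z.1] and second-order data [Z.2] of a path driven by
   the rough path, without any quantitative control on the constants. *)
Definition expands (Y : R -> R) B Z := exists c,
  [/\ forall t, 0 <= t -> t <= 1 -> `|Y t| <= c,
      forall t, 0 <= t -> t <= 1 -> `|B t| <= c,
      forall t i, 0 <= t -> t <= 1 -> `|Z.1 t 0 i| <= c,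
      forall t i j, 0 <= t -> t <= 1 -> `|Z.2 t i j| <= c
    & forall s t, 0 <= s -> s <= t -> t <= 1 ->
        `|Y t - Y s - germ X B Z s t| <= c * h s t ^+ 3].

Lemma expands_ext (Y Y' : R -> R) B B' Z Z' : (forall t, 0 <= t -> t <= 1 ->
    [/\ Y t = Y' t, B t = B' t, Z.1 t = Z'.1 t & Z.2 t = Z'.2 t]) ->
  expands Y B Z -> expands Y' B' Z'.
Proof.
move=> E [c [H1 H2 H3 H4 H5]]; exists c; split.
- by move=> t t0 t1; have [<- _ _ _] := E t t0 t1; exact: H1.
- by move=> t t0 t1; have [_ <- _ _] := E t t0 t1; exact: H2.
- by move=> t i t0 t1; have [_ _ <- _] := E t t0 t1; exact: H3.
- by move=> t i j t0 t1; have [_ _ _ <-] := E t t0 t1; exact: H4.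
- move=> s t s0 st t1; have [<- _ _ _] := E t (le_trans s0 st) t1.
  have [<- E2 E3 E4] := E s s0 (le_trans st t1).
  by rewrite /germ -E2 -E3 -E4; exact: H5.
Qed.

Definition esum_integrand Z Z' : integrand R d :=
  (fun r => Z.1 r + Z'.1 r, fun r => Z.2 r + Z'.2 r).

Lemma expandsD (Y Y' : R -> R) B B' Z Z' : expands Y B Z -> expands Y' B' Z' ->
  expands (fun t => Y t + Y' t) (fun t => B t + B' t) (esum_integrand Z Z').
Proof.
move=> [c [H1 H2 H3 H4 H5]] [c' [G1 G2 G3 G4 G5]]; exists (c + c'); split.
- by move=> *; apply: le_trans (ler_normD _ _) _; rewrite lerD ?H1 ?G1.
- by move=> *; apply: le_trans (ler_normD _ _) _; rewrite lerD ?H2 ?G2.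
- by move=> *; rewrite mxE; apply: le_trans (ler_normD _ _) _; rewrite lerD ?H3 ?G3.
- by move=> *; rewrite mxE; apply: le_trans (ler_normD _ _) _; rewrite lerD ?H4 ?G4.
- move=> s t s0 st t1; rewrite germD mulrDl.
  have -> : Y t + Y' t - (Y s + Y' s) - (germ X B Z s t + germ X B' Z' s t) =
   (Y t - Y s - germ X B Z s t) + (Y' t - Y' s - germ X B' Z' s t) by ring.
  by apply: le_trans (ler_normD _ _) _; rewrite lerD ?H5 ?G5.
Qed.

Lemma expands_smooth (f f' : R -> R) c :
  (forall t, 0 <= t -> t <= 1 -> `|f t| <= c) ->
  (forall t, 0 <= t -> t <= 1 -> `|f' t| <= c) ->
  (forall s t, 0 <= s -> s <= t -> t <= 1 ->
     `|f t - f s - f' s * (t - s)| <= c * (t - s) ^+ 2) ->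
  expands f f' (fun=> 0, fun=> 0).
Proof.
move=> fc fc' H; have c0 : 0 <= c by apply: le_trans (fc 0 _ _).
exists c; split => //=.
- by move=> *; rewrite mxE normr0.
- by move=> *; rewrite mxE normr0.
- move=> s t s0 st t1; rewrite /germ /= dotrv0l.
  have -> : mdot 0 (rp2 X s t) = 0 :> R by rewrite -(scale0r 0) mdotZl mul0r.
  rewrite !addr0; apply: le_trans (H s t s0 st t1) _; rewrite ler_wpM2l //.
  have h0 := hpow_ge0 g s t; have h1 := hpow_le1 g_range s0 st t1.
  apply: (@le_trans _ _ ((h s t ^+ 2) ^+ 2)).
    by rewrite lerXn2r ?nnegrE ?exprn_ge0 ?le_hpow2 //; lra.
  by rewrite -exprM; apply: ler_wiXn2l.
Qed.

(** Geometricity enters here: a symmetrized tensor sees only the symmetric part of the second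
    level. *)
Lemma mdot_outer (a b : 'rV[R]_d) s t : 0 <= s -> s <= t -> t <= 1 ->
  mdot (\matrix_(i, j) (a 0 i * b 0 j + b 0 i * a 0 j)) (rp2 X s t) =
  dotrv a (incr w s t) * dotrv b (incr w s t).
Proof.
move=> s0 st t1; rewrite /mdot /dotrv mulr_suml.
transitivity (\sum_i \sum_j a 0 i * b 0 j * rp2 X s t i j +
    \sum_j \sum_i b 0 j * a 0 i * rp2 X s t j i).
  rewrite -big_split; apply: eq_bigr => i _.
  by rewrite -big_split; apply: eq_bigr => j _; rewrite mxE mulrDl.
rewrite [X in _ + X]exchange_big -big_split; apply: eq_bigr => i _.
rewrite mulr_sumr -big_split; apply: eq_bigr => j _ /=.
have := noise_geom HX i j s0 st t1.
by move: (rp2 X s t i j) (rp2 X s t j i) => p q E; rewrite mulrACA -E; ring.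
Qed.

Definition emul_integrand (Y Y' : R -> R) Z Z' : integrand R d :=
  (fun r => Y r *: Z'.1 r + Y' r *: Z.1 r,
   fun r => \matrix_(i, j) (Y r * Z'.2 r i j + Y' r * Z.2 r i j +
     (Z.1 r 0 i * Z'.1 r 0 j + Z'.1 r 0 i * Z.1 r 0 j))).

(* The Leibniz rule needs no correction term because the symmetric part of the
   second level is half the square of the first. *)
Lemma expandsM (Y Y' : R -> R) B B' Z Z' : expands Y B Z -> expands Y' B' Z' ->
  expands (fun t => Y t * Y' t) (fun t => Y t * B' t + Y' t * B t)
    (emul_integrand Y Y' Z Z').
Proof.
move=> [c1 [H1 H2 H3 H4 H5]] [c2 [G1 G2 G3 G4 G5]].
pose c := Num.max c1 c2.
have lec x : x <= c1 -> x <= c by move=> /le_trans; apply; rewrite le_max lexx.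
have lec' x : x <= c2 -> x <= c by move=> /le_trans; apply; rewrite le_max lexx orbT.
have c0 : 0 <= c by apply: lec; apply: le_trans (H1 0 _ _).
have D0 : 0 <= D := ler0n _ _; have N1 := noise_ge1 HX; have N0 := N_ge0.
pose K := c * (1 + D * N + D * (D * N) + 1).
have K0 : 0 <= K by rewrite /K !mulr_ge0 // !addr_ge0 // !mulr_ge0.
(* The increments have order h, and order h^2 once the noise term is subtracted. Stated for a
   generic path in order to serve both factors. *)
have LI (y b : R -> R) (z : integrand R d) : (forall t, 0 <= t -> t <= 1 -> `|b t| <= c) ->
    (forall t i, 0 <= t -> t <= 1 -> `|z.1 t 0 i| <= c) ->
    (forall t i j, 0 <= t -> t <= 1 -> `|z.2 t i j| <= c) ->
    (forall s t, 0 <= s -> s <= t -> t <= 1 ->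
        `|y t - y s - germ X b z s t| <= c * h s t ^+ 3) ->
    forall s t, 0 <= s -> s <= t -> t <= 1 ->
    [/\ `|y t - y s| <= K * h s t,
      `|y t - y s - dotrv (z.1 s) (incr w s t)| <= K * h s t ^+ 2 &
      `|dotrv (z.1 s) (incr w s t)| <= K * h s t].
  move=> B2 B3 B4 B5 s t s0 st t1; have s1 : s <= 1 by lra.
  set x := h s t; have x0 : 0 <= x := hpow_ge0 g s t.
  have x1 : x <= 1 := hpow_le1 g_range s0 st t1.
  have e1 : `|b s * (t - s)| <= c * x ^+ 2.
    rewrite normrM (ger0_norm (_ : 0 <= t - s)); last lra.
    rewrite ler_pM ?B2 //; [lra|exact: le_hpow2].
  have e2 : `|dotrv (z.1 s) (incr w s t)| <= D * (c * (N * x)).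
    by apply: dotrv_le => i; [exact: B3|exact: (noise1 HX)].
  have e3 : `|mdot (z.2 s) (rp2 X s t)| <= D * (D * (c * (N * x ^+ 2))).
    by apply: mdot_le => i j; [exact: B4|exact: (noise2 HX)].
  have e4 := B5 s t s0 st t1; rewrite -/x in e4.
  have x32 : x ^+ 3 <= x ^+ 2 by rewrite exprSr ler_piMr // exprn_ge0.
  have x21 : x ^+ 2 <= x by rewrite expr2 ler_piMr.
  have cx32 := ler_wpM2l c0 x32; have cx21 := ler_wpM2l c0 x21.
  have DNc0 : 0 <= D * N * c by rewrite !mulr_ge0.
  have DNcx0 := mulr_ge0 DNc0 x0.
  have DNcx2 : 0 <= D * N * c * x ^+ 2 by rewrite mulr_ge0 // exprn_ge0.
  have DDNc0 : 0 <= D * (D * N * c) by rewrite !mulr_ge0.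
  have DDx21 := ler_wpM2l DDNc0 x21.
  have DDNcx2 : 0 <= D * (D * N * c) * x ^+ 2 by rewrite mulr_ge0 // exprn_ge0.
  have cx2 : 0 <= c * x ^+ 2 by rewrite mulr_ge0 // exprn_ge0.
  have R2 : `|y t - y s - dotrv (z.1 s) (incr w s t)| <=
      (c + c + D * (D * N * c)) * x ^+ 2.
    have -> : y t - y s - dotrv (z.1 s) (incr w s t) =
      (y t - y s - germ X b z s t) + (b s * (t - s) + mdot (z.2 s) (rp2 X s t)).
      by rewrite /germ; ring.
    apply: le_trans (ler_normD _ _) _.
    apply: le_trans (lerD e4 (ler_normD _ _)) _.
    apply: le_trans (lerD (lexx _) (lerD e1 e3)) _.
    by lra.
  split.
  - rewrite -[y t - y s](subrK (dotrv (z.1 s) (incr w s t))).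
    apply: le_trans (ler_normD _ _) _; apply: le_trans (lerD R2 e2) _.
    by rewrite /K; lra.
  - by apply: le_trans R2 _; rewrite /K; lra.
  - by apply: le_trans e2 _; rewrite /K; nra.
pose c3 := 4 * (c * c) + 2 * (K * K).
exists c3.
have HY t : 0 <= t -> t <= 1 -> `|Y t| <= c by move=> *; exact/lec/H1.
have HY' t : 0 <= t -> t <= 1 -> `|Y' t| <= c by move=> *; exact/lec'/G1.
have HB t : 0 <= t -> t <= 1 -> `|B t| <= c by move=> *; exact/lec/H2.
have HB' t : 0 <= t -> t <= 1 -> `|B' t| <= c by move=> *; exact/lec'/G2.
have HZ t i : 0 <= t -> t <= 1 -> `|Z.1 t 0 i| <= c by move=> *; exact/lec/H3.
have HZ' t i : 0 <= t -> t <= 1 -> `|Z'.1 t 0 i| <= c by move=> *; exact/lec'/G3.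
have HZ2 t i j : 0 <= t -> t <= 1 -> `|Z.2 t i j| <= c by move=> *; exact/lec/H4.
have HZ2' t i j : 0 <= t -> t <= 1 -> `|Z'.2 t i j| <= c by move=> *; exact/lec'/G4.
have LIY := LI Y B Z HB HZ HZ2.
have LIY' := LI Y' B' Z' HB' HZ' HZ2'.
have KK0 : 0 <= K * K by exact: mulr_ge0.
have cc0 : 0 <= c * c by exact: mulr_ge0.
have pr (x y : R) : `|x| <= c -> `|y| <= c -> `|x * y| <= c * c.
  by move=> xc yc; rewrite normrM ler_pM.
have [c3a c3b c3c] : [/\ c * c <= c3, c * c + c * c <= c3 &
    c * c + c * c + (c * c + c * c) <= c3].
  have E : c3 = c * c + c * c + (c * c + c * c) + 2 * (K * K) by rewrite /c3; ring.
  have KK20 : 0 <= 2 * (K * K) by exact: mulr_ge0.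
  have cc2 := addr_ge0 cc0 cc0.
  rewrite E; split; last by rewrite lerDl.
    by rewrite -!addrA lerDl !addr_ge0.
  by rewrite -addrA lerDl addr_ge0.
split.
- by move=> t t0 t1; apply: le_trans (pr _ _ (HY t t0 t1) (HY' t t0 t1)) c3a.
- move=> t t0 t1; apply: le_trans (ler_normD _ _) _.
  exact: le_trans (lerD (pr _ _ (HY t t0 t1) (HB' t t0 t1))
    (pr _ _ (HY' t t0 t1) (HB t t0 t1))) c3b.
- move=> t i t0 t1; rewrite !mxE; apply: le_trans (ler_normD _ _) _.
  exact: le_trans (lerD (pr _ _ (HY t t0 t1) (HZ' t i t0 t1))
    (pr _ _ (HY' t t0 t1) (HZ t i t0 t1))) c3b.
- move=> t i j t0 t1; rewrite !mxE.
  have f1 := pr _ _ (HY t t0 t1) (HZ2' t i j t0 t1).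
  have f2 := pr _ _ (HY' t t0 t1) (HZ2 t i j t0 t1).
  have f3 := pr _ _ (HZ t i t0 t1) (HZ' t j t0 t1).
  have f4 := pr _ _ (HZ' t i t0 t1) (HZ t j t0 t1).
  apply: le_trans (ler_normD _ _) _.
  apply: le_trans (lerD (ler_normD _ _) (ler_normD _ _)) _.
  exact: le_trans (lerD (lerD f1 f2) (lerD f3 f4)) c3c.
- move=> s t s0 st t1; have s1 : s <= 1 := le_trans st t1.
  set x := h s t; have x0 : 0 <= x := hpow_ge0 g s t.
  have x30 : 0 <= x ^+ 3 by exact: exprn_ge0.
  have T1 u v : 0 <= u -> u <= v -> v <= 1 -> `|Y v - Y u - germ X B Z u v| <= c * h u v ^+ 3.
    by move=> *; apply: le_trans (H5 _ _ _ _ _) _ => //; rewrite ler_wpM2r ?exprn_ge0 ?hpow_ge0 // lec.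
  have T2 u v : 0 <= u -> u <= v -> v <= 1 -> `|Y' v - Y' u - germ X B' Z' u v| <= c * h u v ^+ 3.
    by move=> *; apply: le_trans (G5 _ _ _ _ _) _ => //; rewrite ler_wpM2r ?exprn_ge0 ?hpow_ge0 // lec'.
  have [a1 a2 a3] := LIY T1 s t s0 st t1; have [b1 b2 b3] := LIY' T2 s t s0 st t1.
  rewrite -/x in a1 a2 a3 b1 b2 b3.
  (* The product of the two increments is split by subtracting the noise term from the first factor
     and then from the second. The remaining product of the two noise terms belongs to the germ, by
     [mdot_outer]. *)
  have -> : Y t * Y' t - Y s * Y' s - germ X (fun t => Y t * B' t + Y' t * B t)
      (emul_integrand Y Y' Z Z') s t =
    Y s * (Y' t - Y' s - germ X B' Z' s t) + Y' s * (Y t - Y s - germ X B Z s t) +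
    ((Y t - Y s - dotrv (Z.1 s) (incr w s t)) * (Y' t - Y' s) +
     dotrv (Z.1 s) (incr w s t) * (Y' t - Y' s - dotrv (Z'.1 s) (incr w s t))).
    rewrite /germ /= dotrvDl !dotrvZl.
    have -> : mdot (\matrix_(i, j) (Y s * Z'.2 s i j + Y' s * Z.2 s i j +
        (Z.1 s 0 i * Z'.1 s 0 j + Z'.1 s 0 i * Z.1 s 0 j))) (rp2 X s t) =
      Y s * mdot (Z'.2 s) (rp2 X s t) + Y' s * mdot (Z.2 s) (rp2 X s t) +
      dotrv (Z.1 s) (incr w s t) * dotrv (Z'.1 s) (incr w s t); last by ring.
    rewrite -(mdot_outer _ _ s0 st t1) -!mdotZl -!mdotDl.
    by congr mdot; apply/matrixP => i j; rewrite !mxE.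
  apply: le_trans (ler_normD _ _) _.
  apply: le_trans (lerD (ler_normD _ _) (ler_normD _ _)) _.
  rewrite !normrM.
  have f1 := ler_pM (normr_ge0 _) (normr_ge0 _) (HY s s0 s1) (T2 s t s0 st t1).
  have f2 := ler_pM (normr_ge0 _) (normr_ge0 _) (HY' s s0 s1) (T1 s t s0 st t1).
  have f3 := ler_pM (normr_ge0 _) (normr_ge0 _) a2 b1.
  have f4 := ler_pM (normr_ge0 _) (normr_ge0 _) a3 b2.
  apply: le_trans (lerD (lerD f1 f2) (lerD f3 f4)) _; rewrite -/x /c3.
  rewrite [leLHS](_ : _ = (2 * (c * c) + 2 * (K * K)) * x ^+ 3); last by ring.
  by rewrite ler_wpM2r // lerD2r ler_wpM2r // ler_nat.
Qed.

End Noise.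
End Expansions.

(** * Linear rough equations by variation of constants *)

Section Linear.
Context (R : realType) (g : R) (d : nat).
Hypothesis g_range : 1 / 3 < g <= 1 / 2.
Implicit Types (s t u a b c : R) (Y F : cpath R d) (Z : integrand R d) (B : R -> R).
Local Notation h := (hpow g).
Local Notation q0 := (half_pow g).
Local Notation D := (d%:R : R).

Lemma exp_taylor a s t : 0 <= s -> s <= t -> t <= 1 ->
  `|expR (a * t) - expR (a * s) - a * expR (a * s) * (t - s)| <=
  expR `|a| * expR `|a| * a ^+ 2 * (t - s) ^+ 2.
Proof.
move=> s0 st t1; set x := a * (t - s).
have -> : expR (a * t) - expR (a * s) - a * expR (a * s) * (t - s) =
    expR (a * s) * (expR x - 1 - x).
  have -> : a * t = a * s + x by rewrite /x; ring.
  by rewrite expRD /x; ring.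
have ea z : 0 <= z -> z <= 1 -> expR (a * z) <= expR `|a|.
  move=> z0 z1; rewrite ler_expR (le_trans (ler_norm _)) // normrM ler_piMr //.
  by rewrite ger0_norm.
have xa : Num.max x 0 <= `|a|.
  rewrite ge_max normr_ge0 andbT (le_trans (ler_norm _)) // normrM ler_piMr //.
  by rewrite ger0_norm; lra.
have lip : `|expR x - 1| <= expR `|a| * `|x|.
  have := expR_lipschitz x 0; rewrite expR0 subr0 => /le_trans; apply.
  by rewrite ler_wpM2r // ler_expR.
have e1 := expR_ge1Dx x.
have e2 : expR x - 1 - x <= x * (expR x - 1).
  have := expR_ge1Dx (- x); rewrite expRN => H.
  have := ler_wpM2r (ltW (expR_gt0 x)) H.
  by rewrite mulVf ?gt_eqF ?expR_gt0 //; lra.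
have e0 : 0 <= expR x - 1 - x by lra.
rewrite normrM (ger0_norm (expR_ge0 _)) (ger0_norm e0).
rewrite -!mulrA; apply: ler_pM; [exact: expR_ge0|lra|by apply: ea; lra|].
apply: (le_trans e2); apply: (le_trans (ler_norm _)); rewrite normrM.
apply: le_trans (ler_wpM2l (normr_ge0 _) lip) _.
rewrite mulrCA ler_wpM2l ?expR_ge0 // -expr2 -normrX ger0_norm ?sqr_ge0 //.
by rewrite mulrA -expr2 -exprMn.
Qed.

Section Noise.
Context (X : rough R d) (N : R).
Hypothesis HX : noise_on g X N.
Local Notation w := (rp1 X).
Local Notation cb := (cbound g w).
Local Notation kh := (hconst d N).
Local Notation km := (mulconst d N).
Local Notation kg := (germconst d N).
Local Notation ki := (intconst g d N).

(** The product rule with e^{a t}. With - a in place of a it removes a linear drift a Y. *)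
Lemma expands_expM a (Y : R -> R) B Z : expands g X Y B Z ->
  expands g X (fun t => expR (a * t) * Y t)
    (fun t => expR (a * t) * (a * Y t + B t)) (wintegrand a Z).
Proof.
move=> YB.
have eb t : 0 <= t -> t <= 1 -> expR (a * t) <= expR `|a|.
  move=> t0 t1; rewrite ler_expR (le_trans (ler_norm _)) // normrM ler_piMr //.
  by rewrite ger0_norm.
have E : expands g X (fun t => expR (a * t)) (fun t => a * expR (a * t))
    (fun=> 0, fun=> 0).
  pose c1 := expR `|a| * expR `|a| * a ^+ 2.
  have c10 : 0 <= c1 by rewrite mulr_ge0 ?sqr_ge0 // mulr_ge0 ?expR_ge0.
  have c20 : 0 <= `|a| * expR `|a| by rewrite mulr_ge0 ?expR_ge0.
  apply: (@expands_smooth R g d g_range X _ _ (expR `|a| + `|a| * expR `|a| + c1)).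
  - by move=> t t0 t1; rewrite ger0_norm ?expR_ge0 //; have := eb t t0 t1; lra.
  - move=> t t0 t1; rewrite normrM (ger0_norm (expR_ge0 _)).
    by have := ler_wpM2l (normr_ge0 a) (eb t t0 t1); have := expR_ge0 `|a|; lra.
  - move=> s t s0 st t1; apply: le_trans (exp_taylor a s0 st t1) _.
    by rewrite -/c1 ler_wpM2r ?sqr_ge0 //; have := expR_ge0 `|a|; lra.
apply: expands_ext (expandsM g_range HX E YB) => t t0 t1; split => //=.
- by ring.
- by rewrite scaler0 addr0.
- by apply/matrixP => i j; rewrite !mxE mulr0 !mul0r mulr0 !addr0.
Qed.

Lemma expands_near (Y : R -> R) B Z : expands g X Y B Z ->
  near_germ g X (fun s t => Y t - Y s) B Z.
Proof. by move=> [c [_ _ _ _ H]]; exists c. Qed.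

Definition wcpath a F : cpath R d := cmul (fun t => expR (a * t), fun=> 0) F.

Lemma cbound_wcpath a F b : cb F b -> cb (wcpath a F) (km * (expconst a * b)).
Proof.
move=> Fb; apply: cbound_mul => //.
have t00 : 0 <= (0 : R) <= 1 by rewrite lexx ler01.
have := @cbound_exp R g d g_range X a 1 0 t00; rewrite normr1 mulr1.
by apply: cbound_peq => t t0 t1; rewrite /= mulr1 subr0.
Qed.

Lemma icomp_wintegrand a Z j : icomp (wintegrand a Z) j = wcpath a (icomp Z j).
Proof.
congr pair; apply/funext => t /=; first by rewrite mxE.
by apply/rowP => i; rewrite !mxE mulr0 addr0.
Qed.

(** Collects the constants of [rde_bound]. The two products with an exponential cost N^4 through
    [mulconst], the Hölder bound on the transformed coefficients costs N, and sewing costs N; hence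
    the accompanying N^6. *)
Definition rdeconst a : R :=
  (4 * (D + 1) ^+ 2) ^+ 2 * (D + 1) *
  ((1 + D + D * D) * (1 + (1 - q0)^-1) + 1) * expconst a ^+ 2.

Lemma rdeconst_ge0 a : 0 <= rdeconst a.
Proof.
have q1 := half_pow_lt1 g_range; have D0 : 0 <= D := ler0n _ _.
by rewrite /rdeconst !mulr_ge0 ?exprn_ge0 ?addr_ge0 ?mulr_ge0 ?addr_ge0 ?invr_ge0
  ?expR_ge0 ?sqr_ge0 ?mulr_ge0 //; lra.
Qed.

(** e^{- a t} Y has no linear drift, so its increments are plain integrals; multiplication by e^{a
    t} brings Y back. The reference time [t0] is free because centre data are given at the right end
    of a block and stable data at the left end. The second conclusion keeps the exact factor e^a,
    without which the decay over many blocks would be lost. *)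
Lemma rde_bound a Y F Z b t0 :
  expands g X Y.1 (fun t => a * Y.1 t + F.1 t) Z ->
  (forall t, 0 <= t -> t <= 1 -> Y.2 t = Z.1 t) ->
  cb F b -> (forall j, cb (icomp Z j) b) -> 0 <= t0 <= 1 ->
  cb Y (expconst a * `|Y.1 t0| + rdeconst a * N ^+ 6 * b) /\
  `|Y.1 1 - expR a * Y.1 0| <= rdeconst a * N ^+ 6 * b.
Proof.
move=> YZ Y2 Fb Zb /andP[t00 t01].
have b0 : 0 <= b := cbound_ge0 Fb.
have N1 := noise_ge1 HX; have N0 : 0 <= N by lra.
have D0 : 0 <= D := ler0n _ _.
have kh1 := hconst_ge1 HX.
have km1 := mulconst_ge1 HX.
have ki0 : 0 <= ki := intconst_ge0 g_range HX.
have kg0 : 0 <= kg by rewrite /germconst mulr_ge0 // !addr_ge0 // mulr_ge0.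
have ea1 := expconst_ge1 (- a); have ea1' := expconst_ge1 a.
have eaN : expconst (- a) = expconst a by rewrite /expconst normrN.
pose b1 := km * (expconst a * b).
have b10 : 0 <= b1 by rewrite !mulr_ge0 //; lra.
have b1k : b1 <= kh * b1 by rewrite ler_peMl.
pose Yh t := expR (- a * t) * Y.1 t.
have EY := expands_expM (- a) YZ.
have NE : near_germ g X (fun s t => Yh t - Yh s) (wcpath (- a) F).1
    (wintegrand (- a) Z).
  have [c Hc] := expands_near EY; exists c => s t s0 st t1.
  rewrite (_ : germ _ _ _ _ _ = germ X (fun t => expR (- a * t) *
     (- a * Y.1 t + (a * Y.1 t + F.1 t))) (wintegrand (- a) Z) s t); first exact: Hc.
  by rewrite /germ /=; ring.
have Fh : cb (wcpath (- a) F) b1 by rewrite /b1 -eaN; exact: cbound_wcpath.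
have Zh j : cb (icomp (wintegrand (- a) Z) j) b1.
  by rewrite icomp_wintegrand /b1 -eaN; exact: cbound_wcpath.
have Add : additive_on (fun s t => Yh t - Yh s) by move=> s u t *; ring.
have GB := germ_bound g_range HX Add NE
  (fun t p1 p2 => le_trans (let: And4 H _ _ _ := Fh in H t p1 p2) b1k)
  (fun s t p1 p2 p3 => cbound_holder g_range HX Fh p1 p2 p3)
  (fun j => cbound_le b1k (Zh j)).
set P := kg + ki in GB.
have P0 : 0 <= P by rewrite /P addr_ge0.
pose Q := (P + 1) * (kh * b1).
have khb0 : 0 <= kh * b1 by rewrite mulr_ge0 //; lra.
have PQ : P * (kh * b1) <= Q by rewrite /Q (mulrDl P 1) mul1r lerDl.
have bQ : kh * b1 <= Q by rewrite /Q (mulrDl P 1) mul1r lerDr mulr_ge0.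
(* What remains after subtracting the value at [t0] is an integral of size [b]; the value itself is
   propagated by the exponential alone. *)
pose V : cpath R d := (fun t => Yh t - Yh t0, (wintegrand (- a) Z).1).
have cV : cb V Q.
  split.
  - move=> t p0 p1; rewrite /=; case/orP: (le_total t0 t) => le.
      by have [H _] := GB t0 t t00 le p1; exact: le_trans H PQ.
    by have [H _] := GB t t0 p0 le t01; rewrite distrC; exact: le_trans H PQ.
  - move=> t i p0 p1; have [H _ _ _] := Zh i.
    by apply: le_trans (H t p0 p1) _; exact: le_trans bQ.
  - move=> s t i s0 st t1; have := cbound_holder g_range HX (Zh i) s0 st t1.
    by move=> H; apply: le_trans H _; rewrite ler_wpM2r // hpow_ge0.
  - move=> s t s0 st t1; have [_ H] := GB s t s0 st t1.
    rewrite /remainder /=.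
    have -> : Yh t - Yh t0 - (Yh s - Yh t0) = Yh t - Yh s by ring.
    by apply: le_trans H _; rewrite ler_wpM2r // exprn_ge0 // hpow_ge0.
have CC : km * (expconst a * Q) <= rdeconst a * N ^+ 6 * b.
  have -> : km * (expconst a * Q) = (4 * (D + 1) ^+ 2) ^+ 2 * (D + 1) * expconst a ^+ 2 *
      b * N ^+ 5 * (P + 1).
    by rewrite /Q /b1 /mulconst /hconst; ring.
  have -> : rdeconst a * N ^+ 6 * b = (4 * (D + 1) ^+ 2) ^+ 2 * (D + 1) * expconst a ^+ 2 *
      b * N ^+ 5 * (((1 + D + D * D) * (1 + (1 - q0)^-1) + 1) * N).
    by rewrite /rdeconst; ring.
  rewrite ler_wpM2l //.
    by rewrite !mulr_ge0 ?exprn_ge0 ?addr_ge0 ?mulr_ge0 ?expR_ge0 ?exprn_ge0 ?addr_ge0.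
  rewrite /P /intconst /germconst.
  move: (1 - q0)^-1 => z.
  have -> : ((1 + D + D * D) * (1 + z) + 1) * N =
    (1 + D + D * D) * N + (1 + D + D * D) * N * z + N by ring.
  by rewrite lerD2l.
have ee t : expR (a * t) * expR (- a * t) = 1.
  by rewrite -expRD mulNr subrr expR0.
split.
  have c1 : cb (fun t => expR (a * (t - t0)) * Y.1 t0, fun=> 0)
     (expconst a * `|Y.1 t0|).
    by apply: cbound_exp => //; rewrite t00.
  have c2 := cboundD c1 (cbound_wcpath a cV).
  apply: cbound_le (_ : cb Y _); first by apply: lerD (lexx _) CC.
  apply: cbound_peq c2 => t p0 p1; split.
    rewrite -[LHS]/(expR (a * (t - t0)) * Y.1 t0 +
      expR (a * t) * (expR (- a * t) * Y.1 t - expR (- a * t0) * Y.1 t0)).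
    have -> : a * (t - t0) = a * t + - a * t0 by ring.
    by rewrite expRD mulrBr [expR (a * t) * (_ * Y.1 t)]mulrA ee; ring.
  rewrite -[LHS]/(0 + (expR (a * t) *: (expR (- a * t) *: Z.1 t) +
     (Yh t - Yh t0) *: 0)).
  by rewrite scaler0 addr0 add0r scalerA ee Y2 // scale1r.
have [H _] := GB 0 1 (lexx 0) ler01 (lexx 1).
have -> : Y.1 1 - expR a * Y.1 0 = expR a * (Yh 1 - Yh 0).
  rewrite /Yh mulr1 mulr0 expR0 mul1r mulrBr mulrA -expRD.
  by rewrite subrr expR0 mul1r.
rewrite normrM (ger0_norm (expR_ge0 _)); apply: le_trans _ CC.
have ea : expR a <= expconst a by have := @exp_bound R a 1; rewrite mulr1; apply; lra.
apply: (@le_trans _ _ (expconst a * Q)).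
  by rewrite ler_pM ?expR_ge0 //; exact: le_trans H PQ.
have Q0 : 0 <= Q by apply: le_trans PQ; rewrite mulr_ge0.
by rewrite ler_peMl // mulr_ge0 //; lra.
Qed.

Definition conv a B Z s t u : R := drift_conv a B s t u + rough_conv X a Z s t u.

Lemma rough_int_scale c Z b s t : (forall j, cb (icomp Z j) b) -> 0 <= b ->
  0 <= s -> s <= t -> t <= 1 ->
  rough_int X (fun r => c *: Z.1 r, fun r => c *: Z.2 r) s t = c * rough_int X Z s t.
Proof.
move=> Zb b0; pose cZ : integrand R d := (fun r => c *: Z.1 r, fun r => c *: Z.2 r).
have cZb j : cb (icomp cZ j) (`|c| * b).
  apply: cbound_peq (cboundZ c (Zb j)) => r _ _; split; first by rewrite /= mxE.
  by apply/rowP => i; rewrite /= !mxE.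
have [Ia [k Ik]] := rough_int_germ g_range HX Zb b0.
have cb0 : 0 <= `|c| * b by rewrite mulr_ge0.
have [Ja [k' Jk]] := rough_int_germ g_range HX cZb cb0.
have [k'' Hk] := near_germZ c (ex_intro _ k Ik).
have Ca : additive_on (fun s t => c * rough_int X Z s t).
  by move=> s' u' t' *; rewrite -mulrDr -Ia.
apply: (sewing_unique g_range Ja Ca Jk (c' := k'')) => s' t' s0' st' t1'.
by have := Hk s' t' s0' st' t1'; rewrite /germ /= mulr0 mul0r.
Qed.

(** The factor e^{a u} comes out of the convolutions, leaving an additive [J] independent of [u].
    The last clause recognizes every variation-of-constants formula as a solution of the linear
    equation. *)
Lemma conv_expands a F Z b : cb F b -> (forall j, cb (icomp Z j) b) ->
  exists J : R -> R -> R,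
  [/\ additive_on J,
      forall s t u, 0 <= s -> s <= t -> t <= 1 ->
        conv a F.1 Z s t u = expR (a * u) * J s t
    & forall k (Y : R -> R),
        (forall t, 0 <= t -> t <= 1 -> Y t = expR (a * t) * (k + J 0 t)) ->
        expands g X Y (fun t => a * Y t + F.1 t) Z].
Proof.
move=> Fb Zb.
have b0 : 0 <= b := cbound_ge0 Fb.
pose b1 := km * (expconst (- a) * b).
have Fh : cb (wcpath (- a) F) b1 by exact: cbound_wcpath.
have Zh j : cb (icomp (wintegrand (- a) Z) j) b1.
  by rewrite icomp_wintegrand; exact: cbound_wcpath.
have b10 : 0 <= b1 := cbound_ge0 Fh.
have kh1 := hconst_ge1 HX.
have b1k : b1 <= kh * b1 by rewrite ler_peMl.
have Fhold : holder_path g (wcpath (- a) F).1 (kh * b1).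
  by move=> s t *; exact: (cbound_holder g_range HX Fh).
have [Ia [c Ic]] := rough_int_germ g_range HX Zh b10.
have Da := drift_additive g_range Fhold.
pose J s t := drift (wcpath (- a) F).1 s t + rough_int X (wintegrand (- a) Z) s t.
have Ja : additive_on J.
  by move=> s u t *; rewrite /J (Ia s u t) // (Da s u t) //; ring.
have JN : near_germ g X J (wcpath (- a) F).1 (wintegrand (- a) Z).
  exists (kh * b1 + c) => s t s0 st t1; rewrite /J.
  have := drift_germ g_range Fhold s0 st t1; have := Ic s t s0 st t1.
  rewrite /germ mul0r add0r mulrDl => H1 H2.
  rewrite opprD addrACA; apply: le_trans (ler_normD _ _) _.
  exact: lerD.
exists J; split => //.
- move=> s t u s0 st t1; rewrite /conv /J mulrDr; congr +%R.
    rewrite /drift_conv -RintegralZl //; last exact: holder_integrable Fhold s0 t1.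
    apply: eq_Rintegral => r _ /=.
    by rewrite mulrA -expRD; congr (expR _ * _); ring.
  rewrite /rough_conv -(rough_int_scale (expR (a * u)) Zh b10 s0 st t1).
  congr rough_int; congr pair; apply/funext => r /=; rewrite scalerA -expRD;
    by congr (expR _ *: _); ring.
move=> k Y YE.
have E : expands g X (fun t => k + J 0 t) (wcpath (- a) F).1 (wintegrand (- a) Z).
  have [c' Jc] := JN.
  have GB := germ_bound g_range HX Ja JN
    (fun t p1 p2 => le_trans (let: And4 H _ _ _ := Fh in H t p1 p2) b1k)
    Fhold (fun j => cbound_le b1k (Zh j)).
  set P := (kg + ki) * (kh * b1) in GB.
  have P0 : 0 <= P.
    by have [H _] := GB 0 1 (lexx 0) ler01 (lexx 1); exact: le_trans H.
  exists (`|k| + P + b1 + `|c'|); have k0 := normr_ge0 k; have c0 := normr_ge0 c'.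
  split.
  - move=> t p0 p1; have [H _] := GB 0 t (lexx 0) p0 p1.
    by apply: le_trans (ler_normD _ _) _; lra.
  - by move=> t p0 p1; case: Fh => /(_ t p0 p1) H _ _ _; lra.
  - by move=> t i p0 p1; case: (Zh i) => /(_ t p0 p1) /= H _ _ _; lra.
  - by move=> t i j p0 p1; case: (Zh j) => _ /(_ t i p0 p1) /=; rewrite mxE => H _ _; lra.
  - move=> s t s0 st t1.
    have -> : k + J 0 t - (k + J 0 s) = J s t by rewrite (Ja 0 s t) //; ring.
    apply: le_trans (Jc s t s0 st t1) _.
    by rewrite ler_wpM2r ?exprn_ge0 ?hpow_ge0 //; have := ler_norm c'; lra.
have ee t : expR (a * t) * expR (- a * t) = 1.
  by rewrite -expRD mulNr subrr expR0.
apply: expands_ext (expands_expM a E) => t p0 p1; split.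
- by rewrite YE.
- by rewrite YE //= [expR _ * (a * _ + _)]mulrDr [X in _ + X]mulrA ee; ring.
- by rewrite /= scalerA ee scale1r.
- by rewrite /= scalerA ee scale1r.
Qed.

End Noise.
End Linear.

(** * Polynomial functions of countably many variables *)

Section PolynomialFunctionals.
Context (R : realType).
Local Notation env := (nat -> R).
Implicit Types (F G H : env -> R) (a b : env) (I J : pred nat) (p : {poly {poly R}}).

(** Infinitely many variables spare any bookkeeping of their number: in the defect equation 0 is x,
    1 is y or z, and i >= 2 is alpha_i. The inductive form lets bounds and the chain rule be proved
    on sums and products only. *)
Inductive polyfun : (env -> R) -> Prop :=
| polyfun_var i : polyfun (fun a => a i)
| polyfun_cst c : polyfun (fun=> c)
| polyfun_add F G : polyfun F -> polyfun G -> polyfun (fun a => F a + G a)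
| polyfun_mul F G : polyfun F -> polyfun G -> polyfun (fun a => F a * G a).

Lemma polyfun_ext F G : (forall a, F a = G a) -> polyfun F -> polyfun G.
Proof. by move=> /funext ->. Qed.

Lemma polyfun_opp F : polyfun F -> polyfun (fun a => - F a).
Proof.
move=> HF; apply: polyfun_ext (polyfun_mul (polyfun_cst (-1)) HF) => a.
by rewrite mulN1r.
Qed.

Lemma polyfun_sub F G : polyfun F -> polyfun G -> polyfun (fun a => F a - G a).
Proof. by move=> HF /polyfun_opp; exact: polyfun_add. Qed.

Lemma polyfun_sum (T : Type) (r : seq T) (P : pred T) (F : T -> env -> R) :
  (forall i, polyfun (F i)) -> polyfun (fun a => \sum_(i <- r | P i) F i a).
Proof.
move=> HF; elim: r => [|i r IH].
  by apply: polyfun_ext (polyfun_cst 0) => a; rewrite big_nil.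
case Pi : (P i); last by apply: polyfun_ext IH => a; rewrite big_cons Pi.
by apply: polyfun_ext (polyfun_add (HF i) IH) => a; rewrite big_cons Pi.
Qed.

Lemma polyfun_exp F n : polyfun F -> polyfun (fun a => F a ^+ n).
Proof.
move=> HF; elim: n => [|n IH]; first exact: polyfun_cst.
by apply: polyfun_ext (polyfun_mul HF IH) => a; rewrite exprS.
Qed.

Lemma polyfun_subst F (s : nat -> env -> R) : polyfun F ->
  (forall i, polyfun (s i)) -> polyfun (fun a => F (fun i => s i a)).
Proof.
move=> HF Hs; elim: HF => [i|c|F1 G1 _ H1 _ H2|F1 G1 _ H1 _ H2].
- exact: Hs.
- exact: polyfun_cst.
- exact: polyfun_add H1 H2.
- exact: polyfun_mul H1 H2.
Qed.

Lemma ev2E p (x y : R) :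
  ev2 p (x, y) = \sum_(j < size p) \sum_(i < size p`_j) p`_j`_i * x ^+ i * y ^+ j.
Proof.
rewrite /ev2 /= (horner_coef p) horner_sum; apply: eq_bigr => j _.
by rewrite hornerM horner_exp hornerC horner_coef mulr_suml.
Qed.

Lemma polyfun_ev2 p F G : polyfun F -> polyfun G -> polyfun (fun a => ev2 p (F a, G a)).
Proof.
move=> HF HG; apply: polyfun_ext (_ : polyfun (fun a => \sum_(j < size p)
    \sum_(i < size p`_j) p`_j`_i * F a ^+ i * G a ^+ j)) => [a|].
  by rewrite ev2E.
apply: polyfun_sum => j; apply: polyfun_sum => i; apply: polyfun_mul.
  by apply: polyfun_mul; [exact: polyfun_cst|exact: polyfun_exp].
exact: polyfun_exp.
Qed.

(** The derivative along a line is written with [derive1] because [g_coef'] is. On a line a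
    [polyfun] is a univariate polynomial, and the rules of calculus are read off from [deriv]. *)
Definition dirder F a b : R := derive1 (fun h => F (fun i => a i + h * b i)) 0.

Lemma polyfun_line F a b : polyfun F ->
  exists p : {poly R}, forall h, F (fun i => a i + h * b i) = p.[h].
Proof.
elim=> [i|c|F1 G1 _ [p1 H1] _ [p2 H2]|F1 G1 _ [p1 H1] _ [p2 H2]].
- by exists ((a i)%:P + 'X * (b i)%:P) => h; rewrite !hornerE.
- by exists c%:P => h; rewrite hornerC.
- by exists (p1 + p2) => h; rewrite hornerD H1 H2.
- by exists (p1 * p2) => h; rewrite hornerM H1 H2.
Qed.

Lemma dirder_poly F a b (p : {poly R}) :
  (forall h, F (fun i => a i + h * b i) = p.[h]) -> dirder F a b = p^`().[0].
Proof.
move=> E; rewrite /dirder (_ : (fun h => _) = horner p); last by apply/funext.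
by rewrite derivE.
Qed.

Lemma dirder_var i a b : dirder (fun a => a i) a b = b i.
Proof.
rewrite (@dirder_poly _ _ _ ((a i)%:P + (b i) *: 'X)); last first.
  by move=> h; rewrite !hornerE mulrC.
by rewrite derivD derivC add0r derivZ derivX !hornerE.
Qed.

Lemma dirder_cst c a b : dirder (fun=> c) a b = 0.
Proof.
rewrite (@dirder_poly _ _ _ c%:P); last by move=> h; rewrite hornerC.
by rewrite derivC horner0.
Qed.

Lemma line0 F a b : F (fun i => a i + 0 * b i) = F a.
Proof. by congr F; apply/funext => i; rewrite mul0r addr0. Qed.

Lemma dirder_add F G a b : polyfun F -> polyfun G ->
  dirder (fun a => F a + G a) a b = dirder F a b + dirder G a b.
Proof.
move=> /(@polyfun_line _ a b)[p Hp] /(@polyfun_line _ a b)[r Hr].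
rewrite (dirder_poly Hp) (dirder_poly Hr) (@dirder_poly _ _ _ (p + r)).
  by rewrite derivD hornerD.
by move=> h; rewrite hornerD Hp Hr.
Qed.

Lemma dirder_mul F G a b : polyfun F -> polyfun G ->
  dirder (fun a => F a * G a) a b = F a * dirder G a b + G a * dirder F a b.
Proof.
move=> /(@polyfun_line _ a b)[p Hp] /(@polyfun_line _ a b)[r Hr].
rewrite (dirder_poly Hp) (dirder_poly Hr) (@dirder_poly _ _ _ (p * r)).
  by rewrite derivM hornerD !hornerM -Hp -Hr !line0; ring.
by move=> h; rewrite hornerM Hp Hr.
Qed.

Lemma dirder_opp F a b : polyfun F -> dirder (fun a => - F a) a b = - dirder F a b.
Proof.
move=> HF; rewrite (_ : (fun a => - F a) = (fun a => -1 * F a)); last first.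
  by apply/funext => x; rewrite mulN1r.
by rewrite dirder_mul //; [rewrite dirder_cst; ring|exact: polyfun_cst].
Qed.

Lemma dirder_sub F G a b : polyfun F -> polyfun G ->
  dirder (fun a => F a - G a) a b = dirder F a b - dirder G a b.
Proof.
by move=> HF HG; rewrite dirder_add ?dirder_opp //; exact: polyfun_opp.
Qed.

Lemma dirder_sum (T : Type) (r : seq T) (P : pred T) (F : T -> env -> R) a b :
  (forall i, polyfun (F i)) ->
  dirder (fun a => \sum_(i <- r | P i) F i a) a b = \sum_(i <- r | P i) dirder (F i) a b.
Proof.
move=> HF; elim: r => [|i r IH].
  rewrite big_nil -[RHS](dirder_cst 0 a b); apply: (congr1 (fun G => dirder G a b)).
  by apply/funext => x; rewrite big_nil.
rewrite big_cons -IH; case Pi : (P i).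
  rewrite -dirder_add //; last exact: polyfun_sum.
  apply: (congr1 (fun G => dirder G a b)).
  by apply/funext => x; rewrite big_cons Pi.
apply: (congr1 (fun G => dirder G a b)).
by apply/funext => x; rewrite big_cons Pi.
Qed.

Lemma dirder_exp F n a b : polyfun F ->
  dirder (fun a => F a ^+ n) a b = n%:R * F a ^+ n.-1 * dirder F a b.
Proof.
move=> HF; elim: n => [|n IH]; first by rewrite mul0r mul0r dirder_cst.
rewrite (_ : (fun a => F a ^+ n.+1) = (fun a => F a * F a ^+ n)); last first.
  by apply/funext => x; rewrite exprS.
rewrite dirder_mul //; last exact: polyfun_exp.
rewrite IH; case: n {IH} => [|n] /=.
  ring.
by rewrite -[n.+2%:R]natr1 exprS; ring.
Qed.

Lemma polyfun_dirder F (H : nat -> env -> R) : polyfun F ->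
  (forall i, polyfun (H i)) -> polyfun (fun a => dirder F a (fun i => H i a)).
Proof.
move=> HF HH; elim: HF => [i|c|F1 G1 P1 H1 P2 H2|F1 G1 P1 H1 P2 H2].
- by apply: polyfun_ext (HH i) => a; rewrite dirder_var.
- by apply: polyfun_ext (polyfun_cst 0) => a; rewrite dirder_cst.
- by apply: polyfun_ext (polyfun_add H1 H2) => a; rewrite dirder_add.
- apply: polyfun_ext (polyfun_add (polyfun_mul P1 H2) (polyfun_mul P2 H1)) => a.
  by rewrite dirder_mul.
Qed.

(** With [polyfun] for [P] this is the ideal generated by the variables in [I]; with an ideal for
    [P] it is the product of the two ideals. Nesting records the order of vanishing, and each level
    later yields one small factor. *)
Inductive pideal I (P : (env -> R) -> Prop) : (env -> R) -> Prop :=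
| pideal0 : pideal I P (fun=> 0)
| pideal_gen i F : I i -> P F -> pideal I P (fun a => a i * F a)
| pideal_add F G : pideal I P F -> pideal I P G -> pideal I P (fun a => F a + G a).

Lemma pideal_ext I P F G : (forall a, F a = G a) -> pideal I P F -> pideal I P G.
Proof. by move=> /funext ->. Qed.

Definition poly_module (P : (env -> R) -> Prop) :=
  (forall F, P F -> polyfun F) /\ forall F G, polyfun G -> P F -> P (fun a => F a * G a).

Lemma polyfun_module : poly_module polyfun.
Proof. by split=> // F G HG HF; exact: polyfun_mul. Qed.

Lemma pideal_module I P : poly_module P -> poly_module (pideal I P).
Proof.
move=> [P1 P2]; split=> [F|F G HG].
  elim=> [|i F1 _ H1|F1 G1 _ H1 _ H2]; first exact: polyfun_cst.
    by apply: polyfun_mul; [exact: polyfun_var|exact: P1].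
  exact: polyfun_add.
elim=> [|i F1 Ii H1|F1 G1 _ H1 _ H2].
- by apply: pideal_ext (pideal0 I P) => a; rewrite mul0r.
- by apply: pideal_ext (pideal_gen Ii (P2 _ _ HG H1)) => a; rewrite mulrA.
- by apply: pideal_ext (pideal_add H1 H2) => a; rewrite mulrDl.
Qed.

Lemma pideal_mulr I P F G : poly_module P -> pideal I polyfun F -> P G ->
  pideal I P (fun a => F a * G a).
Proof.
move=> [P1 P2] HF HG; elim: HF => [|i F1 Ii H1|F1 G1 _ H1 _ H2].
- by apply: pideal_ext (pideal0 I P) => a; rewrite mul0r.
- apply: pideal_ext (pideal_gen Ii (P2 _ _ H1 HG)) => a.
  by rewrite -mulrA [G a * _]mulrC.
- by apply: pideal_ext (pideal_add H1 H2) => a; rewrite mulrDl.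
Qed.

Lemma pideal_opp I P F : poly_module P -> pideal I P F -> pideal I P (fun a => - F a).
Proof.
move=> /(pideal_module I)[_ H] HF.
by apply: pideal_ext (H _ _ (polyfun_cst (-1)) HF) => a; rewrite mulrN1.
Qed.

Lemma pideal_sub I P F G : poly_module P -> pideal I P F -> pideal I P G ->
  pideal I P (fun a => F a - G a).
Proof. by move=> HP HF /(pideal_opp HP); exact: pideal_add. Qed.

Lemma pideal_sum I P (T : Type) (r : seq T) (Q : pred T) (F : T -> env -> R) :
  (forall i, Q i -> pideal I P (F i)) -> pideal I P (fun a => \sum_(i <- r | Q i) F i a).
Proof.
move=> HF; elim: r => [|i r IH].
  by apply: pideal_ext (pideal0 I P) => a; rewrite big_nil.
case Pi : (Q i); last by apply: pideal_ext IH => a; rewrite big_cons Pi.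
by apply: pideal_ext (pideal_add (HF i Pi) IH) => a; rewrite big_cons Pi.
Qed.

Definition zero_on I a : env := fun i => if I i then 0 else a i.
Definition restrict_on I a : env := fun i => if I i then a i else 0.

(** Hadamard's lemma by induction. With index 0 for the value at vanishing variables, the product
    case is F G - F0 G0 = (F - F0) G + (G - G0) F0. *)
Lemma pideal_hadamard I F : polyfun F ->
  pideal I polyfun (fun a => F a - F (zero_on I a)).
Proof.
have Z G : polyfun G -> polyfun (fun a => G (zero_on I a)).
  move=> /polyfun_subst; apply => i; rewrite /zero_on; case: (I i).
    exact: polyfun_cst.
  exact: polyfun_var.
elim=> [i|c|F1 G1 P1 H1 P2 H2|F1 G1 P1 H1 P2 H2].
- rewrite /zero_on; case Ii : (I i).
    apply: pideal_ext (pideal_gen Ii (polyfun_cst 1)) => a.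
    by rewrite mulr1 subr0.
  by apply: pideal_ext (pideal0 I polyfun) => a; rewrite subrr.
- by apply: pideal_ext (pideal0 I polyfun) => a; rewrite subrr.
- by apply: pideal_ext (pideal_add H1 H2) => a; ring.
- have [_ M] := pideal_module I polyfun_module.
  apply: pideal_ext (pideal_add (M _ _ P2 H1) (M _ _ (Z _ P1) H2)) => a.
  by ring.
Qed.

(** Write E as a sum of a_i F_i with i in I. Replacing each F_i by its value at vanishing J
    variables costs an element of the product I J, and what is left is the directional derivative
    assumed to vanish. *)
Lemma pideal_second I J E : {subset I <= J} -> pideal I polyfun E ->
  (forall a, dirder E (zero_on J a) (restrict_on J a) = 0) ->
  pideal I (pideal J polyfun) E.
Proof.
move=> IJ HE D0.
suff H : pideal I (pideal J polyfun)
    (fun a => E a - dirder E (zero_on J a) (restrict_on J a)).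
  by apply: pideal_ext H => a; rewrite D0 subr0.
elim: HE {D0} => [|i F Ii HF|F G HF IHF HG IHG].
- apply: pideal_ext (pideal0 I _) => a; rewrite dirder_cst subr0 //.
- apply: pideal_ext (pideal_gen Ii (pideal_hadamard J HF)) => a.
  rewrite dirder_mul //; last exact: polyfun_var.
  have Ji : J i by exact: IJ.
  by rewrite dirder_var /zero_on /restrict_on Ji; ring.
- have [PF _] := pideal_module I polyfun_module.
  apply: pideal_ext (pideal_add IHF IHG) => a.
  by rewrite (dirder_add _ _ (PF _ HF) (PF _ HG)); ring.
Qed.

Lemma dirder_second J E a : pideal J (pideal J polyfun) E ->
  dirder E (zero_on J a) (restrict_on J a) = 0.
Proof.
have [PF _] := pideal_module J polyfun_module.
have [PF2 _] := pideal_module J (pideal_module J polyfun_module).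
have V F : pideal J polyfun F -> F (zero_on J a) = 0.
  elim=> [//|i F1 Ji _|F1 G1 _ -> _ ->]; last by rewrite addr0.
  by rewrite /zero_on Ji mul0r.
elim=> [|i F Ji HF|F G HF IHF HG IHG]; first exact: dirder_cst.
  rewrite dirder_mul; [|exact: polyfun_var|exact: PF].
  by rewrite V // /zero_on Ji !mul0r addr0.
by rewrite (dirder_add _ _ (PF2 _ HF) (PF2 _ HG)) IHF IHG addr0.
Qed.

Lemma pideal_subst J F (s : nat -> env -> R) : pideal J (pideal J polyfun) F ->
  (forall i, polyfun (s i)) -> (forall i, J i -> pideal J polyfun (s i)) ->
  pideal J (pideal J polyfun) (fun a => F (fun i => s i a)).
Proof.
move=> HF Hs HJ.
have S1 G : pideal J polyfun G -> pideal J polyfun (fun a => G (fun i => s i a)).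
  elim=> [|i F1 Ji H1|F1 G1 _ H1 _ H2]; first exact: pideal0.
    have [_ M] := pideal_module J polyfun_module.
    by apply: M; [exact: polyfun_subst|exact: HJ].
  exact: pideal_add.
elim: HF => [|i F1 Ji H1|F1 G1 _ H1 _ H2]; first exact: pideal0.
  by apply: pideal_mulr; [exact/pideal_module/polyfun_module|exact: HJ|exact: S1].
exact: pideal_add.
Qed.

End PolynomialFunctionals.

(** * Polynomials of controlled paths *)

Section Composition.
Context (R : realType) (g : R) (d : nat).
Hypothesis g_range : 1 / 3 < g <= 1 / 2.
Local Notation env := (nat -> R).
Local Notation D := (d%:R : R).

Definition pcomp (F : env -> R) (Y : nat -> cpath R d) : cpath R d :=
  (fun t => F (fun v => (Y v).1 t),
   fun t => \row_l dirder F (fun v => (Y v).1 t) (fun v => (Y v).2 t 0 l)).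

Lemma pcomp_add F G Y : polyfun F -> polyfun G ->
  pcomp (fun a => F a + G a) Y = pcomp F Y + pcomp G Y.
Proof.
move=> HF HG; congr pair; apply/funext => t; apply/rowP => l.
by rewrite !mxE dirder_add.
Qed.

Lemma pcomp_mul F G Y : polyfun F -> polyfun G ->
  pcomp (fun a => F a * G a) Y = cmul (pcomp F Y) (pcomp G Y).
Proof.
move=> HF HG; congr pair; apply/funext => t; apply/rowP => l.
by rewrite !mxE dirder_mul.
Qed.

Lemma pcomp_var i Y : pcomp (fun a => a i) Y = Y i.
Proof.
rewrite /pcomp [RHS]surjective_pairing; congr pair; apply/funext => t.
by apply/rowP => l; rewrite mxE dirder_var.
Qed.

(** [k] comes before [B]: the power of the noise size decides the radius and must not depend on the
    size of the paths, while [c] may. [beta] is the small factor gained, and [adm] restricts the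
    vectors of bounds. *)
Definition poly_bound (adm : env -> Prop) (P : (env -> R) -> Prop) (beta : env -> R) :=
  forall F, P F -> exists k : nat, forall B : R, exists2 c : R, 0 <= c &
    forall X N Y b, noise_on g X N -> (forall v, cbound g (rp1 X) (Y v) (b v)) ->
      (forall v, b v <= B) -> adm b ->
      cbound g (rp1 X) (pcomp F Y) (c * N ^+ k * beta b).

Lemma poly_bound_polyfun adm : poly_bound adm (@polyfun R) (fun=> 1).
Proof.
move=> F; elim=> [i|c|F1 G1 P1 [k1 H1] P2 [k2 H2]|F1 G1 P1 [k1 H1] P2 [k2 H2]].
- exists 0%N => B; exists `|B| => // X N Y b HX Yb bB _; rewrite pcomp_var.
  by apply: cbound_le (Yb i); rewrite expr0 !mulr1; exact: le_trans (ler_norm B).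
- exists 0%N => B; exists `|c| => // X N Y b HX Yb bB _; rewrite expr0 !mulr1.
  have Cc : cbound g (rp1 X) (fun=> c, fun=> 0) `|c|.
    apply: cbound_smooth => // s t *.
    by rewrite subrr normr0 mulr_ge0 // subr_ge0.
  apply: cbound_peq Cc => t _ _; split=> //.
  by apply/rowP => l; rewrite !mxE dirder_cst.
- exists (k1 + k2)%N => B; have [c1 c10 C1] := H1 B; have [c2 c20 C2] := H2 B.
  exists (c1 + c2); first exact: addr_ge0.
  move=> X N Y b HX Yb bB ab; rewrite pcomp_add //.
  have N1 := noise_ge1 HX.
  have N0 : 0 <= N by lra.
  apply: cbound_le (cboundD (C1 X N Y b HX Yb bB ab) (C2 X N Y b HX Yb bB ab)).
  rewrite !mulr1 mulrDl exprD; have e1 := @exprn_ege1 R k1 N N1.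
  have e2 := @exprn_ege1 R k2 N N1.
  apply: lerD; rewrite ler_wpM2l //.
    by rewrite ler_peMr // exprn_ge0.
  by rewrite ler_peMl // exprn_ge0.
- exists (2 + (k1 + k2))%N => B; have [c1 c10 C1] := H1 B; have [c2 c20 C2] := H2 B.
  exists (4 * (D + 1) ^+ 2 * (c1 * c2)).
    by rewrite !mulr_ge0 ?addr_ge0.
  move=> X N Y b HX Yb bB ab; rewrite pcomp_mul //.
  apply: cbound_le (cbound_mul g_range HX (C1 X N Y b HX Yb bB ab)
     (C2 X N Y b HX Yb bB ab)).
  rewrite le_eqVlt; apply/orP; left; apply/eqP.
  by rewrite /mulconst /hconst !exprD; ring.
Qed.

(** A generator contributes the bound [betaI] on its path as an extra factor, so products of ideals
    give products of small factors. *)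
Lemma poly_bound_pideal (adm : env -> Prop) (I : pred nat) (P : (env -> R) -> Prop)
    (beta betaI : env -> R) : poly_module P ->
  (forall b, (forall v, 0 <= b v) -> 0 <= betaI b) ->
  (forall b v, adm b -> (forall v, 0 <= b v) -> I v -> b v <= betaI b) ->
  (forall b, (forall v, 0 <= b v) -> 0 <= beta b) ->
  poly_bound adm P beta ->
  poly_bound adm (pideal I P) (fun b => betaI b * beta b).
Proof.
move=> [P1 _] betaI0 HI beta0 HP F.
have PF : forall F, pideal I P F -> polyfun F.
  move=> F0; elim=> [|i F1 _ H1|F1 G1 _ H1 _ H2]; first exact: polyfun_cst.
    by apply: polyfun_mul; [exact: polyfun_var|exact: P1].
  exact: polyfun_add.
elim=> [|i F1 Ii H1|F1 G1 p1 [k1 H1] p2 [k2 H2]].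
- exists 0%N => B; exists 0 => // X N Y b HX Yb bB _; rewrite !mul0r.
  apply: cbound_peq (cbound0 _ _) => t _ _; split=> //.
  by apply/rowP => l; rewrite !mxE dirder_cst.
- have [k Hk] := HP F1 H1; exists (2 + k)%N => B; have [c c0 C] := Hk B.
  exists (4 * (D + 1) ^+ 2 * c); first by rewrite !mulr_ge0 ?addr_ge0.
  move=> X N Y b HX Yb bB ab; rewrite pcomp_mul; [|exact: polyfun_var|exact: P1].
  rewrite pcomp_var.
  have b0 v : 0 <= b v := cbound_ge0 (Yb v).
  have bi := HI b i ab b0 Ii.
  have N0 : 0 <= N by have := noise_ge1 HX; lra.
  have H := cbound_mul g_range HX (cbound_le bi (Yb i)) (C X N Y b HX Yb bB ab).
  apply: cbound_le H; rewrite le_eqVlt; apply/orP; left; apply/eqP.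
  by rewrite /mulconst /hconst !exprD; ring.
- exists (k1 + k2)%N => B; have [c1 c10 C1] := H1 B; have [c2 c20 C2] := H2 B.
  exists (c1 + c2); first exact: addr_ge0.
  move=> X N Y b HX Yb bB ab; rewrite pcomp_add //; [|exact: PF|exact: PF].
  have H3 := cboundD (C1 X N Y b HX Yb bB ab) (C2 X N Y b HX Yb bB ab).
  have N1 := noise_ge1 HX.
  have N0 : 0 <= N by lra.
  apply: cbound_le H3.
  have e1 := @exprn_ege1 R k1 N N1; have e2 := @exprn_ege1 R k2 N N1.
  have b0 v : 0 <= b v := cbound_ge0 (Yb v).
  have z : 0 <= betaI b * beta b by rewrite mulr_ge0 ?betaI0 ?beta0.
  rewrite -mulrDl ler_wpM2r // mulrDl exprD.
  apply: lerD; rewrite ler_wpM2l //.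
    by rewrite ler_peMr // exprn_ge0.
  by rewrite ler_peMl // exprn_ge0.
Qed.

End Composition.

(** * Chain rule for polynomials of the solution of a system *)

Section ChainRule.
Context (R : realType) (g : R) (d : nat).
Hypothesis g_range : 1 / 3 < g <= 1 / 2.
Local Notation env := (nat -> R).
Context (X : rough R d) (N : R).
Hypothesis HX : noise_on g X N.

Definition field_der (H : nat -> env -> R) (F : env -> R) : env -> R :=
  fun a => dirder F a (fun i => H i a).

Context (B : nat -> env -> R) (H : 'I_d -> nat -> env -> R) (Y : nat -> R -> R).
Hypothesis H_poly : forall j v, polyfun (H j v).
Local Notation Yt t := (fun v => Y v t).

Definition field_integrand (F : env -> R) : integrand R d :=
  (fun t => \row_j field_der (H j) F (Yt t),
   fun t => \matrix_(i, j) field_der (H i) (field_der (H j) F) (Yt t)).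

Hypothesis Y_expands : forall v, expands g X (Y v) (fun t => B v (Yt t))
  (fun t => \row_j H j v (Yt t), fun t => \matrix_(i, j) field_der (H i) (H j v) (Yt t)).

(** In the product case the cross terms of [expandsM] are exactly those of the iterated derivative
    [field_der (H i) (field_der (H j) F)]. *)
Lemma chain_rule F : polyfun F ->
  expands g X (fun t => F (Yt t)) (fun t => field_der B F (Yt t)) (field_integrand F).
Proof.
have Hd F' j : polyfun F' -> polyfun (field_der (H j) F').
  by move=> HF; apply: polyfun_dirder.
have fi1 F' t j : (field_integrand F').1 t 0 j = field_der (H j) F' (Yt t) by rewrite mxE.
have fi2 F' t i j : (field_integrand F').2 t i j =
  field_der (H i) (field_der (H j) F') (Yt t) by rewrite mxE.
have ar (x y p q u v w z : R) : x * p + y * q + (u * v + w * z) =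
  x * p + v * u + (y * q + z * w) by ring.
have DA F1 G1 j : polyfun F1 -> polyfun G1 -> field_der (H j) (fun a => F1 a + G1 a) =
    fun a => field_der (H j) F1 a + field_der (H j) G1 a.
  by move=> P1 P2; apply/funext => a; exact: dirder_add.
have DM F1 G1 j : polyfun F1 -> polyfun G1 -> field_der (H j) (fun a => F1 a * G1 a) =
    fun a => F1 a * field_der (H j) G1 a + G1 a * field_der (H j) F1 a.
  by move=> P1 P2; apply/funext => a; exact: dirder_mul.
elim=> [v|c|F1 G1 P1 IH1 P2 IH2|F1 G1 P1 IH1 P2 IH2].
- apply: expands_ext (Y_expands v) => t t0 t1; split => //=.
  + by rewrite /field_der dirder_var.
  + by apply/rowP => j; rewrite !mxE /field_der dirder_var.
  + apply/matrixP => i j; rewrite !mxE; congr field_der; apply/funext => a.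
    by rewrite /field_der dirder_var.
- have E : expands g X (fun=> c) (fun=> 0) (fun=> 0, fun=> 0).
    apply: (@expands_smooth R g d g_range X _ _ `|c|) => *; rewrite ?normr0 //.
    by rewrite subrr mul0r subr0 normr0 mulr_ge0 // sqr_ge0.
  apply: expands_ext E => t t0 t1; split => //=.
  + by rewrite /field_der dirder_cst.
  + by apply/rowP => j; rewrite !mxE /field_der dirder_cst.
  + apply/matrixP => i j; rewrite !mxE /field_der.
    rewrite (_ : (fun a => dirder _ _ _) = fun=> 0) ?dirder_cst //.
    by apply/funext => a; rewrite dirder_cst.
- apply: expands_ext (expandsD IH1 IH2) => t t0 t1; split=> [//| | |].
  + by rewrite /field_der dirder_add.
  + apply/rowP => j; apply: etrans (_ : field_der (H j) F1 (Yt t) + field_der (H j) G1 (Yt t) = _).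
      by rewrite mxE; congr (_ + _); exact: fi1.
    exact: etrans (esym (dirder_add _ _ P1 P2)) (esym (fi1 _ t j)).
  + apply/matrixP => i j; apply: etrans (_ : field_der (H i) (field_der (H j) F1) (Yt t) +
        field_der (H i) (field_der (H j) G1) (Yt t) = _).
      by rewrite mxE; congr (_ + _); exact: fi2.
    apply: etrans (esym (dirder_add _ _ (Hd F1 j P1) (Hd G1 j P2))) _.
    by rewrite (fi2 _ t i j) (DA F1 G1 j P1 P2).
- apply: expands_ext (expandsM g_range HX IH1 IH2) => t t0 t1; split=> [//| | |].
  + by rewrite /field_der dirder_mul.
  + apply/rowP => j; apply: etrans (_ : F1 (Yt t) * field_der (H j) G1 (Yt t) +
        G1 (Yt t) * field_der (H j) F1 (Yt t) = _).
      by rewrite mxE; congr (_ + _); rewrite mxE; congr (_ * _); exact: fi1.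
    exact: etrans (esym (dirder_mul _ _ P1 P2)) (esym (fi1 _ t j)).
  + have H1 j := Hd F1 j P1; have H2 j := Hd G1 j P2.
    apply/matrixP => i j; rewrite (fi2 _ t i j) (DM F1 G1 j P1 P2).
    rewrite [RHS](dirder_add _ _ (polyfun_mul P1 (H2 j)) (polyfun_mul P2 (H1 j))).
    rewrite (dirder_mul _ _ P1 (H2 j)) (dirder_mul _ _ P2 (H1 j)).
    apply: etrans (ar _ _ _ _ _ _ _ _); rewrite mxE; congr (_ + _ + (_ + _));
      by congr (_ * _); (exact: fi1 || exact: fi2).
Qed.

End ChainRule.

(** * Comparison of [cbound] with the extended-real norms *)

Section Norms.
Context (R : realType) (g : R) (d : nat).
Hypothesis g_range : 1 / 3 < g <= 1 / 2.
Local Notation h := (hpow g).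
Implicit Types (b c : R).

Lemma mx_norm_leP (m n : nat) (x : 'M[R]_(m, n)) b : 0 <= b ->
  `|x| <= b <-> forall i j, `|x i j| <= b.
Proof.
move=> b0; have -> : `|x| = mx_norm x by []; rewrite mx_normrE; split.
  move=> /bigmax_leP[_ H] i j; exact: (H (i, j)).
by move=> H; apply/bigmax_leP; split => // -[i j].
Qed.

Lemma sup_norm_leP (V : normedModType R) (f : R -> V) b :
  (sup_norm 0 1 f <= b%:E)%E <-> forall t, 0 <= t -> t <= 1 -> `|f t| <= b.
Proof.
split=> [/ereal_supP H t t0 t1|H].
  by rewrite -lee_fin; apply: H; exists t => //=; rewrite t0.
by apply/ereal_supP => _ [t /= /andP[t0 t1] <-]; rewrite lee_fin H.
Qed.

Lemma holder2_leP (V : normedModType R) (f : R -> R -> V) (T0 T1 al b : R) :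
  (holder2 T0 T1 al f <= b%:E)%E <->
  forall s t, T0 <= s -> s < t -> t <= T1 -> `|f s t| <= b * (t - s) `^ al.
Proof.
split=> [/ereal_supP H s t s0 st t1|H].
  rewrite -ler_pdivrMr ?powR_gt0 ?subr_gt0 // -lee_fin.
  by apply: H; exists (s, t).
apply/ereal_supP => _ [[s t] /= [s0 st t1] <-].
by rewrite lee_fin ler_pdivrMr ?powR_gt0 ?subr_gt0 // H.
Qed.

Lemma holder2_fin (V : normedModType R) (f : R -> R -> V) (T0 T1 al : R) :
  (holder2 T0 T1 al f < +oo)%E ->
  exists2 b, 0 <= b & (holder2 T0 T1 al f <= b%:E)%E.
Proof.
case E : (holder2 T0 T1 al f) => [r| |] // _; last by exists 0; rewrite ?leNye.
by exists (Num.max r 0); rewrite ?lee_fin ?le_max ?lexx ?orbT.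
Qed.

Lemma sup_norm_ge0 (V : normedModType R) (f : R -> V) : (0 <= sup_norm 0 1 f)%E.
Proof.
apply: (@le_trans _ _ (`|f 0|)%:E); first by rewrite lee_fin.
by apply: ereal_sup_ubound; exists 0 => //=; rewrite lexx ler01.
Qed.

Lemma holder2_ge0 (V : normedModType R) (f : R -> R -> V) al :
  (0 <= holder2 0 1 al f)%E.
Proof.
apply: (@le_trans _ _ (`|f 0 1| / (1 - 0) `^ al)%:E).
  by rewrite lee_fin divr_ge0 // powR_ge0.
by apply: ereal_sup_ubound; exists (0, 1).
Qed.

Section Path.
Context (w : R -> 'rV[R]_d).
Implicit Types (Y : cpath R d) (U : cpath2 R d).

Lemma incr_self (V : normedModType R) (f : R -> V) s : incr f s s = 0.
Proof. by rewrite /incr subrr. Qed.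

Lemma cbound_cnorm Y b : cbound g w Y b -> (cnorm g w Y <= (4 * b)%:E)%E.
Proof.
move=> Yb; have b0 := cbound_ge0 Yb; case: Yb => H1 H2 H3 H4.
have -> : (4 * b)%:E = (b%:E + b%:E + b%:E + b%:E)%E.
  by rewrite -!EFinD; congr EFin; ring.
rewrite /cnorm !leeD //; first exact/sup_norm_leP.
- by apply/sup_norm_leP => t t0 t1; apply/mx_norm_leP => // i j; rewrite ord1 H2.
- apply/holder2_leP => s t s0 st t1; apply/mx_norm_leP.
    by rewrite mulr_ge0 // powR_ge0.
  by move=> i j; rewrite ord1 !mxE H3 // ltW.
- by apply/holder2_leP => s t s0 st t1; rewrite hpow2 ?(ltW st) // H4 // ltW.
Qed.

Lemma cnorm_cbound Y b : (cnorm g w Y <= b%:E)%E -> cbound g w Y b.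
Proof.
rewrite /cnorm; have p1 := sup_norm_ge0 Y.1; have p2 := sup_norm_ge0 Y.2.
have p3 := holder2_ge0 (incr Y.2) g.
have p4 := holder2_ge0 (remainder w Y) (2 * g) => le.
have q12 := adde_ge0 p1 p2; have q123 := adde_ge0 q12 p3.
have l4 : (holder2 0 1 (2 * g) (remainder w Y) <= b%:E)%E.
  by apply: le_trans le; rewrite leeDr.
have l123 := le_trans (leeDl _ p4) le.
have l3 : (holder2 0 1 g (incr Y.2) <= b%:E)%E.
  by apply: le_trans l123; rewrite leeDr.
have l12 := le_trans (leeDl _ p3) l123.
have l1 := le_trans (leeDl _ p2) l12.
have l2 : (sup_norm 0 1 Y.2 <= b%:E)%E by apply: le_trans l12; rewrite leeDr.
have b0 : 0 <= b by rewrite -lee_fin; exact: le_trans l1.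
split.
- exact/sup_norm_leP.
- by move=> t i t0 t1; move/sup_norm_leP: l2 => /(_ t t0 t1) /(mx_norm_leP _ b0); exact.
- move=> s t i s0; rewrite le_eqVlt => /predU1P[->|st] t1.
    by rewrite subrr normr0 mulr_ge0 // hpow_ge0.
  move/holder2_leP: l3 => /(_ s t s0 st t1).
  by move=> /(mx_norm_leP _ (mulr_ge0 b0 (powR_ge0 _ _))) /(_ 0 i); rewrite !mxE.
- move=> s t s0; rewrite le_eqVlt => /predU1P[->|st] t1.
    rewrite /remainder incr_self subrr sub0r /dotrv big1 => [|i _].
      by rewrite oppr0 normr0 mulr_ge0 // exprn_ge0 // hpow_ge0.
    by rewrite mxE mulr0.
  by rewrite -hpow2 ?(ltW st) //; move/holder2_leP: l4; exact.
Qed.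

Definition cbound2 U b := cbound g w U.1 b /\ cbound g w U.2 b.

Lemma cbound2_cnorm2 U b : cbound2 U b -> (cnorm2 g w U <= (8 * b)%:E)%E.
Proof.
move=> [/cbound_cnorm H1 /cbound_cnorm H2]; rewrite /cnorm2.
have -> : 8 * b = 4 * b + 4 * b by ring.
by rewrite EFinD leeD.
Qed.

Lemma cnorm_ge0 Y : (0 <= cnorm g w Y)%E.
Proof.
by rewrite /cnorm !adde_ge0 // ?sup_norm_ge0 ?holder2_ge0.
Qed.

Lemma cnorm2_cbound2 U b : (cnorm2 g w U <= b%:E)%E -> cbound2 U b.
Proof.
move=> le; split; apply: cnorm_cbound; apply: le_trans le.
  by rewrite leeDl // cnorm_ge0.
by rewrite leeDr // cnorm_ge0.
Qed.

Lemma controlled_fin Y : controlled g w Y -> exists b, cbound g w Y b.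
Proof.
move=> [h1 h2 h3].
have [b1 b10 /holder2_leP H1] := holder2_fin h1.
have [b2 b20 /holder2_leP H2] := holder2_fin h2.
have [b3 b30 /holder2_leP H3] := holder2_fin h3.
have n0 := normr_ge0 (Y.1 0); have n1 := normr_ge0 (Y.2 0).
have L (V : normedModType R) (f : R -> V) c : 0 <= c ->
    (forall s t, 0 <= s -> s < t -> t <= 1 -> `|incr f s t| <= c * (t - s) `^ g) ->
    forall t, 0 <= t -> t <= 1 -> `|f t| <= `|f 0| + c.
  move=> c0 Hf t; rewrite le_eqVlt => /predU1P[<- _|t0 t1]; first by rewrite lerDl.
  have := Hf 0 t (lexx 0) t0 t1; rewrite /incr => H.
  rewrite -[f t](subrK (f 0)) addrC; apply: le_trans (ler_normD _ _) _.
  rewrite lerD2l; apply: le_trans H _; rewrite ler_piMr //.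
  by apply: hpow_le1 => //; exact: ltW.
exists ((`|Y.1 0| + b1) + (`|Y.2 0| + b2) + b2 + b3); apply: cnorm_cbound.
rewrite /cnorm !EFinD !leeD // -?EFinD.
- exact/sup_norm_leP/L.
- exact/sup_norm_leP/L.
- exact/holder2_leP.
- exact/holder2_leP.
Qed.

End Path.
End Norms.

(** * The truncation and the truncated polynomial nonlinearities *)

Section Cutoff.
Context (R : realType) (g : R) (d : nat).
Hypothesis g_range : 1 / 3 < g <= 1 / 2.
Local Notation h := (hpow g).
Local Notation env := (nat -> R).
Implicit Types (b c r : R) (U V : cpath2 R d) (p : {poly {poly R}}).

Lemma cbound2_le w U b b' : b <= b' -> cbound2 g w U b -> cbound2 g w U b'.
Proof. by move=> bb [H1 H2]; split; exact: cbound_le bb _. Qed.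

Lemma cbound2D w U V a b : cbound2 g w U a -> cbound2 g w V b -> cbound2 g w (U + V) (a + b).
Proof. by move=> [H1 H2] [G1 G2]; split; exact: cboundD. Qed.

Lemma cbound2N w U a : cbound2 g w U a -> cbound2 g w (- U) a.
Proof. by move=> [H1 H2]; split; exact: cboundN. Qed.

Lemma cbound2B w U V a b : cbound2 g w U a -> cbound2 g w V b -> cbound2 g w (U - V) (a + b).
Proof. by move=> ? /cbound2N; exact: cbound2D. Qed.

Lemma cbound2Z w c U a : cbound2 g w U a -> cbound2 g w (c *: U) (`|c| * a).
Proof. by move=> [H1 H2]; split; exact: cboundZ. Qed.

Lemma cbound20 w : cbound2 g w (0 : cpath2 R d) 0.
Proof. by split; exact: cbound0. Qed.

Lemma ceq_sym U V : ceq U V -> ceq V U.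
Proof. by move=> H t /H[-> -> -> ->]. Qed.

Lemma cbound2_ceq w U V b : ceq U V -> cbound2 g w U b -> cbound2 g w V b.
Proof.
move=> E [H1 H2]; split; [apply: cbound_peq H1|apply: cbound_peq H2] => t t0 t1;
  by case: (E t) => [|? ? ? ?]; [rewrite t0|split].
Qed.

Lemma ceqB U V U' V' : ceq U U' -> ceq V V' -> ceq (U - V) (U' - V').
Proof.
move=> E1 E2 t t01; have [e1 e2 e3 e4] := E1 t t01; have [f1 f2 f3 f4] := E2 t t01.
split.
- by rewrite -[LHS]/(U.1.1 t - V.1.1 t) e1 f1.
- by rewrite -[LHS]/(U.1.2 t - V.1.2 t) e2 f2.
- by rewrite -[LHS]/(U.2.1 t - V.2.1 t) e3 f3.
- by rewrite -[LHS]/(U.2.2 t - V.2.2 t) e4 f4.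
Qed.

Lemma cbound2_eq0 w U V : cbound2 g w (U - V) 0 -> ceq U V.
Proof.
move=> [[H1 H2 _ _] [G1 G2 _ _]] t /andP[t0 t1]; split.
- by apply/eqP; rewrite -subr_eq0 -normr_le0; exact: H1.
- apply/rowP => i; apply/eqP; rewrite -subr_eq0 -normr_le0.
  by have := H2 t i t0 t1; rewrite !mxE.
- by apply/eqP; rewrite -subr_eq0 -normr_le0; exact: G1.
- apply/rowP => i; apply/eqP; rewrite -subr_eq0 -normr_le0.
  by have := G2 t i t0 t1; rewrite !mxE.
Qed.

Section Noise.
Context (X : rough R d) (N : R).
Hypothesis HX : noise_on g X N.
Local Notation w := (rp1 X).
Local Notation cb2 := (cbound2 g w).

Lemma cbound_controlled (Y : cpath R d) b : cbound g w Y b -> controlled g w Y.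
Proof.
move=> Yb; have b0 := cbound_ge0 Yb; have Yh := cbound_holder g_range HX Yb.
have k1 := hconst_ge1 HX; case: Yb => H1 H2 H3 H4; split.
- apply: (@le_lt_trans _ _ ((hconst d N * b))%:E); last exact: ltry.
  by apply/holder2_leP => s t s0 st t1; apply: Yh => //; exact: ltW.
- apply: (@le_lt_trans _ _ (b)%:E); last exact: ltry.
  apply/holder2_leP => s t s0 st t1; apply/mx_norm_leP.
    by rewrite mulr_ge0 // powR_ge0.
  by move=> i j; rewrite ord1 !mxE H3 // ltW.
- apply: (@le_lt_trans _ _ (b)%:E); last exact: ltry.
  by apply/holder2_leP => s t s0 st t1; rewrite hpow2 ?(ltW st) // H4 // ltW.
Qed.

Lemma cbound2_controlled2 U b : cb2 U b -> controlled2 g w U.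
Proof.
by move=> [H1 H2]; split; [exact: cbound_controlled H1|exact: cbound_controlled H2].
Qed.

Context (L : R) (ch : cpath2 R d -> cpath2 R d).
Hypothesis Hch : is_cutoff g L w ch.

Lemma chi0 : ceq (ch 0) 0.
Proof.
apply: (cutoff_id Hch); first exact: cbound2_controlled2 (cbound20 _).
apply: le_trans (cbound2_cnorm2 (cbound20 w)) _.
by rewrite mulr0 lee_fin divr_ge0.
Qed.

Lemma cnorm2_ge0 U : (0 <= cnorm2 g w U)%E.
Proof. by rewrite /cnorm2 adde_ge0 // cnorm_ge0. Qed.

Lemma chi_lip U V bU bV b : cb2 U bU -> cb2 V bV -> (cnorm2 g w (U - V)%R <= b%:E)%E ->
  cb2 (ch U - ch V) (`|L| * b).
Proof.
move=> HU HV HUV; apply: cnorm2_cbound2.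
apply: le_trans (cutoff_lip Hch (cbound2_controlled2 HU) (cbound2_controlled2 HV)) _.
rewrite EFinM; apply: (@le_trans _ _ (`|L|%:E * cnorm2 g w (U - V)%R)%E).
  by rewrite lee_wpmul2r ?cnorm2_ge0 // lee_fin ler_norm.
by rewrite lee_wpmul2l // lee_fin.
Qed.

(** The scalings by r and its inverse cancel; 8 is the price of passing from [cbound2] to
    [cnorm2]. *)
Lemma chiR_lip r U V bU bV b : 0 < r -> cb2 U bU -> cb2 V bV -> cb2 (U - V) b ->
  cb2 (chiR ch r U - chiR ch r V) (8 * `|L| * b).
Proof.
move=> r0 HU HV HUV; rewrite /chiR -scalerBr.
have -> : 8 * `|L| * b = `|r| * (`|L| * (8 * (`|r^-1| * b))).
  rewrite normfV (gtr0_norm r0); field; lra.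
apply: cbound2Z; apply: chi_lip (cbound2Z _ HU) (cbound2Z _ HV) _.
by rewrite -scalerBr; apply: cbound2_cnorm2; exact: cbound2Z.
Qed.

(** The truncated path has size r however large U is: from norm 1 on the cutoff vanishes, and below
    1 the Lipschitz bound compares it with its value 0 at 0. *)
Lemma chiR_bound r U bU : 0 < r -> cb2 U bU -> cb2 (chiR ch r U) (`|L| * r).
Proof.
move=> r0 HU; rewrite /chiR; have HrU := cbound2Z r^-1 HU.
have -> : `|L| * r = `|r| * `|L| by rewrite (gtr0_norm r0) mulrC.
apply: cbound2Z.
have [le|/ltW gt] := leP 1%:E (cnorm2 g w (r^-1 *: U)%R).
  have E := cutoff_0 Hch (cbound2_controlled2 HrU) le.
  apply: (cbound2_ceq (ceq_sym E)); apply: cbound2_le (cbound20 w) => //.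
have := @chi_lip (r^-1 *: U) 0 _ 0 1 HrU (cbound20 w).
rewrite subr0 mulr1 => /(_ gt) H.
have E : ceq (ch (r^-1 *: U) - ch 0) (ch (r^-1 *: U) - 0).
  by apply: ceqB chi0 => t.
by have := cbound2_ceq E H; rewrite subr0.
Qed.

Lemma ceqZ c U V : ceq U V -> ceq (c *: U) (c *: V).
Proof.
move=> E t t01; have [e1 e2 e3 e4] := E t t01; split.
- by rewrite -[LHS]/(c * U.1.1 t) e1.
- by rewrite -[LHS]/(c *: U.1.2 t) e2.
- by rewrite -[LHS]/(c * U.2.1 t) e3.
- by rewrite -[LHS]/(c *: U.2.2 t) e4.
Qed.

(** The norm of U / r is at most 8 b / r, which 16 b <= r brings down to 1/2. *)
Lemma chiR_id r U b : 0 < r -> cb2 U b -> 16 * b <= r -> ceq (chiR ch r U) U.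
Proof.
move=> r0 HU br; have HrU := cbound2Z r^-1 HU.
have E : ceq (ch (r^-1 *: U)) (r^-1 *: U).
  apply: (cutoff_id Hch); first exact: cbound2_controlled2 HrU.
  apply: le_trans (cbound2_cnorm2 HrU) _; rewrite lee_fin normfV (gtr0_norm r0).
  by rewrite mulrCA ler_pdivrMl //; lra.
have := ceqZ r E; rewrite scalerA divff ?scale1r //; lra.
Qed.

Lemma chiR_0 r : ceq (chiR ch r 0) 0.
Proof. by rewrite /chiR scaler0; have := ceqZ r chi0; rewrite scaler0. Qed.

End Noise.

Definition ev2fun p : env -> R := fun a => ev2 p (a 0%N, a 1%N).

Lemma ev2fun_poly p : polyfun (ev2fun p).
Proof. by apply: polyfun_ev2; exact: polyfun_var. Qed.

Lemma dirder_ev2 p (F G F' G' : R) (a b : env) : a 0%N = F -> a 1%N = G ->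
  b 0%N = F' -> b 1%N = G' ->
  'D_(F', G') (ev2 p) (F, G) = dirder (ev2fun p) a b.
Proof.
move=> <- <- <- <-; rewrite /dirder derive1E /derive.
set f := (X in lim (X @ _)); set f' := (X in _ = lim (X @ _)).
suff -> : f = f' by [].
apply/funext => h; rewrite /f /f' /ev2fun /=.
rewrite !mul0r !addr0; congr (_ *: (ev2 p _ - _)).
by rewrite -[LHS]/(h * b 0%N + a 0%N, h * b 1%N + a 1%N) -[h *: 1]/(h * 1) mulr1;
  congr (_, _); rewrite addrC.
Qed.

Definition polycomp p (V : cpath2 R d) : cpath R d :=
  (fun t => ev2 p (V.1.1 t, V.2.1 t),
   fun t => \row_l 'D_(V.1.2 t 0 l, V.2.2 t 0 l) (ev2 p) (V.1.1 t, V.2.1 t)).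

Lemma icomp_GR ch r (G : 'I_d -> {poly {poly R}}) U j :
  icomp (GR ch r G U) j = polycomp (G j) (chiR ch r U).
Proof.
congr pair; apply/funext => t; first by rewrite mxE.
by apply/rowP => i; rewrite mxE [LHS]mxE [RHS]mxE.
Qed.

Definition flat2 p : Prop := ev2 p 0 = 0 /\ forall v, 'D_v (ev2 p) 0 = 0.

Lemma flat_second p : flat2 p ->
  pideal (fun v => (v < 2)%N) (pideal (fun v => (v < 2)%N) (@polyfun R)) (ev2fun p).
Proof.
move=> [p0 Dp]; set J := fun v => (v < 2)%N.
have Z a : ev2fun p (zero_on J a) = 0 by [].
have H1 : pideal J (@polyfun R) (ev2fun p).
  have := pideal_hadamard J (ev2fun_poly p).
  by apply: pideal_ext => a; rewrite Z subr0.
apply: pideal_second => // a.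
by rewrite -(@dirder_ev2 p 0 0 (a 0%N) (a 1%N)).
Qed.

(** Variables 2 and 3 carry the differences, so that p(V) - p(V') becomes a single polynomial in
    four paths. *)
Definition diff_env (V V' : cpath2 R d) : nat -> cpath R d := fun v =>
  if v is 0%N then V.1 else if v is 1%N then V.2 else
  if v is 2%N then V.1 - V'.1 else if v is 3%N then V.2 - V'.2 else 0.

(** In the variables of [diff_env] the difference vanishes with the variables 2 and 3 and has no
    linear part, so it lies in the product of their ideal with the ideal of all variables. One
    factor is a difference, the other has size r; this factor r is what makes the Lyapunov-Perron
    map contractive. *)
Lemma polycomp_lip p : flat2 p -> exists k : nat, forall B, exists2 c, 0 <= c &
  forall X N V V' r b, noise_on g X N -> cbound2 g (rp1 X) V r ->
    cbound2 g (rp1 X) V' r -> cbound2 g (rp1 X) (V - V') b -> r <= B ->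
    cbound g (rp1 X) (polycomp p V - polycomp p V') (c * N ^+ k * (r * b)).
Proof.
move=> Fp.
pose s (i : nat) : env -> R := if i is 0%N then fun a => a 0%N - a 2%N else
  if i is 1%N then fun a => a 1%N - a 3%N else fun=> 0.
have Ps i : polyfun (s i).
  by case: i => [|[|i]]; [apply: polyfun_sub; exact: polyfun_var..|exact: polyfun_cst].
pose E a := ev2fun p a - ev2fun p (fun i => s i a).
pose I : pred nat := fun v => (v == 2%N) || (v == 3%N).
have PE2 := polyfun_subst (ev2fun_poly p) Ps.
have PE : polyfun E by apply: polyfun_sub => //; exact: ev2fun_poly.
have HE1 : pideal I (@polyfun R) E.
  have := pideal_hadamard I PE; apply: pideal_ext => a.
  by rewrite {2}/E /ev2fun /s /zero_on /= !subr0 subrr subr0.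
have HE2 : pideal I (pideal xpredT (@polyfun R)) E.
  apply: pideal_second => // a; rewrite dirder_sub //; last exact: ev2fun_poly.
  have D0 (b : env) : dirder (ev2fun p) (zero_on xpredT a) b = 0.
    by rewrite -(@dirder_ev2 p 0 0 (b 0%N) (b 1%N)) //; exact: Fp.2.
  rewrite D0 sub0r; apply/eqP; rewrite oppr_eq0; apply/eqP.
  rewrite -[RHS](D0 (fun i => s i a)) /dirder; congr (derive1 _ 0).
  by apply/funext => h; rewrite /ev2fun /s /zero_on /restrict_on /=;
    congr (ev2 p (_, _)); ring.
pose adm (b : env) := forall v, (4 <= v)%N -> b v = 0.
have PB1 := @poly_bound_pideal R g d g_range adm xpredT (@polyfun R) (fun=> 1)
  (fun e : env => e 0%N + e 1%N + e 2%N + e 3%N) (@polyfun_module R).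
have {}PB1 := PB1 (fun (e : env) e_ge0 => addr_ge0 (addr_ge0 (addr_ge0 (e_ge0 _) (e_ge0 _)) (e_ge0 _)) (e_ge0 _)).
have {}PB1 : poly_bound g d adm (pideal xpredT (@polyfun R))
    (fun e : env => (e 0%N + e 1%N + e 2%N + e 3%N) * 1).
  apply: PB1 => [b v ab b0 _|//|]; last exact: poly_bound_polyfun.
  have := b0 0%N; have := b0 1%N; have := b0 2%N; have := b0 3%N.
  case: v => [|[|[|[|v]]]]; [lra..|by rewrite (ab v.+4) //; lra].
have PB2 := @poly_bound_pideal R g d g_range adm I (pideal xpredT (@polyfun R))
  (fun e : env => (e 0%N + e 1%N + e 2%N + e 3%N) * 1) (fun e : env => e 2%N + e 3%N)
  (pideal_module _ (@polyfun_module R)) (fun (e : env) e_ge0 => addr_ge0 (e_ge0 _) (e_ge0 _)).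
have {PB1}[] := PB2 _ _ PB1 E HE2.
- move=> b v ab b0 /orP[]/eqP->; have := b0 2%N; have := b0 3%N; lra.
- by move=> b b0; rewrite mulr1 !addr_ge0.
move=> k Hk; exists k => B; have [c c0 C] := Hk (2 * `|B|); exists (24 * c).
  by rewrite mulr_ge0.
move=> X N V V' r b HX HV HV' HVV rB.
have r0 : 0 <= r by case: HV => /cbound_ge0.
have N0 : 0 <= N by have := noise_ge1 HX; lra.
(* Both [b] and 2 r bound the difference. With the smaller one all four variables are at most 2 r,
   as the second factor requires. *)
pose b' := Num.min b (2 * r).
have HVV' : cbound2 g (rp1 X) (V - V') b'.
  rewrite /b'; case: (leP b (2 * r)) => // _.
  by rewrite mulr_natl mulr2n; exact: cbound2B.
have b'0 : 0 <= b' by case: HVV' => /cbound_ge0.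
have b'r : b' <= 2 * r by rewrite /b' ge_min lexx orbT.
have b'b : b' <= b by rewrite /b' ge_min lexx.
pose be : env := fun v => if v is 0%N then r else if v is 1%N then r else
  if v is 2%N then b' else if v is 3%N then b' else 0.
have rB' : r <= `|B| := le_trans rB (ler_norm B).
have := C X N (diff_env V V') be HX.
case.
- case: HV HVV' => H1 H2 [H3 H4] [|[|[|[|v]]]] //=; exact: cbound0.
- by case=> [|[|[|[|v]]]] /=; lra.
- by case=> [|[|[|[|v]]]].
move=> H1 H2 H3 H4.
have : cbound g (rp1 X) (pcomp E (diff_env V V'))
    (c * N ^+ k * ((be 2%N + be 3%N) * ((be 0%N + be 1%N + be 2%N + be 3%N) * 1))) by split.
move=> {H1 H2 H3 H4} /cbound_le H.
have le : c * N ^+ k * ((be 2%N + be 3%N) * ((be 0%N + be 1%N + be 2%N + be 3%N) * 1)) <=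
    24 * c * N ^+ k * (r * b).
  have -> : 24 * c * N ^+ k * (r * b) = c * N ^+ k * (24 * (r * b)) by ring.
  rewrite ler_wpM2l ?mulr_ge0 ?exprn_ge0 //= mulr1.
  by have := ler_wpM2l r0 b'b; nra.
apply: cbound_peq (H _ le) => t _ _; split; first by rewrite /E /ev2fun /s /= !subKr.
apply/rowP => l; rewrite -[RHS]/(((polycomp p V).2 t - (polycomp p V').2 t) 0 l) !mxE.
rewrite dirder_sub //; last exact: ev2fun_poly.
congr (_ - _).
  by rewrite (@dirder_ev2 p _ _ _ _ (fun v => (diff_env V V' v).1 t)
    (fun v => (diff_env V V' v).2 t 0 l)).
rewrite (@dirder_ev2 p _ _ _ _ (fun i => s i (fun v => (diff_env V V' v).1 t))
  (fun i => s i (fun v => (diff_env V V' v).2 t 0 l))) /s /=.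
- rewrite /dirder; congr (derive1 _ 0); apply/funext => h.
  by rewrite /ev2fun /=; congr (ev2 p (_, _)); ring.
- by rewrite subKr.
- by rewrite subKr.
- by rewrite !mxE subKr.
- by rewrite !mxE subKr.
Qed.

End Cutoff.

(** * Lipschitz dependence of the solution on one block *)

Section BlockEstimate.
Context (R : realType) (g : R) (d : nat).
Hypothesis g_range : 1 / 3 < g <= 1 / 2.
Implicit Types (b c r : R) (U V : cpath2 R d) (p : {poly {poly R}}).

Lemma expandsB (X : rough R d) (Y Y' : R -> R) B B' (Z Z' : integrand R d) :
  expands g X Y B Z -> expands g X Y' B' Z' ->
  expands g X (fun t => Y t - Y' t) (fun t => B t - B' t)
   (fun t => Z.1 t - Z'.1 t, fun t => Z.2 t - Z'.2 t).
Proof.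
move=> HY [c [H1 H2 H3 H4 H5]].
have N : expands g X (fun t => - Y' t) (fun t => - B' t)
    (fun t => - Z'.1 t, fun t => - Z'.2 t).
  exists c; split.
  - by move=> *; rewrite normrN H1.
  - by move=> *; rewrite normrN H2.
  - by move=> *; rewrite mxE normrN H3.
  - by move=> *; rewrite mxE normrN H4.
  - move=> s t s0 st t1; have := H5 s t s0 st t1.
    have -> : germ X (fun t => - B' t) (fun t => - Z'.1 t, fun t => - Z'.2 t) s t =
      - germ X B' Z' s t.
      by rewrite /germ /= -[- Z'.1 s]scaleN1r -[- Z'.2 s]scaleN1r dotrvZl mdotZl; ring.
    by rewrite -normrN; congr (`|_| <= _); ring.
exact: expandsD HY N.
Qed.

Lemma expands0 (X : rough R d) : expands g X (fun=> 0) (fun=> 0) (fun=> 0, fun=> 0).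
Proof.
apply: (@expands_smooth R g d g_range X _ _ 0) => *; rewrite ?normr0 //.
by rewrite subrr mul0r subr0 normr0 mul0r.
Qed.

Definition solves (X : rough R d) a (F : R -> R) (Z : integrand R d) (Y : cpath R d) :=
  expands g X Y.1 (fun t => a * Y.1 t + F t) Z /\
  forall t, 0 <= t -> t <= 1 -> Y.2 t = Z.1 t.

Definition isub (Z Z' : integrand R d) : integrand R d :=
  (fun t => Z.1 t - Z'.1 t, fun t => Z.2 t - Z'.2 t).

Lemma solvesB (X : rough R d) a (F F' : cpath R d) Z Z' Y Y' :
  solves X a F.1 Z Y -> solves X a F'.1 Z' Y' ->
  solves X a (F - F').1 (isub Z Z') (Y - Y').
Proof.
move=> [EY Y2] [EY' Y2']; split.
  apply: expands_ext (expandsB EY EY') => t _ _; split => //.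
  rewrite -[(Y - Y').1 t]/(Y.1 t - Y'.1 t) -[(F - F').1 t]/(F.1 t - F'.1 t).
  by ring.
by move=> t p0 p1; rewrite -[LHS]/(Y.2 t - Y'.2 t) Y2 // Y2'.
Qed.

Lemma icomp_isub (Z Z' : integrand R d) j : icomp (isub Z Z') j = icomp Z j - icomp Z' j.
Proof.
congr pair; apply/funext => t; first by rewrite /= !mxE.
by apply/rowP => i; rewrite /= !mxE.
Qed.

Lemma isub_cbound w (Z Z' : integrand R d) (P P' : 'I_d -> cpath R d) b :
  (forall j, icomp Z j = P j) -> (forall j, icomp Z' j = P' j) ->
  (forall j, cbound g w (P j - P' j) b) -> forall j, cbound g w (icomp (isub Z Z') j) b.
Proof. by move=> E E' H j; rewrite icomp_isub E E'. Qed.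

Context (a L : R) (p : {poly {poly R}}) (G : 'I_d -> {poly {poly R}}).
Hypothesis Fp : flat2 p.
Hypothesis FG : forall j, flat2 (G j).

Lemma polycomp_lip_unif : exists k : nat, forall B, exists2 c, 0 <= c &
  forall X N V V' r b, noise_on g X N -> cbound2 g (rp1 X) V r ->
    cbound2 g (rp1 X) V' r -> cbound2 g (rp1 X) (V - V') b -> r <= B ->
    cbound g (rp1 X) (polycomp p V - polycomp p V') (c * N ^+ k * (r * b)) /\
    forall j, cbound g (rp1 X) (polycomp (G j) V - polycomp (G j) V')
      (c * N ^+ k * (r * b)).
Proof.
have [k0 H0] := @polycomp_lip R g d g_range p Fp.
have /choice[k Hk] : forall j : 'I_d, exists k : nat, forall B, exists2 c, 0 <= c &
  forall X N V V' r b, noise_on g X N -> cbound2 g (rp1 X) V r ->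
    cbound2 g (rp1 X) V' r -> cbound2 g (rp1 X) (V - V') b -> r <= B ->
    cbound g (rp1 X) (polycomp (G j) V - polycomp (G j) V') (c * N ^+ k * (r * b)).
  by move=> j; exact: polycomp_lip.
exists (k0 + \sum_j k j)%N => B; have [c0 c00 C0] := H0 B.
have /choice[c Hc] : forall j : 'I_d, exists c : R, 0 <= c /\
  forall X N V V' r b, noise_on g X N -> cbound2 g (rp1 X) V r ->
    cbound2 g (rp1 X) V' r -> cbound2 g (rp1 X) (V - V') b -> r <= B ->
    cbound g (rp1 X) (polycomp (G j) V - polycomp (G j) V') (c * N ^+ k j * (r * b)).
  by move=> j; have [c p1 p2] := Hk j B; exists c.
exists (c0 + \sum_j c j).
  by rewrite addr_ge0 // sumr_ge0 // => j _; have [] := Hc j.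
move=> X N V V' r b HX HV HV' HVV rB.
have N1 := noise_ge1 HX; have N0 : 0 <= N by lra.
have r0 : 0 <= r by case: HV => /cbound_ge0.
have b0 : 0 <= b by case: HVV => /cbound_ge0.
have rb0 : 0 <= r * b by exact: mulr_ge0.
have sc0 : 0 <= \sum_j c j by apply: sumr_ge0 => j _; have [] := Hc j.
split.
  apply: cbound_le (C0 X N V V' r b HX HV HV' HVV rB).
  rewrite ler_wpM2r // ler_pM ?exprn_ge0 // ?lerDl //.
  by rewrite ler_weXn2l // leq_addr.
move=> j; have [cj0 Cj] := Hc j.
apply: cbound_le (Cj X N V V' r b HX HV HV' HVV rB).
rewrite ler_wpM2r // ler_pM ?exprn_ge0 //.
  rewrite (bigD1 j) //= addrCA lerDl addr_ge0 // sumr_ge0 // => i _.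
  by have [] := Hc i.
rewrite ler_weXn2l //; apply: leq_trans (leq_addl _ _).
by rewrite (bigD1 j) //= leq_addr.
Qed.

(** [k] and [C] do not depend on the noise: for r = kappa / N^p with k <= p the factor C N^k r is at
    most C kappa, hence as small as desired. *)
Definition block_spec (k : nat) (C : R) : Prop := 0 <= C /\
  forall X N ch r U V b bU bV (Y Y' : cpath R d) t0, noise_on g X N ->
    is_cutoff g L (rp1 X) ch -> 0 < r -> r <= 1 ->
    cbound2 g (rp1 X) U bU -> cbound2 g (rp1 X) V bV -> cbound2 g (rp1 X) (U - V) b ->
    solves X a (FR ch r p U) (GR ch r G U) Y ->
    solves X a (FR ch r p V) (GR ch r G V) Y' -> 0 <= t0 <= 1 ->
    cbound g (rp1 X) (Y - Y')
      (expconst a * `|Y.1 t0 - Y'.1 t0| + C * N ^+ k * r * b) /\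
    `|(Y.1 1 - Y'.1 1) - expR a * (Y.1 0 - Y'.1 0)| <= C * N ^+ k * r * b.

Lemma block_diff : exists k C, block_spec k C.
Proof.
have [k Hk] := polycomp_lip_unif; have [c c0 Hc] := Hk `|L|.
have q0 := rdeconst_ge0 d g_range a.
(* 6 comes from [rde_bound]; one factor [|L|] is the size of the truncated paths divided by r, and 8
   [|L|] is their Lipschitz constant. *)
exists (6 + k)%N, (rdeconst g d a * c * (8 * `|L| ^+ 2)); split.
  by apply: mulr_ge0; [exact: mulr_ge0|rewrite mulr_ge0 ?sqr_ge0].
move=> X N ch r U V b bU bV Y Y' t0 HX Hch r0 r1 HU HV HUV SY SY' t01.
have B1 := chiR_bound g_range HX Hch r0 HU; have B2 := chiR_bound g_range HX Hch r0 HV.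
have B3 := chiR_lip g_range HX Hch r0 HU HV HUV.
have [D1 D2] := Hc X N _ _ _ _ HX B1 B2 B3 (ler_piMr (normr_ge0 L) r1).
set bb := c * N ^+ k * _ in D1 D2.
have [EZ YZ2] := @solvesB X a (polycomp p (chiR ch r U)) (polycomp p (chiR ch r V))
  _ _ _ _ SY SY'.
have HZ := isub_cbound (icomp_GR ch r G U) (icomp_GR ch r G V) D2.
have [C1 C2] := rde_bound g_range HX EZ YZ2 D1 HZ t01.
have E : rdeconst g d a * N ^+ 6 * bb =
    rdeconst g d a * c * (8 * `|L| ^+ 2) * N ^+ (6 + k) * r * b.
  by rewrite /bb exprD; ring.
by rewrite E in C1 C2.
Qed.

Lemma solves_zero_of_ceq X V (Z : integrand R d) : ceq V 0 ->
  (forall j, icomp Z j = polycomp (G j) V) -> solves X a (polycomp p V).1 Z 0.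
Proof.
move=> E HZ.
have E' t : 0 <= t -> t <= 1 ->
    [/\ V.1.1 t = 0, V.2.1 t = 0, V.1.2 t = 0 & V.2.2 t = 0].
  by move=> t0 t1; case: (E t) => [|? ? ? ?]; [rewrite t0|split].
have Z1 t : 0 <= t -> t <= 1 -> Z.1 t = 0.
  move=> t0 t1; have [e1 e2 _ _] := E' t t0 t1; apply/rowP => j.
  have := congr1 (fun Y : cpath R d => Y.1 t) (HZ j); rewrite /= => ->.
  by rewrite e1 e2 mxE; case: (FG j).
have Z2 t : 0 <= t -> t <= 1 -> Z.2 t = 0.
  move=> t0 t1; have [e1 e2 e3 e4] := E' t t0 t1; apply/matrixP => i j.
  have := congr1 (fun Y : cpath R d => Y.2 t 0 i) (HZ j).
  rewrite /icomp /polycomp [LHS]mxE [RHS]mxE => ->.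
  by rewrite e1 e2 e3 e4 !mxE; case: (FG j) => _ ->.
split; last by move=> t t0 t1; rewrite Z1.
apply: expands_ext (@expands0 X) => t t0 t1.
have [e1 e2 _ _] := E' t t0 t1; split; rewrite ?Z1 ?Z2 //.
rewrite mulr0 add0r -[RHS]/(ev2 p (V.1.1 t, V.2.1 t)) e1 e2.
by case: Fp.
Qed.

Lemma solves_zero X N ch r : noise_on g X N -> is_cutoff g L (rp1 X) ch ->
  solves X a (FR ch r p 0) (GR ch r G 0) 0.
Proof.
move=> HX Hch; apply: solves_zero_of_ceq (chiR_0 g_range HX Hch r) _ => j.
exact: icomp_GR.
Qed.

(** Ensures that the rough integrals over the block exist; smallness is supplied by [block_spec]. *)
Lemma block_bounded X N ch r U bU : noise_on g X N -> is_cutoff g L (rp1 X) ch ->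
  0 < r -> r <= 1 -> cbound2 g (rp1 X) U bU ->
  exists b, cbound g (rp1 X) (polycomp p (chiR ch r U)) b /\
   forall j, cbound g (rp1 X) (icomp (GR ch r G U) j) b.
Proof.
move=> HX Hch r0 r1 HU.
have [k Hk] := polycomp_lip_unif; have [c c0 Hc] := Hk `|L|.
have B1 := chiR_bound g_range HX Hch r0 HU.
have B0 : cbound2 g (rp1 X) (0 : cpath2 R d) (`|L| * r).
  by apply: cbound2_le (cbound20 _ _); rewrite mulr_ge0 // ltW.
have B3 := cbound2B B1 B0.
have [D1 D2] := Hc X N _ _ _ _ HX B1 B0 B3 (ler_piMr (normr_ge0 L) r1).
set bb := c * N ^+ k * _ in D1 D2.
have Z (q : {poly {poly R}}) : flat2 q -> peq (polycomp q (0 : cpath2 R d)) 0.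
  move=> [q0 q1] t t0 t1; split => //.
  by apply/rowP => i; rewrite !mxE q1.
have S (q : {poly {poly R}}) : flat2 q ->
    cbound g (rp1 X) (polycomp q (chiR ch r U) - polycomp q 0) bb ->
    cbound g (rp1 X) (polycomp q (chiR ch r U)) bb.
  move=> Fq; apply: cbound_peq => t t0 t1; have [e1 e2] := Z q Fq t t0 t1.
  split.
    by rewrite -[LHS]/((polycomp q (chiR ch r U)).1 t - (polycomp q 0).1 t) e1 subr0.
  by rewrite -[LHS]/((polycomp q (chiR ch r U)).2 t - (polycomp q 0).2 t) e2 subr0.
exists bb; split; first exact: S.
by move=> j; rewrite (icomp_GR ch r G U j); exact: (S _ (FG j) (D2 j)).
Qed.

End BlockEstimate.

(** * The Lyapunov-Perron map *)

Section GeometricSums.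
Context (R : realType).
Implicit Types (u : nat -> R) (c q h : R).

Lemma geometric_shift_le u c q n M : 0 <= c -> 0 <= q -> q < 1 ->
  (forall i, `|u (n + i)%N| <= c * q ^+ i) -> `|\sum_(n <= l < M) u l| <= c / (1 - q).
Proof.
move=> c0 q0 q1 Hu.
have S K : `|\sum_(0 <= i < K) u (n + i)%N| <= c / (1 - q) * (1 - q ^+ K).
  elim: K => [|K IH]; first by rewrite big_geq // normr0 expr0 subrr mulr0.
  rewrite big_nat_recr //=; apply: le_trans (ler_normD _ _) _.
  apply: le_trans (lerD IH (Hu K)) _.
  by rewrite exprS le_eqVlt; apply/orP; left; apply/eqP; field; lra.
have B : 0 <= c / (1 - q) by rewrite divr_ge0 //; lra.
have [Mn|nM] := leqP M n; first by rewrite big_geq // normr0.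
rewrite -(add0n n) -(subnK (ltnW nM)) big_addn addnK.
under eq_bigr do rewrite addnC.
by apply: le_trans (S _) _; rewrite ler_piMr // lerBlDr lerDl exprn_ge0.
Qed.

Lemma geometric_cvg u c q n : 0 <= c -> 0 <= q -> q < 1 ->
  (forall l, `|u l| <= c * q ^+ l) -> cvgn (fun M => \sum_(n <= l < M) u l).
Proof.
move=> c0 q0 q1 Hu; rewrite (is_cvg_series_restrict n u).
apply: normed_cvg; apply: (@series_le_cvg _ _ (geometric c q)) => //=.
  by move=> l; rewrite mulr_ge0 // exprn_ge0.
by apply: is_cvg_geometric_series; rewrite ger0_norm.
Qed.

Lemma lim_norm_le u c : cvgn u -> (forall n, `|u n| <= c) -> `|limn u| <= c.
Proof.
move=> cu Hu; rewrite ler_norml; apply/andP; split.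
  by apply: limr_ge => //; apply: nearW => n; have := Hu n; rewrite ler_norml => /andP[].
by apply: limr_le => //; apply: nearW => n; have := Hu n; rewrite ler_norml => /andP[].
Qed.

Lemma lim_diff_le (u v : nat -> R) c : cvgn u -> cvgn v ->
  (forall n, `|u n - v n| <= c) -> `|limn u - limn v| <= c.
Proof.
move=> cu cv H; rewrite -limB //; apply: lim_norm_le; first exact: is_cvgB.
exact: H.
Qed.

Lemma lim_mull (u : nat -> R) c : cvgn u -> limn (fun n => c * u n) = c * limn u.
Proof. by move=> cu; apply/cvg_lim => //; exact: (cvgM (cvg_cst c) cu). Qed.

(** The weights grow geometrically, so their sum is comparable to the next weight. This controls the
    centre sum, whose terms do not decay. *)
Lemma exp_sum_le h n : 0 < h ->
  \sum_(0 <= l < n) expR (h * l.+1%:R) <= expR (h * n.+1%:R) / (expR h - 1).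
Proof.
move=> h0; have e1 : 1 < expR h by rewrite expR_gt1.
rewrite ler_pdivlMr; last lra.
elim: n => [|n IH]; first by rewrite big_geq // mul0r expR_ge0.
rewrite big_nat_recr //= mulrDl.
have -> : expR (h * n.+2%:R) = expR (h * n.+1%:R) * expR h.
  by rewrite -expRD -[n.+2%:R]natr1; congr expR; ring.
by move: IH; lra.
Qed.

End GeometricSums.

Section LyapunovPerron.
Context (R : realType) (g : R) (d : nat).
Hypothesis g_range : 1 / 3 < g <= 1 / 2.
Context (S : system R d) (L : R)
  (chi : (R -> 'rV[R]_d) -> cpath2 R d -> cpath2 R d) (X : rough R d)
  (rad Nn : nat -> R).
Local Notation wn n := (rp1 (block_noise X n)).
Local Notation cn n := (chi (wn n)).
Hypothesis HN : forall n, noise_on g (block_noise X n) (Nn n).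
Hypothesis Hchi : forall n, is_cutoff g L (wn n) (cn n).
Hypothesis rad01 : forall n, 0 < rad n <= 1.

Section Component.
Context (a : R) (p : {poly {poly R}}) (G : 'I_d -> {poly {poly R}}).
Hypothesis Fp : flat2 p.
Hypothesis FG : forall j, flat2 (G j).
Context (k : nat) (C e : R).
Hypothesis HC : block_spec g a L p G k C.
Hypothesis small : forall n, C * Nn n ^+ k * rad n <= e.

Local Notation bsolves n U Y := (solves g (block_noise X n) a
  (FR (cn n) (rad n) p U) (GR (cn n) (rad n) G U) Y).

Lemma block_conv_solves n U b : cbound2 g (wn n) U b -> exists J : R -> R -> R,
  [/\ additive_on J, forall s t u, 0 <= s -> s <= t -> t <= 1 ->
        block_conv chi X rad a p G n U s t u = expR (a * u) * J s t
    & forall c (Y : cpath R d),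
        (forall t, 0 <= t -> t <= 1 -> Y.1 t = expR (a * t) * (c + J 0 t)) ->
        (forall t, 0 <= t -> t <= 1 -> Y.2 t = (GR (cn n) (rad n) G U).1 t) ->
        bsolves n U Y].
Proof.
move=> HU; have /andP[r0 r1] := rad01 n.
have [bb [B1 B2]] := block_bounded g_range Fp FG (HN n) (Hchi n) r0 r1 HU.
have [J [Ja Jc Je]] := conv_expands g_range (HN n) a B1 B2.
exists J; split => //.
by move=> c Y Y1 Y2; split=> //; exact: Je Y1.
Qed.

(** The convolution over a whole block is the final value of the solution that starts at 0, so the
    endpoint estimate of [block_spec] applies with zero initial values. *)
Lemma block_conv_diff n U V bU bV b : cbound2 g (wn n) U bU -> cbound2 g (wn n) V bV ->
  cbound2 g (wn n) (U - V) b ->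
  `|block_conv chi X rad a p G n U 0 1 1 - block_conv chi X rad a p G n V 0 1 1| <= e * b.
Proof.
move=> HU HV HUV; have /andP[r0 r1] := rad01 n.
have b0 : 0 <= b by case: HUV => /cbound_ge0.
have [J [Ja Jc Js]] := block_conv_solves HU.
have [J' [Ja' Jc' Js']] := block_conv_solves HV.
pose Y : cpath R d := (fun t => expR (a * t) * (0 + J 0 t), (GR (cn n) (rad n) G U).1).
pose Y' : cpath R d := (fun t => expR (a * t) * (0 + J' 0 t), (GR (cn n) (rad n) G V).1).
have SY := Js 0 Y (fun _ _ _ => erefl) (fun _ _ _ => erefl).
have SY' := Js' 0 Y' (fun _ _ _ => erefl) (fun _ _ _ => erefl).
have t01 : 0 <= (0 : R) <= 1 by rewrite lexx ler01.
have [_] := HC.2 _ _ _ _ _ _ _ _ _ Y Y' 0 (HN n) (Hchi n) r0 r1 HU HV HUV SY SY' t01.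
have J0 I : additive_on I -> I 0 0 = 0 :> R.
  by move=> Ia; have := Ia 0 0 0 (lexx _) (lexx _) (lexx _) ler01; lra.
rewrite /Y /Y' /= (J0 J) // (J0 J') // !add0r !mulr0 subrr mulr0 subr0 mulr1.
have := Jc 0 1 1 (lexx 0) ler01 (lexx 1); rewrite mulr1 => ->.
have := Jc' 0 1 1 (lexx 0) ler01 (lexx 1); rewrite mulr1 => ->.
by move=> H; apply: le_trans H _; rewrite ler_wpM2r.
Qed.

Lemma block_conv0 n : block_conv chi X rad a p G n 0 0 1 1 = 0.
Proof.
have /andP[r0 r1] := rad01 n.
have H0 : cbound2 g (wn n) (0 : cpath2 R d) 0 by exact: cbound20.
have [J [Ja Jc Js]] := block_conv_solves H0.
pose Y : cpath R d := (fun t => expR (a * t) * (0 + J 0 t), (GR (cn n) (rad n) G 0).1).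
have SY := Js 0 Y (fun _ _ _ => erefl) (fun _ _ _ => erefl).
have t01 : 0 <= (0 : R) <= 1 by rewrite lexx ler01.
have S0 := solves_zero g_range a Fp FG (rad n) (HN n) (Hchi n).
have HD : cbound2 g (wn n) ((0 : cpath2 R d) - 0) 0 by rewrite subr0.
have [_] := HC.2 _ _ _ _ _ _ _ _ _ Y 0 0 (HN n) (Hchi n) r0 r1 H0 H0 HD SY S0 t01.
have J0 : J 0 0 = 0.
  by have := Ja 0 0 0 (lexx _) (lexx _) (lexx _) ler01; lra.
rewrite /Y /= J0 !add0r !mulr0 !subr0 mulr0 subr0 mulr1 normr_le0 => /eqP H.
by have := Jc 0 1 1 (lexx 0) ler01 (lexx 1); rewrite mulr1 H.
Qed.

Lemma block_conv_bound n U b : cbound2 g (wn n) U b ->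
  `|block_conv chi X rad a p G n U 0 1 1| <= e * b.
Proof.
move=> HU; have H0 : cbound2 g (wn n) (0 : cpath2 R d) 0 by exact: cbound20.
have := @block_conv_diff n U 0 b 0 b HU H0; rewrite subr0 block_conv0 subr0.
exact.
Qed.

Lemma bsolves_diff n U V bU bV b Y Y' t0 : cbound2 g (wn n) U bU ->
  cbound2 g (wn n) V bV -> cbound2 g (wn n) (U - V) b -> bsolves n U Y ->
  bsolves n V Y' -> 0 <= t0 <= 1 ->
  cbound g (wn n) (Y - Y') (expconst a * `|Y.1 t0 - Y'.1 t0| + e * b).
Proof.
move=> HU HV HUV SY SY' t01; have /andP[r0 r1] := rad01 n.
have b0 : 0 <= b by case: HUV => /cbound_ge0.
have [H _] := HC.2 _ _ _ _ _ _ _ _ _ Y Y' t0 (HN n) (Hchi n) r0 r1 HU HV HUV SY SY' t01.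
by apply: cbound_le H; rewrite lerD2l ler_wpM2r.
Qed.

End Component.

Context (kc ks : nat) (Cc Cs e h : R).
Hypothesis Ac0 : sAc S = 0.
Hypothesis h_gt0 : 0 < h.
Hypothesis ah : sAs S + h < 0.
Hypotheses (fFc : flat2 (sFc S)) (fFs : flat2 (sFs S)).
Hypotheses (fGc : forall j, flat2 (sGc S j)) (fGs : forall j, flat2 (sGs S j)).
Hypothesis HCc : block_spec g (sAc S) L (sFc S) (sGc S) kc Cc.
Hypothesis HCs : block_spec g (sAs S) L (sFs S) (sGs S) ks Cs.
Hypothesis smallc : forall n, Cc * Nn n ^+ kc * rad n <= e.
Hypothesis smalls : forall n, Cs * Nn n ^+ ks * rad n <= e.
Hypothesis e_ge0 : 0 <= e.

Local Notation LP := (LPmap chi S X rad).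
Local Notation Bc := (block_conv chi X rad (sAc S) (sFc S) (sGc S)).
Local Notation Bs := (block_conv chi X rad (sAs S) (sFs S) (sGs S)).
Local Notation a := (sAs S).

(** The weight on block n. It is used with a small h for the size of the fixed point, and with h = -
    eta for uniqueness. *)
Definition growth n : R := expR (h * n.+1%:R).

Definition bc_bound (U : nat -> cpath2 R d) (b : R) :=
  forall n, cbound2 g (wn n) (U n) (b * growth n).

Lemma growth_ge1 n : 1 <= growth n.
Proof. by rewrite /growth -expR0 ler_expR mulr_ge0 // ltW. Qed.

Definition stable_term (U : nat -> cpath2 R d) n l : R :=
  expR (a * (block_start R n + l%:R)) * Bs l (U l) 0 1 1.

(** From block to block the stable decay beats the growth of the weight by the ratio e^{a + h},
    which is below 1. *)
Lemma stable_weight n i : expR (a * (block_start R n + (n.+1 + i)%:R)) *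
  growth (n.+1 + i) = expR h * growth n * expR (a + h) ^+ i.
Proof.
rewrite /growth /block_start -expRM_natr -!expRD; congr expR.
rewrite -[((n.+1 + i).+1)%:R]natr1 !natrD; ring.
Qed.

Lemma ah_range : 0 <= expR (a + h) /\ expR (a + h) < 1.
Proof. by rewrite expR_ge0 expR_lt1. Qed.

Lemma stable_cvg U b n : bc_bound U b -> cvgn (fun M => \sum_(n.+1 <= l < M) stable_term U n l).
Proof.
move=> HU; have [q0 q1] := ah_range.
have b0 : 0 <= b.
  by have [/cbound_ge0] := HU 0%N; rewrite pmulr_lge0 // (lt_le_trans ltr01) // growth_ge1.
apply: (@geometric_cvg _ _ (expR (a * block_start R n) * (e * b * expR h)) (expR (a + h))) => //.
  by rewrite !mulr_ge0 ?expR_ge0.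
move=> l; rewrite /stable_term normrM ger0_norm ?expR_ge0 //.
have H := block_conv_bound fFs fGs HCs smalls (HU l).
apply: le_trans (ler_wpM2l (expR_ge0 _) H) _.
have E : expR (a * (block_start R n + l%:R)) * growth l =
    expR (a * block_start R n) * expR h * expR (a + h) ^+ l.
  by rewrite /growth -expRM_natr -!expRD; congr expR; rewrite -[l.+1%:R]natr1; ring.
have -> : expR (a * (block_start R n + l%:R)) * (e * (b * growth l)) =
    e * b * (expR (a * (block_start R n + l%:R)) * growth l) by ring.
by rewrite E le_eqVlt; apply/orP; left; apply/eqP; ring.
Qed.

Lemma stable_diff U V bU bV b n : bc_bound U bU -> bc_bound V bV ->
  bc_bound (fun l => U l - V l) b ->
  `|limn (fun M => \sum_(n.+1 <= l < M) stable_term U n l) -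
    limn (fun M => \sum_(n.+1 <= l < M) stable_term V n l)| <=
  e * b * expR h / (1 - expR (a + h)) * growth n.
Proof.
move=> HU HV HUV; have [q0 q1] := ah_range.
have b0 : 0 <= b.
  by have [/cbound_ge0] := HUV 0%N; rewrite pmulr_lge0 // (lt_le_trans ltr01) // growth_ge1.
have gn0 : 0 <= growth n by apply: le_trans (growth_ge1 n).
have cU := @stable_cvg _ _ n HU; have cV := @stable_cvg _ _ n HV.
apply: (lim_diff_le cU cV) => M; rewrite -sumrB.
have -> : e * b * expR h / (1 - expR (a + h)) * growth n =
  e * b * (expR h * growth n) / (1 - expR (a + h)) by ring.
apply: geometric_shift_le => //; first by rewrite !mulr_ge0 ?expR_ge0.
move=> i; rewrite /stable_term -mulrBr normrM ger0_norm ?expR_ge0 //.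
set l := (n.+1 + i)%N.
have H := block_conv_diff fFs fGs HCs smalls (HU l) (HV l) (HUV l).
apply: le_trans (ler_wpM2l (expR_ge0 _) H) _.
have := stable_weight n i; rewrite -/l; move: (expR (a * _)) (growth l) => x y W.
have -> : x * (e * (b * y)) = e * b * (x * y) by ring.
by rewrite W le_eqVlt; apply/orP; left; apply/eqP; ring.
Qed.

(** e^{a t} comes out of the series, whose sum becomes the initial value of the stable component on
    the block; the rest is variation of constants. *)
Lemma LP_stable xi U b n : bc_bound U b ->
  solves g (block_noise X n) a (FR (cn n) (rad n) (sFs S) (U n))
    (GR (cn n) (rad n) (sGs S) (U n)) (LP xi U n).2 /\
  (LP xi U n).2.1 0 = limn (fun M => \sum_(n.+1 <= l < M) stable_term U n l) /\
  (LP xi U n).2.1 1 = expR a * limn (fun M => \sum_(n.+1 <= l < M) stable_term U n l) +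
    Bs n (U n) 0 1 1.
Proof.
move=> HU; have [J [Ja Jc Js]] := block_conv_solves a fFs fGs (HU n).
set l0 := limn _.
have E t : 0 <= t -> t <= 1 -> (LP xi U n).2.1 t = expR (a * t) * (l0 + J 0 t).
  move=> t0 t1; rewrite /LPmap /= Jc // mulrDr; congr +%R.
  rewrite /l0 -(lim_mull _ (stable_cvg HU)).
  rewrite (_ : (fun N => \sum_(n.+1 <= l < N) _) =
    (fun M => expR (a * t) * \sum_(n.+1 <= l < M) stable_term U n l)) //.
  apply/funext => M; rewrite mulr_sumr; apply: eq_bigr => l _; rewrite /stable_term mulrA -expRD.
  by congr (expR _ * _); ring.
split; first exact: (Js l0).
split; last by rewrite E // Jc // mulr1 mulrDr.
rewrite E // mulr0 expR0 mul1r.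
by have := Ja 0 0 0 (lexx _) (lexx _) (lexx _) ler01; lra.
Qed.

(** All centre exponentials are 1, and additivity of [J] rewrites the integral from t to 1 as an
    integral from 0 with another constant, the form that [block_conv_solves] recognizes. *)
Lemma LP_center xi U b n : bc_bound U b ->
  solves g (block_noise X n) (sAc S) (FR (cn n) (rad n) (sFc S) (U n))
    (GR (cn n) (rad n) (sGc S) (U n)) (LP xi U n).1 /\
  (LP xi U n).1.1 1 = xi - \sum_(0 <= l < n) Bc l (U l) 0 1 1 /\
  (LP xi U n).1.1 0 = xi - \sum_(0 <= l < n.+1) Bc l (U l) 0 1 1.
Proof.
move=> HU; have [J [Ja Jc Js]] := block_conv_solves (sAc S) fFc fGc (HU n).
have e0 x : expR (sAc S * x) = 1 by rewrite Ac0 mul0r expR0.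
have E t : 0 <= t -> t <= 1 -> (LP xi U n).1.1 t = expR (sAc S * t) *
    (xi - \sum_(0 <= l < n) Bc l (U l) 0 1 1 - J 0 1 + J 0 t).
  move=> t0 t1; rewrite /LPmap /= Jc // !e0 !mul1r.
  under eq_bigr do rewrite e0 mul1r.
  by rewrite (Ja 0 t 1) //; ring.
split; first exact: (Js _ _ E).
split; first by rewrite E // e0 mul1r subrK.
rewrite E // e0 mul1r big_nat_recr //= Jc // e0 mul1r.
by have := Ja 0 0 0 (lexx _) (lexx _) (lexx _) ler01; lra.
Qed.

Lemma center_diff U V bU bV b n : bc_bound U bU -> bc_bound V bV ->
  bc_bound (fun l => U l - V l) b ->
  `|\sum_(0 <= l < n) Bc l (U l) 0 1 1 - \sum_(0 <= l < n) Bc l (V l) 0 1 1| <=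
  e * b / (expR h - 1) * growth n.
Proof.
move=> HU HV HUV.
have b0 : 0 <= b.
  by have [/cbound_ge0] := HUV 0%N; rewrite pmulr_lge0 // (lt_le_trans ltr01) // growth_ge1.
rewrite -sumrB; apply: le_trans (ler_norm_sum _ _ _) _.
apply: (@le_trans _ _ (\sum_(0 <= l < n) (e * b) * growth l)).
  apply: ler_sum => l _; rewrite -mulrA.
  exact: (block_conv_diff fFc fGc HCc smallc (HU l) (HV l) (HUV l)).
have -> : e * b / (expR h - 1) * growth n = e * b * (growth n / (expR h - 1)) by ring.
by rewrite -mulr_sumr ler_wpM2l ?mulr_ge0 //; exact: exp_sum_le.
Qed.

(** 1 stands for the block itself, the second term for the centre sum over later blocks, the third
    for the stable series over earlier blocks. *)
Definition contraction_const : R :=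
  1 + (expR h - 1)^-1 + expconst a * (expR h / (1 - expR (a + h))).

Lemma center_arith (ec x x' xi xi' s1 s2 b G y z : R) : ec = 1 -> x = xi - s1 ->
  x' = xi' - s2 -> `|s1 - s2| <= e * b * z * G -> 0 <= y -> 0 <= e * b * G -> 1 <= G ->
  ec * `|x - x'| + e * (b * G) <= (`|xi - xi'| + e * (1 + z + y) * b) * G.
Proof.
move=> -> -> -> H y0 eb0 G1; rewrite mul1r.
have -> : xi - s1 - (xi' - s2) = (xi - xi') - (s1 - s2) by ring.
apply: le_trans (lerD (ler_normB _ _) (lexx _)) _.
have e1 : `|xi - xi'| <= `|xi - xi'| * G by rewrite ler_peMr.
have := mulr_ge0 y0 eb0; lra.
Qed.

Lemma stable_arith (ea x x' xi xi' s1 s2 b G eh y z : R) : 1 <= ea -> x = s1 ->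
  x' = s2 -> `|s1 - s2| <= e * b * eh * y * G -> 0 <= z -> 0 <= e * b * G ->
  0 <= `|xi - xi'| * G ->
  ea * `|x - x'| + e * (b * G) <= (`|xi - xi'| + e * (1 + z + ea * (eh * y)) * b) * G.
Proof.
move=> ea1 -> -> H z0 eb0 X0.
have := ler_wpM2l (le_trans ler01 ea1) H; have := mulr_ge0 z0 eb0; lra.
Qed.

Lemma LP_diff xi xi' U V bU bV b : bc_bound U bU -> bc_bound V bV ->
  bc_bound (fun l => U l - V l) b ->
  bc_bound (fun n => LP xi U n - LP xi' V n) (`|xi - xi'| + e * contraction_const * b).
Proof.
move=> HU HV HUV n.
have b0 : 0 <= b.
  by have [/cbound_ge0] := HUV 0%N; rewrite pmulr_lge0 // (lt_le_trans ltr01) // growth_ge1.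
have [q0 q1] := ah_range.
have eh : 1 < expR h by rewrite expR_gt1.
have gn1 := growth_ge1 n; have gn0 : 0 <= growth n by lra.
have k1 : 0 <= (expR h - 1)^-1 by rewrite invr_ge0; lra.
have k2 : 0 <= expconst a * (expR h / (1 - expR (a + h))).
  rewrite mulr_ge0 ?divr_ge0 ?expR_ge0 //; last lra.
  by apply: le_trans (expconst_ge1 a).
have eb0 : 0 <= e * b * growth n by rewrite !mulr_ge0.
have X0 : 0 <= `|xi - xi'| * growth n by rewrite mulr_ge0.
have [Sc [Ec _]] := @LP_center xi _ _ n HU; have [Sc' [Ec' _]] := @LP_center xi' _ _ n HV.
have [Ss [Es _]] := @LP_stable xi _ _ n HU; have [Ss' [Es' _]] := @LP_stable xi' _ _ n HV.
have t0 : 0 <= (0 : R) <= 1 by rewrite lexx ler01.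
have t1 : 0 <= (1 : R) <= 1 by rewrite lexx ler01.
(* The reference time is 1 for the centre and 0 for the stable component: there their values are the
   finite sum and the series. *)
have Dc := bsolves_diff HCc smallc (HU n) (HV n) (HUV n) Sc Sc' t1.
have Ds := bsolves_diff HCs smalls (HU n) (HV n) (HUV n) Ss Ss' t0.
have ec1 : expconst (sAc S) = 1 by rewrite Ac0 /expconst normr0 expR0 addr0 mul1r.
split; [apply: cbound_le _ Dc|apply: cbound_le _ Ds].
  exact: center_arith ec1 Ec Ec' (@center_diff _ _ _ _ _ n HU HV HUV) k2 eb0 gn1.
exact: stable_arith (expconst_ge1 a) Es Es' (@stable_diff _ _ _ _ _ n HU HV HUV) k1 eb0 X0.
Qed.

Lemma zero_arith (ec x z xi G : R) : ec = 1 -> x = xi - 0 -> z = 0 -> 1 <= G ->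
  ec * `|x - z| + e * (0 * G) <= `|xi| * G.
Proof. by move=> -> -> -> G1; rewrite mul0r mulr0 addr0 !subr0 mul1r ler_peMr. Qed.

Lemma zero_arith_stable (ec x z xi G : R) : x = 0 -> z = 0 -> 1 <= G ->
  ec * `|x - z| + e * (0 * G) <= `|xi| * G.
Proof.
move=> -> -> G1; rewrite mul0r mulr0 addr0 !subr0 normr0 mulr0 mulr_ge0 //; lra.
Qed.

Lemma LP_zero xi : bc_bound (LP xi (fun=> 0)) `|xi|.
Proof.
have H0 : bc_bound (fun=> 0) 0 by move=> n; rewrite mul0r; exact: cbound20.
have HD : bc_bound (fun l => (0 : cpath2 R d) - 0) 0 by move=> n; rewrite subr0.
move=> n; have gn1 := growth_ge1 n.
have [Sc [Ec _]] := @LP_center xi _ _ n H0; have [Ss [Es _]] := @LP_stable xi _ _ n H0.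
have t0 : 0 <= (0 : R) <= 1 by rewrite lexx ler01.
have t1 : 0 <= (1 : R) <= 1 by rewrite lexx ler01.
have Zc := solves_zero g_range (sAc S) fFc fGc (rad n) (HN n) (Hchi n).
have Zs := solves_zero g_range a fFs fGs (rad n) (HN n) (Hchi n).
have Hc := bsolves_diff HCc smallc (H0 n) (H0 n) (HD n) Sc Zc t1.
have Hs := bsolves_diff HCs smalls (H0 n) (H0 n) (HD n) Ss Zs t0.
have ec1 : expconst (sAc S) = 1 by rewrite Ac0 /expconst normr0 expR0 addr0 mul1r.
have s0 : \sum_(0 <= l < n) Bc l 0 0 1 1 = 0.
  by apply: big1 => l _; exact: (block_conv0 fFc fGc HCc).
have l0 : limn (fun M => \sum_(n.+1 <= l < M) stable_term (fun=> 0) n l) = 0.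
  rewrite (_ : (fun M => _) = fun=> 0) ?lim_cst //.
  apply/funext => M; apply: big1 => l _.
  by rewrite /stable_term (block_conv0 fFs fGs HCs) mulr0.
rewrite s0 in Ec; rewrite l0 in Es.
rewrite (subr0 (LP xi (fun=> 0) n).1) in Hc; rewrite (subr0 (LP xi (fun=> 0) n).2) in Hs.
split; [apply: cbound_le _ Hc|apply: cbound_le _ Hs].
  exact: zero_arith ec1 Ec erefl gn1.
exact: zero_arith_stable Es erefl gn1.
Qed.

(** Passing from block n + 1 to block n multiplies the stable series by e^a and adds the integral
    over block n + 1 as its first term; the centre sum likewise gains one term. *)
Lemma LP_match xi U b n : bc_bound U b ->
  (LP xi U n).1.1 0 = (LP xi U n.+1).1.1 1 /\ (LP xi U n).2.1 0 = (LP xi U n.+1).2.1 1.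
Proof.
move=> HU; split.
  have [_ [_ e1]] := @LP_center xi _ _ n HU.
  have [_ [e2 _]] := @LP_center xi _ _ n.+1 HU.
  exact: etrans e1 (esym e2).
have [_ [e1 _]] := @LP_stable xi _ _ n HU.
have [_ [_ e2]] := @LP_stable xi _ _ n.+1 HU.
apply: (etrans e1); apply: esym; apply: (etrans e2).
have cT := stable_cvg (n := n.+1) HU.
have st l : stable_term U n l = expR a * stable_term U n.+1 l.
  rewrite /stable_term mulrA -expRD; congr (expR _ * _).
  by rewrite /block_start -[n.+2%:R]natr1; ring.
have E : Bs n.+1 (U n.+1) 0 1 1 = stable_term U n n.+1.
  by rewrite /stable_term /block_start addNr mulr0 expR0 mul1r.
rewrite E addrC; apply: esym; apply/cvg_lim => //.
have cD : (fun M => stable_term U n n.+1 +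
      expR a * \sum_(n.+2 <= l < M) stable_term U n.+1 l) @ \oo -->
    stable_term U n n.+1 + expR a * limn (fun M => \sum_(n.+2 <= l < M) stable_term U n.+1 l).
  by apply: cvgD; [exact: cvg_cst|apply: cvgM => //; exact: cvg_cst].
apply: cvg_trans cD; apply: near_eq_cvg; exists n.+2 => // M /= nM.
rewrite [RHS]big_ltn // mulr_sumr; congr (_ + _); apply: eq_bigr => l _.
by rewrite st.
Qed.

End LyapunovPerron.

(** * Completeness of the controlled paths *)

Section Completeness.
Context (R : realType) (g : R) (d : nat).
Implicit Types (w : R -> 'rV[R]_d) (b c q : R).

Lemma cbound_lim w (Yn : nat -> cpath R d) (Y : cpath R d) b :
  (forall t, 0 <= t -> t <= 1 -> (fun m => (Yn m).1 t) @ \oo --> Y.1 t) ->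
  (forall t i, 0 <= t -> t <= 1 -> (fun m => (Yn m).2 t 0 i) @ \oo --> Y.2 t 0 i) ->
  (forall m, cbound g w (Yn m) b) -> cbound g w Y b.
Proof.
move=> H1 H2 Hb.
have le (u : nat -> R) (l x : R) : u @ \oo --> l -> (forall m, `|u m| <= x) -> `|l| <= x.
  by move=> ul ux; rewrite -(cvg_lim _ ul) //; apply: lim_norm_le => //; exact: cvgP ul.
split.
- by move=> t t0 t1; apply: le (H1 t t0 t1) _ => m; case: (Hb m) => H *; exact: H.
- by move=> t i t0 t1; apply: le (H2 t i t0 t1) _ => m; case: (Hb m) => _ H *; exact: H.
- move=> s t i s0 st t1.
  have c1 := H2 t i (le_trans s0 st) t1; have c2 := H2 s i s0 (le_trans st t1).
  by apply: le (cvgB c1 c2) _ => m; case: (Hb m) => _ _ H *; exact: H.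
- move=> s t s0 st t1.
  have c1 := H1 t (le_trans s0 st) t1; have c2 := H1 s s0 (le_trans st t1).
  have c3 : (fun m => dotrv ((Yn m).2 s) (incr w s t)) @ \oo -->
      dotrv (Y.2 s) (incr w s t).
    apply: cvg_big => [|i _]; first exact: add_continuous.
    by apply: cvgM; [exact: H2 (le_trans st t1)|exact: cvg_cst].
  by apply: le (cvgB (cvgB c1 c2) c3) _ => m; case: (Hb m) => _ _ _ H *; exact: H.
Qed.

Lemma geometric_increments_cvg (u : nat -> R) c q : 0 <= q -> q < 1 ->
  (forall k, `|u k.+1 - u k| <= c * q ^+ k) -> cvgn u.
Proof.
move=> q0 q1 H.
have c0 : 0 <= c by have := le_trans (normr_ge0 _) (H 0%N); rewrite expr0 mulr1.
have -> : u = (fun n => u 0%N + \sum_(0 <= l < n) (u l.+1 - u l)).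
  by apply/funext => n; rewrite telescope_sumr // addrC subrK.
apply: is_cvgD; first exact: is_cvg_cst.
exact: geometric_cvg c0 q0 q1 H.
Qed.

(** Pointwise limits of the path and of its Gubinelli derivative suffice, because every inequality
    in [cbound] is preserved by pointwise convergence. *)
Lemma cbound_complete w (Y : nat -> cpath R d) c q : 0 <= q -> q < 1 ->
  (forall k, cbound g w (Y k.+1 - Y k) (c * q ^+ k)) ->
  exists Z : cpath R d, forall k, cbound g w (Z - Y k) (c / (1 - q) * q ^+ k).
Proof.
move=> q0 q1 H.
have c0 : 0 <= c by have /cbound_ge0 := H 0%N; rewrite expr0 mulr1.
have C1 t : 0 <= t -> t <= 1 -> cvgn (fun k => (Y k).1 t).
  move=> t0 t1; apply: (@geometric_increments_cvg _ c q) => // k.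
  by case: (H k) => /(_ t t0 t1).
have C2 t i : 0 <= t -> t <= 1 -> cvgn (fun k => (Y k).2 t 0 i).
  move=> t0 t1; apply: (@geometric_increments_cvg _ c q) => // k.
  by case: (H k) => _ /(_ t i t0 t1); rewrite !mxE.
pose Z : cpath R d := (fun t => limn (fun k => (Y k).1 t),
  fun t => \row_i limn (fun k => (Y k).2 t 0 i)).
exists Z => k.
have S m : cbound g w (Y (m + k)%N - Y k) (c / (1 - q) * (q ^+ k - q ^+ (m + k))).
  elim: m => [|m IH]; first by rewrite add0n !subrr mulr0; exact: cbound0.
  have -> : Y (m.+1 + k)%N - Y k = (Y (m + k).+1 - Y (m + k)%N) + (Y (m + k)%N - Y k).
    by rewrite addSn addrA addrNK.
  apply: cbound_le (cboundD (H (m + k)%N) IH).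
  by rewrite le_eqVlt; apply/orP; left; apply/eqP; rewrite addSn exprS; field; lra.
have B0 : 0 <= c / (1 - q) by rewrite divr_ge0 //; lra.
apply: (@cbound_lim w (fun m => Y (m + k)%N - Y k)).
- move=> t t0 t1; apply: cvgB; last exact: cvg_cst.
  have := C1 t t0 t1; rewrite -(cvg_shiftn k); exact.
- move=> t i t0 t1; rewrite [X in _ --> X]mxE [X in _ --> _ + X]mxE.
  have -> : (fun m => ((Y (m + k)%N - Y k).2 t) 0 i) =
      (fun m => (Y (m + k)%N).2 t 0 i - (Y k).2 t 0 i).
    by apply/funext => m; rewrite !mxE.
  apply: cvgB; last exact: cvg_cst.
  rewrite mxE; have := C2 t i t0 t1; rewrite -(cvg_shiftn k); exact.
- move=> m; apply: cbound_le (S m); rewrite ler_wpM2l // lerBlDr lerDl.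
  exact: exprn_ge0.
Qed.

Lemma cbound2_complete w (U : nat -> cpath2 R d) c q : 0 <= q -> q < 1 ->
  (forall k, cbound2 g w (U k.+1 - U k) (c * q ^+ k)) ->
  exists Z : cpath2 R d, forall k, cbound2 g w (Z - U k) (c / (1 - q) * q ^+ k).
Proof.
move=> q0 q1 H.
have [Z1 H1] := @cbound_complete w (fun k => (U k).1) c q q0 q1 (fun k => (H k).1).
have [Z2 H2] := @cbound_complete w (fun k => (U k).2) c q q0 q1 (fun k => (H k).2).
by exists (Z1, Z2) => k; split; [exact: H1|exact: H2].
Qed.

Lemma cbound2_small w (U V : cpath2 R d) c q : 0 <= q -> q < 1 ->
  (forall k, cbound2 g w (U - V) (c * q ^+ k)) -> ceq U V.
Proof.
move=> q0 q1 H; apply: (@cbound2_eq0 R g d w).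
have E k : c * q ^+ k = 0 + q ^+ k * c by ring.
split; apply: (cbound_contract q0 q1 (c := c)) => k; rewrite -E.
  by have [H1 _] := H k; exact: H1.
by have [_ H1] := H k; exact: H1.
Qed.

End Completeness.

(** * Existence and uniqueness of the fixed point for a given weight *)

Section FixedPoint.
Context (R : realType) (g : R) (d : nat).
Hypothesis g_range : 1 / 3 < g <= 1 / 2.
Context (S : system R d) (L : R)
  (chi : (R -> 'rV[R]_d) -> cpath2 R d -> cpath2 R d) (X : rough R d)
  (rad Nn : nat -> R).
Local Notation wn n := (rp1 (block_noise X n)).
Local Notation cn n := (chi (wn n)).
Hypothesis HN : forall n, noise_on g (block_noise X n) (Nn n).
Hypothesis Hchi : forall n, is_cutoff g L (wn n) (cn n).
Hypothesis rad01 : forall n, 0 < rad n <= 1.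
Context (kc ks : nat) (Cc Cs e h : R).
Hypothesis Ac0 : sAc S = 0.
Hypothesis h_gt0 : 0 < h.
Hypothesis ah : sAs S + h < 0.
Hypotheses (fFc : flat2 (sFc S)) (fFs : flat2 (sFs S)).
Hypotheses (fGc : forall j, flat2 (sGc S j)) (fGs : forall j, flat2 (sGs S j)).
Hypothesis HCc : block_spec g (sAc S) L (sFc S) (sGc S) kc Cc.
Hypothesis HCs : block_spec g (sAs S) L (sFs S) (sGs S) ks Cs.
Hypothesis smallc : forall n, Cc * Nn n ^+ kc * rad n <= e.
Hypothesis smalls : forall n, Cs * Nn n ^+ ks * rad n <= e.
Hypothesis e_ge0 : 0 <= e.
Hypothesis contract : e * contraction_const S h <= 1 / 2.

Local Notation LP := (LPmap chi S X rad).
Local Notation bc := (bc_bound g X h).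

Lemma bc_bound_le U b b' : b <= b' -> bc U b -> bc U b'.
Proof.
move=> bb HU n; apply: cbound2_le (HU n); rewrite ler_wpM2r //.
by apply: le_trans (growth_ge1 h_gt0 n).
Qed.

Lemma bc_boundB U V a b : bc U a -> bc V b -> bc (fun n => U n - V n) (a + b).
Proof. by move=> HU HV n; rewrite mulrDl; exact: cbound2B. Qed.

Lemma bc_boundD U V a b : bc U a -> bc V b -> bc (fun n => U n + V n) (a + b).
Proof. by move=> HU HV n; rewrite mulrDl; exact: cbound2D. Qed.

Lemma bc_bound_ge0 U b : bc U b -> 0 <= b.
Proof.
move=> HU; have [/cbound_ge0] := HU 0%N.
by rewrite pmulr_lge0 // (lt_le_trans ltr01) // growth_ge1.
Qed.

Lemma LP_half xi U V bU bV b : bc U bU -> bc V bV -> bc (fun l => U l - V l) b ->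
  bc (fun n => LP xi U n - LP xi V n) (b / 2).
Proof.
move=> HU HV HUV.
have H := LP_diff g_range HN Hchi rad01 Ac0 h_gt0 ah fFc fFs fGc fGs HCc HCs
  smallc smalls e_ge0 xi xi HU HV HUV.
apply: bc_bound_le H; rewrite subrr normr0 add0r.
have b0 := bc_bound_ge0 HUV.
by apply: le_trans (ler_wpM2r b0 contract) _; rewrite mul1r mulrC.
Qed.

Lemma LP_bc xi U b : bc U b -> exists b', bc (LP xi U) b'.
Proof.
move=> HU.
have H0 : bc (fun=> 0) 0 by move=> n; rewrite mul0r; exact: cbound20.
have HU0 : bc (fun l => U l - 0) b by move=> n; rewrite subr0; exact: HU.
have H1 := LP_half xi HU H0 HU0.
have H2 := LP_zero g_range HN Hchi rad01 Ac0 h_gt0 ah fFc fFs fGc fGs HCc HCs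
  smallc smalls e_ge0 xi.
exists (b / 2 + `|xi|) => n.
have := bc_boundD H1 H2 n.
by rewrite subrK.
Qed.

(** The map halves any bound on V - U and leaves V - U unchanged. *)
Lemma LP_fixed_unique xi U V bU bV : bc U bU -> bc V bV ->
  (forall n, ceq (LP xi U n) (U n)) -> (forall n, ceq (LP xi V n) (V n)) ->
  forall n, ceq (V n) (U n).
Proof.
move=> HU HV EU EV n.
have H k : bc (fun l => V l - U l) ((bV + bU) * (1 / 2) ^+ k).
  elim: k => [|k IH]; first by rewrite expr0 mulr1; exact: bc_boundB.
  move=> l; have := LP_half xi HV HU IH l.
  have -> : (bV + bU) * (1 / 2) ^+ k / 2 = (bV + bU) * (1 / 2) ^+ k.+1.
    by rewrite exprSr; ring.
  by apply: cbound2_ceq; apply: ceqB; [exact: EV|exact: EU].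
apply: (@cbound2_small R g d (wn n) _ _ ((bV + bU) * growth h n) (1 / 2));
  [lra|lra|] => k.
by rewrite mulrAC; exact: H.
Qed.

Definition picard xi k : nat -> cpath2 R d := iter k (LP xi) (fun=> 0).

Lemma picard_bc xi k : exists b, bc (picard xi k) b.
Proof.
elim: k => [|k [b IH]]; last exact: LP_bc IH.
by exists 0 => n; rewrite mul0r; exact: cbound20.
Qed.

Lemma picard_diff xi k :
  bc (fun n => picard xi k.+1 n - picard xi k n) (`|xi| * (1 / 2) ^+ k).
Proof.
elim: k => [|k IH].
  move=> n; rewrite (subr0 (picard xi 1 n)) expr0 mulr1.
  exact: (LP_zero g_range HN Hchi rad01 Ac0 h_gt0 ah fFc fFs fGc fGs HCc HCs
    smallc smalls e_ge0 xi n).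
have [b1 B1] := picard_bc xi k.+1; have [b2 B2] := picard_bc xi k.
have := LP_half xi B1 B2 IH.
have -> : `|xi| * (1 / 2) ^+ k / 2 = `|xi| * (1 / 2) ^+ k.+1.
  by rewrite exprSr; ring.
exact.
Qed.

(** Consecutive Picard iterates from 0 differ by |xi| 2^-k, which sums to 2 |xi|. That this bound is
    linear in xi is what later produces the power |xi|^(q+1). *)
Lemma LP_fixed_exists xi : exists U, [/\ bc U (2 * `|xi|),
  forall n, ceq (LP xi U n) (U n) &
  forall n, (U n).1.1 0 = (U n.+1).1.1 1 /\ (U n).2.1 0 = (U n.+1).2.1 1].
Proof.
have /choice[U HU] : forall n, exists Z : cpath2 R d, forall k,
    cbound2 g (wn n) (Z - picard xi k n)
      (`|xi| * growth h n / (1 - 1 / 2) * (1 / 2) ^+ k).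
  move=> n; apply: cbound2_complete; [lra|lra|] => k.
  by rewrite mulrAC; exact: picard_diff.
have HD k : bc (fun n => U n - picard xi k n) (2 * `|xi| * (1 / 2) ^+ k).
  move=> n; have -> : 2 * `|xi| * (1 / 2) ^+ k * growth h n =
      `|xi| * growth h n / (1 - 1 / 2) * (1 / 2) ^+ k by field.
  exact: HU.
have BU : bc U (2 * `|xi|).
  by move=> n; have := HD 0%N n; rewrite (subr0 (U n)) expr0 mulr1.
have EU n : ceq (LP xi U n) (U n).
  apply: (@cbound2_small R g d (wn n) _ _ (2 * `|xi| * growth h n) (1 / 2));
    [lra|lra|] => k.
  have [b B] := picard_bc xi k.
  have H1 := LP_half xi BU B (HD k) n.
  have H2 := cbound2N (HD k.+1 n).
  have := cbound2D H1 H2; rewrite opprB.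
  rewrite (_ : LP xi U n - LP xi (picard xi k) n + (picard xi k.+1 n - U n) =
    LP xi U n - U n); last exact: subrKA.
  apply: cbound2_le; rewrite le_eqVlt; apply/orP; left; apply/eqP.
  by rewrite exprSr; field.
exists U; split => // n.
have [M1 M2] := LP_match g_range HN Hchi rad01 Ac0 h_gt0 ah fFc fFs fGc fGs HCs
  smalls e_ge0 xi n BU.
have i0 : 0 <= (0 : R) <= 1 by rewrite lexx ler01.
have i1 : 0 <= (1 : R) <= 1 by rewrite lexx ler01.
have [a1 _ a2 _] := EU n 0 i0; have [b1 _ b2 _] := EU n.+1 1 i1.
split; first exact: etrans (esym a1) (etrans M1 b1).
exact: etrans (esym a2) (etrans M2 b2).
Qed.

End FixedPoint.

(** * The driving noise *)

Section NoiseFromCocycle.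
Context (R : realType) (d : nat) (g : R).
Hypothesis g_range : 1 / 3 < g <= 1 / 2.
Implicit Types (X : rough R d) (s t u e : R).
Local Notation h := (hpow g).

(** Integration by parts; the boundary term at s vanishes because the increments start there. *)
Lemma lift_symmetric (w : R -> 'rV[R]_d) s t i j : (forall k, Ck k w) -> s < t ->
  rp2 (canonical_lift w) s t i j + rp2 (canonical_lift w) s t j i =
  incr w s t 0 i * incr w s t 0 j.
Proof.
move=> Cw st; have [dw cw] := Cw 1%N.
have {}cw : continuous (fun x => 'D_1 w x) := cw 1.
have dw1 x : derivable w x 1 by exact: diff_derivable.
have dwk k x : derivable (fun u => w u 0 k) x 1.
  exact: ((derivable_mxP w x 1).1 (dw1 x)).
have cd k : continuous (derive1 (fun u => w u 0 k)).
  have -> : derive1 (fun u => w u 0 k) = (fun x => ('D_1 w x) 0 k).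
    apply/funext => x; rewrite derive1E derive_mx ?mxE //.
  move=> x; apply: (@continuous_comp _ _ _ (fun x => 'D_1 w x) (fun M : 'rV[R]_d => M 0 k)).
    exact: cw.
  exact: coord_continuous.
have di k x : derivable (fun u => incr w s u 0 k) x 1.
  rewrite (_ : (fun u => _) = (fun u => w u 0 k) - cst (w s 0 k)).
    by apply: derivableB => //; exact: dwk.
  by apply/funext => u; rewrite /incr !mxE.
have Di k : derive1 (fun u => incr w s u 0 k) = derive1 (fun u => w u 0 k).
  apply/funext => x; rewrite !derive1E.
  rewrite (_ : (fun u => incr w s u 0 k) = (fun u => w u 0 k) - cst (w s 0 k)).
    by rewrite deriveB ?derive_cst ?subr0 //; exact: dwk.
  by apply/funext => u; rewrite /incr !mxE.
have LR k : derivable_oo_LRcontinuous (fun u => incr w s u 0 k) s t.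
  have c x : {for x, continuous (fun u => incr w s u 0 k)}.
    exact/differentiable_continuous/derivable1_diffP.
  split; first by move=> x _; exact: di.
    exact: cvg_at_right_filter (c s).
  exact: cvg_at_left_filter (c t).
rewrite /canonical_lift /= !mxE.
rewrite (@Rintegration_by_parts R (fun u => incr w s u 0 i) (fun u => incr w s u 0 j)
  (derive1 (fun u => w u 0 i)) (derive1 (fun u => w u 0 j)) s t) //.
- have -> : \int[lebesgue_measure]_(x in `[s, t])
      (derive1 (fun u => w u 0 i) x * incr w s x 0 j) =
    \int[lebesgue_measure]_(x in `[s, t])
      (incr w s x 0 j * derive1 (fun u => w u 0 i) x).
    by apply: eq_Rintegral => x _; rewrite mulrC.
  by rewrite subrK incr_self !mxE mul0r subr0.
- exact: continuous_subspaceT.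
- by move=> x _; rewrite Di.
- exact: continuous_subspaceT.
- by move=> x _; rewrite Di.
Qed.

(** The identity holds for canonical lifts and passes to the limit, since the rough distance on
    [-1, 1] bounds both levels at (s, t). *)
Lemma geometric_symmetric X s t i j : is_geometric g X -> 0 <= s -> s < t -> t <= 1 ->
  rp2 X s t i j + rp2 X s t j i = incr (rp1 X) s t 0 i * incr (rp1 X) s t 0 j.
Proof.
move=> /(_ 1 ltr01)[w [Cw /fine_cvgP[fin lim0]]] s0 st t1.
set p := rp2 X s t i j; set p' := rp2 X s t j i.
set a := incr (rp1 X) s t 0 i; set b := incr (rp1 X) s t 0 j.
have key e : 0 < e -> e <= 1 -> exists q q' x y, [/\ q + q' = x * y,
    `|q - p| <= e, `|q' - p'| <= e, `|x - a| <= e & `|y - b| <= e].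
  move=> e0 e1.
  move/cvgrPdist_lt : lim0 => /(_ e e0) lim0.
  have [n [Hf Hn]] := filter_ex (filterI fin lim0).
  move: Hf Hn; rewrite /= sub0r normrN /rough_dist.
  set A := holder2 (-1) 1 g _; set B := holder2 (-1) 1 (2 * g) _ => Hf Hn.
  have ge0 (V : normedModType R) (f : R -> R -> V) al : (0 <= holder2 (-1) 1 al f)%E.
    apply: (@le_trans _ _ (`|f 0 1| / (1 - 0) `^ al)%:E).
      by rewrite lee_fin divr_ge0 // powR_ge0.
    by apply: ereal_sup_ubound; exists (0, 1) => //=; split; rewrite // lerN10.
  have A0 : (0 <= A)%E := ge0 _ _ _.
  have B0 : (0 <= B)%E := ge0 _ _ _.
  have AB : (A + B <= e%:E)%E.
    rewrite -(fineK Hf) lee_fin; apply: le_trans (ler_norm _) _; exact: ltW.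
  have Ae : (A <= e%:E)%E by apply: le_trans AB; rewrite leeDl.
  have Be : (B <= e%:E)%E by apply: le_trans AB; rewrite leeDr.
  have pw al : 0 <= al -> e * (t - s) `^ al <= e.
    move=> al0; rewrite ler_piMr ?(ltW e0) //.
    have <- : 1 `^ al = 1 :> R by rewrite powR1.
    by apply: ge0_ler_powR; rewrite ?nnegrE; lra.
  have gp := gamma_gt0 g_range.
  have m1 : -1 <= s by lra.
  move/holder2_leP : Ae => /(_ s t m1 st t1) Ae.
  move/holder2_leP : Be => /(_ s t m1 st t1) Be.
  have {}Ae := le_trans Ae (pw g (ltW gp)).
  have {}Be := le_trans Be (pw (2 * g) (mulr_ge0 (ler0n _ _) (ltW gp))).
  move/(mx_norm_leP _ (ltW e0)) : Ae => Ae; move/(mx_norm_leP _ (ltW e0)) : Be => Be.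
  exists (rp2 (canonical_lift (w n)) s t i j), (rp2 (canonical_lift (w n)) s t j i),
    (incr (w n) s t 0 i), (incr (w n) s t 0 j); split.
  - exact: lift_symmetric (Cw n) st.
  - by have := Be i j; rewrite [X in `|X|]mxE [X in _ + X]mxE.
  - by have := Be j i; rewrite [X in `|X|]mxE [X in _ + X]mxE.
  - by have := Ae 0 i; rewrite [X in `|X|]mxE [X in _ + X]mxE.
  - by have := Ae 0 j; rewrite [X in `|X|]mxE [X in _ + X]mxE.
apply/eqP; rewrite -subr_eq0 -normr_le0; apply/ler_addgt0Pl => e e0; rewrite addr0.
(* The two second-level errors, the two first-level errors multiplied by |a| and |b|, and the
   product of the first-level errors, at most e' because e' <= 1, add up to K e'. *)
pose K := 3 + `|a| + `|b|.
have K0 : 0 < K by rewrite /K; have := normr_ge0 a; have := normr_ge0 b; lra.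
pose e' := Num.min 1 (e / K).
have e'0 : 0 < e' by rewrite lt_min ltr01 divr_gt0.
have e'1 : e' <= 1 by rewrite ge_min lexx.
have e'K : K * e' <= e by rewrite mulrC -ler_pdivlMr // ge_min lexx orbT.
have [q [q' [x [y [E H1 H2 H3 H4]]]]] := key e' e'0 e'1.
have -> : p + p' - a * b = - (q - p) - (q' - p') + (a * (y - b) + (x - a) * b
   + (x - a) * (y - b)) by lra.
apply: le_trans e'K.
apply: le_trans (ler_normD _ _) _.
apply: le_trans (lerD (ler_normB _ _) (ler_normD _ _)) _.
apply: le_trans (lerD (lexx _) (lerD (ler_normD _ _) (lexx _))) _.
rewrite normrN !normrM.
have f1 := ler_wpM2l (normr_ge0 a) H4; have f2 := ler_wpM2r (normr_ge0 b) H3.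
have f3 := ler_pM (normr_ge0 _) (normr_ge0 _) H3 H4.
have f4 : e' * e' <= e' by rewrite ler_piMr // ltW.
rewrite /K; lra.
Qed.

Lemma holder2_sub (V : normedModType R) (f : R -> R -> V) al :
  (holder2 (-1) 1 al f < +oo)%E -> (holder2 0 1 al f < +oo)%E.
Proof.
apply: le_lt_trans; apply: ereal_sup_le => _ [[s t] /= [s0 st t1] <-].
by exists (s, t) => //=; split => //; apply: le_trans s0; rewrite lerN10.
Qed.

Lemma holder2_fine (V : normedModType R) (f : R -> R -> V) al s t :
  (holder2 0 1 al f < +oo)%E -> 0 <= s -> s < t -> t <= 1 ->
  `|f s t| <= fine (holder2 0 1 al f) * (t - s) `^ al.
Proof.
move=> fin s0 st t1.
have E : (holder2 0 1 al f <= (fine (holder2 0 1 al f))%:E)%E.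
  by rewrite fineK // ge0_fin_numE // holder2_ge0.
by move/holder2_leP : E; exact.
Qed.

Lemma rough_path_noise X : is_rough_path g X -> is_geometric g X ->
  noise_on g X (noise_size g X).
Proof.
move=> HX gX.
have f1 := holder2_sub (rough_holder1 HX ltr01).
have f2 := holder2_sub (rough_holder2 HX ltr01).
have p1 : 0 <= fine (holder2 0 1 g (incr (rp1 X))) by rewrite fine_ge0 // holder2_ge0.
have p2 : 0 <= fine (holder2 0 1 (2 * g) (rp2 X)) by rewrite fine_ge0 // holder2_ge0.
have N1 : 1 <= noise_size g X by rewrite /noise_size; lra.
have z2 s : rp2 X s s = 0.
  have := rough_chen HX (lexx s) (lexx s).
  rewrite incr_self trmx0 mul0mx subrr sub0r => /eqP.
  by rewrite oppr_eq0 => /eqP.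
split => //.
- move=> s t i s0; rewrite le_eqVlt => /predU1P[->|st] t1.
    by rewrite incr_self mxE normr0 mulr_ge0 ?hpow_ge0 //; lra.
  have := holder2_fine f1 s0 st t1 => H.
  have b0 : 0 <= noise_size g X * h s t by rewrite mulr_ge0 ?hpow_ge0 //; lra.
  apply: (mx_norm_leP _ b0).1; apply: le_trans H _.
  by rewrite ler_wpM2r ?powR_ge0 // /noise_size; lra.
- move=> s t i j s0; rewrite le_eqVlt => /predU1P[->|st] t1.
    by rewrite z2 mxE normr0 mulr_ge0 ?exprn_ge0 ?hpow_ge0 //; lra.
  have := holder2_fine f2 s0 st t1; rewrite hpow2 ?(ltW st) // => H.
  have b0 : 0 <= noise_size g X * h s t ^+ 2.
    by rewrite mulr_ge0 ?exprn_ge0 ?hpow_ge0 //; lra.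
  apply: (mx_norm_leP _ b0).1; apply: le_trans H _.
  by rewrite ler_wpM2r ?exprn_ge0 ?hpow_ge0 // /noise_size; lra.
- move=> s u t i j s0 su ut t1.
  have := congr1 (fun M : 'M[R]_d => M i j) (rough_chen HX su ut).
  by rewrite !mxE big_ord1 !mxE; lra.
- move=> s t i j s0; rewrite le_eqVlt => /predU1P[->|st] t1.
    by rewrite z2 incr_self !mxE mul0r addr0.
  exact: geometric_symmetric.
Qed.

(** The second levels are compared for ordered times only, as this is all that the cocycle identity
    provides. *)
Lemma noise_on_ext X X' N : rp1 X = rp1 X' ->
  (forall s t, 0 <= s -> s <= t -> rp2 X s t = rp2 X' s t) ->
  noise_on g X N -> noise_on g X' N.
Proof.
move=> E1 E2 [H1 H2 H3 H4 H5]; split => //; rewrite -?E1 //.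
- by move=> s t i j s0 st t1; rewrite -E2 //; exact: H3.
- move=> s u t i j s0 su ut t1; have u0 : 0 <= u by lra.
  have st : s <= t by lra.
  by rewrite -(E2 s t s0 st) -(E2 s u s0 su) -(E2 u t u0 ut); exact: H4.
- by move=> s t i j s0 st t1; rewrite -!E2 //; exact: H5.
Qed.

Context (disp : measure_display) (Omega : measurableType disp) (P : probability Omega R)
  (theta : R -> Omega -> Omega) (W : Omega -> rough R d).
Hypothesis theta_mds : metric_ds P theta.
Hypothesis W_cocycle : rough_cocycle theta g W.

Lemma block_noise1 omega n :
  rp1 (block_noise (W omega) n) = rp1 (W (theta (block_start R n) omega)).
Proof.
by apply/funext => t; rewrite -(coc_shift1 W_cocycle) /incr /= [t + _]addrC.
Qed.

Lemma cocycle_shift2 omega tau s t : s <= t ->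
  rp2 (W omega) (s + tau) (t + tau) = rp2 (W (theta tau omega)) s t.
Proof.
move=> st; have ts : 0 <= t - s by rewrite subr_ge0.
have := coc_shift2 W_cocycle (theta tau omega) s ts.
have := coc_shift2 W_cocycle omega (s + tau) ts.
rewrite (mdsD theta_mds) [s + (t - s)]addrC subrK => E1 E2.
have E : s + tau + (t - s) = t + tau by ring.
by rewrite E in E1; exact: etrans E1 (esym E2).
Qed.

Lemma cocycle_shift1 omega tau s t :
  incr (rp1 (W omega)) (s + tau) (t + tau) = incr (rp1 (W (theta tau omega))) s t.
Proof.
rewrite [RHS]/incr -!(coc_shift1 W_cocycle) /incr [tau + t]addrC [tau + s]addrC.
by rewrite opprB addrA subrK.
Qed.

Lemma block_noise2 omega n s t : s <= t ->
  rp2 (block_noise (W omega) n) s t = rp2 (W (theta (block_start R n) omega)) s t.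
Proof. exact: cocycle_shift2. Qed.

Lemma cocycle_noise omega : noise_on g (W omega) (noise_size g (W omega)).
Proof.
exact: rough_path_noise (coc_rough W_cocycle omega) (coc_geom W_cocycle omega).
Qed.

Lemma block_noise_on omega n :
  noise_on g (block_noise (W omega) n) (noise_size g (W (theta (block_start R n) omega))).
Proof.
apply: noise_on_ext (cocycle_noise (theta (block_start R n) omega)).
  by rewrite block_noise1.
by move=> s t _ st; rewrite block_noise2.
Qed.

End NoiseFromCocycle.

(** * The defect equation *)

Section PolynomialValued.
Context (R : realType).
Local Notation env := (nat -> R).
Implicit Types (P Q : env -> {poly R}).

(** The uniform bound on the size makes the expansion of the defect polynomial a finite sum with the
    same range for all values of the variables. *)
Definition polyfunp P := (forall i, polyfun (fun a => (P a)`_i)) /\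
  exists M : nat, forall a, (size (P a) <= M)%N.

Lemma polyfunp_cst (p : {poly R}) : polyfunp (fun=> p).
Proof. by split=> [i|]; [exact: polyfun_cst|exists (size p)]. Qed.

Lemma polyfunpD P Q : polyfunp P -> polyfunp Q -> polyfunp (fun a => P a + Q a).
Proof.
move=> [P1 [M PM]] [Q1 [K QK]]; split.
  move=> i; apply: polyfun_ext (polyfun_add (P1 i) (Q1 i)) => a.
  by rewrite coefD.
exists (maxn M K) => a; apply: leq_trans (size_polyD _ _) _.
by rewrite geq_max !leq_max PM QK orbT.
Qed.

Lemma polyfunpM P Q : polyfunp P -> polyfunp Q -> polyfunp (fun a => P a * Q a).
Proof.
move=> [P1 [M PM]] [Q1 [K QK]]; split.
  move=> i; apply: polyfun_ext (_ : polyfun (fun a =>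
    \sum_(j < i.+1) (P a)`_j * (Q a)`_(i - j))) => [a|].
    by rewrite coefM.
  by apply: polyfun_sum => j; apply: polyfun_mul.
exists (M + K)%N => a; apply: leq_trans (size_polyMleq _ _) _.
by apply: leq_trans (leq_pred _) _; rewrite leq_add.
Qed.

Lemma polyfunpZ (F : env -> R) P : polyfun F -> polyfunp P ->
  polyfunp (fun a => F a *: P a).
Proof.
move=> HF [P1 [M PM]]; split.
  by move=> i; apply: polyfun_ext (polyfun_mul HF (P1 i)) => a; rewrite coefZ.
by exists M => a; apply: leq_trans (size_scale_leq _ _) _.
Qed.

Lemma polyfunp_sum (T : Type) (r : seq T) (Pr : pred T) (F : T -> env -> {poly R}) :
  (forall i, polyfunp (F i)) -> polyfunp (fun a => \sum_(i <- r | Pr i) F i a).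
Proof.
move=> HF; elim: r => [|i r IH].
  rewrite (_ : (fun a => _) = fun=> 0); first exact: polyfunp_cst.
  by apply/funext => a; rewrite big_nil.
case Pi : (Pr i).
  rewrite (_ : (fun a => _) = fun a => F i a + \sum_(i <- r | Pr i) F i a).
    exact: polyfunpD.
  by apply/funext => a; rewrite big_cons Pi.
rewrite (_ : (fun a => _) = fun a => \sum_(i <- r | Pr i) F i a) //.
by apply/funext => a; rewrite big_cons Pi.
Qed.

Lemma polyfunp_exp P n : polyfunp P -> polyfunp (fun a => P a ^+ n).
Proof.
move=> HP; elim: n => [|n IH]; first exact: (polyfunp_cst 1).
rewrite (_ : (fun a => _) = fun a => P a * P a ^+ n); first exact: polyfunpM.
by apply/funext => a; rewrite exprS.
Qed.

Lemma polyfunp_horner (ps : {poly {poly R}}) P : polyfunp P ->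
  polyfunp (fun a => ps.[P a]).
Proof.
move=> HP; rewrite (_ : (fun a => _) = fun a => \sum_(j < size ps) ps`_j * P a ^+ j).
  apply: polyfunp_sum => j; apply: polyfunpM; first exact: polyfunp_cst.
  exact: polyfunp_exp.
by apply/funext => a; rewrite horner_coef.
Qed.

End PolynomialValued.

Lemma pideal_sum_nat (R : realType) (I : pred nat) (P : ((nat -> R) -> R) -> Prop)
    (m n : nat) (F : nat -> (nat -> R) -> R) :
  (forall i, (m <= i < n)%N -> pideal I P (F i)) ->
  pideal I P (fun a => \sum_(m <= i < n) F i a).
Proof.
move=> H; rewrite (_ : (fun a => _) = fun a =>
  \sum_(m <= i < n | (m <= i < n)%N && true) F i a).
  by apply: pideal_sum => i /andP[/H].
by apply/funext => a; rewrite big_nat_cond.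
Qed.

Section Defect.
Context (R : realType) (q : nat) (ps pc : {poly {poly R}}).
Local Notation env := (nat -> R).
Implicit Types (a b : env).

Definition phifun a : R := \sum_(2 <= i < q.+1) a i * a 0%N ^+ i.
Definition dphifun a : R := \sum_(2 <= k < q.+1) k%:R * a k * a 0%N ^+ k.-1.
Definition zfun a : R := a 1%N - phifun a.
Definition defect_coef i a : R := (defect_poly q ps pc a)`_i.
(** The nonlinearity in the equation for z = y - phi(x): that of y, minus those of the alpha_i times
    x^i, minus phi'(x) times that of x. One formula serves the drift and each component of the
    diffusion. *)
Definition residual a : R := ev2 ps (a 0%N, a 1%N) -
  \sum_(2 <= i < q.+1) defect_coef i a * a 0%N ^+ i - dphifun a * ev2 pc (a 0%N, a 1%N).

Lemma polyfun_phi : polyfun phifun.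
Proof.
apply: polyfun_sum => i; apply: polyfun_mul; first exact: polyfun_var.
by apply: polyfun_exp; exact: polyfun_var.
Qed.

Lemma polyfun_dphi : polyfun dphifun.
Proof.
apply: polyfun_sum => i; apply: polyfun_mul; last first.
  by apply: polyfun_exp; exact: polyfun_var.
by apply: polyfun_mul; [exact: polyfun_cst|exact: polyfun_var].
Qed.

Lemma polyfun_z : polyfun zfun.
Proof. by apply: polyfun_sub; [exact: polyfun_var|exact: polyfun_phi]. Qed.

Lemma polyfunp_phi : polyfunp (phi_poly q : env -> {poly R}).
Proof.
apply: polyfunp_sum => i; apply: polyfunpZ; first exact: polyfun_var.
exact: polyfunp_cst.
Qed.

Lemma polyfunp_defect : polyfunp (defect_poly q ps pc : env -> {poly R}).
Proof.
rewrite (_ : (defect_poly q ps pc : env -> {poly R}) = fun a => ps.[phi_poly q a] +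
  (-1) *: (\sum_(2 <= k < q.+1) ((k%:R * a k) *: 'X^(k.-1)) * pc.[phi_poly q a])).
  have H p : polyfunp (fun a : env => p.[phi_poly q a]).
    by apply: polyfunp_horner; exact: polyfunp_phi.
  apply: polyfunpD; first exact: H.
  apply: polyfunpZ; first exact: polyfun_cst.
  apply: polyfunp_sum => k; apply: polyfunpM; last exact: H.
  apply: polyfunpZ; last exact: polyfunp_cst.
  by apply: polyfun_mul; [exact: polyfun_cst|exact: polyfun_var].
by apply/funext => a; rewrite scaleN1r.
Qed.

Lemma polyfun_defect i : polyfun (defect_coef i).
Proof. by case: polyfunp_defect => H _; exact: H. Qed.

Lemma polyfun_residual : polyfun residual.
Proof.
apply: polyfun_sub; first apply: polyfun_sub.
- by apply: polyfun_ev2; exact: polyfun_var.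
- apply: polyfun_sum => i; apply: polyfun_mul; first exact: polyfun_defect.
  by apply: polyfun_exp; exact: polyfun_var.
- apply: polyfun_mul; first exact: polyfun_dphi.
  by apply: polyfun_ev2; exact: polyfun_var.
Qed.

Lemma horner_horner (p : {poly {poly R}}) (f : {poly R}) x :
  p.[f].[x] = ev2 p (x, f.[x]).
Proof.
rewrite ev2E (horner_coef p) horner_sum; apply: eq_bigr => j _.
by rewrite hornerM horner_exp (horner_coef p`_j) mulr_suml.
Qed.

Lemma horner_phi a x : (phi_poly q a).[x] = \sum_(2 <= i < q.+1) a i * x ^+ i.
Proof.
by rewrite horner_sum; apply: eq_bigr => i _; rewrite hornerZ hornerXn.
Qed.

Lemma horner_defect a x : (defect_poly q ps pc a).[x] =
  ev2 ps (x, \sum_(2 <= i < q.+1) a i * x ^+ i) -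
  (\sum_(2 <= k < q.+1) k%:R * a k * x ^+ k.-1) *
    ev2 pc (x, \sum_(2 <= i < q.+1) a i * x ^+ i).
Proof.
rewrite /defect_poly hornerD hornerN horner_horner horner_phi; congr (_ - _).
rewrite horner_sum mulr_suml; apply: eq_bigr => k _.
by rewrite hornerM hornerZ hornerXn horner_horner horner_phi.
Qed.

Lemma eq_phi_poly a b : (forall i, (2 <= i <= q)%N -> a i = b i) ->
  phi_poly q a = phi_poly q b.
Proof. by move=> E; apply: eq_big_nat => i; rewrite ltnS => /E ->. Qed.

Lemma eq_defect_poly a b : (forall i, (2 <= i <= q)%N -> a i = b i) ->
  defect_poly q ps pc a = defect_poly q ps pc b.
Proof.
move=> E; rewrite /defect_poly (eq_phi_poly E); congr (_ - _).
by apply: eq_big_nat => i; rewrite ltnS => /E ->.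
Qed.

Local Notation J := (fun v : nat => (v < 2)%N).
Local Notation PJ := (pideal J (@polyfun R)).
Local Notation PJJ := (pideal J PJ).
Let PM := @polyfun_module R.
Let JM : poly_module PJ := pideal_module J PM.
Let JJM : poly_module PJJ := pideal_module J JM.

Lemma var_PJ i : (i < 2)%N -> PJ (fun a => a i).
Proof.
move=> i2; apply: pideal_ext (pideal_gen (I := J) i2 (polyfun_cst 1)) => a.
by rewrite mulr1.
Qed.

Lemma pow_PJJ (F : env -> R) i : (2 <= i)%N -> polyfun F -> PJJ (fun a => F a * a 0%N ^+ i).
Proof.
case: i => [|[|i]] // _ HF.
have H : polyfun (fun a => F a * a 0%N ^+ i).
  by apply: polyfun_mul => //; apply: polyfun_exp; exact: polyfun_var.
apply: pideal_ext (pideal_gen (I := J) (i := 0%N) isT (pideal_gen (I := J) (i := 0%N) isT H)) => a.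
by rewrite !exprS; ring.
Qed.

Lemma phi_PJ : PJ phifun.
Proof.
apply: pideal_sum_nat => i /andP[i2 _].
have H : polyfun (fun a : env => a i * a 0%N ^+ i.-1).
  by apply: polyfun_mul; [|apply: polyfun_exp]; exact: polyfun_var.
apply: pideal_ext (pideal_gen (I := J) (i := 0%N) isT H) => a.
by case: i i2 H => // i _ _; rewrite exprS /=; ring.
Qed.

(** The change of variables y = z + phi(x); variable 1 now holds z. *)
Definition ysubst i : env -> R :=
  if i is 0%N then fun b => b 0%N else
  if i is 1%N then fun b => b 1%N + phifun b else fun b => b i.

Lemma ysubst_poly i : polyfun (ysubst i).
Proof.
case: i => [|[|i]]; [exact: polyfun_var| |exact: polyfun_var].
by apply: polyfun_add; [exact: polyfun_var|exact: polyfun_phi].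
Qed.

Lemma ysubst_PJ i : (i < 2)%N -> PJ (ysubst i).
Proof.
case: i => [|[|i]] // _; first exact: var_PJ.
by apply: pideal_add; [exact: var_PJ|exact: phi_PJ].
Qed.

Definition residual_z b : R := residual (fun i => ysubst i b).

Lemma dphifun_ysubst b : dphifun (fun i => ysubst i b) = dphifun b.
Proof. by apply: eq_big_nat => -[|[|i]]. Qed.

Lemma defect_coef_ysubst i b : defect_coef i (fun i => ysubst i b) = defect_coef i b.
Proof.
by rewrite /defect_coef (@eq_defect_poly _ b) // => -[|[|k]].
Qed.

Lemma residual_zE b : residual_z b = ev2 ps (b 0%N, b 1%N + phifun b) -
  \sum_(2 <= i < q.+1) defect_coef i b * b 0%N ^+ i -
  dphifun b * ev2 pc (b 0%N, b 1%N + phifun b).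
Proof.
rewrite /residual_z /residual dphifun_ysubst; congr (_ - _ - _).
by apply: eq_bigr => i _; rewrite defect_coef_ysubst.
Qed.

Lemma residual_z_of_z a : residual a =
  residual_z (fun v => if v is 1%N then zfun a else a v).
Proof.
rewrite residual_zE; set b := (fun v => _).
have Ep : phifun b = phifun a by apply: eq_big_nat => -[|[|i]].
have Ed : dphifun b = dphifun a by apply: eq_big_nat => -[|[|i]].
rewrite Ep Ed /b /zfun subrK /residual; congr (_ - _ - _).
apply: eq_bigr => i _; congr (_ * _).
by rewrite /defect_coef (@eq_defect_poly a (fun v => if v is 1%N then zfun a else a v)) // => -[|[|k]].
Qed.

Hypotheses (flat_s : flat2 ps) (flat_c : flat2 pc).

(** [ps] and [pc] are flat at the origin, phi lies in the ideal (x, z), and the sum over the alpha_i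
    starts with x^2. *)
Lemma residual_z_PJJ : PJJ residual_z.
Proof.
have E : forall p, flat2 p -> PJJ (fun b => ev2 p (b 0%N, b 1%N + phifun b)).
  move=> p Fp; exact: (pideal_subst (flat_second Fp) ysubst_poly ysubst_PJ).
apply: pideal_ext (_ : PJJ (fun b => ev2 ps (b 0%N, b 1%N + phifun b) -
  \sum_(2 <= i < q.+1) defect_coef i b * b 0%N ^+ i -
  ev2 pc (b 0%N, b 1%N + phifun b) * dphifun b)) => [b|].
  by rewrite residual_zE [dphifun b * _]mulrC.
apply: pideal_sub => //; first apply: pideal_sub => //; first exact: E.
  apply: pideal_sum_nat => i /andP[i2 _]; apply: pow_PJJ => //.
  exact: polyfun_defect.
have [_ M] := JJM; apply: M; first exact: polyfun_dphi.
exact: E.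
Qed.

Local Notation I1 := (pred1 1%N).

Lemma zero_PJJ F : PJJ F -> PJJ (fun b => F (zero_on I1 b)).
Proof.
move=> HF; apply: (pideal_subst HF) => i; rewrite /zero_on /=.
  by case: eqP => _; [exact: polyfun_cst|exact: polyfun_var].
case: eqP => [_ _|_ i2]; last exact: var_PJ.
exact: pideal0.
Qed.

(** Subtracting the value at z = 0 leaves a multiple of z. Both terms vanish to second order in (x,
    z), so by [pideal_second] the cofactor may be taken in the ideal (x, z). *)
Lemma residual_z_part : pideal I1 PJ (fun b => residual_z b - residual_z (zero_on I1 b)).
Proof.
have H := residual_z_PJJ; have H0 := zero_PJJ H.
have [P2 _] := JJM.
apply: pideal_second; first by move=> i /eqP->.
  by apply: pideal_hadamard; exact: P2.
move=> a; rewrite (dirder_sub _ _ (P2 _ H) (P2 _ H0)).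
by rewrite (dirder_second a H) (dirder_second a H0) subrr.
Qed.

(** On the graph y = phi(x) the residual is the defect polynomial without its coefficients from 2 to
    q, which the equations of the alpha_i cancel. *)
Lemma residual_z0 b : residual_z (zero_on I1 b) = (defect_poly q ps pc b).[b 0%N] -
  \sum_(2 <= i < q.+1) defect_coef i b * b 0%N ^+ i.
Proof.
rewrite residual_zE horner_defect {1 4}/zero_on /= add0r.
have Ep : phifun (zero_on I1 b) = \sum_(2 <= i < q.+1) b i * b 0%N ^+ i.
  by apply: eq_big_nat => -[|[|i]].
have Ed : dphifun (zero_on I1 b) = \sum_(2 <= k < q.+1) k%:R * b k * b 0%N ^+ k.-1.
  by apply: eq_big_nat => -[|[|i]].
rewrite Ep Ed -!addrA; congr (_ + _); rewrite addrC; congr (_ - _).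
apply: eq_bigr => i _; congr (_ * _).
by rewrite /defect_coef (@eq_defect_poly (zero_on I1 b) b) // => -[|[|k]].
Qed.

(** For z = 0 the residual is a polynomial in x vanishing to second order, and the sum subtracted
    from the defect polynomial contains only powers from 2 on. *)
Lemma defect_low a i : (i < 2)%N -> (defect_poly q ps pc a)`_i = 0.
Proof.
move=> i2; pose b : env := fun v => if v is 0%N then 1 else if v is 1%N then 0 else a v.
have H0 := zero_PJJ residual_z_PJJ.
pose S := \sum_(2 <= i < q.+1) defect_coef i a *: 'X^i.
pose D := defect_poly q ps pc a - S.
(* By the choice of [b] this line has x = h, z = 0 and constant alpha_i. *)
have line h : residual_z (zero_on I1 (fun v => zero_on J b v + h * restrict_on J b v)) = D.[h].
  rewrite residual_z0 /D hornerD hornerN.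
  have E v : (2 <= v <= q)%N -> zero_on J b v + h * restrict_on J b v = a v.
    by case: v => [|[|v]] // _; rewrite /zero_on /restrict_on /= mulr0 addr0.
  have e0 : zero_on J b 0%N + h * restrict_on J b 0%N = h.
    by rewrite /zero_on /restrict_on /b /= add0r mulr1.
  rewrite (eq_defect_poly E) e0; congr (_ - _); rewrite horner_sum; apply: eq_bigr => k _.
  rewrite hornerZ hornerXn; congr (_ * _).
  by rewrite /defect_coef (eq_defect_poly E).
have D1 : D^`().[0] = 0.
  have := dirder_second b H0; rewrite (@dirder_poly _ _ _ _ D) //.
have D0 : D.[0] = 0.
  rewrite -line; have V : forall F, PJ F -> forall c : env, c 0%N = 0 -> c 1%N = 0 -> F c = 0.
    move=> F; elim=> [//|[|[|k]] F1 // _ _ c c0 c1|F1 G1 _ IH1 _ IH2 c c0 c1].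
    - by rewrite c0 mul0r.
    - by rewrite c1 mul0r.
    - by rewrite IH1 // IH2 // addr0.
  have [JP _] := JM.
  have PJJ_PJ : forall F, PJJ F -> PJ F.
    move=> F; elim=> [|k F1 Jk H1|F1 G1 _ IH1 _ IH2]; first exact: pideal0.
      by apply: pideal_gen => //; exact: JP.
    exact: pideal_add.
  apply: V (PJJ_PJ _ residual_z_PJJ) _ _ _ => //.
  by rewrite /zero_on /restrict_on /= mul0r addr0.
have Sc : S`_i = 0.
  rewrite /S coef_sum big_nat_cond big1 // => k /andP[/andP[k2 _] _].
  rewrite coefZ coefXn; case: eqP => [ik|_]; last by rewrite mulr0.
  by move: i2; rewrite ik ltnNge k2.
have -> : (defect_poly q ps pc a)`_i = D`_i by rewrite [RHS]coefB Sc subr0.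
case: i i2 {Sc} => [|[|i]] // _; first by rewrite -horner_coef0.
by move: D1; rewrite horner_coef0 coef_deriv mulr1n.
Qed.

Hypothesis deg_s : total_degree_le q ps.
Local Notation I2 := (fun v : nat => (2 <= v)%N).

(** At alpha = 0 the coefficient is that of x^i in ps(x, 0), which is 0 because the degree of ps is
    at most q. Every surviving power of x therefore carries a factor alpha. *)
Lemma defect_high i : (q < i)%N -> pideal I2 (@polyfun R) (defect_coef i).
Proof.
move=> qi; have := pideal_hadamard I2 (polyfun_defect i).
apply: pideal_ext => a; suff -> : defect_coef i (zero_on I2 a) = 0 by rewrite subr0.
have p0 : phi_poly q (zero_on I2 a) = 0.
  rewrite /phi_poly big_nat_cond big1 // => k /andP[/andP[k2 _] _].
  by rewrite /zero_on k2 scale0r.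
rewrite /defect_coef /defect_poly p0 horner_coef0 big_nat_cond big1 => [|k /andP[/andP[k2 _] _]].
  rewrite subr0; apply/eqP; apply: contraT => /deg_s.
  by rewrite addn0 leqNgt qi.
by rewrite /zero_on k2 mulr0 scale0r mul0r.
Qed.

Definition x_power (n : nat) (P : (env -> R) -> Prop) := iter n (pideal (pred1 0%N)) P.

Lemma x_power_module n P : poly_module P -> poly_module (x_power n P).
Proof. by move=> HP; elim: n => //= n IH; exact: pideal_module. Qed.

Lemma x_power_gen n P F : P F -> x_power n P (fun a => a 0%N ^+ n * F a).
Proof.
move=> HF; elim: n => [|n IH] /=.
  by rewrite (_ : (fun a => _) = F) //; apply/funext => a; rewrite expr0 mul1r.
apply: pideal_ext (pideal_gen (I := pred1 0%N) (i := 0%N) isT IH) => a.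
by rewrite exprS mulrA.
Qed.

Lemma residual_z0_part : x_power q.+1 (pideal I2 (@polyfun R))
  (fun b => residual_z (zero_on I1 b)).
Proof.
have [_ [M HM]] := polyfunp_defect.
have IM : poly_module (pideal I2 (@polyfun R)) by exact: pideal_module.
rewrite (_ : (fun b => _) = fun b => \sum_(q.+1 <= i < maxn q.+1 M)
    b 0%N ^+ q.+1 * (defect_coef i b * b 0%N ^+ (i - q.+1))).
  rewrite /=; apply: pideal_sum_nat => i /andP[qi _].
  apply: (@x_power_gen q.+1 _ (fun b => defect_coef i b * b 0%N ^+ (i - q.+1))).
  have [_ G] := IM; apply: G; last exact: defect_high.
  by apply: polyfun_exp; exact: polyfun_var.
apply/funext => b; rewrite residual_z0.
rewrite (@horner_coef_wide _ (maxn q.+1 M)); last first.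
  by apply: leq_trans (HM b) _; exact: leq_maxr.
rewrite -(big_mkord xpredT (fun i => (defect_poly q ps pc b)`_i * b 0%N ^+ i)).
(* For q = 0 the first q + 1 coefficients cannot be split at index 2. *)
have [q1|q2] := leqP q.+1 1.
  have q0 : q = 0%N by apply/eqP; rewrite -leqn0 -ltnS.
  rewrite [X in _ - X]big_geq ?subr0; last by rewrite q0.
  rewrite (big_cat_nat (n := q.+1)) ?leq_maxl //= [X in X + _](_ : _ = 0).
    rewrite add0r; apply: eq_big_nat => i /andP[i1 _].
    by rewrite mulrCA -exprD subnKC.
  rewrite big_nat_cond big1 // => i /andP[/andP[_ i1] _].
  by rewrite defect_low ?mul0r // (leq_trans i1 (leqW q1)).
rewrite (big_cat_nat (n := q.+1)) ?leq_maxl //= [in X in X + _ - _](@big_cat_nat _ _ _ 2) //=.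
rewrite [X in X + _ + _ - _](_ : _ = 0); last first.
  by rewrite big_nat_cond big1 // => i /andP[/andP[_ i2] _]; rewrite defect_low // mul0r.
rewrite add0r addrAC subrr add0r; apply: eq_big_nat => i /andP[i1 _].
by rewrite mulrCA -exprD subnKC.
Qed.

End Defect.

(** Gives common constants to the drift and the d components of the diffusion: a finite sum
    dominates each of its terms. *)
Lemma uniform_constants (R : realType) (T : finType) (P : T -> nat -> R -> R -> Prop) :
  (forall j k k' B c c', (k <= k')%N -> 0 <= c -> c <= c' -> P j k B c -> P j k' B c') ->
  (forall j, exists k, forall B, exists2 c, 0 <= c & P j k B c) ->
  exists k, forall B, exists2 c, 0 <= c & forall j, P j k B c.
Proof.
move=> mono /choice[k Hk]; exists (\sum_j k j)%N => B.
have /choice[c Hc] : forall j, exists c : R, 0 <= c /\ P j (k j) B c.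
  by move=> j; have [c c0 Pc] := Hk j B; exists c.
have c0 j : 0 <= c j by case: (Hc j).
exists (\sum_j c j) => [|j]; first exact: sumr_ge0.
apply: mono (c0 j) _ (proj2 (Hc j)); first by rewrite (bigD1 j) //= leq_addr.
by rewrite (bigD1 j) //= lerDl sumr_ge0.
Qed.

(** * Size of the residual on a block *)

Section DefectBlock.
Context (R : realType) (g : R) (d : nat).
Hypothesis g_range : 1 / 3 < g <= 1 / 2.
Local Notation env := (nat -> R).
Implicit Types (Y : nat -> cpath R d).

Lemma pcomp_subst (F : env -> R) (s : nat -> env -> R) Y : polyfun F ->
  (forall i, polyfun (s i)) ->
  pcomp (fun a => F (fun i => s i a)) Y = pcomp F (fun v => pcomp (s v) Y).
Proof.
move=> HF Hs; elim: HF => [i|c|F1 G1 P1 IH1 P2 IH2|F1 G1 P1 IH1 P2 IH2].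
- by rewrite pcomp_var.
- by congr (_, _); apply/funext => t; apply/rowP => l; rewrite !mxE.
- rewrite (pcomp_add _ P1 P2) -IH1 -IH2.
  exact: (pcomp_add _ (polyfun_subst P1 Hs) (polyfun_subst P2 Hs)).
- rewrite (pcomp_mul _ P1 P2) -IH1 -IH2.
  exact: (pcomp_mul _ (polyfun_subst P1 Hs) (polyfun_subst P2 Hs)).
Qed.

Context (q : nat).

Definition zsubst i : env -> R := if i is 1%N then zfun q else fun a => a i.

Lemma zsubst_poly i : polyfun (zsubst i).
Proof. by case: i => [|[|i]]; [exact: polyfun_var|exact: polyfun_z|exact: polyfun_var]. Qed.

(** Makes [b 2] a common bound for all alpha_i, so that a factor alpha can be estimated whatever its
    index. *)
Definition tail_adm (b : env) := forall v, (2 <= v)%N -> b v <= b 2%N.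

Lemma poly_bound_first : poly_bound g d tail_adm (pideal (fun v => (v < 2)%N) (@polyfun R))
  (fun b => (b 0%N + b 1%N) * 1).
Proof.
apply: poly_bound_pideal => //; first exact: polyfun_module.
- by move=> b b0; rewrite addr_ge0.
- by move=> b [|[|v]] // _ b0 _; rewrite ?lerDl ?lerDr.
- exact: poly_bound_polyfun.
Qed.

Lemma zfun_bound : exists k : nat, forall B, exists2 c, 0 <= c &
  forall X N Y b, noise_on g X N -> (forall v, cbound g (rp1 X) (Y v) (b v)) ->
    (forall v, b v <= B) -> tail_adm b ->
    cbound g (rp1 X) (pcomp (zfun q) Y) (c * N ^+ k * ((b 0%N + b 1%N) * 1)).
Proof.
apply: poly_bound_first; apply: pideal_sub; first exact: polyfun_module.
  apply: pideal_ext (pideal_gen (I := fun v => (v < 2)%N) (i := 1%N) isT (polyfun_cst 1)) => a.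
  by rewrite mulr1.
exact: phi_PJ.
Qed.

Lemma poly_bound_x_power n P beta : poly_module P ->
  (forall b, (forall v, 0 <= b v) -> 0 <= beta b) -> poly_bound g d tail_adm P beta ->
  poly_bound g d tail_adm (x_power n P) (fun b => b 0%N ^+ n * beta b).
Proof.
move=> PM beta0 HP; elim: n => [|n IH] /=.
  by under [X in poly_bound _ _ _ _ X]eq_fun do rewrite expr0 mul1r.
under [X in poly_bound _ _ _ _ X]eq_fun do rewrite exprS -mulrA.
apply: (@poly_bound_pideal _ _ _ _ _ _ _ (fun b => b 0%N ^+ n * beta b) (fun b => b 0%N)) => //.
- exact: x_power_module.
- by move=> b v _ _ /eqP->.
- by move=> b b0; rewrite mulr_ge0 ?exprn_ge0 ?beta0.
Qed.

(** The two summands come from splitting the residual at z = 0: z times an element of (x, z), and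
    x^(q+1) times an element of (alpha). *)
Lemma residual_z_bound ps pc : flat2 ps -> flat2 pc -> total_degree_le q ps ->
  exists k : nat, forall B, exists2 c, 0 <= c &
  forall X N Y b, noise_on g X N -> (forall v, cbound g (rp1 X) (Y v) (b v)) ->
    (forall v, b v <= B) -> tail_adm b ->
    cbound g (rp1 X) (pcomp (residual_z q ps pc) Y)
      (c * N ^+ k * (b 1%N * (b 0%N + b 1%N) + b 0%N ^+ q.+1 * b 2%N)).
Proof.
move=> fs fc ds.
have PM := @polyfun_module R.
have [k1 H1] : exists k : nat, forall B, exists2 c, 0 <= c &
  forall X N Y b, noise_on g X N -> (forall v, cbound g (rp1 X) (Y v) (b v)) ->
    (forall v, b v <= B) -> tail_adm b ->
    cbound g (rp1 X) (pcomp (fun a => residual_z q ps pc a - residual_z q ps pc (zero_on (pred1 1%N) a)) Y)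
      (c * N ^+ k * (b 1%N * ((b 0%N + b 1%N) * 1))).
  apply: (@poly_bound_pideal _ g d g_range tail_adm (pred1 1%N) _
    (fun b => (b 0%N + b 1%N) * 1) (fun b => b 1%N) (pideal_module _ PM) _ _ _ poly_bound_first).
  - by move=> b; exact.
  - by move=> b v _ _ /eqP->.
  - by move=> b b0; rewrite mulr1 addr_ge0.
  - exact: residual_z_part.
have [k2 H2] : exists k : nat, forall B, exists2 c, 0 <= c &
  forall X N Y b, noise_on g X N -> (forall v, cbound g (rp1 X) (Y v) (b v)) ->
    (forall v, b v <= B) -> tail_adm b ->
    cbound g (rp1 X) (pcomp (fun a => residual_z q ps pc (zero_on (pred1 1%N) a)) Y)
      (c * N ^+ k * (b 0%N ^+ q.+1 * (b 2%N * 1))).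
  apply: (@poly_bound_x_power q.+1 (pideal (fun v => (2 <= v)%N) (@polyfun R))
    (fun b => b 2%N * 1)).
  - exact: pideal_module.
  - by move=> b b0; rewrite mulr1.
  - apply: (@poly_bound_pideal _ g d g_range tail_adm _ _ (fun=> 1) (fun b => b 2%N)) => //.
    + by move=> b v ab _; exact: ab.
    + exact: poly_bound_polyfun.
  - exact: residual_z0_part.
exists (k1 + k2)%N => B; have [c1 c10 C1] := H1 B; have [c2 c20 C2] := H2 B.
exists (c1 + c2) => [|X N Y b HX Yb bB ab]; first exact: addr_ge0.
have N1 := noise_ge1 HX.
have N0 : 0 <= N by lra.
have b0 v : 0 <= b v := cbound_ge0 (Yb v).
have E : pcomp (residual_z q ps pc) Y =
    pcomp (fun a => residual_z q ps pc a - residual_z q ps pc (zero_on (pred1 1%N) a)) Y +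
    pcomp (fun a => residual_z q ps pc (zero_on (pred1 1%N) a)) Y.
  have P1 : polyfun (residual_z q ps pc).
    by apply: polyfun_subst; [exact: polyfun_residual|exact: ysubst_poly].
  have P2 : polyfun (fun a => residual_z q ps pc (zero_on (pred1 1%N) a)).
    apply: polyfun_subst => // i; rewrite /zero_on /=.
    by case: eqP => _; [exact: polyfun_cst|exact: polyfun_var].
  rewrite -pcomp_add //; last exact: polyfun_sub.
  by congr (pcomp _ _); apply/funext => a; rewrite subrK.
rewrite E.
apply: cbound_le (cboundD (C1 X N Y b HX Yb bB ab) (C2 X N Y b HX Yb bB ab)).
have e1 := @exprn_ege1 R k1 N N1; have e2 := @exprn_ege1 R k2 N N1.
rewrite !mulr1 [X in _ <= X]mulrDr exprD.
have u0 : 0 <= b 1%N * (b 0%N + b 1%N) by rewrite mulr_ge0 ?addr_ge0.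
have v0 : 0 <= b 0%N ^+ q.+1 * b 2%N by rewrite mulr_ge0 ?exprn_ge0.
apply: lerD; apply: ler_wpM2r => //.
  by apply: ler_pM; rewrite ?exprn_ge0 ?lerDl // ler_peMr ?exprn_ge0.
by apply: ler_pM; rewrite ?exprn_ge0 ?lerDr // ler_peMl ?exprn_ge0.
Qed.

(** The joint path has y in place 1. Composition with [zsubst] puts z there, with a bound [bz] of
    its own that can be improved independently of that on y. *)
Lemma residual_bound ps pc : flat2 ps -> flat2 pc -> total_degree_le q ps ->
  exists k : nat, forall B, exists2 c, 0 <= c &
  forall X N Y b bz, noise_on g X N -> (forall v, cbound g (rp1 X) (Y v) (b v)) ->
    (forall v, b v <= B) -> tail_adm b -> bz <= B ->
    cbound g (rp1 X) (pcomp (zfun q) Y) bz ->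
    cbound g (rp1 X) (pcomp (residual q ps pc) Y)
      (c * N ^+ k * (bz * (b 0%N + bz) + b 0%N ^+ q.+1 * b 2%N)).
Proof.
move=> fs fc ds; have [k Hk] := residual_z_bound fs fc ds; exists k => B.
have [c c0 C] := Hk B; exists c => // X N Y b bz HX Yb bB ab bzB Hz.
rewrite (_ : residual q ps pc = fun a => residual_z q ps pc (fun i => zsubst i a)).
  rewrite pcomp_subst; first last.
  - exact: zsubst_poly.
  - by apply: polyfun_subst; [exact: polyfun_residual|exact: ysubst_poly].
  apply: (C X N _ (fun v => if v is 1%N then bz else b v)) => //.
  - case=> [|[|v]]; rewrite ?pcomp_var //; exact: Yb.
  - by case=> [|[|v]].
  - by case=> [|[|v]] // /ab.
apply/funext => a; rewrite residual_z_of_z; congr (residual_z _ _ _ _).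
by apply/funext => -[|[|v]].
Qed.

End DefectBlock.

(** * The equation for z and its estimate at the end of a block *)

Section DefectEquation.
Context (R : realType) (g : R) (d : nat).
Hypothesis g_range : 1 / 3 < g <= 1 / 2.
Local Notation env := (nat -> R).
Context (q : nat).

(** If b0 > 2 A, iterating b |-> A + E b with E <= 1/2 descends from b0 to at most 2 A and never
    leaves the range b <= b0 in which the hypothesis applies. *)
Lemma cbound_improve w (Z : cpath R d) b0 A E : 0 <= A -> 0 <= E -> E <= 1 / 2 ->
  cbound g w Z b0 ->
  (forall b, b <= b0 -> cbound g w Z b -> cbound g w Z (A + E * b)) ->
  cbound g w Z (2 * A).
Proof.
move=> A0 E0 E1 H0 H; have [bA|Ab] := leP b0 (2 * A); first exact: cbound_le H0.
apply: (@cbound_contract _ _ _ _ _ (1 / 2) _ (b0 - 2 * A)); [lra|lra|].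
have Hb : forall n, 0 <= (1 / 2 : R) ^+ n <= 1.
  by move=> n; apply/andP; split; [apply: exprn_ge0; lra|apply: exprn_ile1; lra].
elim=> [|n IH]; first by rewrite expr0 mul1r subrKC.
have /andP[p0 p1] := Hb n.
set p := _ ^+ n in IH p0 p1.
have u : 2 * A + p * (b0 - 2 * A) <= b0 by nra.
apply: cbound_le (H _ u IH); rewrite exprS -/p.
have v0 : 0 <= 2 * A + p * (b0 - 2 * A) by nra.
nra.
Qed.

Lemma dirder_z a b : dirder (zfun q : env -> R) a b = b 1%N -
  \sum_(2 <= i < q.+1) (a i * (i%:R * a 0%N ^+ i.-1 * b 0%N) + a 0%N ^+ i * b i).
Proof.
rewrite dirder_sub; [|exact: polyfun_var|exact: polyfun_phi].
rewrite dirder_var; congr (_ - _).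
have P0 i : polyfun (fun a : env => a 0%N ^+ i).
  by apply: polyfun_exp; exact: polyfun_var.
rewrite dirder_sum => [|i]; last by apply: polyfun_mul; [exact: polyfun_var|exact: P0].
apply: eq_bigr => i _.
rewrite (@dirder_mul R (fun a => a i) (fun a => a 0%N ^+ i) a b (@polyfun_var R i) (P0 i)) dirder_var.
by rewrite (@dirder_exp R (fun a => a 0%N) i a b (@polyfun_var R 0%N)) dirder_var.
Qed.

Lemma dirder_z_residual ps pc (a b : env) : b 0%N = ev2 pc (a 0%N, a 1%N) ->
  b 1%N = ev2 ps (a 0%N, a 1%N) ->
  (forall i, (2 <= i <= q)%N -> b i = defect_coef q ps pc i a) ->
  dirder (zfun q) a b = residual q ps pc a.
Proof.
move=> E0 E1 Ei; rewrite dirder_z E0 E1 /residual -addrA; congr (_ + _).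
rewrite -opprD; congr (- _); rewrite /dphifun mulr_suml -big_split.
apply: eq_big_nat => i Hi; rewrite Ei //=; ring.
Qed.

(** A vanishing centre rate gives y and all the alpha_i the same linear rate, which therefore acts
    on z as a multiplication. *)
Lemma dirder_z_linear c (a b b' : env) : b 0%N = b' 0%N -> b 1%N = c * a 1%N + b' 1%N ->
  (forall i, (2 <= i <= q)%N -> b i = c * a i + b' i) ->
  dirder (zfun q) a b = c * zfun q a + dirder (zfun q) a b'.
Proof.
move=> E0 E1 Ei; rewrite !dirder_z E0 E1 /zfun /phifun.
have -> : \sum_(2 <= i < q.+1) (a i * (i%:R * a 0%N ^+ i.-1 * b' 0%N) + a 0%N ^+ i * b i) =
  c * (\sum_(2 <= i < q.+1) a i * a 0%N ^+ i) +
  \sum_(2 <= i < q.+1) (a i * (i%:R * a 0%N ^+ i.-1 * b' 0%N) + a 0%N ^+ i * b' i).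
  rewrite mulr_sumr -big_split; apply: eq_big_nat => i Hi; rewrite Ei //=; ring.
ring.
Qed.

(** n1, n2, n3 stand for the powers of the noise size from [rde_bound], from the residual and from
    z; x and y for the bounds on the two components; [E] for the factor in front of z and [T] for
    the source term. *)
Lemma defect_arith (cz r cr ec n1 n2 n3 x y M : R) : 0 <= cz -> 0 <= r -> 0 <= cr ->
  1 <= ec -> 1 <= n1 -> 1 <= n2 -> 1 <= n3 -> 0 <= x -> 0 <= y -> 0 <= M ->
  let C := cz + 2 * ec * (r * cr * (1 + cz)) in let z := cz * n3 * ((x + y) * 1) in
  let E := r * n1 * (cr * n2 * (x + z)) in let T := r * n1 * (cr * n2 * M) in
  C * (n1 * n2 * n3) * (x + y) <= 1 ->
  [/\ z <= 1, 0 <= E /\ E <= 1 / 2, 2 * ec * E <= C * (n1 * n2 * n3) * (x + y) &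
      0 <= T /\ 2 * T <= C * (n1 * n2 * n3) * M].
Proof.
move=> cz0 r0 cr0 ec1 n11 n21 n31 x0 y0 M0 C z E T small.
have n10 : 0 <= n1 by lra.
have n20 : 0 <= n2 by lra.
have n30 : 0 <= n3 by lra.
have ec0 : 0 <= ec by lra.
have rc0 : 0 <= r * cr by exact: mulr_ge0.
have nn1 : 1 <= n1 * n2 by rewrite -[1]mulr1 ler_pM.
have nn0 : 0 <= n1 * n2 by lra.
have nnn1 : 1 <= n1 * n2 * n3 by rewrite -[1]mulr1 ler_pM.
have xy0 : 0 <= x + y by lra.
have z0 : 0 <= z by rewrite /z mulr1 !mulr_ge0.
have K0 : 0 <= r * cr * (1 + cz) by rewrite mulr_ge0 //; lra.
have u1 : x + z <= (1 + cz) * n3 * (x + y).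
  rewrite /z mulr1 mulrDl mul1r mulrDl lerD // (le_trans (_ : _ <= x + y)) ?lerDl //.
  by rewrite ler_peMl.
have u2 : E <= r * cr * (1 + cz) * (n1 * n2 * n3) * (x + y).
  rewrite (_ : E = r * cr * (n1 * n2) * (x + z)); last by rewrite /E; ring.
  rewrite (_ : _ * (x + y) = r * cr * (n1 * n2) * ((1 + cz) * n3 * (x + y))); last by ring.
  by apply: ler_wpM2l => //; exact: mulr_ge0.
have w0 : 0 <= (n1 * n2 * n3) * (x + y) by rewrite mulr_ge0 //; lra.
have C1 : 2 * ec * (r * cr * (1 + cz)) <= C by rewrite /C lerDr.
have C2 : cz <= C by rewrite /C lerDl mulr_ge0 // mulr_ge0.
have E0 : 0 <= E by rewrite /E !mulr_ge0 // addr_ge0.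
have u3 : 2 * ec * E <= C * (n1 * n2 * n3) * (x + y).
  apply: le_trans (_ : 2 * ec * (r * cr * (1 + cz)) * ((n1 * n2 * n3) * (x + y)) <= _).
    rewrite -mulrA [2 * _ * _]mulrC -!mulrA; rewrite [X in _ <= X](_ : _ =
      2 * (ec * (r * cr * (1 + cz) * (n1 * n2 * n3) * (x + y)))); last by ring.
    by apply: ler_wpM2l => //; apply: ler_wpM2l.
  by rewrite -[C * _ * _]mulrA; apply: ler_wpM2r.
split=> //.
- apply: le_trans small; rewrite /z mulr1 -!mulrA; apply: ler_pM => //.
    by rewrite mulr_ge0.
  rewrite !mulrA; apply: ler_wpM2r => //.
  by rewrite -[leLHS]mul1r; apply: ler_wpM2r.
- split=> //; have := le_trans u3 small; nra.
- split; first by rewrite /T !mulr_ge0.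
  rewrite (_ : 2 * T = 2 * (r * cr) * (n1 * n2) * M); last by rewrite /T; ring.
  apply: ler_wpM2r => //; apply: ler_pM => //.
  + by rewrite !mulr_ge0.
  + apply: le_trans C1; nra.
  + by rewrite -[leLHS]mulr1; apply: ler_wpM2l.
Qed.

Lemma defect_arith2 (r n1 c n2 x z0 z M : R) : 0 <= r -> 0 <= n1 -> 0 <= c -> 0 <= n2 ->
  0 <= x -> 0 <= z -> z <= z0 ->
  r * n1 * (c * n2 * (z * (x + z) + M)) <=
  r * n1 * (c * n2 * (x + z0)) * z + r * n1 * (c * n2 * M).
Proof.
move=> r0 n10 c0 n20 x0 z_ge0 zz.
rewrite [X in _ <= X](_ : _ = r * n1 * (c * n2 * (z * (x + z0) + M))); last by ring.
do 2 (apply: ler_wpM2l; first exact: mulr_ge0).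
by rewrite lerD2r; apply: ler_wpM2l => //; rewrite lerD2l.
Qed.

Lemma defect_arith3 (e ec E T C1 C2 u v bz : R) : 0 <= E -> E <= 1 / 2 -> 0 <= T ->
  2 * ec * E <= C1 -> 2 * T <= C2 -> bz <= 2 * (ec * `|u| + T) -> 0 <= e ->
  `|v - e * u| <= E * bz + T -> `|v| <= (e + C1) * `|u| + C2.
Proof.
move=> E0 E1 T0 h1 h2 hb e0 H.
have u0 := normr_ge0 u.
have : `|v| <= e * `|u| + (E * bz + T).
  rewrite -[v](subrK (e * u)) addrC.
  by apply: le_trans (ler_normD _ _) _; rewrite lerD // normrM (ger0_norm e0).
have k1 : E * bz <= E * (2 * (ec * `|u| + T)) by exact: ler_wpM2l.
have k2 : 2 * ec * E * `|u| <= C1 * `|u| by exact: ler_wpM2r.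
have k3 : 2 * E * T <= T by nra.
lra.
Qed.

Context (S : system R d).
Hypothesis Ac0 : sAc S = 0.

(** Indices beyond q carry the zero field, so that the joint system has an equation for every
    variable. *)
Definition joint_field ps pc (v : nat) : env -> R :=
  if v is 0%N then ev2fun pc else if v is 1%N then ev2fun ps else
  if (v <= q)%N then defect_coef q ps pc v else fun=> 0.

Definition joint_drift (v : nat) : env -> R :=
  fun a => if v is 0%N then sAc S * a 0%N + ev2fun (sFc S) a else
  if v is 1%N then sAs S * a 1%N + ev2fun (sFs S) a else
  if (v <= q)%N then A_alpha S v * a v + defect_coef q (sFs S) (sFc S) v a else 0.

Definition joint_diff (j : 'I_d) := joint_field (sGs S j) (sGc S j).

Lemma joint_field_poly ps pc v : polyfun (joint_field ps pc v).
Proof.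
case: v => [|[|v]] /=; [exact: ev2fun_poly|exact: ev2fun_poly|].
by case: ifP => _; [exact: polyfun_defect|exact: polyfun_cst].
Qed.

Lemma field_der_joint ps pc : field_der (joint_field ps pc) (zfun q) = residual q ps pc.
Proof.
apply/funext => a; apply: dirder_z_residual => // i /andP[i2 iq].
by case: i i2 iq => [|[|i]] // _ iq; rewrite /joint_field iq.
Qed.

Lemma field_der_drift a : field_der joint_drift (zfun q) a =
  sAs S * zfun q a + residual q (sFs S) (sFc S) a.
Proof.
rewrite -field_der_joint; apply: dirder_z_linear => //.
  by rewrite /joint_drift Ac0 mul0r add0r.
case=> [|[|i]] // /andP[_ iq]; rewrite /joint_drift /joint_field iq.
by rewrite /A_alpha Ac0 mulr0 subr0.
Qed.

Definition joint_solution (X : rough R d) (Y : nat -> cpath R d) : Prop :=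
  forall v, expands g X (Y v).1 (fun t => joint_drift v (fun u => (Y u).1 t))
    (fun t => \row_j joint_diff j v (fun u => (Y u).1 t),
     fun t => \matrix_(i, j)
       field_der (joint_diff i) (joint_diff j v) (fun u => (Y u).1 t)) /\
  forall t, 0 <= t -> t <= 1 -> (Y v).2 t = \row_j joint_diff j v (fun u => (Y u).1 t).

Hypotheses (flat_Fc : flat2 (sFc S)) (flat_Fs : flat2 (sFs S))
  (flat_Gc : forall j, flat2 (sGc S j)) (flat_Gs : forall j, flat2 (sGs S j))
  (deg_Fs : total_degree_le q (sFs S)) (deg_Gs : forall j, total_degree_le q (sGs S j)).

(** The factor of z is e^{A^s} plus a small term rather than a constant times e^{A^s}; only so can
    the estimate be iterated over arbitrarily many blocks. *)
Definition defect_spec (k : nat) (B C : R) : Prop := 0 <= C /\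
  forall X N Y b, noise_on g X N -> (forall v, cbound g (rp1 X) (Y v) (b v)) ->
    (forall v, b v <= B) -> tail_adm b -> joint_solution X Y ->
    C * N ^+ k * (b 0%N + b 1%N) <= 1 ->
    `|zfun q (fun v => (Y v).1 1)| <=
      (expR (sAs S) + C * N ^+ k * (b 0%N + b 1%N)) * `|zfun q (fun v => (Y v).1 0)| +
      C * N ^+ k * (b 0%N ^+ q.+1 * b 2%N).

(** The product of z with the bound on (x, z) is linear in z with a small coefficient and is
    absorbed by [cbound_improve]. The endpoint estimate of [rde_bound] then applies with the
    improved bound. *)
Lemma defect_block : exists k : nat, forall B, exists C, defect_spec k B C.
Proof.
pose ps (o : option 'I_d) := if o is Some j then sGs S j else sFs S.
pose pc (o : option 'I_d) := if o is Some j then sGc S j else sFc S.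
pose Bd (o : option 'I_d) (k : nat) (B c : R) := forall (X : rough R d) N Y b bz,
    noise_on g X N -> (forall v, cbound g (rp1 X) (Y v) (b v)) ->
    (forall v, b v <= B) -> tail_adm b -> bz <= B ->
    cbound g (rp1 X) (pcomp (zfun q) Y) bz ->
    cbound g (rp1 X) (pcomp (residual q (ps o) (pc o)) Y)
      (c * N ^+ k * (bz * (b 0%N + bz) + b 0%N ^+ q.+1 * b 2%N)).
have [kr Hr] : exists k : nat, forall B, exists2 c, 0 <= c & forall o, Bd o k B c.
  apply: (@uniform_constants _ _ Bd) => [oj k k' B c c' kk c0 cc H X N Y b bz HX Yb bB ab bzB Hz|].
    apply: cbound_le (H X N Y b bz HX Yb bB ab bzB Hz).
    have N1 := noise_ge1 HX.
    have b0 v : 0 <= b v := cbound_ge0 (Yb v).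
    have z0 := cbound_ge0 Hz.
    apply: ler_wpM2r; first by rewrite addr_ge0 // mulr_ge0 ?exprn_ge0 ?addr_ge0.
    apply: ler_pM => //; last by rewrite ler_weXn2l.
    by rewrite exprn_ge0 // (le_trans ler01).
  case=> [j|].
    exact: (residual_bound d g_range (flat_Gs j) (flat_Gc j) (@deg_Gs j)).
  exact: (residual_bound d g_range flat_Fs flat_Fc (@deg_Fs)).
have [kz Hz] := zfun_bound d g_range q.
exists (6 + kr + kz)%N => B.
(* The smallness assumption makes the bound on z at most 1, hence the maximum with 1. *)
have [cr cr0 {}Hr] := Hr (Num.max B 1); have [cz cz0 {}Hz] := Hz B.
have r0 := rdeconst_ge0 d g_range (sAs S); have ec1 := expconst_ge1 (sAs S).
set r := rdeconst _ _ _ in r0; set ec := expconst _ in ec1.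
have ec0 : 0 <= ec := le_trans ler01 ec1.
exists (cz + 2 * ec * (r * cr * (1 + cz))); split.
  exact: addr_ge0 cz0 (mulr_ge0 (mulr_ge0 (ler0n _ 2) ec0)
    (mulr_ge0 (mulr_ge0 r0 cr0) (addr_ge0 ler01 cz0))).
move=> X N Y b HX Yb bB ab HY; set C := cz + _ => small.
have N1 := noise_ge1 HX.
have b0 v : 0 <= b v := cbound_ge0 (Yb v).
have Hz0 := Hz X N Y b HX Yb bB ab.
set bz0 := _ * _ in Hz0.
set M := b 0%N ^+ q.+1 * b 2%N.
have M0 : 0 <= M by rewrite mulr_ge0 ?exprn_ge0.
have n6 := exprn_ege1 6 N1; have nr := exprn_ege1 kr N1; have nz := exprn_ege1 kz N1.
rewrite !exprD in small *.
have [bz1 [E0 E1] EC [T0 TC]] := defect_arith cz0 r0 cr0 ec1 n6 nr nz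
  (b0 _) (b0 _) M0 small.
rewrite -/bz0 in bz1 E0 E1 EC.
set E := r * N ^+ 6 * (cr * N ^+ kr * (b 0%N + bz0)) in E0 E1 EC.
set T := r * N ^+ 6 * (cr * N ^+ kr * M) in T0 TC.
pose Z := pcomp (zfun q) Y.
have Zx : expands g X Z.1
    (fun t => sAs S * Z.1 t + (pcomp (residual q (sFs S) (sFc S)) Y).1 t)
    (field_integrand joint_diff (fun v => (Y v).1) (zfun q)).
  have Yx v := proj1 (HY v).
  have := @chain_rule _ _ _ g_range _ _ HX _ _ _ (fun j => joint_field_poly _ _) Yx
    _ (polyfun_z R q).
  apply: expands_ext => t _ _; split=> //; exact: field_der_drift.
have Z2 t : 0 <= t -> t <= 1 ->
    Z.2 t = (field_integrand joint_diff (fun v => (Y v).1) (zfun q)).1 t.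
  move=> t0 t1; apply/rowP => l; rewrite !mxE; congr (dirder _ _ _).
  by apply/funext => v; rewrite (proj2 (HY v) t t0 t1) mxE.
have Zj j : peq (pcomp (residual q (sGs S j) (sGc S j)) Y)
    (icomp (field_integrand joint_diff (fun v => (Y v).1) (zfun q)) j).
  move=> t t0 t1; rewrite /icomp /=; split; first by rewrite mxE field_der_joint.
  apply/rowP => l; rewrite !mxE field_der_joint /field_der; congr (dirder _ _ _).
  by apply/funext => v; rewrite (proj2 (HY v) t t0 t1) mxE.
have step bz t1 : bz <= bz0 -> cbound g (rp1 X) Z bz -> 0 <= t1 <= 1 ->
    cbound g (rp1 X) Z (ec * `|Z.1 t1| + (E * bz + T)) /\
    `|Z.1 1 - expR (sAs S) * Z.1 0| <= E * bz + T.
  move=> bzz Hbz t01.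
  have bz_ge0 := cbound_ge0 Hbz.
  have ub : r * N ^+ 6 * (cr * N ^+ kr * (bz * (b 0%N + bz) + M)) <= E * bz + T.
    by apply: defect_arith2 => //; apply: le_trans ler01 _.
  have bB' v : b v <= Num.max B 1 by rewrite le_max bB.
  have bzB : bz <= Num.max B 1 by rewrite le_max (le_trans bzz bz1) orbT.
  have H1 := Hr None X N Y b bz HX Yb bB' ab bzB Hbz.
  have H2 j := cbound_peq (Zj j) (Hr (Some j) X N Y b bz HX Yb bB' ab bzB Hbz).
  have [C1 C2] := rde_bound g_range HX Zx Z2 H1 H2 t01.
  split; last exact: le_trans C2 ub.
  by apply: cbound_le C1; rewrite lerD2l.
have [z0 z1] : 0 <= ec * `|Z.1 0| + T /\ 0 <= (0 : R) <= 1.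
  by split; [rewrite addr_ge0 // mulr_ge0 //; lra|rewrite lexx ler01].
have HZ : cbound g (rp1 X) Z (2 * (ec * `|Z.1 0| + T)).
  apply: (cbound_improve z0 E0 E1 Hz0) => bz bzz Hbz.
  have [C1 _] := step bz 0 bzz Hbz z1.
  by apply: cbound_le C1; rewrite addrA addrAC.
(* The smaller of the a priori and the improved bound, because [step] accepts only bounds up to
   [bz0]. *)
have [bz [bzz Hbz bz2]] : exists bz, [/\ bz <= bz0, cbound g (rp1 X) Z bz &
    bz <= 2 * (ec * `|Z.1 0| + T)].
  have [le|lt] := leP bz0 (2 * (ec * `|Z.1 0| + T)); first by exists bz0.
  by exists (2 * (ec * `|Z.1 0| + T)); split=> //; exact: ltW.
have [_ C2] := step bz 0 bzz Hbz z1.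
exact: (defect_arith3 E0 E1 T0 EC TC bz2 (expR_ge0 _) C2).
Qed.
End DefectEquation.

(** * The coefficients alpha_i as solutions along the noise *)

Section AlphaExpansion.
Context (R : realType) (g : R) (d : nat).
Hypothesis g_range : 1 / 3 < g <= 1 / 2.
Local Notation env := (nat -> R).
Context (disp : measure_display) (Omega : measurableType disp) (P : probability Omega R)
  (theta : R -> Omega -> Omega) (W : Omega -> rough R d).
Hypothesis theta_mds : metric_ds P theta.
Hypothesis W_cocycle : rough_cocycle theta g W.
Context (q : nat) (S : system R d) (alpha : nat -> Omega -> R).
Hypothesis alpha_sol : alpha_ok theta g W q S alpha.

Lemma expands_noise_ext (X X' : rough R d) (Y : R -> R) B Z : rp1 X = rp1 X' ->
  (forall s t, s <= t -> rp2 X s t = rp2 X' s t) ->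
  expands g X Y B Z -> expands g X' Y B Z.
Proof.
move=> E1 E2 [c [H1 H2 H3 H4 H5]]; exists c; split=> // s t s0 st t1.
by have := H5 s t s0 st t1; rewrite /germ E1 (E2 s t st).
Qed.

Lemma defect_coef_eq ps pc i (a a' : env) : (forall v, (2 <= v <= q)%N -> a v = a' v) ->
  defect_coef q ps pc i a = defect_coef q ps pc i a'.
Proof. by move=> E; rewrite /defect_coef (eq_defect_poly _ _ E). Qed.

Lemma dirder_defect_eq ps pc i (a a' b b' : env) :
  (forall v, (2 <= v <= q)%N -> a v = a' v) -> (forall v, (2 <= v <= q)%N -> b v = b' v) ->
  dirder (defect_coef q ps pc i) a b = dirder (defect_coef q ps pc i) a' b'.
Proof.
move=> Ea Eb; rewrite /dirder; congr (derive1 _ 0); apply/funext => h.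
apply: defect_coef_eq => v Hv.
by rewrite Ea // Eb.
Qed.

Lemma alpha_cpath_shift i omega tau :
  alpha_cpath theta q S alpha i omega tau = alpha_cpath theta q S alpha i (theta tau omega) 0.
Proof.
have E t : alpha_at theta alpha omega (t + tau) = alpha_at theta alpha (theta tau omega) (t + 0).
  by apply/funext => k; rewrite /alpha_at (mdsD theta_mds) addr0.
by congr (_, _); apply/funext => t; rewrite /g_path /= E.
Qed.

Definition alpha_env (omega : Omega) (v : nat) : cpath R d :=
  if (2 <= v <= q)%N then alpha_cpath theta q S alpha v omega 0 else 0.

Lemma alpha_env_val omega v t : (2 <= v <= q)%N ->
  alpha_at theta alpha omega t v = (alpha_env omega v).1 t.
Proof. by move=> Hv; rewrite /alpha_env Hv /= addr0. Qed.

(** [poly_bound] asks for a bound uniform in the index; it exists because the paths vanish outside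
    the indices 2 to q. *)
Lemma alpha_env_bounded omega (F : env -> R) : polyfun F ->
  exists b, cbound g (rp1 (W omega)) (pcomp F (alpha_env omega)) b.
Proof.
move=> HF; have HX := cocycle_noise g_range W_cocycle omega.
have /choice[b Hb] : forall v, exists b, cbound g (rp1 (W omega)) (alpha_env omega v) b /\
    ((q < v)%N -> b = 0).
  move=> v; rewrite /alpha_env; case: ifP => Hv.
    have [b bH] := controlled_fin g_range (alpha_controlled alpha_sol omega Hv).
    by exists b; split=> //; case/andP: Hv => _; rewrite leqNgt => /negP.
  by exists 0; split=> //; exact: cbound0.
have b0 v : 0 <= b v := cbound_ge0 (proj1 (Hb v)).
have [k Hk] := @poly_bound_polyfun R g d g_range (fun=> True) F HF.
have [c _ Hc] := Hk (\sum_(v < q.+1) b v).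
exists (c * noise_size g (W omega) ^+ k * 1); apply: Hc HX (fun v => proj1 (Hb v)) _ I => v.
have [vq|vq] := ltnP v q.+1; last by rewrite (proj2 (Hb v)) // sumr_ge0.
by rewrite (bigD1 (Ordinal vq)) //= lerDl sumr_ge0.
Qed.

(** Stationarity expresses alpha_i along the orbit by the variation-of-constants formula started at
    alpha_i(omega), which [conv_expands] recognizes as a solution. *)
Lemma alpha_expands omega i : (2 <= i <= q)%N ->
  expands g (W omega) (alpha_env omega i).1
    (fun t => A_alpha S i * (alpha_env omega i).1 t +
       defect_coef q (sFs S) (sFc S) i (fun v => (alpha_env omega v).1 t))
    (fun t => \row_j defect_coef q (sGs S j) (sGc S j) i (fun v => (alpha_env omega v).1 t),
     fun t => \matrix_(l, j) dirder (defect_coef q (sGs S j) (sGc S j) i)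
       (fun v => (alpha_env omega v).1 t) (fun v => (alpha_env omega v).2 t 0 l)).
Proof.
move=> Hi; have HX := cocycle_noise g_range W_cocycle omega.
set Z := (X in expands _ _ _ _ X).
have HZ j : icomp Z j = pcomp (defect_coef q (sGs S j) (sGc S j) i) (alpha_env omega).
  by congr (_, _); apply/funext => t; [rewrite mxE|apply/rowP => l; rewrite !mxE].
have fE t : f_path theta q S alpha i omega t =
    (pcomp (defect_coef q (sFs S) (sFc S) i) (alpha_env omega)).1 t.
  apply: defect_coef_eq => v Hv.
  exact: alpha_env_val.
have gE : g_path theta q S alpha i omega = Z.
  congr (_, _); apply/funext => t.
    apply/rowP => j; rewrite !mxE; apply: defect_coef_eq => v Hv.
    exact: alpha_env_val.
  apply/matrixP => l j; rewrite !mxE.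
  transitivity (dirder (defect_coef q (sGs S j) (sGc S j) i)
      (alpha_at theta alpha omega t)
      (fun v => g_coef q S v (alpha_at theta alpha omega t) 0 l)).
    by rewrite /dirder; congr (derive1 _ 0); apply/funext => h; rewrite mxE.
  apply: dirder_defect_eq => v Hv; first exact: alpha_env_val.
  by rewrite /alpha_env Hv /= addr0.
have [bF HF] := alpha_env_bounded omega (polyfun_defect q (sFs S) (sFc S) i).
have /choice[bG HG] : forall j, exists b, cbound g (rp1 (W omega)) (icomp Z j) b.
  by move=> j; rewrite HZ; apply: alpha_env_bounded; exact: polyfun_defect.
have bG0 j : 0 <= bG j := cbound_ge0 (HG j).
have bF0 := cbound_ge0 HF.
have HF' : cbound g (rp1 (W omega)) (pcomp (defect_coef q (sFs S) (sFc S) i) (alpha_env omega))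
    (bF + \sum_j bG j) by apply: cbound_le HF; rewrite lerDl sumr_ge0.
have HG' j : cbound g (rp1 (W omega)) (icomp Z j) (bF + \sum_j bG j).
  by apply: cbound_le (HG j); rewrite (bigD1 j) //= addrCA lerDl addr_ge0 // sumr_ge0.
have [J [_ J2 J3]] := conv_expands g_range HX (A_alpha S i) HF' HG'.
apply: (J3 (alpha i omega)) => t t0 t1.
rewrite -alpha_env_val // /alpha_at -(alpha_stationary alpha_sol Hi omega t0).
have E : drift_conv (A_alpha S i) (f_path theta q S alpha i omega) 0 t t +
    rough_conv (W omega) (A_alpha S i) (g_path theta q S alpha i omega) 0 t t =
    expR (A_alpha S i * t) * J 0 t.
  rewrite gE; move/funext: fE => ->; exact: J2.
by apply: etrans (esym (addrA _ _ _)) _; rewrite [RHS]mulrDr; congr (_ + _); exact: E.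
Qed.

End AlphaExpansion.

(** * The joint system on a block *)

Section JointPath.
Context (R : realType) (g : R) (d : nat).
Hypothesis g_range : 1 / 3 < g <= 1 / 2.
Local Notation env := (nat -> R).
Context (disp : measure_display) (Omega : measurableType disp) (P : probability Omega R)
  (theta : R -> Omega -> Omega) (W : Omega -> rough R d).
Hypothesis theta_mds : metric_ds P theta.
Hypothesis W_cocycle : rough_cocycle theta g W.
Context (q : nat) (S : system R d) (alpha : nat -> Omega -> R).
Hypothesis alpha_sol : alpha_ok theta g W q S alpha.

Definition joint_path (U : cpath2 R d) (omega : Omega) (v : nat) : cpath R d :=
  if v is 0%N then U.1 else if v is 1%N then U.2 else alpha_env theta q S alpha omega v.

Lemma solves_joint X p G (V U : cpath2 R d) Y a : ceq V U ->
  solves g X a (fun t => ev2 p (V.1.1 t, V.2.1 t))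
    (fun t => evG G (V.1.1 t, V.2.1 t), fun t => \matrix_(i, j)
      'D_(V.1.2 t 0 i, V.2.2 t 0 i) (ev2 (G j)) (V.1.1 t, V.2.1 t)) Y ->
  forall y : cpath R d, peq Y y ->
  expands g X y.1 (fun t => a * y.1 t + ev2 p (U.1.1 t, U.2.1 t))
    (fun t => evG G (U.1.1 t, U.2.1 t), fun t => \matrix_(i, j)
     'D_(U.1.2 t 0 i, U.2.2 t 0 i) (ev2 (G j)) (U.1.1 t, U.2.1 t)) /\
  forall t, 0 <= t -> t <= 1 -> y.2 t = evG G (U.1.1 t, U.2.1 t).
Proof.
move=> E [H1 H2] y Yy; split.
  apply: expands_ext H1 => t t0 t1; have [y1 y2] := Yy t t0 t1.
  have t01 : 0 <= t <= 1 by rewrite t0.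
  have [e1 e2 e3 e4] := E t t01.
  split; [exact: y1|by rewrite y1 e1 e3|by rewrite /= e1 e3|].
  by apply/matrixP => i j; rewrite !mxE e1 e2 e3 e4.
move=> t t0 t1; have [y1 y2] := Yy t t0 t1.
have t01 : 0 <= t <= 1 by rewrite t0.
have [e1 e2 e3 e4] := E t t01.
by rewrite -y2 H2 //= e1 e3.
Qed.

(** [V] is the image of [U] under the Lyapunov-Perron map and carries the equation. Where the
    truncation is the identity, the equation is the original one, and the alpha_i solve theirs along
    the noise of the shifted point, which agrees with the block noise. *)
Lemma joint_solution_block omega n ch r (U V : cpath2 R d) :
  ceq (chiR ch r U) U -> ceq V U ->
  solves g (block_noise (W omega) n) (sAc S) (FR ch r (sFc S) U) (GR ch r (sGc S) U) V.1 ->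
  solves g (block_noise (W omega) n) (sAs S) (FR ch r (sFs S) U) (GR ch r (sGs S) U) V.2 ->
  joint_solution g q S (block_noise (W omega) n)
    (joint_path U (theta (block_start R n) omega)).
Proof.
move=> EU VU Hc Hs; set om := theta _ _; set Y := joint_path U om.
have P1 : peq V.1 U.1.
  by move=> t t0 t1; have [|-> -> _ _] := VU t _; rewrite ?t0 ?t1.
have P2 : peq V.2 U.2.
  by move=> t t0 t1; have [|_ _ -> ->] := VU t _; rewrite ?t0 ?t1.
have [Ec Dc] := solves_joint EU Hc P1; have [Es Ds] := solves_joint EU Hs P2.
have D2 v t : 0 <= t -> t <= 1 ->
    (Y v).2 t = \row_j joint_diff q S j v (fun u => (Y u).1 t).
  case: v => [|[|v]] t0 t1; [exact: Dc|exact: Ds|].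
  rewrite /Y /joint_path /alpha_env; case: ifP => Hv; last first.
    by apply/rowP => j; rewrite !mxE /joint_diff /joint_field; move: Hv => /= ->.
  apply/rowP => j; rewrite !mxE /joint_diff /joint_field; move: (Hv) => /= ->.
  rewrite addr0; apply: defect_coef_eq => -[|[|u]] // Hu.
  exact: alpha_env_val.
move=> v; split=> [|t t0 t1]; last exact: D2.
case: v => [|[|v]].
- apply: expands_ext Ec => t t0 t1; split=> //.
  apply/matrixP => i j; rewrite !mxE; apply: dirder_ev2 => //.
    by have := D2 0%N t t0 t1; move=> /rowP/(_ i) /=; rewrite !mxE => <-.
  by have := D2 1%N t t0 t1; move=> /rowP/(_ i) /=; rewrite !mxE => <-.
- apply: expands_ext Es => t t0 t1; split=> //.
  apply/matrixP => i j; rewrite !mxE; apply: dirder_ev2 => //.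
    by have := D2 0%N t t0 t1; move=> /rowP/(_ i) /=; rewrite !mxE => <-.
  by have := D2 1%N t t0 t1; move=> /rowP/(_ i) /=; rewrite !mxE => <-.
- have [Hv|Hv] := boolP (2 <= v.+2 <= q)%N; last first.
    have vq : (v.+2 <= q)%N = false by apply/negbTE.
    apply: expands_ext (expands0 g_range (block_noise (W omega) n)) => t _ _.
    rewrite /Y /joint_path /alpha_env (negbTE Hv) /joint_drift /joint_diff /joint_field vq.
    split=> //; first by apply/rowP => j; rewrite !mxE.
    by apply/matrixP => i j; rewrite !mxE /field_der dirder_cst.
  have Hv' : (v.+2 <= q)%N by [].
  have E1 : rp1 (W om) = rp1 (block_noise (W omega) n).
    by rewrite (block_noise1 W_cocycle).
  apply: (@expands_noise_ext _ _ _ (W om)) => // [s t st|].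
    by rewrite (block_noise2 theta_mds W_cocycle).
  have := alpha_expands g_range W_cocycle alpha_sol om Hv.
  apply: expands_ext => t t0 t1; rewrite /joint_drift /joint_diff /joint_field Hv'.
  have A u : (2 <= u <= q)%N -> (alpha_env theta q S alpha om u).1 t = (Y u).1 t.
    by case: u => [|[|u]].
  have eD ps pc : defect_coef q ps pc v.+2 (fun u => (alpha_env theta q S alpha om u).1 t) =
      defect_coef q ps pc v.+2 (fun u => (Y u).1 t).
    exact: defect_coef_eq.
  split=> //.
  + by rewrite eD.
  + by apply/rowP => j; rewrite !mxE eD.
  + apply/matrixP => l j; rewrite !mxE; apply: dirder_defect_eq => // -[|[|u]] // Hu.
    by have := D2 u.+2 t t0 t1; move=> /rowP/(_ l) /=; rewrite !mxE => <-.
Qed.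

End JointPath.

(** * Temperedness and measurability *)

Section Tempered.
Context (R : realType) (disp : measure_display) (Omega : measurableType disp)
  (P : probability Omega R) (theta : R -> Omega -> Omega).
Hypothesis theta_mds : metric_ds P theta.
Implicit Types (Z : Omega -> R) (omega : Omega).

(** A working form of temperedness whose constant is valid for all times, including those near 0,
    where the defining limit gives no control. *)
Definition subexponential Z := forall omega (delta : R), 0 < delta ->
  exists2 C : R, 1 <= C & forall t, Z (theta t omega) <= C * expR (delta * `|t|).

Lemma ln_rate (x C delta t : R) : 0 < x -> 1 <= C -> 0 < delta ->
  x <= C * expR (delta * `|t|) -> ln C / delta <= `|t| -> 0 < `|t| ->
  Num.max 0 (ln x) / `|t| <= 2 * delta.
Proof.
move=> x0 C1 d0 xC Ct t0; rewrite ler_pdivrMr // ge_max.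
have C0 : 0 < C by lra.
have h1 : ln x <= ln C + delta * `|t|.
  by rewrite -[delta * _]expRK -lnM ?posrE ?expR_gt0 // ler_ln ?posrE // mulr_gt0 ?expR_gt0.
have h2 : ln C <= `|t| * delta by rewrite -ler_pdivrMr.
by apply/andP; split; nra.
Qed.

Lemma subexponential_tempered Z : (forall omega, 0 < Z omega) ->
  subexponential Z -> tempered_above theta Z.
Proof.
move=> Z0 HZ omega.
have key (e : R) : 0 < e -> exists2 M : R, 0 < M & forall t, M <= `|t| ->
    `|0 - Num.max 0 (ln (Z (theta t omega))) / `|t| | <= e.
  move=> e0; have e2 : 0 < e / 2 by rewrite divr_gt0.
  have [C C1 HC] := HZ omega _ e2.
  have C0 : 0 <= ln C by rewrite ln_ge0.
  exists (1 + ln C / (e / 2)) => [|t Mt].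
    by rewrite ltr_wpDr // divr_ge0 // ltW.
  have d0 : 0 <= ln C / (e / 2) by rewrite divr_ge0 // ltW.
  have t0 : 0 < `|t| by lra.
  rewrite sub0r normrN ger0_norm; last by rewrite divr_ge0 // le_max lexx.
  have := ln_rate (Z0 _) C1 e2 (HC t) _ t0.
  by rewrite [2 * _]mulrC divfK // => -> //; lra.
split; apply/cvgrPdist_le => e e0; have [M M0 HM] := key e e0.
  exists M; split; first exact: num_real.
  by move=> x Mx; apply: HM; rewrite (le_trans (ltW Mx)) // ler_norm.
exists (- M); split; first exact: num_real.
move=> x Mx; apply: HM; rewrite -normrN; apply: le_trans (ler_norm _).
by rewrite lerNr ltW.
Qed.

(** The limit takes care of large times; boundedness on compact sets of times covers the rest. *)
Lemma tempered_subexponential Z : (forall omega, 1 <= Z omega) ->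
  tempered_above theta Z ->
  (forall omega (T : R), 0 < T -> exists B, forall t, `|t| <= T -> Z (theta t omega) <= B) ->
  subexponential Z.
Proof.
move=> Z1 HZ HB omega delta d0.
have [/cvgrPdist_le/(_ delta d0) Hp /cvgrPdist_le/(_ delta d0) Hn] := HZ omega.
have [M1 [_ H1]] := Hp; have [M2 [_ H2]] := Hn.
pose T := 1 + `|M1| + `|M2|.
have T0 : 0 < T by rewrite /T; have := normr_ge0 M1; have := normr_ge0 M2; lra.
have [B HBt] := HB omega T T0.
exists (1 + `|B|) => [|t]; first by rewrite lerDl.
have E1 : 1 <= expR (delta * `|t|).
  by rewrite -[leLHS]expR0 ler_expR mulr_ge0 // ltW.
have [tT|tT] := leP `|t| T.
  have := HBt t tT; have := ler_norm B; have := normr_ge0 B; nra.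
have t0 : 0 < `|t| by lra.
have H : `|0 - Num.max 0 (ln (Z (theta t omega))) / `|t| | <= delta.
  have m1 := ler_norm M1; have m2 := ler_norm (- M2).
  rewrite normrN in m2.
  have n1 := normr_ge0 M1; have n2 := normr_ge0 M2.
  have [tp|tn] := leP 0 t.
    by apply: H1; move: tT; rewrite /T (ger0_norm tp); lra.
  by apply: H2; move: tT; rewrite /T (ltr0_norm tn); lra.
have Zp : 0 < Z (theta t omega) by apply: lt_le_trans (Z1 _).
have L : Z (theta t omega) <= expR (delta * `|t|).
  rewrite -[leLHS]lnK ?posrE // ler_expR.
  move: H; rewrite sub0r normrN ger0_norm; last by rewrite divr_ge0 // le_max lexx.
  rewrite ler_pdivrMr //; apply: le_trans.
  by rewrite le_max lexx orbT.
apply: le_trans L _; rewrite ler_peMl ?expR_ge0 //.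
by rewrite lerDl.
Qed.

Lemma subexponential_power Z (c : R) p : (forall omega, 1 <= Z omega) -> 1 <= c ->
  subexponential Z -> subexponential (fun omega => c * Z omega ^+ p).
Proof.
move=> Z1 c1 HZ omega delta d0.
(* The rate is divided by p + 1 so that p = 0 is included. *)
have p0 : 0 < (p.+1)%:R :> R by [].
have [C C1 HC] := HZ omega (delta / p.+1%:R) (divr_gt0 d0 p0).
exists (c * C ^+ p) => [|t].
  by rewrite -[leLHS]mulr1 ler_pM // exprn_ege1.
rewrite -mulrA; apply: ler_wpM2l; first by lra.
have Z0 : 0 <= Z (theta t omega) by apply: le_trans (Z1 _).
apply: le_trans (_ : (C * expR (delta / p.+1%:R * `|t|)) ^+ p <= _).
  apply: lerXn2r; rewrite ?nnegrE //.
  by rewrite mulr_ge0 ?expR_ge0 //; lra.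
rewrite exprMn ler_wpM2l //; first by rewrite exprn_ge0 //; lra.
rewrite -expRM_natl ler_expR mulrA ler_wpM2r // mulrCA.
by rewrite ler_piMr ?(ltW d0) // ler_pdivrMr // mul1r ler_nat.
Qed.

Lemma measurable_of_le (f : Omega -> R) :
  (forall b, measurable [set omega | f omega <= b]) -> measurable_fun setT f.
Proof.
move=> H; apply: (measurability _ (RGenOInfty.measurableE R)).
move=> _ [_ [x ->] <-]; rewrite setTI.
rewrite (_ : _ @^-1` _ = ~` [set omega | f omega <= x]); first exact: measurableC.
apply/seteqP; split => omega /=; rewrite in_itv /= andbT.
  by move=> xf; apply/negP; rewrite -ltNge.
by move/negP; rewrite -ltNge.
Qed.

Lemma measurable_le_set (f : Omega -> R) b : measurable_fun setT f ->
  measurable [set omega | f omega <= b].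
Proof.
move=> mf; rewrite (_ : [set _ | _] = setT `&` f @^-1` `]-oo, b]%classic).
  exact: mf.
by rewrite setTI; apply/seteqP; split => omega /=; rewrite in_itv.
Qed.

(** The supremum is described through its upper bounds, so that its sublevel sets are countable
    intersections. *)
Lemma measurable_countable_sup (I : countType) (f : Omega -> R) (u : I -> Omega -> R) :
  (forall omega b, f omega <= b <-> forall i, u i omega <= b) ->
  (forall i, measurable_fun setT (u i)) -> measurable_fun setT f.
Proof.
move=> fu mu; apply: measurable_of_le => b.
rewrite (_ : [set _ | _] = \bigcap_n
    (if unpickle n is Some i then [set omega | u i omega <= b] else setT)).
  apply: bigcapT_measurable => n; case: unpickle => [i|//].
  exact: measurable_le_set.
apply/seteqP; split => omega /=.
  by move/fu => H n _; case: unpickle => //= i; exact: H.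
move=> H; apply/fu => i; by have := H (pickle i) Logic.I; rewrite pickleK.
Qed.

Lemma measurable_theta t : measurable_fun setT (theta t).
Proof.
apply: (@measurableT_comp _ _ _ _ _ _ (fun z : measurableTypeR R * Omega => theta z.1 z.2)
  _ (fun omega => (t, omega))); first exact: mds_meas theta_mds.
exact: pair1_measurable.
Qed.

(** [s] is the supremum of 1 and of e^{- e (n + 1)} Z at the starts of the past blocks. It bounds
    the noise on all blocks by one tempered variable times a slowly growing weight; [rho] is built
    from it. *)
Lemma orbit_sup Z (e : R) : 0 < e -> (forall omega, 1 <= Z omega) ->
  measurable_fun setT Z -> subexponential Z ->
  exists s : Omega -> R, [/\ measurable_fun setT s, forall omega, 1 <= s omega,
    subexponential s &
    forall omega n, Z (theta (block_start R n) omega) <= s omega * expR (e * n.+1%:R)].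
Proof.
move=> e0 Z1 mZ HZ.
pose u n omega : R := if n is m.+1 then
  expR (- (e * m.+1%:R)) * Z (theta (block_start R m) omega) else 1.
have ub omega C delta : 1 <= C -> 0 <= delta -> delta <= e -> forall t,
    (forall s, Z (theta s omega) <= C * expR (delta * `|s|)) ->
    forall n, u n (theta t omega) <= C * expR (delta * `|t|).
  move=> C1 d0 de t HC [|n] /=.
    by rewrite -[leLHS]mulr1 ler_pM // -[leLHS]expR0 ler_expR mulr_ge0.
  rewrite -(mdsD theta_mds).
  apply: le_trans (ler_wpM2l (expR_ge0 _) (HC _)) _.
  rewrite mulrCA ler_wpM2l //; first by lra.
  rewrite -expRD ler_expR.
  have h1 : `|block_start R n + t| <= n.+1%:R + `|t|.
    apply: le_trans (ler_normD _ _) _.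
    by rewrite /block_start normrN normr_nat.
  have n0 : 0 <= n.+1%:R :> R by [].
  have h2 := ler_wpM2l d0 h1; have h3 := ler_wpM2r n0 de.
  by rewrite mulrDr in h2; lra.
have hs omega : has_sup (range (u^~ omega)).
  split; first by exists 1, 0%N.
  have [C C1 HC] := HZ omega e e0.
  exists (C * expR (e * `|0 : R|)) => _ [n _ <-].
  by have := ub omega C e C1 (ltW e0) (lexx e) 0 HC n; rewrite (mds0 theta_mds).
have us omega n : u n omega <= sup (range (u^~ omega)).
  by apply: ub_le_sup; [case: (hs omega)|exists n].
exists (fun omega => sup (range (u^~ omega))); split.
- apply: (@measurable_countable_sup nat _ u) => [omega b|[|n]].
  + split=> [H n|H]; first exact: le_trans (us omega n) H.
    by apply: ge_sup => [|_ [n _ <-]//]; case: (hs omega).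
  + exact: measurable_cst.
  + apply: measurable_funM; first exact: measurable_cst.
    by apply: measurableT_comp => //; exact: measurable_theta.
- by move=> omega; exact: (us omega 0%N).
(* The weight in [u] compensates growth up to the rate e only, so a larger delta is replaced by
   e. *)
- move=> omega delta d0; have d1 : 0 < Num.min delta e by rewrite lt_min d0.
  have [C C1 HC] := HZ omega _ d1; exists C => // t.
  have de : Num.min delta e <= e by rewrite ge_min lexx orbT.
  apply: le_trans (_ : C * expR (Num.min delta e * `|t|) <= _).
    apply: ge_sup => [|_ [n _ <-]]; first by case: (hs (theta t omega)).
    exact: ub (ltW d1) de t HC n.
  rewrite ler_wpM2l //; first by lra.
  by rewrite ler_expR ler_wpM2r // ge_min lexx.
- move=> omega n; have /= := us omega n.+1.
  by rewrite expRN mulrC ler_pdivrMr ?expR_gt0.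
Qed.

Lemma power_radius Z (kappa : R) p : 0 < kappa -> kappa <= 1 ->
  (forall omega, 1 <= Z omega) -> measurable_fun setT Z -> subexponential Z ->
  tempered_radius theta (fun omega => kappa / Z omega ^+ p).
Proof.
move=> k0 k1 Z1 mZ HZ.
have Zp omega : 1 <= Z omega ^+ p by exact: exprn_ege1.
have Zp0 omega : 0 < Z omega ^+ p by apply: lt_le_trans (Zp omega).
split.
- apply: measurable_of_le => b.
  have [b0|b0] := leP b 0.
    rewrite (_ : [set _ | _] = set0) //; apply/seteqP; split => // omega /=.
    by move=> H; have := lt_le_trans (divr_gt0 k0 (Zp0 omega)) (le_trans H b0); rewrite ltxx.
  rewrite (_ : [set _ | _] = [set omega | - (Z omega ^+ p) <= - (kappa / b)]).
    apply: measurable_le_set; apply: measurableT_comp => //.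
    exact: measurable_funX.
  apply/seteqP; split => omega /=; by rewrite lerN2 !ler_pdivrMr // mulrC.
- by move=> omega; rewrite divr_gt0 //= ler_pdivrMr // mul1r (le_trans k1).
- have H := @subexponential_power Z kappa^-1 p Z1 _ HZ.
  rewrite /tempered_below (_ : (fun omega => _) = (fun omega => kappa^-1 * Z omega ^+ p)); last first.
    by apply/funext => omega; rewrite invf_div mulrC.
  apply: subexponential_tempered; last by apply: H; rewrite invf_ge1.
  by move=> omega; rewrite mulr_gt0 ?invr_gt0.
Qed.

End Tempered.

(** * Measurability and temperedness of the noise size *)

Section NoiseSize.
Context (R : realType) (d : nat) (g : R).
Hypothesis g_range : 1 / 3 < g <= 1 / 2.
Local Notation h := (hpow g).

Lemma fine_le_real (x : \bar R) (b : R) : (0 <= x)%E -> (x < +oo)%E ->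
  fine x <= b <-> (x <= b%:E)%E.
Proof.
move=> x0 xo; rewrite -[X in (X <= _)%E]fineK ?ge0_fin_numE //.
Qed.

Lemma hpow_small (e : R) : 0 < e -> exists2 delta : R, 0 < delta &
  forall s t, s <= t -> t <= s + delta -> h s t <= e.
Proof.
move=> e0; exists (e `^ g^-1); first exact: powR_gt0.
have g0 := gamma_gt0 g_range.
move=> s t st te; rewrite -[leRHS]powRr1 ?(ltW e0) // -(mulVf (lt0r_neq0 g0)) powRrM.
apply: ge0_ler_powR; rewrite ?nnegrE ?powR_ge0 ?subr_ge0 ?(ltW g0) //.
by rewrite lerBlDl.
Qed.

Section Rational.
Context (m n : nat) (f : R -> R -> 'M[R]_(m, n)) (al K : R).
Hypothesis al0 : 0 <= al.
Hypothesis K0 : 0 <= K.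
Hypothesis f_near : forall s s' t' t i j, 0 <= s -> s <= s' -> s' <= t' -> t' <= t ->
  t <= 1 -> `|f s t i j - f s' t' i j| <= K * (h s s' + h t' t).

Lemma holder2_rational b : 0 <= b ->
  (forall (p q : rat) i j, 0 <= ratr p :> R -> (ratr p : R) < ratr q -> ratr q <= 1 :> R ->
    `|f (ratr p) (ratr q) i j| <= b * (ratr q - ratr p) `^ al) ->
  (holder2 0 1 al f <= b%:E)%E.
Proof.
move=> b0 H; apply/holder2_leP => s t s0 st t1.
apply/mx_norm_leP => [|i j]; first by rewrite mulr_ge0 ?powR_ge0.
apply/ler_addgt0Pr => e e0.
pose e' := e / (2 * K + 1).
have K1 : 0 < 2 * K + 1 by rewrite ltr_wpDl // mulr_ge0.
have e'0 : 0 < e' by rewrite divr_gt0.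
have [delta d0 Hd] := hpow_small e'0.
have [p] : exists p : rat, ratr p \in `]s, (Num.min (s + delta) ((s + t) / 2))[.
  by apply: rat_in_itvoo; rewrite lt_min ltrDl d0 /=; lra.
rewrite in_itv /= lt_min => /andP[sp /andP[pd pm]].
have [r] : exists r : rat, ratr r \in `](Num.max (t - delta) ((s + t) / 2)), t[.
  by apply: rat_in_itvoo; rewrite gt_max ltrBlDr ltrDl d0 /=; lra.
rewrite in_itv /= gt_max => /andP[/andP[rd rm] rt].
have pr : (ratr p : R) < ratr r by lra.
have p0 : 0 <= ratr p :> R by lra.
have r1 : ratr r <= 1 :> R by lra.
have F := f_near i j s0 (ltW sp) (ltW pr) (ltW rt) t1.
have h1 := Hd s (ratr p) (ltW sp) (ltW pd).
have h2 : h (ratr r) t <= e' by apply: (Hd _ _ (ltW rt)); rewrite -lerBlDr ltW.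
have E : K * (h s (ratr p) + h (ratr r) t) <= e.
  apply: le_trans (_ : K * (e' + e') <= _).
    by apply: ler_wpM2l => //; exact: lerD.
  have -> : e = (2 * K + 1) * e' by rewrite mulrC divfK // gt_eqF.
  nra.
have G : `|f s t i j| <= `|f (ratr p) (ratr r) i j| + e.
  rewrite -[f s t i j](subrK (f (ratr p) (ratr r) i j)) addrC.
  by apply: le_trans (ler_normD _ _) _; rewrite lerD2l (le_trans F).
apply: le_trans G _; rewrite lerD2r.
apply: le_trans (H p r i j p0 pr r1) _; rewrite ler_wpM2l //.
by apply: ge0_ler_powR; rewrite ?nnegrE //; lra.
Qed.

End Rational.

Context (disp : measure_display) (Omega : measurableType disp).

Lemma measurable_holder2 (m n : nat) (f : Omega -> R -> R -> 'M[R]_(m, n)) (al : R)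
    (K : Omega -> R) : 0 <= al -> (forall omega, 0 <= K omega) ->
  (forall omega s s' t' t i j, 0 <= s -> s <= s' -> s' <= t' -> t' <= t -> t <= 1 ->
    `|f omega s t i j - f omega s' t' i j| <= K omega * (h s s' + h t' t)) ->
  (forall omega, (holder2 0 1 al (f omega) < +oo)%E) ->
  (forall s t i j, s <= t -> measurable_fun setT (fun omega => f omega s t i j)) ->
  measurable_fun setT (fun omega => fine (holder2 0 1 al (f omega))).
Proof.
move=> al0 K0 fK fin mf.
pose u (x : option (rat * rat * ('I_m * 'I_n))) omega : R :=
  if x is Some (p, r, (i, j)) then
    if [&& 0 <= ratr p :> R, (ratr p : R) < ratr r & ratr r <= 1 :> R] then
      `|f omega (ratr p) (ratr r) i j| * ((ratr r - ratr p) `^ al)^-1 else 0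
  else 0.
apply: (@measurable_countable_sup _ _ _ _ _ u) => [omega b|[[[p r] [i j]]|]].
- rewrite (fine_le_real _ (holder2_ge0 _ _) (fin omega)); split=> [H x|H].
    have b0 : 0 <= b by rewrite -lee_fin (le_trans (holder2_ge0 _ _) H).
    case: x => [[[p r] [i j]]|] //=; case: ifP => // /and3P[p0 pr r1].
    rewrite ler_pdivrMr ?powR_gt0 ?subr_gt0 //.
    have b1 : 0 <= b * (ratr r - ratr p) `^ al by rewrite mulr_ge0 ?powR_ge0.
    apply: (mx_norm_leP _ b1).1; move/holder2_leP: H; exact.
  apply: (holder2_rational al0 (K0 omega) (fK omega)); first exact: (H None).
  move=> p r i j p0 pr r1; have := H (Some (p, r, (i, j))); rewrite /u p0 pr r1 /=.
  by rewrite ler_pdivrMr ?powR_gt0 ?subr_gt0.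
- rewrite /u; have := @and3P (0 <= ratr p :> R) ((ratr p : R) < ratr r) (ratr r <= 1 :> R).
  case: [&& _, _ & _] => /elimT; last by move=> _; exact: measurable_cst.
  case=> // _ /ltW pr _.
  apply: measurable_funM; last exact: measurable_cst.
  by apply: measurableT_comp => //; exact: mf.
- exact: measurable_cst.
Qed.

Context (P : probability Omega R) (theta : R -> Omega -> Omega) (W : Omega -> rough R d).
Hypothesis theta_mds : metric_ds P theta.
Hypothesis W_cocycle : rough_cocycle theta g W.

Lemma noise_size_ge1 omega : 1 <= noise_size g (W omega).
Proof. exact: noise_ge1 (cocycle_noise g_range W_cocycle omega). Qed.

Lemma measurable_noise_size : measurable_fun setT (fun omega => noise_size g (W omega)).
Proof.
have HN omega := cocycle_noise g_range W_cocycle omega.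
have g0 := gamma_gt0 g_range.
have f1 omega := holder2_sub (rough_holder1 (coc_rough W_cocycle omega) ltr01).
have f2 omega := holder2_sub (rough_holder2 (coc_rough W_cocycle omega) ltr01).
(* The square comes from Chen's relation, which expresses the change of the second level through
   products of increments. *)
pose K omega := noise_size g (W omega) + noise_size g (W omega) ^+ 2.
have N1 := noise_size_ge1.
have K0 omega : 0 <= K omega.
  by rewrite /K addr_ge0 ?sqr_ge0 // (le_trans ler01).
apply: measurable_funD; first (apply: measurable_funD; first exact: measurable_cst).
- apply: (measurable_holder2 (ltW g0) K0) => [omega s s' t' t i j s0 ss st tt t1|//|s t i j st].
    have s'0 : 0 <= s' by lra.
    have t'0 : 0 <= t' by lra.
    have s'1 : s' <= 1 by lra.
    rewrite ord1.
    have n1 := noise1 (HN omega) j s0 ss s'1; have n2 := noise1 (HN omega) j t'0 tt t1.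
    rewrite (_ : _ - _ = incr (rp1 (W omega)) s s' 0 j + incr (rp1 (W omega)) t' t 0 j).
      apply: le_trans (ler_normD _ _) _; apply: le_trans (lerD n1 n2) _.
      rewrite -mulrDr ler_wpM2r ?addr_ge0 ?hpow_ge0 //.
      by rewrite /K lerDl sqr_ge0.
    by rewrite /incr !mxE; ring.
  rewrite ord1 (_ : (fun _ => _) = fun omega => rp1 (W omega) t 0 j - rp1 (W omega) s 0 j).
    by apply: measurable_funB; exact: (coc_meas1 W_cocycle).
  by apply/funext => omega; rewrite /incr !mxE.
- have g20 : 0 <= 2 * g by lra.
  apply: (measurable_holder2 g20 K0) => [omega s s' t' t i j s0 ss st tt t1|//|s t i j st].
    have s'0 : 0 <= s' by lra.
    have t'0 : 0 <= t' by lra.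
    have s'1 : s' <= 1 by lra.
    have t'1 : t' <= 1 by lra.
    have s't : s' <= t by lra.
    rewrite (noise_chen (HN omega) i j s0 ss s't t1).
    rewrite (noise_chen (HN omega) i j s'0 st tt t1).
    have n1 := noise1 (HN omega) i s0 ss s'1; have n2 := noise1 (HN omega) j t'0 tt t1.
    have n3 := noise1 (HN omega) j s'0 s't t1; have n4 := noise1 (HN omega) i s'0 st t'1.
    have n5 := noise2 (HN omega) i j s0 ss s'1; have n6 := noise2 (HN omega) i j t'0 tt t1.
    have l1 : h s s' <= 1 by apply: hpow_le1.
    have l2 : h t' t <= 1 by apply: hpow_le1.
    have l3 : h s' t <= 1 by apply: hpow_le1.
    have l4 : h s' t' <= 1 by apply: hpow_le1.
    move: n1 n2 n3 n4 n5 n6 l1 l2 l3 l4 (hpow_ge0 g s s') (hpow_ge0 g t' t)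
      (hpow_ge0 g s' t) (hpow_ge0 g s' t') (N1 omega).
    rewrite /K; set a1 := incr (rp1 (W omega)) s s' 0 i; set a2 := incr (rp1 (W omega)) t' t 0 j.
    set a3 := incr (rp1 (W omega)) s' t 0 j; set a4 := incr (rp1 (W omega)) s' t' 0 i.
    set c1 := rp2 (W omega) s s' i j; set c2 := rp2 (W omega) t' t i j; set c3 := rp2 (W omega) s' t' i j.
    set M := noise_size g (W omega).
    move: a1 a2 a3 a4 c1 c2 c3 M (h s s') (h t' t) (h s' t) (h s' t').
    move=> a1 a2 a3 a4 c1 c2 c3 M x y z w n1 n2 n3 n4 n5 n6 l1 l2 l3 l4 x0 y0 z0 w0 M1.
    have M0 : 0 <= M by lra.
    rewrite (_ : _ - c3 = c1 + c2 + a1 * a3 + a4 * a2); last by ring.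
    apply: le_trans (ler_normD _ _) _.
    apply: le_trans (lerD (ler_normD _ _) (lexx _)) _.
    apply: le_trans (lerD (lerD (ler_normD _ _) (lexx _)) (lexx _)) _.
    rewrite !normrM.
    have m1 : `|a1| * `|a3| <= (M * x) * (M * 1).
      apply: ler_pM => //; apply: le_trans n3 _; exact: ler_wpM2l.
    have m2 : `|a4| * `|a2| <= (M * 1) * (M * y).
      apply: ler_pM => //; apply: le_trans n4 _; exact: ler_wpM2l.
    have m3 : M * x ^+ 2 <= M * x by rewrite ler_wpM2l // expr2 ler_piMr.
    have m4 : M * y ^+ 2 <= M * y by rewrite ler_wpM2l // expr2 ler_piMr.
    rewrite mulr1 in m1; rewrite mulr1 in m2.
    apply: le_trans (lerD (lerD (lerD (le_trans n5 m3) (le_trans n6 m4)) m1) m2) _.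
    by rewrite le_eqVlt; apply/orP; left; apply/eqP; ring.
  exact: (coc_meas2 W_cocycle).
Qed.

(** For |t| <= T the noise on [t, t + 1] is part of the noise on [- T - 1, T + 1], which bounds the
    noise size on compact pieces of an orbit. *)
Lemma noise_size_subexponential :
  subexponential theta (fun omega => noise_size g (W omega)).
Proof.
apply: tempered_subexponential; [exact: noise_size_ge1|exact: coc_tempered W_cocycle|].
move=> omega T T0; have T1 : 0 < T + 1 by lra.
have [b1 b10 /holder2_leP H1] := holder2_fin (rough_holder1 (coc_rough W_cocycle omega) T1).
have [b2 b20 /holder2_leP H2] := holder2_fin (rough_holder2 (coc_rough W_cocycle omega) T1).
exists (1 + b1 + b2) => t; rewrite ler_norml => /andP[t1 t2].
have f1 := holder2_sub (rough_holder1 (coc_rough W_cocycle (theta t omega)) ltr01).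
have f2 := holder2_sub (rough_holder2 (coc_rough W_cocycle (theta t omega)) ltr01).
rewrite /noise_size; apply: lerD; first apply: lerD => //.
- apply/(fine_le_real _ (holder2_ge0 _ _) f1)/holder2_leP => x y x0 xy y1.
  rewrite -(cocycle_shift1 W_cocycle) (_ : y - x = (y + t) - (x + t)); last by ring.
  by apply: H1; lra.
- apply/(fine_le_real _ (holder2_ge0 _ _) f2)/holder2_leP => x y x0 xy y1.
  rewrite -(cocycle_shift2 theta_mds W_cocycle _ _ (ltW xy)).
  rewrite (_ : y - x = (y + t) - (x + t)); last by ring.
  by apply: H2; lra.
Qed.

End NoiseSize.

(** * Approximation of the centre manifold *)

Section LinearPart.
Context (R : realType).

Lemma spectrum_real (a : R) (P : R[i] -> Prop) : spectrum_in a P -> P (real_complex R a).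
Proof.
move=> H; apply: H; apply/eigenvalueP; exists 1%:M.
  by rewrite mul1mx scalemx1.
by apply/eqP => /matrixP/(_ 0 0); rewrite !mxE /= => /eqP; rewrite oner_eq0.
Qed.

Lemma linear_center Ac As Mc Ms nu beta : linear_ok Ac As Mc Ms nu beta -> Ac = 0 :> R.
Proof. by case=> /spectrum_real. Qed.

Lemma linear_stable Ac As Mc Ms nu beta : linear_ok Ac As Mc Ms nu beta -> As <= - beta :> R.
Proof.
case=> _ _ [_ Ms1] _ _ Hs; rewrite leNgt; apply/negP => lt.
pose k := As + beta; have k0 : 0 < k by rewrite /k; lra.
(* At time Ms / k the assumed decay would give e^Ms <= Ms, contrary to e^Ms >= 1 + Ms. *)
have t0 : 0 <= Ms / k by rewrite divr_ge0 ?ltW //; lra.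
have := Hs (Ms / k) 1 t0; rewrite mulr1 normr1 mulr1 ger0_norm ?expR_ge0 //.
rewrite mulNr expRN ler_pdivlMr ?expR_gt0 // -expRD -mulrDl -/k mulrCA divff ?gt_eqF // mulr1.
by have := expR_ge1Dx Ms; lra.
Qed.

End LinearPart.

Section FlatNonlinearities.
Context (R : realType) (d : nat).

Lemma drift_flat m q (p : {poly {poly R}}) : drift_ok m q p -> flat2 p.
Proof. by case=> _ _ H0 HD _; split. Qed.

Lemma diffusion_flat m q (G : 'I_d -> {poly {poly R}}) k : diffusion_ok m q G -> flat2 (G k).
Proof.
move=> HG; have E0 := diff_0 HG; have D0 := diff_D0 HG.
have S : forall x, differentiable (evG G) x.
  by have := diff_smooth HG; rewrite addn3 /= => -[].
split=> [|v]; first by have /rowP/(_ k) := E0; rewrite !mxE.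
have dv : derivable (evG G) 0 v by apply: diff_derivable; exact: S.
have /rowP/(_ k) := D0 v; rewrite (derive_mx dv) !mxE => <-.
by congr ('D_v _ 0); apply/funext => z; rewrite mxE.
Qed.

End FlatNonlinearities.

(** * Iteration over blocks and the number of blocks *)

Section Recurrence.
Context (R : realType).

(** The factor r^2 gained per block beats the growth r^-1 of the source and leaves a geometric
    series of ratio r. *)
Lemma recurrence_bound (u : nat -> R) (r A : R) N : 0 < r -> r < 1 -> 0 <= A ->
  (forall n, (n < N)%N -> u n <= r ^+ 2 * u n.+1 + A * r^-1 ^+ n.+1) ->
  u 0%N <= r ^+ (2 * N) * u N + A * r^-1 / (1 - r).
Proof.
move=> r0 r1 A0; have r10 : 0 < 1 - r by rewrite subr_gt0.
have ri0 : 0 <= r^-1 by rewrite invr_ge0 ltW.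
have AA : 0 <= A * r^-1 by exact: mulr_ge0.
suff H : (forall n, (n < N)%N -> u n <= r ^+ 2 * u n.+1 + A * r^-1 ^+ n.+1) ->
    u 0%N <= r ^+ (2 * N) * u N + A * r^-1 * ((1 - r ^+ N) / (1 - r)).
  move/H => {}H; apply: le_trans H _; rewrite lerD2l ler_wpM2l //.
  by rewrite -[leRHS]mul1r ler_wpM2r ?invr_ge0 ?(ltW r10) // lerBlDr lerDl exprn_ge0 // ltW.
elim: N => [_|N IH H].
  by rewrite muln0 expr0 mul1r subrr mul0r mulr0 addr0.
have {}IH := IH (fun n nN => H n (ltnW nN)).
have rN : 0 <= r ^+ (2 * N) by rewrite exprn_ge0 // ltW.
apply: le_trans IH _; have := ler_wpM2l rN (H N (ltnSn N)).
rewrite mulrDr mulrA -exprD mulnS addnC => h.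
have E : r ^+ (2 * N) * (A * r^-1 ^+ N.+1) = A * r^-1 * r ^+ N.
  rewrite mul2n -addnn exprD exprVn exprS; field.
  by rewrite expf_neq0 gt_eqF.
rewrite E in h.
have E2 : (1 - r ^+ N.+1) / (1 - r) = (1 - r ^+ N) / (1 - r) + r ^+ N.
  by rewrite exprSr; field; rewrite gt_eqF.
rewrite E2 mulrDr; move: h; set x := r ^+ _ * u N; lra.
Qed.

(** N is the integer part of ln(Lam / x) / th, the last n with x e^{th n} <= Lam; hence e^{- th N}
    <= e^th x / Lam. The square of Lam in the assumption gives (x / Lam)^2 <= x, which is why the
    exponent has a factor 2. *)
Lemma horizon (x Lam th : R) q : 0 < x -> 0 < Lam -> Lam <= 1 -> 0 < th ->
  x <= Lam ^+ 2 * expR (- th) ->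
  exists N, [/\ (0 < N)%N, x * expR (th * N%:R) <= Lam &
    expR (- th * (2 * q.+1 * N)%:R) <= expR (th * (2 * q.+1)%:R) * x ^+ q.+1].
Proof.
move=> x0 L0 L1 t0 xL.
have Lx0 : 0 < Lam / x by rewrite divr_gt0.
pose v := ln (Lam / x) / th.
have xL1 : x <= Lam * expR (- th).
  by apply: le_trans xL _; rewrite ler_wpM2r ?expR_ge0 // expr2 ler_piMl // ltW.
have v1 : 1 <= v.
  rewrite ler_pdivlMr // mul1r -[leLHS]expRK ler_ln ?posrE ?expR_gt0 //.
  by rewrite ler_pdivlMr // mulrC -ler_pdivlMr ?expR_gt0 // -expRN.
have v0 : 0 <= v by lra.
have /andP[N1 N2] := truncn_itv v0.
exists (Num.truncn v); set N := Num.truncn v in N1 N2 *; split.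
- by rewrite lt0n; apply/eqP => N0; move: N2; rewrite N0; lra.
- rewrite mulrC -ler_pdivlMr // -[leRHS]lnK ?posrE // ler_expR.
  by rewrite mulrC -ler_pdivlMr.
- have e1 : expR (- th * N%:R) <= expR th * (x / Lam).
    rewrite -[leRHS]lnK ?posrE ?mulr_gt0 ?expR_gt0 ?invr_gt0 // ler_expR.
    rewrite lnM ?posrE ?expR_gt0 ?divr_gt0 // expRK.
    have -> : ln (x / Lam) = - ln (Lam / x) by rewrite -lnV ?posrE // invf_div.
    have E : ln (Lam / x) = v * th by rewrite /v divfK // gt_eqF.
    rewrite E; move: N2; rewrite -natr1; nra.
  have e2 : (x / Lam) ^+ 2 <= x.
    rewrite expr_div_n ler_pdivrMr ?exprn_gt0 // expr2 ler_wpM2l ?(ltW x0) //.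
    apply: le_trans xL _; rewrite ler_piMr ?sqr_ge0 //.
    by rewrite -[leRHS]expR0 ler_expR; lra.
  have -> : - th * (2 * q.+1 * N)%:R = (2 * q.+1)%:R * (- th * N%:R).
    by rewrite natrM; ring.
  rewrite expRM_natl.
  apply: le_trans (_ : (expR th * (x / Lam)) ^+ (2 * q.+1) <= _).
    by apply: lerXn2r; rewrite ?nnegrE ?expR_ge0 ?mulr_ge0 ?expR_ge0 ?invr_ge0 // ltW.
  rewrite exprMn [th * _]mulrC expRM_natl ler_wpM2l ?exprn_ge0 ?expR_ge0 //.
  rewrite exprM; apply: lerXn2r; rewrite ?nnegrE ?sqr_ge0 //; exact: ltW.
Qed.

End Recurrence.

(** * Passage between weights and the space of the statement *)

Section WeightedSequences.
Context (R : realType) (g : R) (d : nat).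
Hypothesis g_range : 1 / 3 < g <= 1 / 2.
Context (X : rough R d) (Nn : nat -> R).
Hypothesis HN : forall n, noise_on g (block_noise X n) (Nn n).
Implicit Types (U : nat -> cpath2 R d).

Lemma in_BC_of_bound eta h U b : h <= - eta -> 0 <= b -> bc_bound g X h U b ->
  (forall n, (U n).1.1 0 = (U n.+1).1.1 1 /\ (U n).2.1 0 = (U n.+1).2.1 1) ->
  in_BC g eta X U.
Proof.
move=> he b0 HU match_U; split=> // [n|].
  exact: (cbound2_controlled2 g_range (HN n) (HU n)).
apply: le_lt_trans (ltry (8 * b)); apply: ge_ereal_sup => _ [n _ <-].
have := cbound2_cnorm2 (HU n); set c := cnorm2 _ _ _ => Hc.
apply: le_trans (lee_wpmul2l _ Hc) _; first by rewrite lee_fin expR_ge0.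
rewrite -EFinM lee_fin /growth /block_start.
rewrite [X in X <= _](_ : _ = 8 * b * (expR (- eta * - n.+1%:R) * expR (h * n.+1%:R))); last by ring.
rewrite -expRD -[leRHS]mulr1 ler_wpM2l ?mulr_ge0 // -[leRHS]expR0 ler_expR.
have n0 : 0 <= n.+1%:R :> R by [].
nra.
Qed.

Lemma bound_of_in_BC eta U : in_BC g eta X U -> exists b, bc_bound g X (- eta) U b.
Proof.
case=> _ _ fin.
have [M HM] : exists M : R, (ereal_sup (range (fun n => (expR (- eta * block_start R n))%:E *
    cnorm2 g (rp1 (block_noise X n)) (U n))) <= M%:E)%E.
  move: fin; case: ereal_sup => [r _|//|_]; first by exists r.
  by exists 0; rewrite leNye.
exists M => n; apply: cnorm2_cbound2.
have H : ((expR (- eta * block_start R n))%:E * cnorm2 g (rp1 (block_noise X n)) (U n)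
    <= M%:E)%E by apply: le_trans HM; apply: ereal_sup_ubound; exists n.
move: H; rewrite /growth /block_start.
have -> : - eta * - n.+1%:R = - (- eta * n.+1%:R) by ring.
rewrite expRN -lee_pdivlMl ?invr_gt0 ?expR_gt0 // invrK -EFinM.
by rewrite mulrC.
Qed.

Lemma bc_bound_weaken h h' U b : h <= h' -> 0 <= b -> bc_bound g X h U b -> bc_bound g X h' U b.
Proof.
move=> hh b0 HU n; apply: cbound2_le (HU n); rewrite ler_wpM2l // /growth ler_expR.
by rewrite ler_wpM2r.
Qed.

End WeightedSequences.

(** * The defect along the fixed point *)

Section Approximation.
Context (R : realType) (g : R) (d : nat).
Hypothesis g_range : 1 / 3 < g <= 1 / 2.
Context (disp : measure_display) (Omega : measurableType disp) (P : probability Omega R)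
  (theta : R -> Omega -> Omega) (W : Omega -> rough R d).
Hypothesis theta_mds : metric_ds P theta.
Hypothesis W_cocycle : rough_cocycle theta g W.
Context (q : nat) (S : system R d) (alpha : nat -> Omega -> R).
Hypothesis alpha_sol : alpha_ok theta g W q S alpha.
Context (L : R) (chi : (R -> 'rV[R]_d) -> cpath2 R d -> cpath2 R d).
Hypothesis chi_ok : forall omega, is_cutoff g L (rp1 (W omega)) (chi (rp1 (W omega))).
Hypothesis Ac0 : sAc S = 0.
Hypothesis As_lt0 : sAs S < 0.
Hypotheses (flat_Fc : flat2 (sFc S)) (flat_Fs : flat2 (sFs S))
  (flat_Gc : forall j, flat2 (sGc S j)) (flat_Gs : forall j, flat2 (sGs S j)).

Local Notation a := (sAs S).
Local Notation bs n := (block_start R n).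

Definition power_rad (kappa : R) (p : nat) (omega : Omega) : R :=
  kappa / noise_size g (W omega) ^+ p.

Lemma block_radius_noise kappa p omega n k c e : 0 <= kappa -> 0 <= c -> (k <= p)%N ->
  c * kappa <= e ->
  c * noise_size g (W (theta (bs n) omega)) ^+ k *
    block_radius theta (power_rad kappa p) omega n <= e.
Proof.
move=> k0 c0 kp ce; rewrite /block_radius /power_rad; set N := noise_size _ _.
have N1 : 1 <= N by exact: (noise_size_ge1 g_range W_cocycle).
have N0 : 0 < N by lra.
apply: le_trans ce; rewrite -mulrA ler_wpM2l // mulrCA ler_piMr //.
by rewrite ler_pdivrMr ?exprn_gt0 // mul1r ler_weXn2l.
Qed.

Context (kz : nat) (Calpha Cz kappa h : R) (p : nat).
Hypothesis Calpha0 : 0 <= Calpha.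
Hypothesis defect_ok : defect_spec g q S kz (1 + Calpha) Cz.
Hypothesis kappa_gt0 : 0 < kappa.
Hypothesis kappa_le1 : kappa <= 1.
Hypothesis kz_le : (kz <= p)%N.
Local Notation Rad := (power_rad kappa p).
Hypothesis alpha_small : alpha_bound theta g W q S alpha Rad Calpha.
Context (ks : nat) (Cs e : R).
Hypothesis h_gt0 : 0 < h.
Hypothesis ah : a + h < 0.
Hypothesis HCs : block_spec g a L (sFs S) (sGs S) ks Cs.
Hypothesis smalls : forall omega n, Cs * noise_size g (W (theta (bs n) omega)) ^+ ks *
  block_radius theta Rad omega n <= e.
Hypothesis e_ge0 : 0 <= e.

(** The decay e^a of a block is weakened to r^2 = e^{a/2}: [delta] is the room for the perturbation,
    and the slack against r absorbs the growth of the source. In [k2], 1/16 makes the truncation the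
    identity by [chiR_id], and the other entry keeps the perturbation below [delta]. *)
Let r := expR (a / 4).
Let delta := r ^+ 2 - expR a.
Let k2 := Num.min (1 / 16) (delta / (2 * Cz + 1)).

Let r_gt0 : 0 < r. Proof. exact: expR_gt0. Qed.

Let r_lt1 : r < 1.
Proof. by rewrite /r -[ltRHS]expR0 ltr_expR; have := As_lt0; lra. Qed.

Let Cz_ge0 : 0 <= Cz. Proof. by case: defect_ok. Qed.

Let delta_gt0 : 0 < delta.
Proof. by rewrite subr_gt0 /r -expRM_natl ltr_expR; have := As_lt0; lra. Qed.

Let delta_le1 : delta <= 1.
Proof.
have := expR_gt0 a; have : r ^+ 2 <= 1 by rewrite exprn_ile1 // ltW.
rewrite /delta; lra.
Qed.

Let k2_gt0 : 0 < k2.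
Proof.
rewrite lt_min; apply/andP; split; first by rewrite divr_gt0.
by rewrite divr_gt0 // ltr_wpDl // mulr_ge0.
Qed.

Let k2_le : k2 <= 1 / 16. Proof. by rewrite ge_min lexx. Qed.

Let k2_delta : 2 * Cz * k2 <= delta.
Proof.
have H : k2 <= delta / (2 * Cz + 1) by rewrite ge_min lexx orbT.
have C1 : 0 < 2 * Cz + 1 by rewrite ltr_wpDl // mulr_ge0.
move: H; rewrite ler_pdivlMr // => H; have := ltW k2_gt0; nra.
Qed.

Section Path.
Context (omega : Omega) (xi : R) (U : nat -> cpath2 R d).
Local Notation Nn n := (noise_size g (W (theta (bs n) omega))).
Local Notation rad n := (block_radius theta Rad omega n).
Hypothesis U_bound : bc_bound g (W omega) h U (2 * `|xi|).
Hypothesis U_fixed : forall n,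
  ceq (LPmap chi S (W omega) (block_radius theta Rad omega) xi U n) (U n).
Hypothesis U_match : forall n,
  (U n).1.1 0 = (U n.+1).1.1 1 /\ (U n).2.1 0 = (U n.+1).2.1 1.

Definition zpath n t : R := (U n).2.1 t -
  \sum_(2 <= i < q.+1) alpha_at theta alpha omega (t + bs n) i * (U n).1.1 t ^+ i.

Lemma zpath_match n : zpath n 0 = zpath n.+1 1.
Proof.
have [E1 E2] := U_match n; rewrite /zpath E1 E2.
suff -> : 0 + bs n = 1 + bs n.+1 by [].
by rewrite /block_start -[n.+2%:R]natr1; ring.
Qed.

Lemma zpathE n t : zfun q (fun v =>
  (joint_path theta q S alpha (U n) (theta (bs n) omega) v).1 t) = zpath n t.
Proof.
rewrite /zfun /phifun /zpath; congr (_ - _); apply: eq_big_nat => i.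
rewrite ltnS => Hi; congr (_ * _).
case: i Hi => [|[|i]] // Hi; rewrite /joint_path -alpha_env_val //.
by rewrite /alpha_at (mdsD theta_mds).
Qed.

Let bn n := 2 * `|xi| * growth h n.

Let bn_ge0 n : 0 <= bn n.
Proof. by rewrite /bn !mulr_ge0 // expR_ge0. Qed.

Lemma rad_range n : 0 < rad n <= 1.
Proof.
have N1 : 1 <= Nn n by exact: (noise_size_ge1 g_range W_cocycle).
have Np : 1 <= Nn n ^+ p by exact: exprn_ege1.
have Np0 : 0 < Nn n ^+ p by lra.
by rewrite /block_radius /power_rad divr_gt0 //= ler_pdivrMr // mul1r (le_trans kappa_le1).
Qed.

Lemma block_cutoff n :
  is_cutoff g L (rp1 (block_noise (W omega) n)) (chi (rp1 (block_noise (W omega) n))).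
Proof. by rewrite (block_noise1 W_cocycle). Qed.

Lemma joint_path_bound n v :
  cbound g (rp1 (block_noise (W omega) n))
    (joint_path theta q S alpha (U n) (theta (bs n) omega) v)
    (if (v < 2)%N then bn n else Calpha * rad n).
Proof.
case: v => [|[|v]]; [exact: proj1 (U_bound n)|exact: proj2 (U_bound n)|].
rewrite /joint_path /alpha_env; case: ifP => Hv.
  rewrite -(alpha_cpath_shift theta_mds); apply: cnorm_cbound.
  exact: alpha_small.
apply: cbound_le (cbound0 _ _).
by have /andP[/ltW r0 _] := rad_range n; rewrite mulr_ge0.
Qed.

(** The condition on [bn n] makes the truncation the identity on the block, so that the original
    equations hold there. *)
Lemma active_joint n : bn n <= k2 * rad n ->
  joint_solution g q S (block_noise (W omega) n)
    (joint_path theta q S alpha (U n) (theta (bs n) omega)).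
Proof.
move=> act; have HN := block_noise_on g_range theta_mds W_cocycle omega.
have /andP[r0 _] := rad_range n.
have E : ceq (chiR (chi (rp1 (block_noise (W omega) n))) (rad n) (U n)) (U n).
  apply: (chiR_id g_range (HN n) (block_cutoff n) r0 (U_bound n)).
  apply: le_trans (_ : 16 * (k2 * rad n) <= _); first by rewrite ler_wpM2l.
  by rewrite mulrA ler_piMl ?(ltW r0) //; have := k2_le; lra.
have [Sc _] := LP_center g_range HN block_cutoff rad_range Ac0 flat_Fc flat_Gc xi n U_bound.
have [Ss _] := LP_stable g_range HN block_cutoff rad_range h_gt0 ah flat_Fs flat_Gs HCs
  (smalls omega) e_ge0 xi n U_bound.
exact: (joint_solution_block g_range theta_mds W_cocycle alpha_sol E (U_fixed n) Sc Ss).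
Qed.

Lemma active_bounds n : bn n <= k2 * rad n -> bn n <= 1 /\ Calpha * rad n <= Calpha.
Proof.
move=> act; have /andP[r0 r1] := rad_range n; split; last by rewrite ler_piMr.
by apply: le_trans act _; have := k2_le; have := k2_gt0; nra.
Qed.

(** In the source term the radius contained in the bound on the alpha_i cancels the power of the
    noise size, so the constant is the same for all blocks and all omega. *)
Lemma active_step n : bn n <= k2 * rad n ->
  `|zpath n 1| <= r ^+ 2 * `|zpath n.+1 1| + Cz * Calpha * bn n ^+ q.+1.
Proof.
move=> act; have HN := block_noise_on g_range theta_mds W_cocycle omega n.
have [b1 c1] := active_bounds act.
have [_ Hz] := defect_ok.
have /andP[r0 r1] := rad_range n.
have M1 : Cz * Nn n ^+ kz * rad n <= Cz.
  by apply: block_radius_noise; rewrite ?(ltW kappa_gt0) // ler_piMr.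
have N0 : 0 <= Cz * Nn n ^+ kz.
  by rewrite mulr_ge0 // exprn_ge0 // (le_trans ler01) // (noise_size_ge1 g_range W_cocycle).
have sm : Cz * Nn n ^+ kz * (bn n + bn n) <= delta.
  apply: le_trans (_ : Cz * Nn n ^+ kz * (2 * (k2 * rad n)) <= _).
    by rewrite ler_wpM2l //; lra.
  rewrite (_ : _ * _ = (Cz * Nn n ^+ kz * rad n) * (2 * k2)); last by ring.
  apply: le_trans (ler_wpM2r _ M1) _; first by rewrite mulr_ge0 // ltW.
  by rewrite mulrA [Cz * 2]mulrC.
have := Hz _ _ _ (fun v => if (v < 2)%N then bn n else Calpha * rad n) HN (joint_path_bound n)
  _ _ (active_joint act) (le_trans sm delta_le1).
rewrite !zpathE zpath_match /= => H.
apply: le_trans (H _ _) _.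
- move=> v; case: ifP => _; first by rewrite (le_trans b1) // lerDl.
  by rewrite (le_trans c1) // lerDr.
- by move=> v v2 /=; rewrite ltnNge v2.
- apply: lerD.
    by rewrite ler_wpM2r // -lerBrDl.
  rewrite (_ : _ * _ = (Cz * Nn n ^+ kz * rad n) * (Calpha * bn n ^+ q.+1)); last by ring.
  rewrite -[leRHS]mulrA; apply: ler_wpM2r M1.
  by rewrite mulr_ge0 // exprn_ge0.
Qed.

(** A bound of order 1 suffices at the far end, because it is multiplied by r^(2 N) in the end. *)
Lemma active_start n : bn n <= k2 * rad n -> `|zpath n.+1 1| <= 1 + q%:R * Calpha.
Proof.
move=> act; have [b1 c1] := active_bounds act.
rewrite -zpath_match -zpathE.
have V v : `|(joint_path theta q S alpha (U n) (theta (bs n) omega) v).1 0| <=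
    if (v < 2)%N then bn n else Calpha * rad n.
  by case: (joint_path_bound n v) => H _ _ _; apply: H.
apply: le_trans (ler_normB _ _) _; apply: lerD; first exact: le_trans (V 1%N) b1.
apply: le_trans (ler_norm_sum _ _ _) _.
apply: le_trans (_ : \sum_(2 <= i < q.+1) Calpha <= _).
  apply: ler_sum_nat => i /andP[i2 _]; rewrite normrM normrX -[leRHS]mulr1.
  apply: ler_pM; rewrite ?exprn_ge0 //.
    by have := V i; rewrite ltnNge i2 /= => /le_trans; apply.
  by apply: exprn_ile1 => //; exact: le_trans (V 0%N) b1.
rewrite big_const_nat iter_addr_0 -[leLHS]mulr_natl ler_wpM2r // ler_nat.
by rewrite leq_subLR addSn ltnS leq_addl.
Qed.

(** h (q + 1) <= - a / 4 bounds the power q + 1 of the weight by r^-(n+1), the growth that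
    [recurrence_bound] admits. *)
Lemma path_estimate N : (forall n, (n < N)%N -> bn n <= k2 * rad n) -> (0 < N)%N ->
  h * q.+1%:R <= - (a / 4) ->
  `|zpath 0 1| <= r ^+ (2 * N) * (1 + q%:R * Calpha) +
     Cz * Calpha * (2 * `|xi|) ^+ q.+1 * r^-1 / (1 - r).
Proof.
move=> act N0 hq.
have A0 : 0 <= Cz * Calpha * (2 * `|xi|) ^+ q.+1.
  by rewrite !mulr_ge0 // exprn_ge0 // mulr_ge0.
have H : forall n, (n < N)%N -> `|zpath n 1| <= r ^+ 2 * `|zpath n.+1 1| +
    Cz * Calpha * (2 * `|xi|) ^+ q.+1 * r^-1 ^+ n.+1.
  move=> n nN; apply: le_trans (active_step (act n nN)) _; rewrite lerD2l.
  rewrite -[leRHS]mulrA ler_wpM2l ?mulr_ge0 // /bn exprMn ler_wpM2l ?exprn_ge0 ?mulr_ge0 //.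
  rewrite /growth /r -expRN -!expRM_natl ler_expR.
  have n0 : 0 <= n.+1%:R :> R by [].
  by have := ler_wpM2l n0 hq; lra.
have := @recurrence_bound R (fun n => `|zpath n 1|) _ _ N r_gt0 r_lt1 A0 H.
move=> {}H; apply: le_trans H _; rewrite lerD2r ler_wpM2l ?exprn_ge0 ?(ltW r_gt0) //.
(* The right end of block N is the left end of block N - 1, the last one on which the truncation is
   known to be inactive. *)
by case: N N0 act => // N _ act; apply: active_start; exact: act.
Qed.

End Path.

Context (s : Omega -> R) (th es : R).
Hypothesis s_ge1 : forall omega, 1 <= s omega.
Hypothesis s_bound : forall omega n,
  noise_size g (W (theta (bs n) omega)) <= s omega * expR (es * n.+1%:R).
Hypothesis th_def : th * q.+1%:R = - (a / 4).
Hypothesis h_es : h + es * p%:R <= th.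
Hypothesis es_ge0 : 0 <= es.
Let lam := k2 * kappa / 2.

Let lam_gt0 : 0 < lam. Proof. by rewrite /lam !divr_gt0 // mulr_gt0. Qed.

Let lam_le1 : lam <= 1.
Proof.
rewrite /lam; have := kappa_le1; have := kappa_gt0; have := k2_le; have := k2_gt0; nra.
Qed.

Let th_gt0 : 0 < th.
Proof. by rewrite -(pmulr_lgt0 _ (ltr0Sn R q)) th_def; have := As_lt0; lra. Qed.

(** On block n the path grows like e^{h (n + 1)} and the radius shrinks at worst like e^{- es p (n +
    1)}; [h_es] bounds the ratio by the rate [th] for which N is chosen. *)
Lemma active_range omega (xi : R) n N : (n < N)%N ->
  `|xi| * expR (th * N%:R) <= lam / s omega ^+ p ->
  2 * `|xi| * growth h n <= k2 * block_radius theta Rad omega n.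
Proof.
move=> nN H; rewrite /block_radius /power_rad.
set M := noise_size _ _; have M1 : 1 <= M by exact: (noise_size_ge1 g_range W_cocycle).
have M0 : 0 < M by lra.
have s0 : 0 < s omega by apply: lt_le_trans (s_ge1 omega).
have Mp : M ^+ p <= s omega ^+ p * expR (es * p%:R * n.+1%:R).
  apply: le_trans (_ : (s omega * expR (es * n.+1%:R)) ^+ p <= _).
    by apply: lerXn2r; rewrite ?nnegrE ?mulr_ge0 ?expR_ge0 ?(ltW s0) ?(ltW M0) // s_bound.
  rewrite exprMn -expRM_natl ler_wpM2l ?exprn_ge0 ?(ltW s0) // ler_expR.
  by rewrite le_eqVlt; apply/orP; left; apply/eqP; ring.
rewrite mulrA ler_pdivlMr ?exprn_gt0 //.
apply: le_trans (ler_wpM2l _ Mp) _; first by rewrite !mulr_ge0 ?expR_ge0.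
have H2 : 2 * (`|xi| * expR (th * N%:R) * s omega ^+ p) <= k2 * kappa.
  by rewrite -ler_pdivlMl // -ler_pdivlMr ?exprn_gt0 // [2^-1 * _]mulrC.
apply: le_trans H2; rewrite /growth.
rewrite [X in X <= _](_ : _ = 2 * (`|xi| * (expR (h * n.+1%:R) * expR (es * p%:R * n.+1%:R)) *
   s omega ^+ p)); last by ring.
rewrite ler_wpM2l // ler_wpM2r ?exprn_ge0 ?(ltW s0) // ler_wpM2l //.
rewrite -expRD ler_expR -mulrDl.
apply: le_trans (_ : th * n.+1%:R <= _); first by rewrite ler_wpM2r.
by rewrite ler_wpM2l ?(ltW th_gt0) // ler_nat.
Qed.

(** The radius for xi contains the power 2 p of [s] because [horizon] requires |xi| to be below the
    square of the threshold lam / s^p. *)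
Lemma manifold_approximation : exists kr K : R, [/\ 0 < kr, kr <= 1, 1 <= K &
  forall omega xi U, bc_bound g (W omega) h U (2 * `|xi|) ->
    (forall n, ceq (LPmap chi S (W omega) (block_radius theta Rad omega) xi U n) (U n)) ->
    (forall n, (U n).1.1 0 = (U n.+1).1.1 1 /\ (U n).2.1 0 = (U n.+1).2.1 1) ->
    `|xi| <= kr / s omega ^+ (2 * p) ->
    `|hc U - phi_block theta q alpha omega 0 1 (center_sol U 0 1)| <= K * `|xi| ^+ q.+1].
Proof.
pose A := Cz * Calpha * 2 ^+ q.+1 * r^-1 / (1 - r).
have A0 : 0 <= A.
  have r1 := r_lt1; have r0 := ltW r_gt0.
  by rewrite /A mulr_ge0 ?invr_ge0 ?subr_ge0 ?(ltW r1) // !mulr_ge0 // ?exprn_ge0 ?invr_ge0.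
pose B := expR (th * (2 * q.+1)%:R) * (1 + q%:R * Calpha).
have B0 : 0 <= B by rewrite /B mulr_ge0 ?expR_ge0 ?addr_ge0 ?mulr_ge0.
exists (lam ^+ 2 * expR (- th)), (1 + (B + A)); split.
- by rewrite mulr_gt0 ?exprn_gt0 ?expR_gt0.
- rewrite -[leRHS]mulr1 ler_pM ?exprn_ge0 ?expR_ge0 ?exprn_ile1 ?(ltW lam_gt0) //.
  by rewrite -[leRHS]expR0 ler_expR oppr_le0 ltW.
- by rewrite lerDl addr_ge0.
move=> omega xi U HU FU MU xis.
have -> : hc U - phi_block theta q alpha omega 0 1 (center_sol U 0 1) = zpath omega U 0 1.
  by [].
(* [horizon] takes the logarithm of |xi|. For xi = 0 the path vanishes, and phi contains only
   positive powers of x. *)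
have [x0|xn0] := eqVneq xi 0.
  rewrite x0 normr0 mulr0 in HU *; rewrite expr0n mulr0.
  have [B1 B2] := HU 0%N; rewrite mul0r in B1 B2.
  have l1 : 0 <= (1 : R) by [].
  have [H1 _ _ _] := B1; have [H2 _ _ _] := B2.
  have := H1 1 ler01 (lexx 1); have := H2 1 ler01 (lexx 1).
  rewrite !normr_le0 => /eqP e2 /eqP e1; rewrite /zpath e1 e2 big_nat_cond big1 ?subr0 ?normr0 //.
  by move=> i /andP[/andP[i2 _] _]; rewrite expr0n; case: i i2 => // i _; rewrite mulr0.
have x0 : 0 < `|xi| by rewrite normr_gt0.
have s0 : 0 < s omega by apply: lt_le_trans (s_ge1 omega).
have sp1 : 1 <= s omega ^+ p by exact: exprn_ege1.
have sp0 : 0 < s omega ^+ p by rewrite exprn_gt0.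
have Lam0 : 0 < lam / s omega ^+ p by rewrite divr_gt0.
have Lam1 : lam / s omega ^+ p <= 1 by rewrite ler_pdivrMr // mul1r (le_trans lam_le1).
have xL : `|xi| <= (lam / s omega ^+ p) ^+ 2 * expR (- th).
  by rewrite expr_div_n -exprM mulnC mulrAC.
have [N [N0 N1 N2]] := horizon q x0 Lam0 Lam1 th_gt0 xL.
have hq : h * q.+1%:R <= - (a / 4).
  rewrite -th_def ler_wpM2r //; have : 0 <= es * p%:R by rewrite mulr_ge0.
  by move: h_es; lra.
have H := path_estimate HU FU MU (fun n nN => active_range nN N1) N0 hq.
apply: le_trans H _.
(* th (q + 1) = - a / 4 turns this decay into the exponential that [horizon] compares with
   |xi|^(q+1). *)
have E : r ^+ (2 * N) = expR (- th * (2 * q.+1 * N)%:R).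
  rewrite /r -expRM_natl; congr expR.
  have -> : a / 4 = - (th * q.+1%:R) by rewrite th_def opprK.
  by rewrite !natrM; ring.
rewrite E exprMn.
have X0 : 0 <= `|xi| ^+ q.+1 by rewrite exprn_ge0.
have C0 : 0 <= 1 + q%:R * Calpha by rewrite addr_ge0 ?mulr_ge0.
rewrite [X in _ + X](_ : _ = A * `|xi| ^+ q.+1); last by rewrite /A; ring.
have h1 := ler_wpM2r C0 N2.
apply: le_trans (lerD h1 (lexx _)) _.
rewrite [X in X + _](_ : _ = B * `|xi| ^+ q.+1); last by rewrite /B; ring.
by rewrite -mulrDl ler_wpM2r // lerDr.
Qed.

End Approximation.

Lemma contraction_const_ge1 (R : realType) (d : nat) (S : system R d) (h : R) :
  0 < h -> sAs S + h < 0 -> 1 <= contraction_const S h.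
Proof.
move=> h0 ah; rewrite /contraction_const -addrA lerDl addr_ge0 //.
  by rewrite invr_ge0 subr_ge0 -expR0 ler_expR ltW.
apply: mulr_ge0; first exact: le_trans ler01 (expconst_ge1 _).
rewrite divr_ge0 ?expR_ge0 //.
by rewrite subr_ge0 -expR0 ler_expR ltW.
Qed.

Theorem theorem3p38 (R : realType) (d : nat)
  (disp : measure_display) (Omega : measurableType disp)
  (P : probability Omega R) (theta : R -> Omega -> Omega)
  (gamma : R) (W : Omega -> rough R d)
  (S : system R d) (Mc Ms nu beta eta : R) (m q : nat)
  (L : R) (chi : (R -> 'rV[R]_d) -> cpath2 R d -> cpath2 R d)
  (alpha : nat -> Omega -> R)
  (gamma_range : 1 / 3 < gamma <= 1 / 2)
  (theta_mds : metric_ds P theta)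
  (W_cocycle : rough_cocycle theta gamma W)
  (A_ok : linear_ok (sAc S) (sAs S) Mc Ms nu beta)
  (eta_range : - beta < eta < 0)
  (m_ge2 : (2 <= m)%N) (q_range : (2 <= q <= m)%N)
  (Fc_ok : drift_ok m q (sFc S)) (Fs_ok : drift_ok m q (sFs S))
  (Gc_ok : diffusion_ok m q (sGc S)) (Gs_ok : diffusion_ok m q (sGs S))
  (chi_ok : forall omega,
     is_cutoff gamma L (rp1 (W omega)) (chi (rp1 (W omega))))
  (alpha_sol : alpha_ok theta gamma W q S alpha) :
  exists (Rad rho : Omega -> R) (K : R)
         (Gamma : Omega -> R -> nat -> cpath2 R d),
    [/\ tempered_radius theta Rad,
        (exists (kappa : R) (p : nat), 0 < kappa /\
           forall omega,
             kappa / noise_size gamma (W omega) ^+ p <= Rad omega),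
        tempered_radius theta rho,
        1 <= K &
        forall omega xi,
          LP_unique_fixed gamma eta chi S (W omega)
            (block_radius theta Rad omega) xi (Gamma omega xi)]
    /\
    ((exists C : R, alpha_bound theta gamma W q S alpha Rad C) ->
     forall omega (xi : R), `|xi| <= rho omega ->
       `|hc (Gamma omega xi)
         - phi_block theta q alpha omega 0 1 (center_sol (Gamma omega xi) 0 1)|
       <= K * `|xi| ^+ q.+1).
Proof.
have /andP[eta1 eta2] := eta_range.
have /andP[q2 _] := q_range.
have Ac0 := linear_center A_ok; have AsB := linear_stable A_ok.
have As0 : sAs S < 0 by apply: le_lt_trans AsB (lt_trans eta1 eta2).
have fFc := drift_flat Fc_ok; have fFs := drift_flat Fs_ok.
have fGc j := diffusion_flat j Gc_ok; have fGs j := diffusion_flat j Gs_ok.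
have [kc [Cc HCc]] := block_diff gamma_range (sAc S) L fFc fGc.
have [ks [Cs HCs]] := block_diff gamma_range (sAs S) L fFs fGs.
have [kz Hz] := defect_block gamma_range Ac0 fFc fFs fGc fGs
  (@drift_deg _ _ _ _ Fs_ok) (@diff_deg _ _ _ _ _ Gs_ok).
(* The rate with e^{th (q + 1)} = e^{- A^s / 4}. At most half of it goes to the weight h, the rest
   to the growth of the noise. *)
pose th := - (sAs S / 4) / q.+1%:R.
have q0 : 0 < q.+1%:R :> R by [].
have th0 : 0 < th by rewrite divr_gt0 // oppr_gt0 pmulr_llt0 // invr_gt0.
have thq : th * q.+1%:R = - (sAs S / 4) by rewrite divfK // gt_eqF.
pose h := Num.min (th / 2) (- eta).
have h0 : 0 < h by rewrite lt_min divr_gt0 //= oppr_gt0.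
have h_th : h <= th / 2 by rewrite ge_min lexx.
have h_eta : h <= - eta by rewrite ge_min lexx orbT.
have h1 : 0 < - eta by rewrite oppr_gt0.
have ah1 : sAs S + - eta < 0 by rewrite subr_lt0 (le_lt_trans AsB).
have ah : sAs S + h < 0 by apply: le_lt_trans ah1; rewrite lerD2l.
have c1 := contraction_const_ge1 h0 ah; have c2 := contraction_const_ge1 h1 ah1.
(* A single [e] makes the map a contraction by 1/2 for both weights, h and - eta. *)
pose e := (2 * (contraction_const S h + contraction_const S (- eta)))^-1.
have [e0 ce1 ce2] : [/\ 0 < e, e * contraction_const S h <= 1 / 2 &
    e * contraction_const S (- eta) <= 1 / 2].
  rewrite /e; move: (contraction_const S h) (contraction_const S (- eta)) c1 c2 => x y x1 y1.
  have xy : 0 < 2 * (x + y) by lra.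
  split; first by rewrite invr_gt0.
    by rewrite mulrC ler_pdivrMr //; lra.
  by rewrite mulrC ler_pdivrMr //; lra.
have Cc0 : 0 <= Cc by case: HCc.
have Cs0 : 0 <= Cs by case: HCs.
have C1 : 0 < Cc + Cs + 1 by rewrite ltr_wpDl // addr_ge0.
pose kappa := Num.min 1 (e / (Cc + Cs + 1)).
have k0 : 0 < kappa by rewrite lt_min ltr01 divr_gt0.
have k1 : kappa <= 1 by rewrite ge_min lexx.
have kC : kappa * (Cc + Cs + 1) <= e by rewrite -ler_pdivlMr // ge_min lexx orbT.
have [kCc kCs] : Cc * kappa <= e /\ Cs * kappa <= e.
  by move: (kappa) (e) k0 kC => x y x0; split; nra.
(* One power of the noise size for the centre, stable and defect estimates; [kz] is available
   although the bound on the alpha_i is not yet given. *)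
pose p := (kc + ks + kz)%N.
have [pc ps pz] : [/\ (kc <= p)%N, (ks <= p)%N & (kz <= p)%N].
  by rewrite /p -addnA leq_addr addnCA leq_addr addnA leq_addl.
have N1 := noise_size_ge1 gamma_range W_cocycle.
have mN := measurable_noise_size gamma_range W_cocycle.
have sN := noise_size_subexponential gamma_range theta_mds W_cocycle.
(* Leaves h + es p <= th; the denominator p + 1 excludes a division by 0. *)
pose es := (th - h) / p.+1%:R.
have p0 : 0 < p.+1%:R :> R by [].
have thh : 0 < th - h by rewrite subr_gt0 (le_lt_trans h_th) // ltr_pdivrMr // mulr_natr mulr2n ltrDl.
have es0 : 0 < es by rewrite divr_gt0.
have h_es : h + es * p%:R <= th.
  rewrite -lerBrDl /es mulrAC ler_pdivrMr //.
  by rewrite ler_wpM2l ?(ltW thh) // ler_nat.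
have [s [ms s1 ss Hs]] := orbit_sup theta_mds es0 N1 mN sN.
pose Rad := power_rad gamma W kappa p.
have small C k (k_p : (k <= p)%N) (C0 : 0 <= C) (Ck : C * kappa <= e) omega n :=
  @block_radius_noise R gamma d gamma_range disp Omega theta W W_cocycle
    kappa p omega n k C e (ltW k0) C0 k_p Ck.
have smallc := small _ _ pc Cc0 kCc; have smalls := small _ _ ps Cs0 kCs.
have HN omega := block_noise_on gamma_range theta_mds W_cocycle omega.
have Hchi := block_cutoff W_cocycle chi_ok.
have r01 := rad_range gamma_range W_cocycle p k0 k1.
have /choice[Gm HGm] : forall z : Omega * R, exists U : nat -> cpath2 R d,
    [/\ bc_bound gamma (W z.1) h U (2 * `|z.2|),
        forall n, ceq (LPmap chi S (W z.1) (block_radius theta Rad z.1) z.2 U n) (U n) &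
        forall n, (U n).1.1 0 = (U n.+1).1.1 1 /\ (U n).2.1 0 = (U n.+1).2.1 1].
  move=> [omega xi].
  exact: (LP_fixed_exists gamma_range (HN omega) (Hchi omega) (r01 omega) Ac0 h0 ah fFc fFs
    fGc fGs HCc HCs (smallc omega) (smalls omega) (ltW e0) ce1 xi).
(* The radius and the fixed points are fixed by now; only [kr] and [K] depend on the constant in
   [alpha_bound]. If no such constant exists, the implication is void and both are set to 1. *)
have [kr [K [kr0 kr1 K1 est]]] : exists kr K : R, [/\ 0 < kr, kr <= 1, 1 <= K &
  (exists C : R, alpha_bound theta gamma W q S alpha Rad C) ->
  forall omega xi U, bc_bound gamma (W omega) h U (2 * `|xi|) ->
    (forall n, ceq (LPmap chi S (W omega) (block_radius theta Rad omega) xi U n) (U n)) ->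
    (forall n, (U n).1.1 0 = (U n.+1).1.1 1 /\ (U n).2.1 0 = (U n.+1).2.1 1) ->
    `|xi| <= kr / s omega ^+ (2 * p) ->
    `|hc U - phi_block theta q alpha omega 0 1 (center_sol U 0 1)| <= K * `|xi| ^+ q.+1].
  have [HC|nC] := pselect (exists C : R, alpha_bound theta gamma W q S alpha Rad C); last first.
    by exists 1, 1.
  have [C {}HC] := HC.
  have HC' : alpha_bound theta gamma W q S alpha Rad `|C|.
    move=> omega i n Hi; apply: le_trans (HC omega i n Hi) _; rewrite lee_fin.
    have /andP[/ltW r0 _] := r01 omega n.
    by apply: ler_wpM2r (ler_norm C); exact: r0.
  have [Cz HCz] := Hz (1 + `|C|).
  have [kr [K [a1 a2 a3 a4]]] := manifold_approximation gamma_range theta_mds W_cocycle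
    alpha_sol chi_ok Ac0 As0 fFc fFs fGc fGs (normr_ge0 C) HCz k0 k1 pz HC' h0 ah HCs
    smalls (ltW e0) s1 Hs thq h_es (ltW es0).
  by exists kr, K; split=> // _; exact: a4.
exists Rad, (fun omega => kr / s omega ^+ (2 * p)), K, (fun omega xi => Gm (omega, xi)).
split; last first.
  move=> /est {}est omega xi xir; have [G1 G2 G3] := HGm (omega, xi).
  exact: est G1 G2 G3 xir.
split=> //.
- exact: power_radius k0 k1 N1 mN sN.
- by exists kappa, p.
- exact: power_radius kr0 kr1 s1 ms ss.
- move=> omega xi; have [G1 G2 G3] := HGm (omega, xi); rewrite /= in G1 G2 G3.
  have x0 : 0 <= 2 * `|xi| by rewrite mulr_ge0.
  split; first by split=> //; exact: (in_BC_of_bound gamma_range (HN omega) h_eta x0 G1 G3).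
  (* Uniqueness is proved with the weight h = - eta. The fixed point constructed for the smaller
     weight belongs to that larger space as well. *)
  move=> V [/bound_of_in_BC[b HV] FV] n.
  exact: (LP_fixed_unique gamma_range (HN omega) (Hchi omega) (r01 omega) Ac0 h1 ah1 fFc fFs
    fGc fGs HCc HCs (smallc omega) (smalls omega) (ltW e0) ce2
    (bc_bound_weaken h_eta x0 G1) HV G2 FV n).
Qed.
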